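(* Let $L\subseteq\mathbb{R}^{24}$ be an even unimodular lattice with $L(2)=\{x\in L: x\cdot x=2\}\neq\emptyset$ (a Niemeier lattice). If the root system $L(2)$ is irreducible, i.e. of type $A_{24}$ or $D_{24}$, then for all sufficiently large $\alpha$ the lattice $L$ is a local minimum for the $f_\alpha$-potential energy on the manifold of rank $24$ lattices of point density $1$. In all other cases $L$ is a saddle point for the $f_\alpha$-potential energy for all sufficiently large $\alpha$.
   Context: A lattice $L\subseteq\mathbb{R}^n$ (discrete subgroup of full rank) is unimodular if it equals its dual $L^*=\{y\in\mathbb{R}^n: x\cdot y\in\mathbb{Z}\ \forall x\in L\}$, and even if $x\cdot x$ is an even integer for all $x\in L$. The set $L(2)$ is a root system, an orthogonal sum of irreducible root systems of types $A$, $D$, $E$. For $\alpha>0$ let $f_\alpha(r)=e^{-\alpha r}$ and $\mathcal{E}(f_\alpha,L)=\sum_{x\in L\setminus\{0\}}e^{-\alpha\|x\|^2}$. The manifold of rank $n$ lattices of point density $1$ (one lattice point per unit volume) is parametrized by positive definite symmetric $n\times n$ matrices $Y$ of determinant $1$: with $L$ fixed (of density $1$), the energy function is $F_{\alpha,L}(Y)=\sum_{x\in L\setminus\{0\}}e^{-\alpha x^{\mathsf T}Yx}$, with $L$ itself corresponding to $Y=I_n$. $L$ is a critical point (local minimum, local maximum) for the $f_\alpha$-potential energy if $I_n$ is a critical point (local minimum, local maximum) of $F_{\alpha,L}$ on this manifold; a saddle point is a critical point which is neither a local minimum nor a local maximum. *)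

(* Defs.v *)
From HB Require Import structures.
From mathcomp Require Import all_boot all_order all_algebra.
From mathcomp Require Import all_classical all_reals all_analysis.

Set Implicit Arguments.
Unset Strict Implicit.
Unset Printing Implicit Defensive.

Import Order.TTheory GRing.Theory Num.Theory.
Import numFieldNormedType.Exports.

Local Open Scope classical_set_scope.
Local Open Scope ring_scope.

Definition dotp {R : realType} {n : nat} (x y : 'cV[R]_n) : R :=
  \sum_i x i 0 * y i 0.

Definition is_lattice {R : realType} {n : nat} (L : set 'cV[R]_n) : Prop :=
  [/\ L 0,
      forall x y, L x -> L y -> L (x - y),
      L `<=` isolated L
    & exists B : 'M[R]_n, B \in unitmx /\ forall j, L (col j B)].

Definition dual_lattice {R : realType} {n : nat} (L : set 'cV[R]_n)
    : set 'cV[R]_n :=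
  [set y | forall x, L x -> dotp x y \is a Num.int].

Definition unimodular {R : realType} {n : nat} (L : set 'cV[R]_n) : Prop :=
  L = dual_lattice L.

Definition even_lattice {R : realType} {n : nat} (L : set 'cV[R]_n) : Prop :=
  forall x, L x -> exists k : int, dotp x x = (k *+ 2)%:~R.

Definition shell {R : realType} {n : nat} (L : set 'cV[R]_n) (r : R)
    : set 'cV[R]_n :=
  [set x | L x /\ dotp x x = r].

(* Sound for any set of nonzero vectors: the orthogonal parts are then
   automatically disjoint. *)
Definition irreducible_roots {R : realType} {n : nat} (Phi : set 'cV[R]_n)
    : Prop :=
  Phi !=set0 /\
  forall A B : set 'cV[R]_n, A `|` B = Phi ->
    (forall x y, A x -> B y -> dotp x y = 0) -> A = set0 \/ B = set0.

Definition unit_vec {R : realType} {n : nat} (i : 'I_n) : 'cV[R]_n :=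
  delta_mx i 0.

(* A_n lives in the hyperplane of vectors of R^(n+1) with coordinate sum 0. *)
Definition rootsA (R : realType) (n : nat) : set 'cV[R]_n.+1 :=
  [set v | exists i j : 'I_n.+1, i != j /\ v = unit_vec i - unit_vec j].

Definition rootsD (R : realType) (n : nat) : set 'cV[R]_n :=
  [set v | exists (i j : 'I_n) (s t : bool), i != j /\
     v = (-1) ^+ s *: unit_vec i + (-1) ^+ t *: unit_vec j].

(* Isomorphism of root systems all of whose roots have the same length. The two
   ambient spaces may have different dimensions; preservation of inner products
   on Phi makes M an isometry from the span of Phi onto the span of Psi. *)
Definition root_iso {R : realType} {m n : nat}
    (Phi : set 'cV[R]_m) (Psi : set 'cV[R]_n) : Prop :=
  exists M : 'M[R]_(n, m),
    (forall x y, Phi x -> Phi y -> dotp (M *m x) (M *m y) = dotp x y) /\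
    [set M *m x | x in Phi] = Psi.

Definition quad {R : realType} {n : nat} (Y : 'M[R]_n) (x : 'cV[R]_n) : R :=
  (x^T *m Y *m x) 0 0.

Definition unit_posdef (R : realType) (n : nat) : set 'M[R]_n :=
  [set Y | [/\ Y^T = Y, forall x : 'cV[R]_n, x != 0 -> 0 < quad Y x
             & \det Y = 1]].

Definition gauss {R : realType} (alpha r : R) : R := expR (- alpha * r).

(* The family is summable, so that [fine] loses nothing, when L is a lattice,
   Y is positive definite and alpha > 0. *)
Definition energy {R : realType} {n : nat} (alpha : R) (L : set 'cV[R]_n)
    (Y : 'M[R]_n) : R :=
  fine (\esum_(x in L `\ 0) (gauss alpha (quad Y x))%:E).

Definition local_min {R : realType} {n : nat} (F : 'M[R]_n -> R) : Prop :=
  \forall Y \near within (@unit_posdef R n) (nbhs (1%:M : 'M[R]_n)), F 1%:M <= F Y.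

Definition local_max {R : realType} {n : nat} (F : 'M[R]_n -> R) : Prop :=
  \forall Y \near within (@unit_posdef R n) (nbhs (1%:M : 'M[R]_n)), F Y <= F 1%:M.

(* F restricted to the manifold has zero differential at the identity: the
   tangent vectors there are the velocities of curves lying in the manifold. *)
Definition critical {R : realType} {n : nat} (F : 'M[R]_n -> R) : Prop :=
  forall c : R -> 'M[R]_n,
    (forall t, unit_posdef (c t)) -> c 0 = 1%:M -> derivable c 0 1 ->
    is_derive (0 : R) 1 (F \o c) 0.

Definition saddle {R : realType} {n : nat} (F : 'M[R]_n -> R) : Prop :=
  [/\ critical F, ~ local_min F & ~ local_max F].

(* Main.v *)
(** Write the energy of [1 + K] minus the energy of [1] as a linear term in [K] plus the
sum of the convex remainders [exp (-a K[x]) - 1 + a K[x]], weighted by [exp (-a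
|x|^2)].

The theta series of [L] with a harmonic coefficient of degree 2 transforms under
inversion with weight 14, where there is no cusp form; hence it vanishes, every shell
of [L] is a spherical 2-design, and the linear term is a multiple of [tr K]. Since
[det (1 + K) = 1], the trace is of second order in [K], so that [L] is critical for
every [a].

That there is no such cusp form is shown for a single function [f(t) = sum a_n exp (-2
pi n t)] with [f (1/t) = - t^14 f t]: its 13-fold primitive satisfies the functional
equation of weight [-12] up to a period polynomial (Bol). The three-term relation
forces this polynomial to be the coboundary of a constant, so the primitive minus a
constant has weight [-12]; this makes it [O((Re w)^6)], and Cauchy's estimate kills
its coefficients. Theta inversion itself is obtained without Fourier analysis, from
Polya's argument with binomial sums.

As [a] grows the roots dominate: the remainder is at least [a^2/4 exp (-2a) K[r]^2]
for each root [r], whereas the linear term is [O(a exp (-2a) |K|^2)]. The roots span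
space by the design property. If they are irreducible, a maximal clique of roots with
inner products 1, or else a growing orthonormal frame [f_i] with roots [+-f_i +- f_j],
shows that their type is A or D; in both cases the values [K[r]] bound [K], so the
remainder wins. If they split, take orthogonal roots [x], [y] in different parts. A
shear along [x], [y] changes the norm of each root only to second order, and the trace
lowers the energy; a shear along [x + y], [x - y] changes the norm of [x] to first
order, and the remainder raises it. *)
Require Import Defs.
From HB Require Import structures.
From mathcomp Require Import all_boot all_order all_algebra fingroup perm.
From mathcomp Require Import all_classical all_reals all_analysis.
From mathcomp Require Import complex.
From mathcomp Require Import ring lra zify.
Set Implicit Arguments.
Unset Strict Implicit.
Unset Printing Implicit Defensive.
Import Order.TTheory GRing.Theory Num.Theory.
Import numFieldNormedType.Exports.
Local Open Scope classical_set_scope.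
Local Open Scope ring_scope.

(** * Absolutely convergent sums over sets *)

(** A lattice has in general no orthogonal basis, yet inversion is known only in one variable. The
    bridge is an orthogonal frame of lattice vectors: it spans a sublattice of finite index, on
    whose cosets a Gaussian splits into one-variable sums with a separate scale for each axis.
    Unimodularity reassembles the inverted cosets, and differentiating in a single scale brings down
    the squared coordinate along that axis. The difference of two such coordinates is harmonic.
    These differences suffice for the design property, because every nonzero lattice vector belongs
    to some frame and polarization does the rest.

    Type E is excluded by rank rather than by listing root systems: half-integral coordinates along
    [k] orthonormal vectors use up [k / 4] of the norm 2, so such roots stop in dimension 8, and a
    connected system of rank 24 must leave that space.

    The linear term and the remainder are both of order [|K|^2], since the trace is already
    quadratic; the comparison is decided by one extra factor [a] in the remainder. The
    neighbourhoods and shears may shrink with [a], because [a] is fixed before them. *)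

Lemma cvg_bigsum {R : realType} {T : Type} (F : set_system T)
    {FF : Filter F} (I : Type) (r : seq I) (P : pred I) (f : I -> T -> R) (l : I -> R) :
  (forall i, P i -> f i x @[x --> F] --> l i) ->
  (fun x => \sum_(i <- r | P i) f i x) x @[x --> F] --> \sum_(i <- r | P i) l i.
Proof. by move=> fl; apply: cvg_big => //; exact: add_continuous. Qed.

Section TSum.
Context {R : realType}.

Section Def.
Context {T : choiceType}.
Implicit Types (A B : set T) (f g h : T -> R).

(* [psum] is the sum of a nonnegative family and [tsum] that of a signed one; both are
   meaningful only under [tsm] (absolute summability). *)
Definition tsm A f : Prop := (\esum_(x in A) `|f x|%:E < +oo)%E.
Definition psum A f : R := fine (\esum_(x in A) (f x)%:E).
Definition tsum A f : R :=
  psum A (fun x => Num.max (f x) 0) - psum A (fun x => Num.max (- f x) 0).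

Lemma tsm_le A f g : (forall x, A x -> `|f x| <= g x) -> tsm A g -> tsm A f.
Proof.
move=> fg; apply: le_lt_trans; apply: le_esum => x Ax.
by rewrite lee_fin (le_trans (fg x Ax))// ler_norm.
Qed.

Lemma eq_tsm A f g : (forall x, A x -> f x = g x) -> tsm A g -> tsm A f.
Proof.
move=> fg; rewrite /tsm; under eq_esum => x Ax do rewrite -fg//.
by [].
Qed.

Lemma tsm_norm A f : tsm A f -> tsm A (fun x => `|f x|).
Proof. by rewrite /tsm; under [in X in _ -> X]eq_esum do rewrite normr_id. Qed.

Lemma tsmD A f g : tsm A f -> tsm A g -> tsm A (fun x => f x + g x).
Proof.
move=> sf sg.
have: (\esum_(x in A) (`|f x|%:E + `|g x|%:E) < +oo)%E.
  by rewrite esumD ?lte_add_pinfty// => x Ax; rewrite lee_fin.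
apply: le_lt_trans; apply: le_esum => x Ax.
by rewrite -EFinD lee_fin ler_normD.
Qed.

Lemma tsmZ A (c : R) f : tsm A f -> tsm A (fun x => c * f x).
Proof.
move=> sf; pose n := (Num.trunc `|c|).+1.
have cn : `|c| <= n%:R by rewrite ltW// truncnS_gt.
suff H k : tsm A (fun x => k%:R * `|f x|).
  apply: tsm_le (H n) => x _; rewrite normrM.
  by rewrite ler_wpM2r.
elim: k => [|k IH].
  rewrite /tsm esum1// => x _; by rewrite mul0r normr0.
apply: eq_tsm (tsmD (tsm_norm sf) IH) => x _.
by rewrite -natr1 mulrDl mul1r addrC.
Qed.

Lemma tsmN A f : tsm A f -> tsm A (fun x => - f x).
Proof. by move=> sf; apply: tsm_le (tsm_norm sf) => x _; rewrite normrN. Qed.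

Lemma tsmB A f g : tsm A f -> tsm A g -> tsm A (fun x => f x - g x).
Proof. by move=> sf sg; apply: tsmD => //; exact: tsmN. Qed.

Lemma tsm0 A : tsm A (fun=> 0).
Proof. by rewrite /tsm esum1// => x _; rewrite normr0. Qed.

Lemma sub_esum A B (a : T -> \bar R) : A `<=` B ->
  (\esum_(x in A) a x <= \esum_(x in B) a x)%E.
Proof.
move=> AB; apply: ub_ereal_sup => _ [F [Ff FA] <-].
apply: ereal_sup_ubound; exists F => //; split=> //; exact: subset_trans AB.
Qed.

Lemma sub_tsm A B f : A `<=` B -> tsm B f -> tsm A f.
Proof. by move=> AB; apply: le_lt_trans; exact: sub_esum. Qed.

Lemma psumE A f : (forall x, A x -> 0 <= f x) -> tsm A f ->
  (psum A f)%:E = \esum_(x in A) (f x)%:E.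
Proof.
move=> f0 sf; rewrite /psum fineK// ge0_fin_numE; last first.
  by apply: esum_ge0 => x Ax; rewrite lee_fin f0.
apply: le_lt_trans sf; apply: le_esum => x Ax.
by rewrite lee_fin ler_norm.
Qed.

Lemma eq_psum A f g : (forall x, A x -> f x = g x) -> psum A f = psum A g.
Proof. by move=> fg; rewrite /psum; under eq_esum => x Ax do rewrite fg//. Qed.

Lemma psum0 A : psum A (fun=> 0) = 0.
Proof. by rewrite /psum esum1. Qed.

Lemma psum_ge0 A f : (forall x, A x -> 0 <= f x) -> 0 <= psum A f.
Proof.
move=> f0; rewrite /psum; apply: fine_ge0.
by apply: esum_ge0 => x Ax; rewrite lee_fin f0.
Qed.

Lemma psumD A f g : (forall x, A x -> 0 <= f x) -> (forall x, A x -> 0 <= g x) ->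
  tsm A f -> tsm A g -> psum A (fun x => f x + g x) = psum A f + psum A g.
Proof.
move=> f0 g0 sf sg; apply: EFin_inj; rewrite EFinD !psumE//; last 2 first.
- by move=> x Ax; rewrite addr_ge0 ?f0 ?g0.
- exact: tsmD.
under eq_esum do rewrite EFinD.
by rewrite esumD// => x Ax; rewrite lee_fin ?f0 ?g0.
Qed.

(** Positive parts are not additive, so linearity of [tsum] rests on its value being the same for
    every decomposition into nonnegative summable families. *)
Lemma tsumE A f g h : (forall x, A x -> 0 <= g x) -> (forall x, A x -> 0 <= h x) ->
  tsm A g -> tsm A h -> (forall x, A x -> f x = g x - h x) ->
  tsum A f = psum A g - psum A h.
Proof.
move=> g0 h0 sg sh fgh.
have sf : tsm A f by apply: eq_tsm (tsmB sg sh).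
have sp : tsm A (fun x => Num.max (f x) 0).
  apply: tsm_le (tsm_norm sf) => x _ /=; rewrite ger0_norm ?le_max ?lexx ?orbT//.
  by rewrite ge_max ler_norm normr_ge0.
have sn : tsm A (fun x => Num.max (- f x) 0).
  apply: tsm_le (tsm_norm sf) => x _ /=; rewrite ger0_norm ?le_max ?lexx ?orbT//.
  by rewrite ge_max -normrN ler_norm normr_ge0.
suff : psum A (fun x => Num.max (f x) 0) + psum A h =
       psum A (fun x => Num.max (- f x) 0) + psum A g.
  by rewrite /tsum => e; lra.
rewrite -!psumD//; first last.
- by move=> x _; rewrite le_max lexx orbT.
- by move=> x _; rewrite le_max lexx orbT.
apply: eq_psum => x Ax; rewrite fgh//.
by have [?|?] := leP (g x) (h x); [rewrite max_r ?max_l|rewrite max_l ?max_r]; lra.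
Qed.

Lemma tsum_psum A f : (forall x, A x -> 0 <= f x) -> tsum A f = psum A f.
Proof.
move=> f0; rewrite /tsum.
rewrite (@eq_psum _ _ f) ?(@eq_psum _ (fun x => Num.max (- f x) 0) (fun=> 0)).
- by rewrite psum0 subr0.
- by move=> x Ax; rewrite max_r// oppr_le0 f0.
- by move=> x Ax; rewrite max_l// f0.
Qed.

Lemma eq_tsum A f g : (forall x, A x -> f x = g x) -> tsum A f = tsum A g.
Proof.
move=> fg; rewrite /tsum; congr (_ - _); apply: eq_psum => x Ax; by rewrite fg.
Qed.

Lemma tsm_pos A f : tsm A f -> tsm A (fun x => Num.max (f x) 0).
Proof.
move=> sf; apply: tsm_le (tsm_norm sf) => x _ /=; rewrite ger0_norm ?le_max ?lexx ?orbT//.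
by rewrite ge_max ler_norm normr_ge0.
Qed.

Let maxe0 (x : R) : 0 <= Num.max x 0. Proof. by rewrite le_max lexx orbT. Qed.
Let maxB (x : R) : x = Num.max x 0 - Num.max (- x) 0.
Proof.
have [x0|/ltW x0] := lerP 0 x.
  by rewrite max_r ?oppr_le0// subr0.
by rewrite max_l ?oppr_ge0// sub0r opprK.
Qed.

Lemma tsumD A f g : tsm A f -> tsm A g ->
  tsum A (fun x => f x + g x) = tsum A f + tsum A g.
Proof.
move=> sf sg.
rewrite (@tsumE _ _ (fun x => Num.max (f x) 0 + Num.max (g x) 0)
   (fun x => Num.max (- f x) 0 + Num.max (- g x) 0)).
- rewrite !psumD; first by rewrite /tsum; lra.
  all: try by move=> x _; exact: maxe0.
  + exact/tsm_pos/tsmN.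
  + exact/tsm_pos/tsmN.
  + exact: tsm_pos.
  + exact: tsm_pos.
- by move=> x _; rewrite addr_ge0.
- by move=> x _; rewrite addr_ge0.
- by apply: tsmD; exact: tsm_pos.
- by apply: tsmD; exact/tsm_pos/tsmN.
- by move=> x _; have := maxB (f x); have := maxB (g x); lra.
Qed.

Lemma tsumN A f : tsum A (fun x => - f x) = - tsum A f.
Proof.
by rewrite /tsum opprB; congr (_ - _); apply: eq_psum => x _; rewrite opprK.
Qed.

Lemma tsumB A f g : tsm A f -> tsm A g ->
  tsum A (fun x => f x - g x) = tsum A f - tsum A g.
Proof. by move=> sf sg; rewrite tsumD ?tsumN//; exact: tsmN. Qed.

Lemma tsum_ge0 A f : (forall x, A x -> 0 <= f x) -> 0 <= tsum A f.
Proof. by move=> f0; rewrite tsum_psum// psum_ge0. Qed.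

Lemma le_tsum A f g : tsm A f -> tsm A g -> (forall x, A x -> f x <= g x) ->
  tsum A f <= tsum A g.
Proof.
move=> sf sg fg; rewrite -subr_ge0 -tsumB//; apply: tsum_ge0 => x Ax.
by rewrite subr_ge0 fg.
Qed.

Lemma tsum0 A : tsum A (fun=> 0) = 0.
Proof. by rewrite tsum_psum// psum0. Qed.

Lemma ler_norm_tsum A f : tsm A f -> `|tsum A f| <= tsum A (fun x => `|f x|).
Proof.
move=> sf; rewrite ler_norml -tsumN; apply/andP; split; apply: le_tsum => //.
- exact/tsmN/tsm_norm.
- by move=> x _; rewrite lerNl -normrN ler_norm.
- exact: tsm_norm.
- by move=> x _; rewrite ler_norm.
Qed.

Lemma tsum_sum (I : Type) (r : seq I) (P : pred I) A (F : I -> T -> R) :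
  (forall i, P i -> tsm A (F i)) ->
  tsm A (fun x => \sum_(i <- r | P i) F i x) /\
  tsum A (fun x => \sum_(i <- r | P i) F i x) = \sum_(i <- r | P i) tsum A (F i).
Proof.
move=> sF; elim: r => [|i r [IH1 IH2]].
  split; first by apply: eq_tsm (tsm0 A) => x _; rewrite big_nil.
  by rewrite big_nil -[RHS](tsum0 A); apply: eq_tsum => x _; rewrite big_nil.
case: (boolP (P i)) => Pi; last first.
  split; first by apply: eq_tsm IH1 => x _; rewrite big_cons (negbTE Pi).
  by rewrite big_cons (negbTE Pi) -IH2; apply: eq_tsum => x _; rewrite big_cons (negbTE Pi).
split; first by apply: eq_tsm (tsmD (sF _ Pi) IH1) => x _; rewrite big_cons Pi.
rewrite big_cons Pi -IH2 -tsumD//; last exact: sF.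
by apply: eq_tsum => x _; rewrite big_cons Pi.
Qed.

Lemma ler_sum_tsum A (F : seq T) f : uniq F -> (forall x, x \in F -> A x) ->
  (forall x, A x -> 0 <= f x) -> tsm A f -> \sum_(x <- F) f x <= tsum A f.
Proof.
move=> uF FA f0 sf; rewrite tsum_psum// -lee_fin psumE// -sumEFin.
apply: esum_ge; exists [set` F]; first by split; [exact: finite_seq|exact: FA].
by rewrite -fsbig_seq.
Qed.

Lemma tsum_approx A f (e : R) : (forall x, A x -> 0 <= f x) -> tsm A f -> 0 < e ->
  exists F : seq T, [/\ uniq F, forall x, x \in F -> A x
    & tsum A f < \sum_(x <- F) f x + e].
Proof.
move=> f0 sf e0.
have : ((psum A f - e)%:E < \esum_(x in A) (f x)%:E)%E.
  by rewrite -psumE// lte_fin ltrBlDr ltrDl.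
case/ereal_sup_gt => _ [F [finF FA] <-] lF.
exists (finmap.enum_fset (fset_set F)); split.
- exact: finmap.fset_uniq.
- by move=> x; rewrite in_fset_set// inE => /FA.
- rewrite tsum_psum// -ltrBlDr -lte_fin (lt_le_trans lF)//.
  by rewrite fsbig_finite//= sumEFin.
Qed.

Lemma tsm_bound A f (C : R) :
  (forall F : seq T, uniq F -> (forall x, x \in F -> A x) ->
     \sum_(x <- F) `|f x| <= C) -> tsm A f.
Proof.
move=> H; rewrite /tsm (@le_lt_trans _ _ C%:E)// ?ltry//.
apply: ub_ereal_sup => _ [F [finF FA] <-].
rewrite fsbig_finite//= sumEFin lee_fin H ?finmap.fset_uniq// => x.
by rewrite in_fset_set// inE => /FA.
Qed.

Lemma ler_psum_bound A f (C : R) : (forall x, A x -> 0 <= f x) ->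
  (forall F : seq T, uniq F -> (forall x, x \in F -> A x) ->
     \sum_(x <- F) f x <= C) -> tsm A f /\ tsum A f <= C.
Proof.
move=> f0 H; have sf : tsm A f.
  apply: (@tsm_bound _ _ C) => F uF FA.
  by rewrite (eq_big_seq f) ?H// => x /FA /f0 /ger0_norm.
split => //; rewrite tsum_psum// -lee_fin psumE//.
apply: ub_ereal_sup => _ [F [finF FA] <-].
rewrite fsbig_finite//= sumEFin lee_fin H ?finmap.fset_uniq// => x.
by rewrite in_fset_set// inE => /FA.
Qed.

Lemma psumZ A (c : R) f : 0 <= c -> (forall x, A x -> 0 <= f x) -> tsm A f ->
  psum A (fun x => c * f x) = c * psum A f.
Proof.
move=> c0 f0 sf.
have key d g : 0 <= d -> (forall x, A x -> 0 <= g x) -> tsm A g ->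
    psum A (fun x => d * g x) <= d * psum A g.
  move=> d0 g0 sg; rewrite -tsum_psum; last by move=> x Ax; rewrite mulr_ge0 ?g0.
  apply: (ler_psum_bound _ _).2 => [x Ax|F uF FA]; first by rewrite mulr_ge0 ?g0.
  by rewrite -mulr_sumr ler_wpM2l// -tsum_psum// ler_sum_tsum.
have [->|cn0] := eqVneq c 0.
  transitivity (psum A (fun=> 0)); last by rewrite psum0 mul0r.
  by apply: eq_psum => x _; rewrite mul0r.
apply/eqP; rewrite eq_le key//=.
have cp : 0 < c by rewrite lt_def cn0.
rewrite -(@ler_pM2l _ c^-1) ?invr_gt0// mulrA mulVf// mul1r.
have := @key c^-1 (fun x => c * f x).
rewrite (@eq_psum _ _ f); last by move=> x _; rewrite mulrA mulVf// mul1r.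
apply; [by rewrite invr_ge0|by move=> x Ax; rewrite mulr_ge0 ?f0|exact: tsmZ].
Qed.

Lemma tsumZ A (c : R) f : tsm A f -> tsum A (fun x => c * f x) = c * tsum A f.
Proof.
move=> sf.
have key d : 0 <= d -> tsum A (fun x => d * f x) = d * tsum A f.
  move=> d0; rewrite [in RHS]/tsum mulrBr -!psumZ//; last 2 first.
    exact/tsm_pos/tsmN. exact: tsm_pos.
  apply: tsumE.
  - by move=> x _; rewrite mulr_ge0.
  - by move=> x _; rewrite mulr_ge0.
  - exact/tsmZ/tsm_pos.
  - exact/tsmZ/tsm_pos/tsmN.
  - by move=> x _; rewrite -mulrBr -maxB.
have [c0|/ltW c0] := lerP 0 c; first exact: key.
apply: oppr_inj; rewrite -mulNr -tsumN -key ?oppr_ge0//.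
by apply: eq_tsum => x _; rewrite mulNr.
Qed.

Lemma tsum_mkcond A f : tsum A f = tsum setT (fun x => if x \in A then f x else 0).
Proof.
rewrite /tsum /psum; congr (fine _ - fine _); rewrite esum_mkcond; apply: eq_esum => x _.
  by case: ifP => // _; rewrite maxxx.
by case: ifP => // _; rewrite oppr0 maxxx.
Qed.

Lemma tsm_mkcond A f : tsm A f <-> tsm setT (fun x => if x \in A then f x else 0).
Proof.
rewrite /tsm esum_mkcond; under [in X in _ <-> X]eq_esum => x _.
  rewrite (_ : `|_|%:E = if x \in A then `|f x|%:E else 0%E); last by case: ifP; rewrite ?normr0.
  over.
by [].
Qed.

Lemma tsum_delta A y c : A y ->
  tsm A (fun x => if x == y then c else 0) /\
  tsum A (fun x => if x == y then c else 0) = c.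
Proof.
move=> Ay.
suff key d : 0 <= d -> tsm A (fun x => if x == y then d else 0) /\
  tsum A (fun x => if x == y then d else 0) = d.
  have [c0|/ltW c0] := lerP 0 c; first exact: key.
  have [|k1 k2] := key (- c); first by rewrite oppr_ge0.
  split; first by apply: eq_tsm (tsmN k1) => x _; case: ifP; rewrite ?opprK ?oppr0.
  apply: oppr_inj; rewrite -tsumN -[RHS]k2; apply: eq_tsum => x _.
  by case: ifP; rewrite ?oppr0.
move=> d0.
have [||s1 s2] := @ler_psum_bound A (fun x => if x == y then d else 0) d.
- by move=> x _; case: ifP.
- move=> F uF FA; rewrite -big_mkcond/=.
  have [yF|yF] := boolP (y \in F).
    by rewrite -big_filter filter_pred1_uniq// big_seq1.
  by rewrite big1_seq// => x /andP[/eqP->]; rewrite (negbTE yF).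
split => //; apply/eqP; rewrite eq_le s2/=.
have := @ler_sum_tsum A [:: y] (fun x => if x == y then d else 0).
rewrite big_seq1 eqxx; apply => //; last by move=> x _; case: ifP.
by move=> x; rewrite inE => /eqP->.
Qed.

Lemma tsum_fin A (F : seq T) f : uniq F -> (forall x, x \in F -> A x) ->
  tsm A (fun x => if x \in F then f x else 0) /\
  tsum A (fun x => if x \in F then f x else 0) = \sum_(x <- F) f x.
Proof.
move=> uF FA.
have E x : (if x \in F then f x else 0) = \sum_(y <- F | y \in F) if x == y then f y else 0.
  have [xF|xF] := boolP (x \in F); last first.
    by rewrite big1_seq// => y /andP[_ yF]; case: eqP => // e; rewrite e yF in xF.
  rewrite -big_seq (bigD1_seq x)//= eqxx big1_seq ?addr0// => y /andP[yx _].
  by rewrite eq_sym (negbTE yx).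
have [s1 s2] := @tsum_sum T F (mem F) A (fun y x => if x == y then f y else 0)
   (fun y yF => (tsum_delta (f y) (FA y yF)).1).
split; first by apply: eq_tsm s1 => x _; exact: E.
rewrite [RHS]big_seq -[RHS](eq_bigr _ (fun y yF => (tsum_delta (f y) (FA y yF)).2)).
by rewrite -s2; apply: eq_tsum => x _; exact: E.
Qed.

(** Dominated convergence for sums: a finite set [F] carries the dominating sum up to [e / 4], and
    on [F] the convergence is uniform. *)
Lemma tannery A (g : nat -> T -> R) h G : tsm A G ->
  (\forall n \near \oo, forall x, A x -> `|g n x| <= G x) ->
  (forall x, A x -> g n x @[n --> \oo] --> h x) ->
  tsum A (g n) @[n --> \oo] --> tsum A h.
Proof.
move=> sG gG gh.
have G0 x : A x -> 0 <= G x.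
  move=> Ax; have [n _ /(_ n (leqnn n) x Ax)] := gG; exact: le_trans.
have hG x : A x -> `|h x| <= G x.
  move=> Ax; have : `|g n x| @[n --> \oo] --> `|h x| by apply: cvg_norm; exact: gh.
  move=> cn; rewrite -(cvg_lim _ cn)//; apply: limr_le; first exact: cvgP cn.
  by near=> n; have : forall x, A x -> `|g n x| <= G x; [near: n|exact].
have sh : tsm A h by exact: tsm_le hG sG.
apply/cvgrPdist_lt => e e0.
have e4 : 0 < e / 4 by rewrite divr_gt0.
have [F [uF FA FG]] := tsum_approx G0 sG e4.
have Fcv : \forall n \near \oo, \sum_(x <- F) `|h x - g n x| < e / 4.
  have : \sum_(x <- F) `|h x - g n x| @[n --> \oo] --> (0:R).
    under eq_cvg do rewrite big_seq.
    have := @cvg_bigsum R nat \oo _ T F (mem F) (fun x n => `|h x - g n x|) (fun=> 0).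
    rewrite big1//; apply => x xF; rewrite -(normr0 R); apply: cvg_norm.
    by rewrite -(subrr (h x)); apply: cvgB; [exact: cvg_cst|apply: gh; exact: FA].
  by move/cvgr_lt; apply.
near=> n.
have gnG : forall x, A x -> `|g n x| <= G x by near: n; exact: gG.
have sg : tsm A (g n) by exact: tsm_le gnG sG.
rewrite -tsumB//; apply: le_lt_trans (ler_norm_tsum (tsmB sh sg)) _.
have [f1 f2] := @tsum_fin A F (fun x => `|h x - g n x|) uF FA.
have [f3 f4] := @tsum_fin A F (fun x => 2 * G x) uF FA.
(* A majorant of [|h - g n|]: the difference itself on [F], [2 * G] off [F]. Its sum is below
   [e / 4 + 2 * (e / 4)]. *)
pose D x := (if x \in F then `|h x - g n x| else 0) + (2 * G x - (if x \in F then 2 * G x else 0)).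
have sD : tsm A D by apply: tsmD => //; apply: tsmB => //; exact: tsmZ.
apply: (@le_lt_trans _ _ (tsum A D)).
  apply: le_tsum => //; first exact/tsm_norm/tsmB.
  move=> x Ax; rewrite /D; case: ifP => _; first lra.
  rewrite add0r subr0 (le_trans (ler_normB _ _))//.
  by have := hG x Ax; have := gnG x Ax; lra.
rewrite /D tsumD//; last by apply: tsmB => //; exact: tsmZ.
rewrite tsumB//; last exact: tsmZ.
rewrite tsumZ// f2 f4 -mulr_sumr.
have : \sum_(x <- F) `|h x - g n x| < e / 4 by near: n.
by move: FG; lra.
Unshelve. all: by end_near.
Qed.

End Def.

Lemma tsm_reindex (T T' : choiceType) (P : set T) (Q : set T') (e : T -> T') (f : T' -> R) :
  set_bij P Q e -> tsm P (f \o e) <-> tsm Q f.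
Proof. by move=> b; rewrite /tsm (@reindex_esum R _ _ P Q e _ b). Qed.

Lemma tsum_reindex (T T' : choiceType) (P : set T) (Q : set T') (e : T -> T') (f : T' -> R) :
  set_bij P Q e -> tsum Q f = tsum P (fun x => f (e x)).
Proof. by move=> b; rewrite /tsum /psum !(@reindex_esum R _ _ P Q e _ b). Qed.

Lemma tsum_series (f : nat -> R) : tsm setT f ->
  \sum_(k < n) f k @[n --> \oo] --> tsum setT f.
Proof.
move=> sf.
have H n : \sum_(k < n) f k = tsum setT (fun x => if (x < n)%N then f x else 0).
  have [_] := @tsum_fin _ setT (iota 0 n) f (iota_uniq _ _) (fun _ _ => I).
  rewrite -{1 2}[n]subn0 -/(index_iota 0 n) big_mkord => <-.
  by apply: eq_tsum => x _; rewrite mem_index_iota.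
under eq_cvg do rewrite H.
apply: (@tannery _ _ _ _ (fun x => `|f x|)) => //; first exact: tsm_norm.
  by near=> n => x _; case: ifP; rewrite ?normr0.
move=> x _; apply: cvg_near_cst; near=> n.
by rewrite ifT//; near: n; exact: nbhs_infty_gt.
Unshelve. all: by end_near.
Qed.

Lemma tsm_nat (f : nat -> R) C : (forall n, \sum_(k < n) `|f k| <= C) -> tsm setT f.
Proof.
move=> H; apply: (@tsm_bound _ _ _ C) => F uF _.
pose n := (\max_(x <- F) x).+1.
apply: le_trans (H n).
rewrite -(big_mkord xpredT (fun k => `|f k|)) [leRHS](bigID (mem F))/=.
rewrite (_ : \sum_(_ <- _ | _ \in F) _ = \sum_(x <- F) `|f x|); last first.
  rewrite -big_filter; apply: perm_big; apply: uniq_perm => //.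
    by rewrite filter_uniq// iota_uniq.
  move=> x; rewrite mem_filter mem_index_iota; have [xF|]//= := boolP (x \in F).
  by rewrite ltnS (leq_bigmax_seq x).
by rewrite lerDl sumr_ge0.
Qed.

Lemma psum_prod (T1 T2 : choiceType) (A : set T1) (B : set T2) (f : T1 -> R) (g : T2 -> R) :
  (forall x, A x -> 0 <= f x) -> (forall x, B x -> 0 <= g x) -> tsm A f -> tsm B g ->
  tsm (A `*` B) (fun z => f z.1 * g z.2) /\
  tsum (A `*` B) (fun z => f z.1 * g z.2) = tsum A f * tsum B g.
Proof.
move=> f0 g0 sf sg.
have E : (\esum_(z in A `*` B) (f z.1 * g z.2)%:E = (psum A f * psum B g)%:E)%E.
  rewrite -(@esum_esum _ _ _ A (fun=> B) (fun x y => (f x * g y)%:E)); last first.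
    by move=> x y Ax By; rewrite lee_fin mulr_ge0 ?f0 ?g0.
  under eq_esum => x Ax.
    rewrite -psumE; [|by move=> y By; rewrite mulr_ge0 ?f0 ?g0|exact: tsmZ].
    rewrite psumZ ?f0//; over.
  rewrite -psumE; first last.
  - by apply: eq_tsm (tsmZ (psum B g) sf) => x _; rewrite mulrC.
  - by move=> x Ax; rewrite mulr_ge0 ?f0 ?psum_ge0.
  by rewrite (@eq_psum _ _ _ (fun x => psum B g * f x)) ?psumZ ?psum_ge0// => [|x _]; rewrite mulrC.
have H : tsm (A `*` B) (fun z => f z.1 * g z.2).
  rewrite /tsm (_ : esum _ _ = \esum_(z in A `*` B) (f z.1 * g z.2)%:E) ?E ?ltry//.
  by rewrite -E; apply: eq_esum => z [z1 z2]; rewrite ger0_norm// mulr_ge0 ?f0 ?g0.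
split => //; rewrite tsum_psum; last by move=> z [z1 z2]; rewrite mulr_ge0 ?f0 ?g0.
by rewrite /psum E /= !tsum_psum.
Qed.

Lemma psum_partition (T : choiceType) (A : nat -> set T) (B : set T) (f : T -> R) :
  B = \bigcup_n A n -> trivIset setT A -> (forall x, B x -> 0 <= f x) -> tsm B f ->
  tsm setT (fun n => tsum (A n) f) /\ tsum setT (fun n => tsum (A n) f) = tsum B f.
Proof.
move=> BA tA f0 sf.
have AB n : A n `<=` B by rewrite BA => x; exists n.
have E : \esum_(n in [set: nat]) (tsum (A n) f)%:E = \esum_(x in B) (f x)%:E.
  pose f' x := if x \in B then f x else 0.
  have f'0 x : 0 <= f' x by rewrite /f'; case: ifPn => // /set_mem /f0.
  rewrite [RHS](_ : _ = \esum_(x in B) (f' x)%:E); last first.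
    by apply: eq_esum => x Bx; rewrite /f' ifT// inE.
  rewrite BA esum_bigcupT//; apply: eq_esum => n _.
  rewrite tsum_psum; last by move=> x /AB /f0.
  rewrite psumE; first last.
  - exact: sub_tsm (AB n) sf.
  - by move=> x /AB /f0.
  by apply: eq_esum => x Ax; rewrite /f' ifT// inE; exact: AB Ax.
have p0 n : 0 <= tsum (A n) f by apply: tsum_ge0 => x /AB /f0.
have H : tsm setT (fun n => tsum (A n) f).
  rewrite /tsm; under eq_esum do rewrite ger0_norm//.
  by rewrite E -psumE// ltry.
by split => //; rewrite !tsum_psum// /psum E.
Qed.

End TSum.

(** * Elementary real and complex estimates *)

Section RealBounds.
Context {R : realType}.
Implicit Types x y : R.

Lemma ge0_MVT (f df : R -> R) : (forall x, is_derive x 1 f (df x)) ->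
  (forall x, 0 <= x -> 0 <= df x) -> 0 <= f 0 -> forall x, 0 <= x -> 0 <= f x.
Proof.
move=> fdf df0 f0 x; rewrite le_eqVlt => /predU1P[<-//|x0].
have fdf' y : y \in `]0, x[ -> is_derive y 1 f (df y) by [].
have [|c cx e] := MVT x0 fdf'.
  apply: continuous_subspaceT => y; apply: differentiable_continuous.
  by apply/derivable1_diffP; apply: ex_derive.
have c0 : 0 <= c by move: cx; rewrite in_itv => /andP[/ltW].
have := mulr_ge0 (df0 c c0) (ltW x0).
by rewrite -[x in df c * x](subr0 x) -e; lra.
Qed.

Lemma sin_le x : 0 <= x -> sin x <= x.
Proof.
move=> x0; rewrite -subr_ge0.
apply: (@ge0_MVT (fun x => x - sin x) (fun x => 1 - cos x)) => //.
by rewrite sin0 subr0.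
Qed.

Lemma ler_abs_sin x : `|sin x| <= `|x|.
Proof.
have key y : 0 <= y -> `|sin y| <= y.
  move=> y0; have [y1|y1] := leP y 1; last exact: le_trans (sin_max y) (ltW y1).
  rewrite ger0_norm ?sin_le// sin_ge0_pi// y0/=.
  by have := pihalf_02 R; have := @pi_ge2 R; lra.
have [x0|/ltW x0] := leP 0 x; first by rewrite [`|x|]ger0_norm ?key.
by rewrite -normrN -sinN -[`|x|]normrN [leRHS]ger0_norm ?key ?oppr_ge0.
Qed.

Lemma cos_ge x : 1 - x ^+ 2 / 2 <= cos x.
Proof.
have -> : cos x = 1 - 2 * sin (x / 2) ^+ 2.
  have -> : cos x = cos ((x / 2) *+ 2) by congr cos; lra.
  by rewrite cos_mulr2n cos2sin2; lra.
have : sin (x / 2) ^+ 2 <= (x / 2) ^+ 2.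
  by rewrite -real_normK ?num_real// -[leRHS]real_normK ?num_real// ler_sqr ?nnegrE// ler_abs_sin.
by lra.
Qed.

Lemma sin_ge x : 0 <= x -> x - x ^+ 3 / 6 <= sin x.
Proof.
move=> x0; rewrite -subr_ge0.
apply: (@ge0_MVT (fun x => sin x - (x - x ^+ 3 / 6)) (fun x => cos x - (1 - x ^+ 2 / 2))) => //.
- move=> y.
  have -> : (fun x : R => sin x - (x - x ^+ 3 / 6)) = sin - (id - 6^-1 *: (id ^+ 3)).
    by apply/funext => z; rewrite !fctE /GRing.scale/= mulrC.
  by apply: is_derive_eq; rewrite /GRing.scale/=; lra.
- by move=> y _; have := cos_ge y; lra.
- by rewrite sin0 expr0n/= mul0r !subr0.
Qed.

Lemma expR_le1DxDx2 x : `|x| <= 1 / 2 -> expR x <= 1 + x + 2 * x ^+ 2.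
Proof.
rewrite ler_norml => /andP[x1 x2].
have h : 0 < 1 - x by lra.
have : expR x * (1 - x) <= 1.
  rewrite -[leRHS](expR0 R) -(subrr x) expRD ler_pM2l ?expR_gt0//.
  exact: expR_ge1Dx.
have x20 := sqr_ge0 x.
by rewrite -ler_pdivlMr// => /le_trans; apply; rewrite ler_pdivrMr//; nra.
Qed.

End RealBounds.

Notation cn := (@Normc.normc _).

Section Cplx.
Context {R : realType}.
Local Notation C := R[i].
Local Open Scope complex_scope.
Implicit Types (z w u : C) (x y : R).

Lemma ReD z w : complex.Re (z + w) = complex.Re z + complex.Re w.
Proof. by case: z w => [? ?] [? ?]. Qed.
Lemma ImD z w : complex.Im (z + w) = complex.Im z + complex.Im w.
Proof. by case: z w => [? ?] [? ?]. Qed.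
Lemma ReN z : complex.Re (- z) = - complex.Re z. Proof. by case: z. Qed.
Lemma ImN z : complex.Im (- z) = - complex.Im z. Proof. by case: z. Qed.
Lemma ReM z w : complex.Re (z * w) =
  complex.Re z * complex.Re w - complex.Im z * complex.Im w.
Proof. by case: z w => [? ?] [? ?]. Qed.
Lemma ImM z w : complex.Im (z * w) =
  complex.Re z * complex.Im w + complex.Im z * complex.Re w.
Proof. by case: z w => [? ?] [? ?]. Qed.
Lemma Re_sum (I : Type) (r : seq I) (P : pred I) (F : I -> C) :
  complex.Re (\sum_(i <- r | P i) F i) = \sum_(i <- r | P i) complex.Re (F i).
Proof. by elim/big_rec2: _ => // i y1 y2 _ <-; rewrite ReD. Qed.
Lemma Im_sum (I : Type) (r : seq I) (P : pred I) (F : I -> C) :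
  complex.Im (\sum_(i <- r | P i) F i) = \sum_(i <- r | P i) complex.Im (F i).
Proof. by elim/big_rec2: _ => // i y1 y2 _ <-; rewrite ImD. Qed.
Lemma complex_ext z w : complex.Re z = complex.Re w -> complex.Im z = complex.Im w -> z = w.
Proof. by case: z w => [? ?] [? ?] /= -> ->. Qed.

Lemma cnE z : cn z = Num.sqrt (complex.Re z ^+ 2 + complex.Im z ^+ 2).
Proof. by case: z. Qed.
Lemma cn_ge0 z : 0 <= cn z. Proof. by rewrite cnE sqrtr_ge0. Qed.
Lemma sqr_cn z : cn z ^+ 2 = complex.Re z ^+ 2 + complex.Im z ^+ 2.
Proof. by rewrite cnE sqr_sqrtr// addr_ge0 ?sqr_ge0. Qed.
Lemma cn0 : cn (0 : C) = 0. Proof. exact: Normc.normc0. Qed.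
Lemma cn1 : cn (1 : C) = 1. Proof. exact: Normc.normc1. Qed.
Lemma cnM z w : cn (z * w) = cn z * cn w. Proof. exact: Normc.normcM. Qed.
Lemma cnV z : cn z^-1 = (cn z)^-1. Proof. exact: Normc.normcV. Qed.
Lemma cnX z n : cn (z ^+ n) = cn z ^+ n.
Proof. by elim: n => [|n IH]; rewrite ?expr0 ?cn1// !exprS cnM IH. Qed.
Lemma cnN z : cn (- z) = cn z. Proof. exact: normcN. Qed.
Lemma cnD z w : cn (z + w) <= cn z + cn w. Proof. exact: le_normcD. Qed.
Lemma cnB z w : cn (z - w) <= cn z + cn w.
Proof. by rewrite -[cn w]cnN cnD. Qed.
Lemma cn_real x : cn x%:C = `|x|.
Proof. by rewrite cnE/= expr0n/= addr0 sqrtr_sqr. Qed.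
Lemma cn_nat n : cn (n%:R : C) = n%:R.
Proof. by rewrite -(rmorph_nat (real_complex R)) cn_real normr_nat. Qed.
Lemma cn_eq0 z : cn z = 0 -> z = 0. Proof. exact: Normc.eq0_normc. Qed.
Lemma cn_sum (I : Type) (r : seq I) (P : pred I) (F : I -> C) :
  cn (\sum_(i <- r | P i) F i) <= \sum_(i <- r | P i) cn (F i).
Proof.
elim/big_rec2: _ => [|i y1 y2 _ h]; first by rewrite cn0.
by apply: le_trans (cnD _ _) _; rewrite lerD2l.
Qed.
Lemma Re_le_cn z : `|complex.Re z| <= cn z.
Proof. by rewrite cnE -sqrtr_sqr ler_wsqrtr// lerDl sqr_ge0. Qed.
Lemma Im_le_cn z : `|complex.Im z| <= cn z.
Proof. by rewrite cnE -sqrtr_sqr ler_wsqrtr// lerDr sqr_ge0. Qed.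
Lemma cn_le_ReIm z : cn z <= `|complex.Re z| + `|complex.Im z|.
Proof.
rewrite -ler_sqr ?nnegrE ?cn_ge0// sqr_cn.
rewrite -[complex.Re z ^+ 2]real_normK ?num_real// -[complex.Im z ^+ 2]real_normK ?num_real//.
by have := normr_ge0 (complex.Re z); have := normr_ge0 (complex.Im z); nra.
Qed.
Lemma cn_gt0 z : (0 < cn z) = (z != 0).
Proof.
apply/idP/idP => [|z0]; first by apply: contraTneq => ->; rewrite cn0 ltxx.
by rewrite lt_def cn_ge0 andbT; apply: contraNneq z0 => /cn_eq0 ->.
Qed.

Definition cexp z : C :=
  (expR (complex.Re z) * cos (complex.Im z)) +i* (expR (complex.Re z) * sin (complex.Im z)).

Lemma cexpD z w : cexp (z + w) = cexp z * cexp w.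
Proof.
apply: complex_ext; rewrite /cexp ?ReM ?ImM ?ReD ?ImD/= expRD ?cosD ?sinD; ring.
Qed.
Lemma cexp0 : cexp 0 = 1.
Proof. by rewrite /cexp/= expR0 cos0 sin0 mul1r mulr0. Qed.
Lemma cexpMn z n : cexp (z *+ n) = cexp z ^+ n.
Proof. by elim: n => [|n IH]; rewrite ?mulr0n ?cexp0// mulrS exprS cexpD IH. Qed.
Lemma cn_cexp z : cn (cexp z) = expR (complex.Re z).
Proof.
rewrite cnE/= !exprMn -mulrDr cos2Dsin2 mulr1 sqrtr_sqr ger0_norm// expR_ge0.
Qed.
Lemma cexp_real x : cexp x%:C = (expR x)%:C.
Proof. by rewrite /cexp/= cos0 sin0 mulr1 mulr0. Qed.
Lemma cexp2pi n : cexp (0 +i* (2 * pi * n%:R)) = 1.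
Proof.
have -> : (0 +i* (2 * pi * n%:R)) = (0 +i* (2 * pi)) *+ n :> C.
  move: (2 * pi) => q; elim: n => [|n IH]; first by rewrite mulr0 mulr0n.
    by rewrite [RHS]mulrSr -IH -natr1; apply: complex_ext; rewrite ?ReD ?ImD/=; ring.
rewrite cexpMn (_ : cexp _ = 1) ?expr1n//.
rewrite /cexp/= expR0 !mul1r (_ : 2 * pi = (pi : R) *+ 2); last by rewrite mulr2n; ring.
by rewrite cos2pi sin2pi.
Qed.

Lemma cexp_taylor z : cn z <= 1 / 2 -> cn (cexp z - 1 - z) <= 8 * cn z ^+ 2.
Proof.
move=> z1; apply: le_trans (cn_le_ReIm _) _.
rewrite !(ReD, ImD, ReN, ImN)/=.
set x := complex.Re z; set y := complex.Im z.
have xz : `|x| <= cn z by exact: Re_le_cn.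
have yz : `|y| <= cn z by exact: Im_le_cn.
have x1 : `|x| <= 1 / 2 by lra.
have y1 : `|y| <= 1 / 2 by lra.
rewrite sqr_cn -/x -/y subr0.
have e1 := expR_ge1Dx x; have e2 := expR_le1DxDx2 x1.
have c1 := cos_le1 y; have c2 := cos_ge y.
have a1 : `|expR x * cos y - 1 - x| <= 2 * x ^+ 2 + 2 * y ^+ 2.
  have -> : expR x * cos y - 1 - x = (expR x - 1 - x) * cos y + (1 + x) * (cos y - 1) by ring.
  apply: le_trans (ler_normD _ _) _; rewrite !normrM; apply: lerD.
    rewrite -[leRHS]mulr1 ler_pM ?cos_max// ler_norml; apply/andP; split; last by lra.
    by have := sqr_ge0 x; lra.
  have : `|1 + x| <= 2 by move: x1; rewrite !ler_norml => /andP[? ?]; apply/andP; split; lra.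
  have : `|cos y - 1| <= y ^+ 2 by rewrite ler_norml; apply/andP; split; have := sqr_ge0 y; lra.
  by have := sqr_ge0 y; have := normr_ge0 (cos y - 1); have := normr_ge0 (1 + x); nra.
have s1 : `|sin y - y| <= y ^+ 2.
  have key (t : R) : 0 <= t -> t <= 1 / 2 -> `|sin t - t| <= t ^+ 2.
    move=> t0 t1; have := sin_le t0; have := sin_ge t0 => h1 h2.
    by rewrite ler_norml; apply/andP; split; nra.
  have [y0|/ltW y0] := lerP 0 y; first by apply: key => //; move: y1; rewrite ger0_norm.
  have := key (- y); rewrite sinN -opprD normrN sqrrN; apply; first by rewrite oppr_ge0.
  by rewrite -ler0_norm.
have a2 : `|expR x * sin y - y| <= 3 * x ^+ 2 + 3 * y ^+ 2.
  have -> : expR x * sin y - y = (expR x - 1) * sin y + (sin y - y) by ring.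
  apply: le_trans (ler_normD _ _) _; rewrite normrM.
  have b1 : `|expR x - 1| <= 2 * `|x|.
    have x2 : x ^+ 2 = `|x| ^+ 2 by rewrite real_normK ?num_real.
    have x3 : x <= `|x| by rewrite ler_norm.
    have x4 : - x <= `|x| by rewrite -normrN ler_norm.
    by rewrite ler_norml; apply/andP; split; have := normr_ge0 x; nra.
  have b2 := ler_abs_sin y.
  have : `|expR x - 1| * `|sin y| <= 2 * `|x| * `|y| by rewrite ler_pM.
  have := sqr_ge0 (`|x| - `|y|); rewrite sqrrB !real_normK ?num_real//.
  by rewrite mulr2n; have := sqr_ge0 x; have := sqr_ge0 y; lra.
by have := sqr_ge0 x; have := sqr_ge0 y; lra.
Qed.

Lemma cn_subrX z w (c : R) n : cn z <= c -> cn w <= c ->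
  cn (z ^+ n - w ^+ n) <= cn (z - w) * (n%:R * c ^+ n.-1).
Proof.
move=> zc wc; have c0 : 0 <= c by apply: le_trans zc; exact: cn_ge0.
rewrite subrXX cnM ler_wpM2l ?cn_ge0//.
apply: le_trans (cn_sum _ _ _) _.
rewrite mulr_natl -[X in _ *+ X]card_ord -sumr_const; apply: ler_sum => i _.
rewrite cnM !cnX.
have e : n.-1 = (n - i.+1 + i)%N by have := ltn_ord i; lia.
rewrite e.
rewrite exprD; apply: ler_pM; rewrite ?exprn_ge0 ?cn_ge0//.
  by rewrite addnK lerXn2r ?nnegrE ?cn_ge0.
by rewrite lerXn2r ?nnegrE ?cn_ge0.
Qed.

(** Uniformity on discs makes the exponential a locally uniform limit of polynomials. Both
    [cexp (z / m)] and [1 + z / m] have modulus at most [expR (r / m)], so passing to [m]-th powers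
    costs only a factor [m * expR r] against the error [8 * (r / m)^2]. *)
Lemma cexp_lim (rho e : R) : 0 < e -> exists m : nat, forall z, cn z <= rho ->
  cn (cexp z - (1 + z / m%:R) ^+ m) <= e.
Proof.
move=> e0; pose r := Num.max rho 1.
have r1 : 1 <= r by rewrite le_max lexx orbT.
pose K := 8 * r ^+ 2 * expR r / e + 2 * r.
pose m := (Num.trunc K).+1.
have Km : K < m%:R by exact: truncnS_gt.
have r2 : 1 <= r ^+ 2 by rewrite expr_ge1//; lra.
have K2 : 0 <= 8 * r ^+ 2 * expR r / e.
  by rewrite divr_ge0 ?(ltW e0)// mulr_ge0 ?expR_ge0//; lra.
have mr : 2 * r < m%:R by apply: le_lt_trans Km; rewrite /K; lra.
have m0 : 0 < m%:R :> R by lra.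
have mK : 8 * r ^+ 2 * expR r <= e * m%:R.
  by rewrite mulrC -ler_pdivrMl// mulrC ltW// (le_lt_trans _ Km)// /K; lra.
exists m => z zr.
have {}zr : cn z <= r by rewrite (le_trans zr)// le_max lexx.
pose v := z / m%:R.
have cv : cn v = cn z / m%:R by rewrite /v cnM cnV cn_nat.
have v1 : cn v <= r / m%:R by rewrite cv ler_pM2r ?invr_gt0.
have v2 : r / m%:R <= 1 / 2 by rewrite ler_pdivrMr//; lra.
have -> : cexp z = cexp v ^+ m.
  by rewrite -cexpMn -mulr_natr /v divfK// -cn_gt0 cn_nat.
have rm0 : 0 <= r / m%:R by rewrite divr_ge0//; lra.
have := @cn_subrX (cexp v) (1 + v) (expR (r / m%:R)) m.
have -> : cn (cexp v) <= expR (r / m%:R).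
  by rewrite cn_cexp ler_expR (le_trans _ v1)// (le_trans (ler_norm _))// Re_le_cn.
have -> : cn (1 + v) <= expR (r / m%:R).
  apply: le_trans (cnD _ _) _; rewrite cn1; apply: le_trans (expR_ge1Dx _).
  by rewrite lerD2l.
move=> /(_ isT isT) /le_trans; apply.
have h1 : cn (cexp v - (1 + v)) <= 8 * (r / m%:R) ^+ 2.
  rewrite opprD addrA; apply: le_trans (cexp_taylor (le_trans v1 v2)) _.
  by rewrite ler_pM2l// lerXn2r ?nnegrE ?cn_ge0.
have h2 : expR (r / m%:R) ^+ m.-1 <= expR r.
  rewrite -expRM_natl ler_expR.
  have : m.-1%:R <= m%:R :> R by rewrite ler_nat leq_pred.
  by move=> /(ler_wpM2r rm0) /le_trans; apply; rewrite mulrC divfK// gt_eqF.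
apply: (@le_trans _ _ (8 * (r / m%:R) ^+ 2 * (m%:R * expR r))).
  by rewrite ler_pM ?cn_ge0 ?mulr_ge0 ?exprn_ge0 ?expR_ge0// ler_pM2l.
rewrite (_ : _ * _ = 8 * r ^+ 2 * expR r / m%:R); first by rewrite ler_pdivrMr.
by field; rewrite gt_eqF.
Qed.

End Cplx.
Arguments cexp : simpl never.

(** * Termwise differentiation and Bol's identity *)

Section RealDerive.
Context {R : realType}.
Implicit Types (t h : R).

Lemma expR_quad (u : R) : `|expR u - 1 - u| <= u ^+ 2 * expR `|u|.
Proof.
have e1 := expR_ge1Dx u; rewrite ger0_norm; last lra.
have [u0|/ltW u0] := leP 0 u.
  have h1 : expR u - 1 <= u * expR u.
    have := expR_ge1Dx (- u); have := expR_gt0 u; have := expRxMexpNx_1 u; nra.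
  have := expR_gt0 u; have -> : `|u| = u by rewrite ger0_norm.
  nra.
have h1 : expR u * (1 - u) <= 1.
  by have := expR_ge1Dx (- u); have := expR_gt0 u; have := expRxMexpNx_1 u; nra.
have h2 : 1 <= expR `|u| by have := expR_ge1Dx `|u|; have := normr_ge0 u; lra.
have h3 : expR u - 1 - u <= u ^+ 2 by have := expR_gt0 u; nra.
have := sqr_ge0 u; nra.
Qed.

Lemma is_derive_quad (f : R -> R) (x d C e : R) : 0 < e ->
  (forall h, `|h| <= e -> `|f (x + h) - f x - h * d| <= C * h ^+ 2) ->
  is_derive x 1 f d.
Proof.
move=> e0 H.
have C0 : 0 <= C.
  have := H e; rewrite ger0_norm ?(ltW e0)// => /(_ (lexx _)) /(le_trans (normr_ge0 _)).
  by rewrite pmulr_lge0// exprn_gt0.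
have cv : h^-1 *: ((f \o shift x) (h *: 1) - f x) @[h --> 0^'] --> d.
  apply/cvgrPdist_le => eps eps0.
  near=> h.
  have hn : h != 0 by near: h; exact: nbhs_dnbhs_neq.
  have h1 : `|h| <= e.
    near: h; apply: dnbhs0_le => //.
  have h2 : `|h| <= eps / (C + 1).
    near: h; apply: dnbhs0_le; rewrite divr_gt0//; lra.
  have := H h h1; rewrite /= /GRing.scale/= mulr1 [h + x]addrC => Hh.
  rewrite -(ler_pM2l (_ : 0 < `|h|)) ?normr_gt0// -normrM mulrBr mulrA divff// mul1r.
  rewrite -normrN opprB; apply: le_trans Hh _.
  rewrite -real_normK ?num_real// expr2 mulrA [leRHS]mulrC ler_wpM2r//.
  move: h2; rewrite ler_pdivlMr; last lra.
  have := normr_ge0 h; nra.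
have -> : d = 'D_1 f x by rewrite /derive (cvg_lim _ cv).
by apply: derivableP; apply: cvgP cv.
Unshelve. all: by end_near.
Qed.

Lemma laplace_le (l t : R) : 0 <= l -> 0 < t -> l * expR (- (t * l)) <= t^-1.
Proof.
move=> l0 t0; have := expR_ge1Dx (t * l) => h.
rewrite -ler_pdivlMr ?expR_gt0// -expRN opprK -(ler_pM2l t0) mulrA divff ?gt_eqF//.
lra.
Qed.

(** Half of the exponential absorbs the factor [l x], because [l * expR (- (c / 2 * l))] is
    bounded. *)
Lemma tsm_laplace (T : choiceType) (A : set T) (p l : T -> R) :
  (forall x, A x -> 0 <= l x) ->
  (forall c : R, 0 < c -> tsm A (fun x => p x * expR (- (c * l x)))) ->
  forall c : R, 0 < c -> tsm A (fun x => l x * p x * expR (- (c * l x))).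
Proof.
move=> l0 sp c c0; have c2 : 0 < c / 2 by rewrite divr_gt0.
apply: tsm_le (tsm_norm (tsmZ (c / 2)^-1 (sp _ c2))) => x Ax.
have -> : expR (- (c * l x)) = expR (- (c / 2 * l x)) * expR (- (c / 2 * l x)).
  by rewrite -expRD; congr expR; lra.
have := laplace_le (l0 x Ax) c2.
set E := expR _; have E0 : 0 < E by exact: expR_gt0.
move=> H; have -> : l x * p x * (E * E) = l x * E * (p x * E) by ring.
rewrite normrM [leRHS]normrM ler_wpM2r// !ger0_norm ?mulr_ge0 ?l0 ?(ltW E0)//.
by rewrite invr_ge0 ltW.
Qed.

Lemma laplace_derive (T : choiceType) (A : set T) (p l : T -> R) :
  (forall x, A x -> 0 <= l x) ->
  (forall c : R, 0 < c -> tsm A (fun x => p x * expR (- (c * l x)))) ->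
  forall t, 0 < t -> is_derive t 1 (fun t => tsum A (fun x => p x * expR (- (t * l x))))
    (- tsum A (fun x => l x * p x * expR (- (t * l x)))).
Proof.
move=> l0 sp t t0.
have s1 := tsm_laplace l0 sp; have s2 := tsm_laplace l0 s1.
have t2 : 0 < t / 2 by rewrite divr_gt0.
(* An increment with [|h| <= t / 2] costs a factor [expR (|h| * l x)], so the second-order terms are
   dominated by the series at [t / 2]. *)
pose C := tsum A (fun x => `|l x * (l x * p x) * expR (- (t / 2 * l x))|).
apply: (@is_derive_quad _ t _ C (t / 2)) => // h ht.
have th : 0 < t + h by move: ht; rewrite ler_norml; lra.
have sth := sp _ th; have st := sp _ t0; have st1 := s1 _ t0.
rewrite mulrN opprK -tsumB// -tsumZ// -tsumD//; last 2 first.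
- exact: tsmB.
- exact: tsmZ.
apply: le_trans (ler_norm_tsum _) _.
  by apply: tsmD; [exact: tsmB|exact: tsmZ].
rewrite /C mulrC -tsumZ; last exact/tsm_norm/s2.
apply: le_tsum.
- by apply: tsm_norm; apply: tsmD; [exact: tsmB|exact: tsmZ].
- exact/tsmZ/tsm_norm/s2.
move=> x Ax; have lx := l0 x Ax.
have -> : p x * expR (- ((t + h) * l x)) - p x * expR (- (t * l x)) +
   h * (l x * p x * expR (- (t * l x))) =
   p x * expR (- (t * l x)) * (expR (- (h * l x)) - 1 - (- (h * l x))).
  have -> : - ((t + h) * l x) = - (t * l x) + - (h * l x) by ring.
  by rewrite expRD; ring.
rewrite !normrM.
have q := expR_quad (- (h * l x)).
have e1 : expR (- (t * l x)) * expR `|- (h * l x)| <= expR (- (t / 2 * l x)).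
  rewrite -expRD ler_expR normrN normrM (ger0_norm lx).
  by have := ler_wpM2r lx ht; lra.
apply: (@le_trans _ _ (`|p x| * expR (- (t * l x)) * ((- (h * l x)) ^+ 2 * expR `|- (h * l x)|))).
  by rewrite (ger0_norm (expR_ge0 _)) ler_wpM2l// mulr_ge0// expR_ge0.
rewrite (ger0_norm lx) (ger0_norm (expR_ge0 _)).
have -> : `|p x| * expR (- (t * l x)) * ((- (h * l x)) ^+ 2 * expR `|- (h * l x)|) =
   h ^+ 2 * (l x * (l x * `|p x|)) * (expR (- (t * l x)) * expR `|- (h * l x)|) by ring.
rewrite [leRHS]mulrA ler_wpM2l// mulr_ge0 ?sqr_ge0//.
by rewrite !mulr_ge0.
Qed.

Lemma derive0_const (f : R -> R) :
  (forall x : R, 0 < x -> is_derive x 1 f 0) -> forall x y : R, 0 < x -> 0 < y -> f x = f y.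
Proof.
move=> f0.
have key (x y : R) : 0 < x -> x < y -> f x = f y.
  move=> x0 xy.
  have fd z : z \in `]x, y[ -> is_derive z 1 f ((fun=> 0) z).
    by rewrite in_itv/= => /andP[xz _]; apply: f0; exact: lt_trans xz.
  have [|c _] := MVT xy fd; last by rewrite mul0r => /eqP; rewrite subr_eq0 => /eqP ->.
  apply: derivable_within_continuous => z; rewrite in_itv/= => /andP[xz _].
  by have [] := f0 z (lt_le_trans x0 xz).
move=> x y x0 y0; have [xy|xy|->//] := ltgtP x y; [exact: key|by rewrite -(key y x)].
Qed.

Lemma poly_of_deriv (n : nat) (G : nat -> R -> R) :
  (forall j (x : R), (j < n)%N -> 0 < x -> is_derive x 1 (G j) (G j.+1 x)) ->
  (forall x : R, 0 < x -> G n x = 0) ->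
  exists c : nat -> R, forall x : R, 0 < x -> G 0%N x = \sum_(k < n) c k * x ^+ k.
Proof.
elim: n G => [|n IH] G dG Gn.
  by exists (fun=> 0) => x x0; rewrite big_ord0 Gn.
have [||c cG] := IH (fun j => G j.+1).
- by move=> j x jn x0; apply: dG.
- exact: Gn.
pose P x := \sum_(k < n) (c k / k.+1%:R) * x ^+ k.+1.
have dP (x : R) : is_derive x 1 P (\sum_(k < n) c k * x ^+ k).
  have -> : P = \sum_(k < n) (fun x => (c k / k.+1%:R) * x ^+ k.+1).
    by apply/funext => y; rewrite fct_sumE.
  apply: is_derive_sum => k.
  have -> : (fun x : R => (c k / k.+1%:R) * x ^+ k.+1) = (c k / k.+1%:R) *: (id ^+ k.+1).
    by apply/funext => y; rewrite !fctE.
  apply: is_derive_eq; rewrite /GRing.scale/= mulr1 mulrA divfK//.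
have H (x : R) : 0 < x -> is_derive x 1 (fun x => G 0%N x - P x) 0.
  move=> x0; have d0 : is_derive x 1 (G 0%N) (G 1%N x) by apply: dG.
  by apply: is_derive_eq; rewrite cG// subrr.
pose c' k := if k is k'.+1 then c k' / k%:R else G 0%N 1 - P 1.
exists c' => x x0; rewrite big_ord_recl/= expr0 mulr1.
rewrite (derive0_const H ltr01 x0).
rewrite (_ : \sum_(i < n) _ = P x) ?subrK//.
Qed.

Definition dchain (n : nat) (G : nat -> R -> R) :=
  forall j (x : R), (j < n)%N -> 0 < x -> is_derive x 1 (G j) (G j.+1 x).

Lemma is_derive_inv_comp (f df : R -> R) (n : nat) (x : R) : 0 < x ->
  (forall y : R, 0 < y -> is_derive y 1 f (df y)) ->
  is_derive x 1 (fun x => x^-1 ^+ n * f x^-1)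
    (- (n%:R * x^-1 ^+ n.+1 * f x^-1) - x^-1 ^+ n.+2 * df x^-1).
Proof.
move=> x0 fd.
have xn0 : x != 0 by rewrite gt_eqF.
have dV : is_derive x 1 (fun x : R => x^-1) (- x^-1 ^+ 2).
  apply: (is_derive_eq (is_deriveV xn0 (is_derive_id x 1))).
  by rewrite /GRing.scale/= mulr1 exprVn.
have dV2 : is_derive x 1 ((fun x : R => x^-1) ^+ n) (n%:R * x^-1 ^+ n.-1 * - x^-1 ^+ 2).
  by apply: is_derive_eq; rewrite /GRing.scale/=.
have df1 : is_derive x^-1 1 f (df x^-1) by apply: fd; rewrite invr_gt0.
have dC : is_derive x 1 (f \o (fun x : R => x^-1)) (df x^-1 * - x^-1 ^+ 2).
  exact: is_derive1_comp.
have -> : (fun x => x^-1 ^+ n * f x^-1) = ((fun x : R => x^-1) ^+ n) * (f \o (fun x : R => x^-1)).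
  by apply/funext => y; rewrite !fctE.
apply: is_derive_eq; rewrite !fctE /GRing.scale/=.
case: n {dV2} => [|n]; first by rewrite !mul0r mulr0 expr0 expr2; ring.
by rewrite /= !exprS; ring.
Qed.

(** Bol: the derivative of order [k + 1] of [x^k E(1/x)] involves only the derivative of the same
    order of [E], all lower ones cancelling. This turns the weight [k + 2] of a function into the
    weight [- k] of its iterated primitive. The intermediate derivatives are kept abstract in the
    chain [H]. *)
Lemma bol_identity (E : nat -> R -> R) (k : nat) :
  (forall j (x : R), 0 < x -> is_derive x 1 (E j) (E j.+1 x)) ->
  exists H, [/\ dchain k.+1 H, forall x : R, 0 < x -> H 0%N x = x ^+ k * E 0%N x^-1
    & forall x : R, 0 < x -> H k.+1 x = (-1) ^+ k.+1 * (x^-1 ^+ k.+2 * E k.+1 x^-1)].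
Proof.
move=> dE; elim: k => [|k [H [dH H0 Hk]]].
  exists (fun j => if j is 0%N then (fun x => x^-1 ^+ 0 * E 0%N x^-1)
    else (fun x => - (x^-1 ^+ 2 * E 1%N x^-1))); split.
  - case=> // x _ x0; apply: is_derive_eq; first exact: is_derive_inv_comp (dE 0%N).
    by rewrite !mul0r oppr0 add0r.
  - by move=> x _; rewrite !expr0.
  - by move=> x _; rewrite expr1 mulN1r.
pose Hk2 x := (-1) ^+ k.+1 * (- (k.+2%:R * x^-1 ^+ k.+3 * E k.+1 x^-1) - x^-1 ^+ k.+4 * E k.+2 x^-1).
(* The chain must be differentiated once more; its last member is replaced by the closed formula,
   whose derivative [Hk2] is known. *)
pose H1 j := if j == k.+2 then Hk2 else if j == k.+1 then
  (fun x => (-1) ^+ k.+1 * (x^-1 ^+ k.+2 * E k.+1 x^-1)) else H j.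
have dH1 : dchain k.+2 H1.
  move=> j x jk x0; rewrite /H1 (ltn_eqF jk) eqSS.
  have [/eqP ej|jk1] := boolP (j == k.+1).
    rewrite /Hk2.
    have d := is_derive_inv_comp k.+2 x0 (dE k.+1).
    have := is_deriveZ ((-1) ^+ k.+1) d; exact.
  have jk2 : (j < k.+1)%N by rewrite ltn_neqAle jk1 -ltnS.
  have d := dH j x jk2 x0.
  case: (eqVneq j.+1 k.+1) => [e|//].
  by rewrite -Hk// -e.
have H1e x : 0 < x -> H1 k.+1 x = H k.+1 x.
  by move=> x0; rewrite /H1 ltn_eqF// eqxx Hk.
(* Leibniz' rule for the product of [x] with [x^k E(1/x)]: the derivatives of [x] beyond the first
   vanish. *)
pose H2 j := fun x => x * H1 j x + j%:R * H1 j.-1 x.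
exists H2; split.
- move=> j x jk x0; rewrite /H2.
  have d1 := dH1 j x jk x0.
  have d2 : is_derive x 1 (fun x => j%:R * H1 j.-1 x) (j%:R * H1 j x).
    case: j jk {d1} => [|j] jk.
      rewrite mul0r (_ : (fun x => _) = cst 0); first exact: is_derive_cst.
      by apply/funext => y; rewrite mul0r.
    have := is_deriveZ (j.+1%:R : R) (dH1 j x (ltnW jk) x0); exact.
  have d3 : is_derive x 1 (id * H1 j) (x *: H1 j.+1 x + H1 j x *: 1).
    exact: is_deriveM.
  have := is_deriveD d3 d2; rewrite /GRing.scale/= mulr1 => d4.
  apply: is_derive_eq d4 _.
  by rewrite -natr1; ring.
- move=> x x0; rewrite /H2 mul0r addr0 exprS -mulrA; congr (_ * _).
  by rewrite -H0// /H1; case: (k).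
- move=> x x0; rewrite /H2 H1e// Hk// /H1 eqxx /Hk2.
  have e : x * x^-1 = 1 by rewrite divff// gt_eqF.
  rewrite !exprS; move: e (x^-1 ^+ k) ((-1) ^+ k) (E k.+2 x^-1) (E k.+1 x^-1).
  move: x^-1 => y e Y S' A B'.
  have -> : x * (-1 * S' * (- (k.+2%:R * (y * (y * (y * Y))) * B') - y * (y * (y * (y * Y))) * A)) =
    (x * y) * (-1 * S' * (- (k.+2%:R * (y * (y * Y)) * B') - y * (y * (y * Y)) * A)) by ring.
  by rewrite e; ring.
Qed.

End RealDerive.

(** * Roots of unity and Cauchy's estimate *)

Section RootsOfUnity.
Context {R : realType}.
Local Notation C := R[i].
Local Open Scope complex_scope.

Definition cunit (N k : nat) : C := cexp (0 +i* (2 * pi * (k%:R / N%:R))).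

Lemma cn_cunit N k : cn (cunit N k) = 1.
Proof. by rewrite cn_cexp/= expR0. Qed.

Lemma cunitD N k l : cunit N (k + l) = cunit N k * cunit N l.
Proof.
rewrite -cexpD; congr cexp; apply: complex_ext; rewrite ?ReD ?ImD/= ?addr0// natrD; ring.
Qed.

Lemma cunit0 N : cunit N 0 = 1.
Proof. by rewrite /cunit mul0r mulr0 cexp0. Qed.

Lemma cunitMn N k m : cunit N (k * m) = cunit N k ^+ m.
Proof.
by elim: m => [|m IH]; rewrite ?muln0 ?cunit0// mulnS cunitD IH exprS.
Qed.

Lemma cunitN N m : (0 < N)%N -> cunit N (N * m) = 1.
Proof.
move=> N0; rewrite /cunit natrM (mulrC N%:R) mulfK ?cexp2pi//.
by rewrite pnatr_eq0 -lt0n.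
Qed.

Lemma cunit_mod N k : (0 < N)%N -> cunit N (k %% N) = cunit N k.
Proof. by move=> N0; rewrite [in RHS](divn_eq k N) cunitD mulnC cunitN// mul1r. Qed.

Lemma cos_eq1 (x : R) : 0 < x < 2 * pi -> cos x != 1.
Proof.
move=> /andP[x0 x1]; have -> : x = (x / 2) *+ 2 by rewrite mulr2n; lra.
rewrite cos_mulr2n cos2sin2; have : 0 < sin (x / 2) by apply: sin_gt0_pi; apply/andP; split; lra.
by move=> s0; apply/eqP => e; have := exprn_gt0 2 s0; rewrite mulr2n in e; lra.
Qed.

Lemma cunit_neq1 N k : (0 < k < N)%N -> cunit N k != 1.
Proof.
move=> /andP[k0 kN]; have N0 : 0 < N%:R :> R by rewrite ltr0n; lia.
have : cos (2 * pi * (k%:R / N%:R)) != 1 :> R.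
  have q0 : 0 < k%:R / N%:R :> R by rewrite divr_gt0// ltr0n.
  have q1 : k%:R / N%:R < 1 :> R by rewrite ltr_pdivrMr// mul1r ltr_nat.
  by apply: cos_eq1; have := pi_gt0 R; nra.
apply: contraNneq => e; apply/eqP; move: e => /(congr1 (@complex.Re R))/=.
by rewrite expR0 mul1r.
Qed.

Lemma sum_cunit N k : (0 < N)%N ->
  \sum_(j < N) cunit N k ^+ j = if (N %| k)%N then N%:R else 0.
Proof.
move=> N0; case: ifP => [/dvdnP[m ->]|Nk].
  by rewrite mulnC cunitN//; under eq_bigr do rewrite expr1n; rewrite sumr_const card_ord.
have kN : (0 < k %% N < N)%N by rewrite ltn_mod N0 andbT lt0n; apply/negbT.
have := cunit_neq1 kN; rewrite cunit_mod// -subr_eq0 => w1.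
apply: (mulfI w1); rewrite -subrX1 mulr0 -cunitMn mulnC cunitN// subrr//.
Qed.

(* Cauchy's estimate, by averaging over the N-th roots of unity. *)
Lemma cauchy_poly (p : {poly C}) (rho B : R) n : 0 <= rho ->
  (forall t : R, cn p.[rho%:C * cexp (0 +i* t)] <= B) -> cn p`_n * rho ^+ n <= B.
Proof.
move=> r0 pB.
(* [N] exceeds [n] and every exponent of [p], so the exponents are distinct modulo [N] and the
   twisted average isolates the coefficient of index [n]. *)
pose N := (size p + n.+1)%N.
have N0 : (0 < N)%N by rewrite /N; lia.
have N0' : 0 < N%:R :> R by rewrite ltr0n.
have key : N%:R * (p`_n * (rho ^+ n)%:C) =
    \sum_(j < N) cunit N (N - n) ^+ j * p.[rho%:C * cunit N j].
  under [RHS]eq_bigr => j _.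
    rewrite (@horner_coef_wide _ N); last by rewrite /N; lia.
    rewrite mulr_sumr; over.
  rewrite exchange_big/=.
  have nN : (n < N)%N by rewrite /N; lia.
  rewrite (bigD1 (Ordinal nN))//= [X in _ + X]big1 ?addr0; last first.
    move=> k kn; have kn' : k != n :> nat by apply: contra kn => /eqP e; apply/eqP/val_inj.
    under eq_bigr => j _.
      rewrite exprMn -cunitMn -cunitMn mulrCA (mulrCA (cunit _ _)) -cunitD.
      rewrite (mulnC j) -mulnDl cunitMn mulrA; over.
    rewrite -mulr_sumr sum_cunit// ifF ?mulr0//.
    apply/negP => /dvdnP[q e]; have := ltn_ord k.
    case: q e => [|[|q]]; rewrite ?mul0n ?mul1n ?mulSn; lia.
  under eq_bigr => j _.
    rewrite exprMn -cunitMn -cunitMn mulrCA (mulrCA (cunit _ _)) -cunitD.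
    rewrite (mulnC j) -mulnDl subnK 1?ltnW// cunitMn -[X in cunit _ X]muln1 cunitN// expr1n mulr1; over.
  rewrite /= sumr_const card_ord -[RHS]mulr_natl; congr (_ * (_ * _)); exact: rmorphXn.
have {key} : cn (N%:R * (p`_n * (rho ^+ n)%:C)) <= N%:R * B.
  rewrite key; apply: le_trans (cn_sum _ _ _) _.
  rewrite mulr_natl -[X in _ *+ X](card_ord N) -sumr_const; apply: ler_sum => j _.
  by rewrite cnM cnX cn_cunit expr1n mul1r pB.
by rewrite cnM cn_nat ler_pM2l// cnM cn_real ger0_norm// exprn_ge0.
Qed.

End RootsOfUnity.

(** * Locally uniform limits of polynomials on the unit disc *)
Section Disc.
Context {R : realType}.
Local Notation C := R[i].
Local Open Scope complex_scope.
Implicit Types f g : C -> C.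

(** This plays the role of holomorphy on the open disc. No power series is attached to [f]:
    identities are proved through the coefficients of the approximating polynomials, which
    [cauchy_poly] controls. *)
Definition analytic_disc f := forall (r e : R), 0 <= r < 1 -> 0 < e ->
  exists p : {poly C}, forall u, cn u <= r -> cn (f u - p.[u]) <= e.

Lemma analytic_poly (p : {poly C}) : analytic_disc (fun u => p.[u]).
Proof. by move=> r e _ e0; exists p => u _; rewrite subrr cn0 ltW. Qed.

Lemma poly_bounded (p : {poly C}) : exists2 B : R, 0 <= B & forall u, cn u <= 1 -> cn p.[u] <= B.
Proof.
exists (\sum_(i < size p) cn p`_i); first by apply: sumr_ge0 => i _; exact: cn_ge0.
move=> u u1; rewrite horner_coef; apply: le_trans (cn_sum _ _ _) _.
apply: ler_sum => i _; rewrite cnM cnX ler_piMr ?cn_ge0// exprn_ile1 ?cn_ge0//.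
Qed.

Lemma analytic_bounded f (r : R) : analytic_disc f -> 0 <= r < 1 ->
  exists2 B : R, 0 <= B & forall u, cn u <= r -> cn (f u) <= B.
Proof.
move=> af r01; have [p fp] := af r 1 r01 ltr01; have [B B0 pB] := poly_bounded p.
exists (1 + B) => [|u ur]; first by rewrite addr_ge0.
rewrite -(subrK p.[u] (f u)); apply: le_trans (cnD _ _) (lerD (fp u ur) (pB u _)).
by case/andP: r01 => _ /ltW; exact: le_trans.
Qed.

Lemma analytic_lim f : (forall (r e : R), 0 <= r < 1 -> 0 < e ->
    exists2 g, analytic_disc g & forall u, cn u <= r -> cn (f u - g u) <= e) ->
  analytic_disc f.
Proof.
move=> H r e r01 e0; have e2 : 0 < e / 2 by rewrite divr_gt0.
have [g ag fg] := H r _ r01 e2; have [p gp] := ag r _ r01 e2.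
exists p => u ur; rewrite -(subrKA (g u)); apply: le_trans (cnD _ _) _.
by have := fg u ur; have := gp u ur; lra.
Qed.

Lemma analyticD f g : analytic_disc f -> analytic_disc g -> analytic_disc (fun u => f u + g u).
Proof.
move=> af ag r e r01 e0; have e2 : 0 < e / 2 by rewrite divr_gt0.
have [p fp] := af r _ r01 e2; have [q gq] := ag r _ r01 e2.
exists (p + q) => u ur; rewrite hornerD opprD addrACA; apply: le_trans (cnD _ _) _.
by have := fp u ur; have := gq u ur; lra.
Qed.

Lemma analyticM f g : analytic_disc f -> analytic_disc g -> analytic_disc (fun u => f u * g u).
Proof.
move=> af ag r e r01 e0.
have [B B0 fB] := analytic_bounded af r01.
have [B1 B10 gB] := analytic_bounded ag r01.
pose d := Num.min 1 (e / (B + B1 + 2)).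
have d0 : 0 < d by rewrite lt_min ltr01 divr_gt0//; lra.
have d1 : d <= 1 by rewrite ge_min lexx.
have d2 : d * (B + B1 + 2) <= e by rewrite -ler_pdivlMr ?ge_min ?lexx ?orbT//; lra.
have [p fp] := af r _ r01 d0; have [q gq] := ag r _ r01 d0.
exists (p * q) => u ur; rewrite hornerM.
have -> : f u * g u - p.[u] * q.[u] =
  (f u - p.[u]) * g u + f u * (g u - q.[u]) - (f u - p.[u]) * (g u - q.[u]) by ring.
apply: le_trans (cnB _ _) _; apply: le_trans (lerD (cnD _ _) (lexx _)) _.
rewrite !cnM; have := fp u ur; have := gq u ur; have := fB u ur; have := gB u ur.
have := cn_ge0 (f u - p.[u]); have := cn_ge0 (g u - q.[u]); have := cn_ge0 (f u); have := cn_ge0 (g u).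
move: (cn (f u)) (cn (g u)) (cn (f u - p.[u])) (cn (g u - q.[u])) => a b c k.
move=> b0 a0 k0 c0 bB aB kd cd.
have : c * b <= d * B1 by rewrite ler_pM.
have : a * k <= B * d by rewrite ler_pM.
have : c * k <= d * 1 by rewrite ler_pM//; lra.
by nra.
Qed.

Lemma analyticX f n : analytic_disc f -> analytic_disc (fun u => f u ^+ n).
Proof.
move=> af; elim: n => [|n IH].
  by have := analytic_poly 1; congr analytic_disc; apply/funext => u; rewrite hornerC.
have := analyticM af IH; congr analytic_disc; apply/funext => u; by rewrite exprS.
Qed.

Lemma analytic_cst c : analytic_disc (fun=> c).
Proof.
by have := analytic_poly c%:P; congr analytic_disc; apply/funext => u; rewrite hornerC.
Qed.

Lemma analytic_id : analytic_disc id.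
Proof.
by have := analytic_poly 'X; congr analytic_disc; apply/funext => u; rewrite hornerX.
Qed.

Lemma analytic_sum (I : Type) (r : seq I) (F : I -> C -> C) :
  (forall i, analytic_disc (F i)) -> analytic_disc (fun u => \sum_(i <- r) F i u).
Proof.
move=> aF; elim: r => [|i r IH].
  have := analytic_cst 0; congr analytic_disc; apply/funext => u; by rewrite big_nil.
have := analyticD (aF i) IH; congr analytic_disc; apply/funext => u; by rewrite big_cons.
Qed.

Lemma analytic_comp_opp f : analytic_disc f -> analytic_disc (fun u => f (- u)).
Proof.
move=> af r e r01 e0; have [p fp] := af r e r01 e0; exists (p \Po (- 'X)) => u ur.
by rewrite horner_comp !hornerE fp// cnN.
Qed.

Lemma expr_small (r e : R) : 0 <= r < 1 -> 0 < e -> exists n, r ^+ n <= e.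
Proof.
move=> /andP[r0 r1] e0.
have : r ^+ n @[n --> \oo] --> (0 : R) by apply: cvg_expr; rewrite ger0_norm.
move/cvgr_lt/(_ _ e0) => [n _ /(_ n (leqnn n))/ltW h]; by exists n.
Qed.

Lemma analytic_geom : analytic_disc (fun u => (1 - u)^-1).
Proof.
move=> r e r01 e0; case/andP: (r01) => r0 r1.
have [n rn] := @expr_small r (e * (1 - r)) r01 ltac:(by rewrite mulr_gt0// subr_gt0).
exists (\poly_(i < n) 1) => u ur.
have u1 : 1 - u != 0.
  apply/negP => /eqP/subr0_eq e1; have := ur; rewrite -e1 cn1; lra.
have h : 1 - r <= cn (1 - u).
  have := cnD (1 - u) u; rewrite subrK cn1; lra.
rewrite horner_poly; under eq_bigr do rewrite mul1r.
have -> : (1 - u)^-1 - \sum_(i < n) u ^+ i = u ^+ n / (1 - u).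
  apply: (mulIf u1); rewrite mulrBl mulVf// divfK//.
  have := subrX1 u n; set S := \sum_(i < n) _ => e1.
  by rewrite -[u ^+ n](subrK 1) e1; ring.
rewrite cnM cnX cnV ler_pdivrMr; last by lra.
apply: le_trans (_ : r ^+ n <= _); first by rewrite lerXn2r ?nnegrE ?cn_ge0.
by apply: le_trans rn _; rewrite ler_pM2l.
Qed.

Lemma analytic_cexp f : analytic_disc f -> analytic_disc (fun u => cexp (f u)).
Proof.
move=> af; apply: analytic_lim => r e r01 e0.
have [B B0 fB] := analytic_bounded af r01.
have [m cm] := cexp_lim B e0.
exists (fun u => (1 + f u / m%:R) ^+ m) => [|u /fB /cm//].
apply: analyticX; apply: analyticD; first exact: analytic_cst.
by apply: analyticM => //; exact: analytic_cst.
Qed.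

Lemma geom_tail (x : R) m n : 0 <= x <= 1 / 2 -> \sum_(m <= i < n) x ^+ i <= 2 * x ^+ m.
Proof.
move=> /andP[x0 x1]; have [nm|mn] := leqP n m.
  by rewrite big_geq// mulr_ge0// exprn_ge0.
rewrite -{1}[m]add0n big_addn big_mkord.
under eq_bigr do rewrite exprD mulrC.
rewrite -mulr_sumr mulrC ler_wpM2r ?exprn_ge0//.
have := subrX1 x (n - m); have := exprn_ge0 (n - m) x0.
set S := \sum_(i < _) _; nra.
Qed.

Lemma poly_split (p : {poly C}) u k : exists n, p.[u] =
  \sum_(0 <= i < k) p`_i * u ^+ i + \sum_(k <= i < n) p`_i * u ^+ i.
Proof.
exists (k + size p)%N; rewrite -big_cat_nat//; last by lia.
by rewrite big_mkord; apply: horner_coef_wide; lia.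
Qed.

(* Strong induction on the index: every coefficient of an approximating
   polynomial is small, once the approximation is good enough. *)
Lemma coef_small f (r : R) k : 0 < r < 1 -> analytic_disc f ->
  (forall x : R, 0 <= x < 1 -> f x%:C = 0) ->
  forall e, 0 < e -> exists2 d, 0 < d & forall q : {poly C},
    (forall v, cn v <= r -> cn (f v - q.[v]) <= d) -> cn q`_k <= e.
Proof.
move=> r01 af f0; case/andP: (r01) => r0 r1.
have r01' : 0 <= r < 1 by rewrite ltW.
have [B0 B00 fB0] := analytic_bounded af r01'.
pose B := B0 + 1.
have qB (q : {poly C}) d : d <= 1 -> (forall v, cn v <= r -> cn (f v - q.[v]) <= d) ->
    forall i, cn q`_i * r ^+ i <= B.
  move=> d1 fq i; apply: cauchy_poly; first exact: ltW.
  move=> t; set v := (_ * _); have vr : cn v <= r.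
    by rewrite /v cnM cn_real cn_cexp/= expR0 mulr1 ger0_norm// ltW.
  rewrite -[q.[v]](subKr (f v)); apply: le_trans (cnB _ _) _.
  by apply: lerD; [exact: fB0|exact: le_trans (fq v vr) d1].
have Bp : 0 < B by rewrite /B; lra.
elim/ltn_ind: k => k IH e e0.
(* At the real point [x] the function vanishes, so [q] is small there. The lower coefficients
   contribute at most [k * d1] and the tail, geometric with ratio [x / r <= 1 / 2], at most
   [2 B (x / r)^(k + 1)]. This choice of [x], and that of [d1] below, keep the two parts under
   [e * x^k / 2] each. *)
pose x := Num.min (r / 2) (e * r ^+ k.+1 / (4 * B)).
have rk : 0 < r ^+ k.+1 by rewrite exprn_gt0.
have x0 : 0 < x by rewrite lt_min !divr_gt0 ?mulr_gt0.
have xr : x <= r / 2 by rewrite ge_min lexx.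
have xB : x * (4 * B) <= e * r ^+ k.+1.
  by rewrite -ler_pdivlMr ?mulr_gt0// ge_min lexx orbT.
pose d1 := Num.min 1 (e * x ^+ k / (2 * (k.+1)%:R)).
have xk : 0 < x ^+ k by rewrite exprn_gt0.
have k1 : 0 < k.+1%:R :> R by rewrite ltr0n.
have d10 : 0 < d1 by rewrite lt_min ltr01 divr_gt0 ?mulr_gt0.
have d1e : d1 * k.+1%:R <= e * x ^+ k / 2.
  rewrite -ler_pdivlMr// ge_min; apply/orP; right.
  by rewrite le_eqVlt; apply/orP; left; apply/eqP; field; rewrite gt_eqF.
have [d d0 dP] : exists2 d, 0 < d & d <= d1 /\ forall q : {poly C},
    (forall v, cn v <= r -> cn (f v - q.[v]) <= d) -> forall i, (i < k)%N -> cn q`_i <= d1.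
  elim: {-2}k (leqnn k) => [_|j IHj jk]; first by exists d1.
  have [d2 d20 [d2d h2]] := IHj (ltnW jk).
  have [d3 d30 h3] := IH j jk d1 d10.
  exists (Num.min d2 d3); first by rewrite lt_min d20.
  split; first by rewrite ge_min d2d.
  move=> q fq i; rewrite ltnS leq_eqVlt => /predU1P[->|ij].
    by apply: h3 => v vr; apply: le_trans (fq v vr) _; rewrite ge_min lexx orbT.
  by apply: h2 => // v vr; apply: le_trans (fq v vr) _; rewrite ge_min lexx.
case: dP => dd1 dP; exists d => // q fq.
have d_1 : d <= 1 by rewrite (le_trans dd1)// ge_min lexx.
have {qB} qB := qB q d d_1 fq.
have {dP} dP := dP q fq.
have x1 : x < 1 by lra.
have qx : cn q.[x%:C] <= d.
  have := fq x%:C; rewrite f0 ?sub0r ?cnN ?(ltW x0)//; apply.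
  by rewrite cn_real gtr0_norm//; lra.
have [n] := poly_split q x%:C k.+1; rewrite big_nat_recr//= => E.
have {}E : q`_k * x%:C ^+ k = q.[x%:C] - \sum_(0 <= i < k) q`_i * x%:C ^+ i
   - \sum_(k.+1 <= i < n) q`_i * x%:C ^+ i by rewrite E; ring.
have cx i : cn (q`_i * x%:C ^+ i) = cn q`_i * x ^+ i.
  by rewrite cnM cnX cn_real gtr0_norm.
have : cn (q`_k * x%:C ^+ k) <= d1 + k%:R * d1 + B * (2 * (x / r) ^+ k.+1).
  rewrite E; apply: le_trans (cnB _ _) _; apply: lerD; last first.
    apply: le_trans (cn_sum _ _ _) _.
    apply: (@le_trans _ _ (B * \sum_(k.+1 <= i < n) (x / r) ^+ i)).
      rewrite mulr_sumr; apply: ler_sum => i _; rewrite cx.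
      rewrite expr_div_n mulrA ler_pdivlMr ?exprn_gt0// mulrAC.
      by rewrite ler_pM2r ?exprn_gt0.
    rewrite ler_pM2l//; apply: geom_tail; rewrite divr_ge0 ?(ltW x0) ?(ltW r0)//=.
    by rewrite ler_pdivrMr//; lra.
  apply: le_trans (cnB _ _) _; apply: lerD; first exact: le_trans dd1.
  apply: le_trans (cn_sum _ _ _) _.
  rewrite big_mkord mulr_natl -[X in _ *+ X](card_ord k) -sumr_const; apply: ler_sum => i _.
  rewrite cx -[leRHS]mulr1 ler_pM ?cn_ge0 ?exprn_ge0 ?(ltW x0)//; first exact: dP.
  by rewrite exprn_ile1 ?(ltW x0)// ltW.
rewrite cx => H; rewrite -(ler_pM2r xk); apply: le_trans H _.
have -> : d1 + k%:R * d1 = d1 * k.+1%:R by rewrite -natr1; ring.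
have : B * (2 * (x / r) ^+ k.+1) <= e * x ^+ k / 2.
  rewrite expr_div_n mulrA mulrA ler_pdivrMr// exprSr.
  have := ler_wpM2r (ltW xk) xB; nra.
lra.
Qed.

(** Identity theorem. In a good approximation the first [K] coefficients are small by [coef_small];
    the others are bounded by Cauchy's estimate on a circle of radius [r] between [cn u] and 1, so
    at [u] they form a geometric tail. *)
Lemma analytic_eq0 f : analytic_disc f -> (forall x : R, 0 <= x < 1 -> f x%:C = 0) ->
  forall u, cn u < 1 -> f u = 0.
Proof.
move=> af f0 u u1; apply: cn_eq0; apply/eqP; rewrite eq_le cn_ge0 andbT.
apply/ler_addgt0Pr => e e0; rewrite add0r.
pose r := (1 + cn u) / 2.
have u0 := cn_ge0 u.
have r01 : 0 < r < 1 by apply/andP; split; rewrite /r; lra.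
case/andP: (r01) => r0 r1.
have r01' : 0 <= r < 1 by rewrite ltW.
have ur : cn u < r by rewrite /r; lra.
have [B0 B00 fB0] := analytic_bounded af r01'.
pose t := cn u / r.
have t0 : 0 <= t by rewrite divr_ge0// ltW.
have t1 : t < 1 by rewrite ltr_pdivrMr// mul1r.
have [K tK] := @expr_small t (e * (1 - t) / (4 * (B0 + 1))) ltac:(by rewrite t0 t1)
   ltac:(by rewrite divr_gt0 ?mulr_gt0//; lra).
have {}tK : t ^+ K * (4 * (B0 + 1)) <= e * (1 - t) by rewrite -ler_pdivlMr ?mulr_gt0//; lra.
pose d1 := e / (4 * K.+1%:R).
have K0 : 0 < K.+1%:R :> R by rewrite ltr0n.
have d10 : 0 < d1 by rewrite divr_gt0 ?mulr_gt0.
have d1K : d1 * K%:R <= e / 4.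
  apply: (@le_trans _ _ (d1 * K.+1%:R)); first by rewrite ler_pM2l// ler_nat.
  by rewrite le_eqVlt; apply/orP; left; apply/eqP; rewrite /d1; field; rewrite gt_eqF.
have [d d0 [dd dP]] : exists2 d, 0 < d & d <= Num.min 1 (e / 4) /\ forall q : {poly C},
    (forall v, cn v <= r -> cn (f v - q.[v]) <= d) -> forall i, (i < K)%N -> cn q`_i <= d1.
  elim: {-2}K (leqnn K) => [_|j IHj jK].
    by exists (Num.min 1 (e / 4)) => //; rewrite lt_min ltr01 divr_gt0.
  have [d2 d20 [d2d h2]] := IHj (ltnW jK).
  have [d3 d30 h3] := coef_small j r01 af f0 d10.
  exists (Num.min d2 d3); first by rewrite lt_min d20.
  split; first by rewrite ge_min d2d.
  move=> q fq i; rewrite ltnS leq_eqVlt => /predU1P[->|ij].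
    by apply: h3 => v vr; apply: le_trans (fq v vr) _; rewrite ge_min lexx orbT.
  by apply: h2 => // v vr; apply: le_trans (fq v vr) _; rewrite ge_min lexx.
have [q fq] := af r d r01' d0.
have d_1 : d <= 1 by rewrite (le_trans dd)// ge_min lexx.
have d_e : d <= e / 4 by rewrite (le_trans dd)// ge_min lexx orbT.
have qB i : cn q`_i * r ^+ i <= B0 + 1.
  apply: cauchy_poly; first exact: ltW.
  move=> s; set v := (_ * _); have vr : cn v <= r.
    by rewrite /v cnM cn_real cn_cexp/= expR0 mulr1 ger0_norm// ltW.
  rewrite -[q.[v]](subKr (f v)); apply: le_trans (cnB _ _) _.
  by apply: lerD; [exact: fB0|exact: le_trans (fq v vr) d_1].
have [n E] := poly_split q u K.
rewrite -(subrK q.[u] (f u)); apply: le_trans (cnD _ _) _.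
have h1 := fq u (ltW ur).
have h2 : cn (\sum_(0 <= i < K) q`_i * u ^+ i) <= e / 4.
  apply: le_trans (cn_sum _ _ _) _; apply: le_trans d1K.
  rewrite big_mkord mulr_natr -[X in _ *+ X](card_ord K) -sumr_const; apply: ler_sum => i _.
  rewrite cnM cnX -[leRHS]mulr1 ler_pM ?cn_ge0 ?exprn_ge0//; first exact: (dP q fq).
  by rewrite exprn_ile1// ltW.
have h3 : cn (\sum_(K <= i < n) q`_i * u ^+ i) <= e / 4.
  apply: le_trans (cn_sum _ _ _) _.
  apply: (@le_trans _ _ ((B0 + 1) * \sum_(K <= i < n) t ^+ i)).
    rewrite mulr_sumr; apply: ler_sum => i _; rewrite cnM cnX.
    rewrite /t expr_div_n mulrA ler_pdivlMr ?exprn_gt0// mulrAC.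
    by rewrite ler_wpM2r ?exprn_ge0.
  have g : (1 - t) * \sum_(K <= i < n) t ^+ i <= t ^+ K.
    have [nK|Kn] := leqP n K; first by rewrite big_geq// mulr0 exprn_ge0.
    rewrite -{1}[K]add0n big_addn big_mkord.
    under eq_bigr do rewrite exprD mulrC.
    rewrite -mulr_sumr mulrCA ler_piMr ?exprn_ge0//.
    rewrite -opprB mulNr -subrX1 opprB lerBlDr lerDl exprn_ge0//.
  have t1' : 0 < 1 - t by rewrite subr_gt0.
  rewrite -(ler_pM2l t1') mulrCA.
  have B1 : 0 <= B0 + 1 by lra.
  have := ler_wpM2l B1 g; lra.
have : cn q.[u] <= e / 4 + e / 4 by rewrite E; apply: le_trans (cnD _ _) (lerD h2 h3).
lra.
Qed.

End Disc.

(** * Exponential series on the right half-plane *)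

Section QSeries.
Context {R : realType}.
Local Notation C := R[i].
Local Open Scope complex_scope.
Local Notation ii := (@Complex R 0 1).
Implicit Types u w : C.

Lemma RCX (x : R) n : (x ^+ n)%:C = x%:C ^+ n. Proof. exact: rmorphXn. Qed.
Lemma RCM (x y : R) : (x * y)%:C = x%:C * y%:C. Proof. exact: rmorphM. Qed.
Lemma RCB (x y : R) : (x - y)%:C = x%:C - y%:C. Proof. exact: rmorphB. Qed.
Lemma RCN (x : R) : (- x)%:C = - x%:C. Proof. exact: rmorphN. Qed.
Lemma RCD (x y : R) : (x + y)%:C = x%:C + y%:C. Proof. exact: rmorphD. Qed.
Lemma RCnat n : (n%:R : R)%:C = n%:R. Proof. exact: rmorph_nat. Qed.
Lemma ReZr (x : R) w : complex.Re (x%:C * w) = x * complex.Re w.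
Proof. by rewrite ReM/= mul0r subr0. Qed.
Lemma ImZr (x : R) w : complex.Im (x%:C * w) = x * complex.Im w.
Proof. by rewrite ImM/= mul0r addr0. Qed.

Lemma tsum_split_nat (f : nat -> R) N : tsm setT f ->
  tsm setT (fun k => if (k < N)%N then 0 else f k) /\
  tsum setT f = \sum_(k < N) f k + tsum setT (fun k => if (k < N)%N then 0 else f k).
Proof.
move=> sf.
have sg : tsm setT (fun k => if (k < N)%N then 0 else f k).
  by apply: tsm_le (tsm_norm sf) => k _; case: ifP; rewrite ?normr0.
split=> //.
have [s1 e1] := @tsum_fin R _ setT (iota 0 N) f (iota_uniq _ _) (fun _ _ => I).
rewrite -(big_mkord xpredT f) /index_iota subn0 -e1 -tsumD//.
by apply: eq_tsum => k _; rewrite mem_iota/= add0n; case: ifP; rewrite ?addr0 ?add0r.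
Qed.

Variable b : nat -> R.
Hypothesis sb : forall x : R, 0 < x -> tsm setT (fun n => b n * expR (- (2 * pi * n%:R * x))).

(** The variable is [w = - i tau], so the right half-plane replaces the upper one: the nome is
    [exp (-2 pi w)], the generators of the modular group act as [w + i] and [1 / w], and [qr] is the
    restriction of [qc] to the positive axis. *)
Definition qr (x : R) : R := tsum setT (fun n => b n * expR (- (2 * pi * n%:R * x))).
Definition qn (x : R) : R := tsum setT (fun n => `|b n * expR (- (2 * pi * n%:R * x))|).
Definition qe (n : nat) (w : C) : C := cexp (- ((2 * pi * n%:R)%:C * w)).
Definition qc (w : C) : C :=
  tsum setT (fun n => b n * complex.Re (qe n w)) +i* tsum setT (fun n => b n * complex.Im (qe n w)).

Lemma cn_qe n w : cn (qe n w) = expR (- (2 * pi * n%:R * complex.Re w)).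
Proof. by rewrite cn_cexp ReN ReM/= mul0r subr0. Qed.

Let le_qe n (x : R) w : x <= complex.Re w ->
  cn (qe n w) <= expR (- (2 * pi * n%:R * x)).
Proof.
by move=> xw; rewrite cn_qe ler_expR lerN2 ler_wpM2l// !mulr_ge0// pi_ge0.
Qed.

Let sRe w : 0 < complex.Re w -> tsm setT (fun n => b n * complex.Re (qe n w)).
Proof.
move=> w0; apply: tsm_le (tsm_norm (sb w0)) => n _; rewrite normrM [leRHS]normrM ler_wpM2l//.
by apply: le_trans (Re_le_cn _) _; rewrite cn_qe ler_norm.
Qed.

Let sIm w : 0 < complex.Re w -> tsm setT (fun n => b n * complex.Im (qe n w)).
Proof.
move=> w0; apply: tsm_le (tsm_norm (sb w0)) => n _; rewrite normrM [leRHS]normrM ler_wpM2l//.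
by apply: le_trans (Im_le_cn _) _; rewrite cn_qe ler_norm.
Qed.

Lemma qc_tail N (x : R) w : 0 < x -> x <= complex.Re w ->
  cn (qc w - \sum_(n < N) (b n)%:C * qe n w) <=
  2 * (qn x - \sum_(n < N) `|b n * expR (- (2 * pi * n%:R * x))|).
Proof.
move=> x0 xw; have w0 : 0 < complex.Re w by lra.
have sx := tsm_norm (sb x0).
have [t1] := tsum_split_nat N sx; rewrite -/(qn x) => ->.
rewrite addrAC subrr add0r.
apply: le_trans (cn_le_ReIm _) _.
rewrite ReD ImD ReN ImN Re_sum Im_sum.
under [X in `|_ - X| + _]eq_bigr do rewrite ReZr.
under [X in _ + `|_ - X|]eq_bigr do rewrite ImZr.
have [r1 r2] := tsum_split_nat N (sRe w0).
have [i1 i2] := tsum_split_nat N (sIm w0).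
have -> : complex.Re (qc w) = _ := r2.
have -> : complex.Im (qc w) = _ := i2.
rewrite addrAC subrr add0r addrAC subrr add0r mulr_natl mulr2n.
have bnd (f : nat -> R) : tsm setT f ->
   (forall n, `|f n| <= if (n < N)%N then 0 else `|b n * expR (- (2 * pi * n%:R * x))|) ->
   `|tsum setT f| <= tsum setT (fun k => if (k < N)%N then 0 else
      `|b k * expR (- (2 * pi * k%:R * x))|).
  move=> sf fb; apply: le_trans (ler_norm_tsum sf) _; apply: le_tsum => //.
  exact: tsm_norm.
apply: lerD; apply: bnd => // n; case: ifP => _; rewrite ?normr0// normrM [leRHS]normrM ler_wpM2l//.
- by apply: le_trans (Re_le_cn _) _; apply: le_trans (le_qe n xw) _; rewrite ler_norm.
- by apply: le_trans (Im_le_cn _) _; apply: le_trans (le_qe n xw) _; rewrite ler_norm.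
Qed.

Lemma qc_bound (x : R) w : 0 < x -> x <= complex.Re w -> cn (qc w) <= 2 * qn x.
Proof. by move=> x0 xw; have := qc_tail 0 x0 xw; rewrite !big_ord0 !subr0. Qed.

Lemma qn_ge0 x : 0 <= qn x. Proof. exact: tsum_ge0. Qed.

Lemma qc_approx (x e : R) : 0 < x -> 0 < e -> exists N0, forall N, (N0 <= N)%N ->
  forall w, x <= complex.Re w -> cn (qc w - \sum_(n < N) (b n)%:C * qe n w) <= e.
Proof.
move=> x0 e0; have e2 : 0 < e / 2 by rewrite divr_gt0.
have /cvgrPdist_lt/(_ _ e2)[N0 _ H] := tsum_series (tsm_norm (sb x0)).
exists N0 => N /H/=; rewrite -/(qn x) => h w xw; apply: le_trans (qc_tail N x0 xw) _.
by move: h; rewrite ltr_norml => /andP[_ h]; lra.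
Qed.

Lemma qc_real x : 0 < x -> qc x%:C = (qr x)%:C.
Proof.
move=> x0.
have E n : qe n x%:C = (expR (- (2 * pi * n%:R * x)))%:C.
  by rewrite /qe -rmorphM -rmorphN cexp_real.
apply: complex_ext; first by apply: eq_tsum => n _; rewrite E.
transitivity (tsum [set: nat] (fun=> 0 : R)); last by rewrite tsum0.
by apply: eq_tsum => n _; rewrite E/= mulr0.
Qed.

Lemma qe_period n w : qe n (w - ii) = qe n w.
Proof.
rewrite /qe mulrBr opprB addrC cexpD -[RHS]mulr1; congr (_ * _).
rewrite -(cexp2pi n); congr cexp; apply: complex_ext => /=; ring.
Qed.

Lemma qc_period w : qc (w - ii) = qc w.
Proof. by rewrite /qc; congr (_ +i* _); apply: eq_tsum => n _; rewrite qe_period. Qed.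

Lemma qc_period' w : qc (w + ii) = qc w.
Proof. by rewrite -[in RHS](addrK ii w) qc_period. Qed.

Definition mob (u : C) : C := (1 + u) / (1 - u).

Lemma disc_neq1 u : cn u < 1 -> 1 - u != 0.
Proof. by move=> u1; apply/negP => /eqP/subr0_eq e; move: u1; rewrite -e cn1 ltxx. Qed.

Lemma Re_div (z w : C) : complex.Re (z / w) =
  (complex.Re z * complex.Re w + complex.Im z * complex.Im w) / cn w ^+ 2.
Proof.
case: z w => [a c] [d e]; rewrite sqr_cn ReM/=.
rewrite mulrN opprK; ring.
Qed.

Lemma Re_mob u : cn u < 1 -> complex.Re (mob u) = (1 - cn u ^+ 2) / cn (1 - u) ^+ 2.
Proof.
move=> u1; rewrite Re_div; congr (_ / _); rewrite sqr_cn !(ReD, ImD, ReN, ImN)/=; ring.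
Qed.

Lemma Re_mob_ge u (r : R) : cn u <= r -> r < 1 -> (1 - r ^+ 2) / 4 <= complex.Re (mob u).
Proof.
move=> ur r1; have u1 : cn u < 1 by lra.
have r0 := le_trans (cn_ge0 u) ur.
rewrite Re_mob//; have := disc_neq1 u1; rewrite -cn_gt0 => c0.
have c2 : cn (1 - u) <= 2 by apply: le_trans (cnB _ _) _; rewrite cn1; lra.
have u0 := cn_ge0 u.
rewrite ler_pdivlMr ?exprn_gt0// mulrAC ler_pdivrMr//.
have : cn (1 - u) ^+ 2 <= 4 by nra.
have : cn u ^+ 2 <= r ^+ 2 by nra.
have : r ^+ 2 < 1 by nra.
have := sqr_ge0 (cn (1 - u)); nra.
Qed.

Lemma mob_opp u : mob (- u) = (mob u)^-1.
Proof. by rewrite /mob opprK invfM invrK mulrC. Qed.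

Lemma analytic_mob : analytic_disc mob.
Proof.
apply: analyticM; last exact: analytic_geom.
by apply: analyticD; [exact: analytic_cst|exact: analytic_id].
Qed.

Lemma analytic_qc : analytic_disc (fun u => qc (mob u)).
Proof.
apply: analytic_lim => r e /andP[r0 r1] e0.
have x0 : 0 < (1 - r ^+ 2) / 4 by rewrite divr_gt0//; nra.
have [N H] := qc_approx x0 e0.
exists (fun u => \sum_(n < N) (b n)%:C * qe n (mob u)).
  apply: analytic_sum => n; apply: analyticM; first exact: analytic_cst.
  have := @analytic_cexp R (fun u => - (2 * pi * n%:R)%:C * mob u).
  move=> /(_ (analyticM (analytic_cst _) analytic_mob)); congr analytic_disc.
  by apply/funext => u; rewrite /qe mulNr.
by move=> u ur; apply: H => //; exact: Re_mob_ge.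
Qed.

(* Analytic continuation of the functional equation from the positive reals to
   the right half-plane, which mob maps biholomorphically onto the unit disc
   so that inversion becomes u |-> - u. *)
Lemma qc_functional (r : nat -> R) :
  (forall x, 0 < x -> qr x - x ^+ 12 * qr x^-1 = \sum_(k < 13) r k * x ^+ k) ->
  forall w, 0 < complex.Re w ->
    qc w - w ^+ 12 * qc w^-1 = \sum_(k < 13) (r k)%:C * w ^+ k.
Proof.
move=> Hr.
(* The relation multiplied by [(1 - u) ^+ 12]; since [mob u * (1 - u) = 1 + u], all its coefficients
   become polynomials in [u]. *)
pose f u := (1 - u) ^+ 12 * qc (mob u) - (1 + u) ^+ 12 * qc (mob (- u))
  - \sum_(k < 13) (r k)%:C * ((1 + u) ^+ k * (1 - u) ^+ (12 - k)).
have a1 : analytic_disc (fun u : C => 1 - u).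
  apply: analyticD; first exact: analytic_cst.
  exact: (analytic_comp_opp analytic_id).
have a2 : analytic_disc (fun u : C => 1 + u).
  by apply: analyticD; [exact: analytic_cst|exact: analytic_id].
have aN g : analytic_disc g -> analytic_disc (fun u : C => - g u).
  move=> ag; have := analyticM (analytic_cst (-1)) ag; congr analytic_disc.
  by apply/funext => u; rewrite mulN1r.
have af : analytic_disc f.
  apply: analyticD; first apply: analyticD.
  - by apply: analyticM; [exact: analyticX|exact: analytic_qc].
  - by apply: aN; apply: analyticM; [exact: analyticX|exact: (analytic_comp_opp analytic_qc)].
  - apply: aN; apply: analytic_sum => k; apply: analyticM; first exact: analytic_cst.
    by apply: analyticM; exact: analyticX.
have key u : cn u < 1 -> f u = (1 - u) ^+ 12 *
    (qc (mob u) - mob u ^+ 12 * qc (mob u)^-1 - \sum_(k < 13) (r k)%:C * mob u ^+ k).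
  move=> u1; have n1 := disc_neq1 u1.
  rewrite /f mob_opp mulrBr mulrBr; congr (_ - _ - _).
    by rewrite mulrA -exprMn /mob mulrCA divff// mulr1.
  rewrite mulr_sumr; apply: eq_bigr => k _; rewrite [RHS]mulrCA; congr (_ * _).
  have k12 : (k <= 12)%N by have := ltn_ord k; lia.
  have {1}-> : 1 + u = mob u * (1 - u) by rewrite /mob divfK.
  by rewrite exprMn -mulrA -exprD subnKC// mulrC.
have f0 x : 0 <= x < 1 -> f x%:C = 0.
  move=> /andP[x0 x1].
  have cx : cn x%:C < 1 by rewrite cn_real ger0_norm.
  have E : mob x%:C = ((1 + x) / (1 - x))%:C.
    by rewrite /mob fmorph_div rmorphD rmorphB rmorph1.
  rewrite key// E; have y0 : 0 < (1 + x) / (1 - x) by rewrite divr_gt0//; lra.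
  move: ((1 + x) / (1 - x)) y0 => y y0.
  rewrite -fmorphV qc_real// qc_real ?invr_gt0//.
  rewrite (_ : _ - _ * _ = (qr y - y ^+ 12 * qr y^-1)%:C); last first.
    by rewrite (RCB (qr y)) (RCM (y ^+ 12)) RCX.
  rewrite Hr// rmorph_sum/= -sumrB big1 ?mulr0// => k _.
  by rewrite RCM RCX subrr.
move=> w w0.
have w1 : w + 1 != 0.
  by apply/eqP => /(congr1 (@complex.Re R)); rewrite ReD/=; lra.
pose u := (w - 1) / (w + 1).
have e1 : 1 - u = 2 / (w + 1) by rewrite /u; field.
have e2 : 1 + u = 2 * w / (w + 1) by rewrite /u; field.
have u1 : cn u < 1.
  rewrite /u cnM cnV ltr_pdivrMr ?cn_gt0// mul1r -ltr_sqr ?nnegrE ?cn_ge0//.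
  by rewrite !sqr_cn !(ReD, ImD, ReN, ImN)/=; nra.
have wu : mob u = w.
  by rewrite /mob e1 e2 invf_div mulrA divfK// mulrAC divff ?mul1r// pnatr_eq0.
have := analytic_eq0 af f0 u1; rewrite key// wu => /eqP.
rewrite mulf_eq0 expf_eq0/= (negbTE (disc_neq1 u1))/= subr_eq0 => /eqP.
exact.
Qed.

End QSeries.

(** * Period polynomials in weight 14 *)

Lemma three_term_linear (R : realFieldType) (r s t : nat -> R) :
  (forall k, (k <= 12)%N -> r (12 - k)%N = - r k) ->
  (forall m, s (2 * m)%N = (-1) ^+ m * r (2 * m)%N) ->
  (forall m, t (2 * m).+1 = - ((-1) ^+ m * r (2 * m).+1)) ->
  (forall m, s (2 * m).+1 = 0) -> (forall m, t (2 * m)%N = 0) ->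
  (forall (y : nat) (c := fun k : nat => y%:R ^+ k - (y%:R + 1) ^+ k - y%:R ^+ k * (y%:R + 1) ^+ (12 - k)),
    \sum_(k < 13) s k * c k = 0 /\ \sum_(k < 13) t k * c k = 0) ->
  (forall k, (0 < k < 12)%N -> r k = 0) /\ r 12 = - r 0.
Proof.
move=> S s_even t_odd s_odd t_even Q.
have e0 := S 0 isT; have e1 := S 1 isT; have e2 := S 2 isT; have e3 := S 3 isT.
have e4 := S 4 isT; have e5 := S 5 isT; have e6 := S 6 isT.
rewrite /subn/= in e0 e1 e2 e3 e4 e5 e6.
pose c (y k : nat) : R := y%:R ^+ k - (y%:R + 1) ^+ k - y%:R ^+ k * (y%:R + 1) ^+ (12 - k).
have E (f : nat -> R) : \sum_(k < 13) f k = f 0 + f 1 + f 2 + f 3 + f 4 + f 5 + f 6 + f 7 + f 8 + f 9 + f 10 + f 11 + f 12.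
  by rewrite !big_ord_recr big_ord0/= add0r.
have Qs y : r 0 * c y 0%N - r 2 * c y 2%N + r 4 * c y 4%N - r 6 * c y 6%N + r 8 * c y 8%N - r 10 * c y 10%N + r 12 * c y 12%N = 0.
  have [<- _] := Q y; rewrite (E (fun k => s k * c y k)).
  have := s_even 0; have := s_even 1; have := s_even 2; have := s_even 3.
  have := s_even 4; have := s_even 5; have := s_even 6.
  rewrite /muln/= => -> -> -> -> -> -> ->.
  have := s_odd 0; have := s_odd 1; have := s_odd 2; have := s_odd 3.
  have := s_odd 4; have := s_odd 5; rewrite /muln/= => -> -> -> -> -> ->.
  ring.
have Qt y : r 1 * c y 1%N - r 3 * c y 3%N + r 5 * c y 5%N - r 7 * c y 7%N + r 9 * c y 9%N - r 11 * c y 11%N = 0.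
  have [_] := Q y; rewrite (E (fun k => t k * c y k)).
  have := t_even 0; have := t_even 1; have := t_even 2; have := t_even 3.
  have := t_even 4; have := t_even 5; have := t_even 6.
  rewrite /muln/= => -> -> -> -> -> -> ->.
  have := t_odd 0; have := t_odd 1; have := t_odd 2; have := t_odd 3.
  have := t_odd 4; have := t_odd 5; rewrite /muln/= => -> -> -> -> -> ->.
  move=> H; rewrite -[RHS]oppr0 -H; ring.
(* After antisymmetry the even unknowns are [r 0], [r 2], [r 4] and the odd ones [r 1], [r 3],
   [r 5]. The unknown [r 0] drops out of every equation, being the coboundary of a constant; two
   sample points then settle the even part and three the odd part. *)
have q1 := Qs 2%N; have q2 := Qs 3%N; have q3 := Qt 1%N; have q4 := Qt 2%N; have q5 := Qt 3%N.
rewrite e0 e1 e2 e3 e4 e5 in q1 q2 q3 q4 q5.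
have r6 : r 6 = 0 by lra.
rewrite r6 in q1 q2.
clear E Qs Qt Q S s_even t_odd s_odd t_even s t.
rewrite /c /subn/= in q1 q2 q3 q4 q5; clear c.
(* The even equation at [y = 2], divided by 40. *)
have a24 : 4224 * r 2 = 1950 * r 4.
  have : 40 * (4224 * r 2 - 1950 * r 4) = 0 by rewrite -[RHS]q1; ring.
  lra.
have a2 : r 2 = 0 by lra.
have a4 : r 4 = 0 by lra.
clear q1 q2 a24.
have a1 : r 1 = 0 by lra.
have a3 : r 3 = 0 by lra.
have a5 : r 5 = 0 by lra.
clear q3 q4 q5; split; last exact: e0.
by do 12?[case=> //]; lra.
Qed.

Section PeriodPolynomial.
Context {R : realType}.
Local Notation C := R[i].
Local Open Scope complex_scope.
Local Notation ii := (@Complex R 0 1).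
Implicit Types u w : C.

Lemma sqr_ii : ii ^+ 2 = -1.
Proof. by rewrite expr2; apply: complex_ext => /=; ring. Qed.

(* The three-term relation and antisymmetry under inversion leave only the
   coboundary of a constant: there is no cusp form of weight 14. *)
Lemma period_poly_trivial (r : nat -> R) :
  (forall x, 0 < x -> \sum_(k < 13) r k * x ^+ k =
      - (x ^+ 12 * \sum_(k < 13) r k * x^-1 ^+ k)) ->
  (forall x, 0 < x -> \sum_(k < 13) (r k)%:C * x%:C ^+ k =
     \sum_(k < 13) (r k)%:C * (x%:C - ii) ^+ k +
     \sum_(k < 13) (r k)%:C * ((- ii * x%:C) ^+ k * (x%:C - ii) ^+ (12 - k))) ->
  (forall k, (0 < k < 12)%N -> r k = 0) /\ r 12 = - r 0.
Proof.
move=> rS rT.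
have S k : (k <= 12)%N -> r (12 - k)%N = - r k.
  pose p : {poly R} := \sum_(k < 13) (r k + r (12 - k)%N) *: 'X^k.
  have p0 : p = 0.
    apply/eqP; apply: contraT => pn0.
    have sp : (size p <= 13)%N.
      apply: (leq_trans (size_sum _ _ _)); apply/bigmax_leqP => i _.
      by rewrite (leq_trans (size_scale_leq _ _))// size_polyXn.
    have := @max_poly_roots _ p [seq (i%:R : R) | i <- iota 1 20] pn0.
    rewrite size_map size_iota map_inj_uniq ?iota_uniq; last exact: mulrIn (@oner_neq0 _).
    move=> H; have : (20 < size p)%N; last by lia.
    apply: H => //; rewrite all_map; apply/allP => i; rewrite mem_iota => /andP[i1 _].
    have x0 : 0 < i%:R :> R by rewrite ltr0n.
    rewrite /= rootE /p horner_sum; under eq_bigr do rewrite hornerZ hornerXn mulrDl.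
    rewrite big_split/= rS// [X in _ + X](reindex_inj rev_ord_inj)/=.
    rewrite addrC mulr_sumr subr_eq0; apply/eqP/eq_bigr => l _.
    have l12 : (l <= 12)%N by rewrite -ltnS.
    rewrite subSS subKn// [RHS]mulrCA; congr (_ * _); rewrite exprVn.
    move: (nat_of_ord l) l12 => m m12.
    by rewrite -[in RHS](subnK m12) exprD mulfK// expf_neq0// gt_eqF.
  move=> k12; have := congr1 (fun q : {poly R} => q`_k) p0.
  rewrite coef0 coef_sum (bigD1 (Ordinal (k12 : (k < 13)%N)))//= big1 => [|i ik].
    by rewrite addr0 coefZ coefXn eqxx mulr1 => e; lra.
  rewrite coefZ coefXn (_ : (k == i) = false) ?mulr0//.
  by apply/negbTE; apply: contra ik => /eqP e; apply/eqP/val_inj.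
(* In the variable [z = ii * x] the arguments [x] and [x - ii] become [z] and [z + 1] up to powers
   of [- ii], which [rho] absorbs. The relation is then a polynomial identity with rational data
   apart from [rho], and it may be sampled at natural numbers. *)
pose rho k : C := (r k)%:C * (- ii) ^+ k.
have Q (y : nat) : \sum_(k < 13) rho k *
    (y%:R ^+ k - (y%:R + 1) ^+ k - y%:R ^+ k * (y%:R + 1) ^+ (12 - k)) = 0.
  pose p : {poly C} := \sum_(k < 13) rho k *:
     ('X ^+ k - ('X + 1) ^+ k - 'X ^+ k * ('X + 1) ^+ (12 - k)).
  have pE z : p.[z] = \sum_(k < 13) rho k * (z ^+ k - (z + 1) ^+ k - z ^+ k * (z + 1) ^+ (12 - k)).
    rewrite /p horner_sum; apply: eq_bigr => k _.
    by rewrite hornerZ !hornerE.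
  suff p0 : p = 0 by rewrite -pE p0 horner0.
  apply/eqP; apply: contraT => pn0.
  have sp : (size p <= 14)%N.
    apply: (leq_trans (size_sum _ _ _)); apply/bigmax_leqP => i _.
    have i13 := ltn_ord i.
    have s1 n : size (('X + 1 : {poly C}) ^+ n) = n.+1 by rewrite -[1]opprK -polyCN size_exp_XsubC.
    rewrite (leq_trans (size_scale_leq _ _))//.
    rewrite (leq_trans (size_polyD _ _))// geq_max; apply/andP; split.
      rewrite (leq_trans (size_polyD _ _))// geq_max size_polyXn size_polyN s1; lia.
    by rewrite size_polyN (leq_trans (size_polyMleq _ _))// size_polyXn s1; lia.
  have inj : injective (fun i : nat => ii * i%:R : C).
    move=> i j /(congr1 (@complex.Im R)).
    rewrite !ImM/= !mul0r !add0r !mul1r -!(rmorph_nat (real_complex R))/=.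
    by apply: mulrIn; exact: oner_neq0.
  have := @max_poly_roots _ p [seq (ii * i%:R : C) | i <- iota 1 20] pn0.
  rewrite size_map size_iota map_inj_uniq ?iota_uniq//.
  move=> H; have : (20 < size p)%N; last by lia.
  apply: H => //; rewrite all_map; apply/allP => i; rewrite mem_iota => /andP[i1 _].
  have x0 : 0 < i%:R :> R by rewrite ltr0n.
  have i2 := sqr_ii.
  rewrite /= rootE pE; under eq_bigr do rewrite mulrBr mulrBr.
  rewrite 2!sumrB -addrA -opprD subr_eq0; apply/eqP.
  have ix : (i%:R : C) = (i%:R : R)%:C by rewrite RCnat.
  transitivity (\sum_(k < 13) (r k)%:C * (i%:R : R)%:C ^+ k).
    apply: eq_bigr => k _; rewrite /rho -mulrA -exprMn; congr (_ * _ ^+ _).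
    by rewrite mulrA mulNr -expr2 i2 opprK mul1r.
  rewrite (rT _ x0); congr (_ + _); apply: eq_bigr => k _; rewrite /rho -(mulrA (r k)%:C).
    rewrite -exprMn; congr (_ * _ ^+ _).
    by rewrite mulrDr mulr1 mulrA mulNr -expr2 i2 opprK mul1r ix.
  have k12 : (k <= 12)%N by rewrite -ltnS.
  rewrite -ix; congr (_ * _).
  have e1 : (i%:R - ii : C) = - ii * (ii * i%:R + 1).
    by rewrite mulrDr mulr1 mulrA mulNr -expr2 i2 opprK mul1r.
  have i12 : (- ii) ^+ 12 = 1 :> C.
    by rewrite (_ : 12%N = (2 * 6)%N)// exprM sqrrN i2 -signr_odd.
  move: (nat_of_ord k) k12 => m m12.
  rewrite e1 !exprMn; have {i12} i12 : (- ii) ^+ (12 - m) * (- ii) ^+ m = 1 :> C by rewrite -exprD subnK.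
  have : (- ii) ^+ m * ii ^+ m = 1 :> C by rewrite -exprMn mulNr -expr2 i2 opprK expr1n.
  move: ((- ii) ^+ (12 - m)) ((- ii) ^+ m) (ii ^+ m) i12 => B A D BA AD.
  move: (_ ^+ m) (_ ^+ (12 - m)) => X Y.
  transitivity (B * A * (X * Y)); first ring.
  by rewrite BA -AD; ring.
have {}Q (y : nat) : let c k : R := y%:R ^+ k - (y%:R + 1) ^+ k - y%:R ^+ k * (y%:R + 1) ^+ (12 - k) in
   \sum_(k < 13) complex.Re (rho k) * c k = 0 /\ \sum_(k < 13) complex.Im (rho k) * c k = 0.
  move=> c; have cE k : (c k)%:C = y%:R ^+ k - (y%:R + 1) ^+ k - y%:R ^+ k * (y%:R + 1) ^+ (12 - k).
    by rewrite /c !(RCB, RCM, RCX, RCD, RCnat).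
  have := Q y; under eq_bigr do rewrite -cE mulrC.
  move=> E; split.
    transitivity (complex.Re (\sum_(k < 13) (c k)%:C * rho k)); last by rewrite E.
    rewrite Re_sum; apply: eq_bigr => k _.
    by rewrite [RHS]ReZr mulrC.
  transitivity (complex.Im (\sum_(k < 13) (c k)%:C * rho k)); last by rewrite E.
  rewrite Im_sum; apply: eq_bigr => k _.
  by rewrite [RHS]ImZr mulrC.
have iN2 : (- ii) ^+ 2 = -1 by rewrite sqrrN sqr_ii.
have rhoe m : rho (2 * m)%N = ((-1) ^+ m * r (2 * m)%N)%:C.
  by rewrite /rho exprM iN2 mulrC RCM RCX RCN.
have rhoo m : rho (2 * m).+1 = - ii * ((-1) ^+ m * r (2 * m).+1)%:C.
  by rewrite /rho exprSr exprM iN2 RCM RCX RCN; ring.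
have {rhoe} s_even m : complex.Re (rho (2 * m)%N) = (-1) ^+ m * r (2 * m)%N by rewrite rhoe.
have {rhoo} t_odd m : complex.Im (rho (2 * m).+1) = - ((-1) ^+ m * r (2 * m).+1).
  by rewrite rhoo ImM/=; ring.
have s_odd m : complex.Re (rho (2 * m).+1) = 0.
  by rewrite /rho exprSr exprM iN2 -(RCN 1) -RCX mulrA -RCM ReZr/=; ring.
have t_even m : complex.Im (rho (2 * m)%N) = 0.
  by rewrite /rho exprM iN2 -(RCN 1) -RCX -RCM.
exact: (@three_term_linear R r (fun k => complex.Re (rho k)) (fun k => complex.Im (rho k))).
Qed.

End PeriodPolynomial.

(** * Vanishing of the primitive in weight -12 *)

Section CuspVanish.
Context {R : realType}.
Local Notation C := R[i].
Local Open Scope complex_scope.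
Local Notation ii := (@Complex R 0 1).
Implicit Types u w : C.
Variable b : nat -> R.
Hypothesis sb : forall x : R, 0 < x -> tsm setT (fun n => b n * expR (- (2 * pi * n%:R * x))).
Variable r : nat -> R.
Hypothesis Hr : forall x, 0 < x ->
  qr b x - x ^+ 12 * qr b x^-1 = \sum_(k < 13) r k * x ^+ k.

Let qcF := qc_functional sb Hr.

Lemma qc_period_int (m : int) w : qc b (w + (0 +i* m%:~R)) = qc b w.
Proof.
have keyn (n : nat) v : qc b (v + (0 +i* n%:R)) = qc b v.
  elim: n v => [|n IH] v; first by rewrite (_ : _ +i* _ = 0) ?addr0.
  rewrite -[RHS](IH) -[in RHS]qc_period'; congr (qc b _).
  by apply: complex_ext; rewrite !(ReD, ImD)/= -?natr1; ring.
case: m => n; first exact: keyn.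
rewrite -[in LHS](keyn n.+1); congr (qc b _).
by apply: complex_ext; rewrite !(ReD, ImD)/= ?NegzE ?mulrNz; ring.
Qed.

Lemma period_inversion x : 0 < x -> \sum_(k < 13) r k * x ^+ k =
      - (x ^+ 12 * \sum_(k < 13) r k * x^-1 ^+ k).
Proof.
move=> x0; have x1 : 0 < x^-1 by rewrite invr_gt0.
rewrite -(Hr x0) -(Hr x1) invrK; move: (qr b x) (qr b x^-1) => A A'.
have e : x ^+ 12 * x^-1 ^+ 12 = 1 by rewrite -exprMn divff ?expr1n// gt_eqF.
by transitivity (A * (x ^+ 12 * x^-1 ^+ 12) - x ^+ 12 * A'); [rewrite e mulr1|ring].
Qed.

(** The functional equation is used at [x], at [x - ii] and at [v = 1 / (x - ii) - ii], for which
    [1 / v = 1 / x + ii]. By periodicity the values of [qc] telescope: this is the relation of order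
    three in the modular group. *)
Lemma period_three_term x : 0 < x -> \sum_(k < 13) (r k)%:C * x%:C ^+ k =
     \sum_(k < 13) (r k)%:C * (x%:C - ii) ^+ k +
     \sum_(k < 13) (r k)%:C * ((- ii * x%:C) ^+ k * (x%:C - ii) ^+ (12 - k)).
Proof.
move=> x0.
have i2 := @sqr_ii R.
have xi0 : x%:C - ii != 0 by rewrite eq_complex/= subr0 gt_eqF.
have xn0 : x%:C != 0 by rewrite eq_complex/= gt_eqF.
pose v := - ii * x%:C / (x%:C - ii).
have E1 : v = (x%:C - ii)^-1 - ii.
  rewrite /v; apply: (mulIf xi0); rewrite divfK// mulrBl mulVf//.
  by rewrite mulrBr -expr2 i2; ring.
have E2 : v^-1 = x%:C^-1 + ii.
  rewrite /v invf_div invfM; apply: (mulIf xn0); rewrite mulrA divfK//.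
  have -> : (- ii)^-1 = ii.
    have ni : - ii != 0 by rewrite eq_complex/= oppr0 oppr_eq0 oner_eq0 andbF.
    by apply: (mulIf ni); rewrite mulVf// mulrN -expr2 i2 opprK.
  by rewrite [RHS]mulrDl mulVf// [LHS]mulrBl -expr2 i2; ring.
have E3 : (x%:C - ii) ^+ 12 * v ^+ 12 = x%:C ^+ 12.
  rewrite -exprMn mulrC divfK// exprMn (_ : (- ii) ^+ 12 = 1) ?mul1r//.
  by rewrite (_ : 12%N = (2 * 6)%N)// exprM sqrrN i2 -signr_odd.
have R1 : 0 < complex.Re (x%:C - ii) by rewrite /= subr0.
have R2 : 0 < complex.Re v.
  rewrite E1 ReD ReN -[(x%:C - ii)^-1]mul1r Re_div/= mul1r mul0r !subr0 addr0.
  by rewrite divr_gt0// exprn_gt0// sqrtr_gt0 ltr_wpDr ?sqr_ge0// exprn_gt0.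
have -> : \sum_(k < 13) (r k)%:C * ((- ii * x%:C) ^+ k * (x%:C - ii) ^+ (12 - k)) =
   (x%:C - ii) ^+ 12 * \sum_(k < 13) (r k)%:C * v ^+ k.
  rewrite mulr_sumr; apply: eq_bigr => k _; rewrite [RHS]mulrCA; congr (_ * _).
  have k12 : (k <= 12)%N by rewrite -ltnS.
  move: (nat_of_ord k) k12 => m m12.
  rewrite -[in RHS](subnK m12) exprD -mulrA -exprMn mulrC; congr (_ * _ ^+ _).
  by rewrite [RHS]mulrC /v divfK.
have R0 : 0 < complex.Re x%:C by [].
rewrite -(qcF R0) -(qcF R1) -(qcF R2).
rewrite mulrBr [X in _ = _ + (_ - X)]mulrA E3 E2 qc_period' E1 !qc_period; ring.
Qed.

Let rho := r 0.

(** The period polynomial has become [rho * (1 - w ^+ 12)], which subtracting the constant [rho]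
    removes. *)
Lemma qc_weight w : 0 < complex.Re w ->
  qc b w - rho%:C = w ^+ 12 * (qc b w^-1 - rho%:C).
Proof.
move=> w0; have [r1 r2] := period_poly_trivial period_inversion period_three_term.
have := qcF w0; rewrite big_ord_recr big_ord_recl/= big1 => [|i _]; last first.
  by rewrite r1 ?mul0r//; have := ltn_ord i; rewrite /bump; lia.
rewrite expr0 mulr1 addr0 r2 -/rho RCN mulNr => E.
by rewrite mulrBr -[w ^+ 12 * rho%:C]mulrC -[qc b w](subrK (w ^+ 12 * qc b w^-1)) E; ring.
Qed.

(** The quotient of [cn (qc b w - rho)] by [(Re w)^6] is invariant under [w + i] and [1 / w],
    because [Re (1 / w) = Re w / |w|^2]. When [Re w < 1 / 2], a translation to [|Im w| <= 1 / 2]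
    gives [|w|^2 <= 1 / 2], so inversion at least doubles the real part; induction on the number of
    doublings replaces the fundamental domain. The factor 64 is [(1 / 2)^-6]. *)
Lemma qc_cusp_bound : exists2 B : R, 0 <= B & forall w, 0 < complex.Re w ->
  cn (qc b w - rho%:C) <= B * complex.Re w ^+ 6.
Proof.
have h2 : 0 < 1 / 2 :> R by [].
pose C0 := 2 * qn b (1 / 2) + `|rho|.
have C00 : 0 <= C0 by rewrite addr_ge0// mulr_ge0// qn_ge0.
exists (64 * C0); first by rewrite mulr_ge0.
have base w : 1 / 2 <= complex.Re w -> cn (qc b w - rho%:C) <= 64 * C0 * complex.Re w ^+ 6.
  move=> w2; apply: le_trans (cnB _ _) _; rewrite cn_real.
  apply: (@le_trans _ _ C0); first by rewrite lerD2r; exact: qc_bound.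
  rewrite mulrAC ler_peMl//.
  have : (1 / 2) ^+ 6 <= complex.Re w ^+ 6 by rewrite lerXn2r ?nnegrE//; lra.
  lra.
suff H j w : 0 < complex.Re w -> 1 <= 2 ^+ j.+1 * complex.Re w ->
    cn (qc b w - rho%:C) <= 64 * C0 * complex.Re w ^+ 6.
  move=> w w0; pose j := Num.trunc (complex.Re w)^-1.
  apply: (H j) => //; rewrite -ler_pdivrMr// mul1r.
  have : (complex.Re w)^-1 < j.+1%:R by exact: truncnS_gt.
  move/ltW/le_trans; apply.
  by rewrite -natrX ler_nat ltnW// ltn_expl.
elim: j w => [|j IH] w w0 wj; first by apply: base; rewrite expr1 in wj; lra.
have [w2|w2] := leP (1 / 2) (complex.Re w); first exact: base.
pose m := Num.floor (complex.Im w + 1 / 2).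
pose v := w + (0 +i* (- m)%:~R).
have vR : complex.Re v = complex.Re w by rewrite ReD/= addr0.
have v0 : 0 < complex.Re v by rewrite vR.
have vI : `|complex.Im v| <= 1 / 2.
  have m1 : m%:~R <= complex.Im w + 1 / 2 by exact: floor_le.
  have m2 : complex.Im w + 1 / 2 < m%:~R + 1 by rewrite -[1]/(1%:~R) -intrD; exact: floorD1_gt.
  by rewrite ImD/= mulrNz ler_norml; apply/andP; split; lra.
have cv : cn v ^+ 2 <= 1 / 2.
  rewrite sqr_cn vR; have : complex.Im v ^+ 2 <= (1 / 2) ^+ 2.
    by rewrite -real_normK ?num_real// lerXn2r ?nnegrE.
  have : complex.Re w ^+ 2 <= (1 / 2) ^+ 2 by rewrite lerXn2r ?nnegrE// ltW.
  lra.
have vn0 : v != 0 by apply/eqP => e; move: v0; rewrite e ltxx.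
have cv0 : 0 < cn v ^+ 2 by rewrite exprn_gt0// cn_gt0.
have RV : complex.Re v^-1 = complex.Re v / cn v ^+ 2.
  by rewrite -[v^-1]mul1r Re_div/= mul1r mul0r addr0.
rewrite -(qc_period_int (- m) w) -/v -vR qc_weight// cnM cnX.
have RV0 : 0 < complex.Re v^-1 by rewrite RV divr_gt0.
have := IH v^-1 RV0; rewrite RV => /(_ _) H.
have {H} : cn (qc b v^-1 - rho%:C) <= 64 * C0 * (complex.Re v / cn v ^+ 2) ^+ 6.
  apply: H; rewrite mulrA ler_pdivlMr// mul1r vR; rewrite exprS in wj; lra.
move=> H; apply: (@le_trans _ _ (cn v ^+ 12 * (64 * C0 * (complex.Re v / cn v ^+ 2) ^+ 6))).
  by rewrite ler_wpM2l// exprn_ge0// cn_ge0.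
rewrite expr_div_n -exprM mulrCA [_ ^+ 12 * _]mulrC divfK//.
by rewrite expf_neq0// gt_eqF// cn_gt0.
Qed.

(** Cauchy's estimate on the circle of radius [exp (-2 pi x)] in the nome bounds
    [|b n| * exp (-2 pi n x)] by [B * x^6], and [x] tends to 0. The constant [rho] affects only the
    index 0. *)
Lemma cusp_coef_eq0 n : (0 < n)%N -> b n = 0.
Proof.
move=> n0; have [B B0 HB] := qc_cusp_bound.
have key x : 0 < x -> `|b n| * expR (- (2 * pi * x)) ^+ n <= B * x ^+ 6.
  move=> x0; apply/ler_addgt0Pr => e e0.
  have [N0 HN] := qc_approx sb x0 e0.
  pose N := (N0 + n.+1)%N.
  pose p : {poly C} := \poly_(k < N) (b k)%:C - (rho%:C)%:P.
  have -> : `|b n| = cn p`_n.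
    rewrite /p coefB coefC coef_poly ifT ?(gtn_eqF n0) ?subr0 ?cn_real//; last by rewrite /N; lia.
  apply: cauchy_poly; first exact: expR_ge0.
  move=> t; pose w : C := x +i* (- t / (2 * pi)).
  have pi0 : (pi : R) != 0 by rewrite gt_eqF// pi_gt0.
  have qeE k : qe k w = ((expR (- (2 * pi * x)))%:C * cexp (0 +i* t)) ^+ k.
    rewrite -cexp_real -cexpD -cexpMn; congr cexp.
    have -> : (- (2 * pi * x))%:C + 0 +i* t = - ((2 * pi)%:C * w) :> C.
      apply: complex_ext; rewrite ?(ReD, ImD) ?(ReN, ImN) ?(ReZr, ImZr)/=; first ring.
      by rewrite add0r mulrC divfK ?opprK// mulf_neq0// pnatr_eq0.
    by rewrite mulNrn; congr (- _); rewrite -[RHS]mulr_natr (RCM (2 * pi)) RCnat; ring.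
  have -> : p.[(expR (- (2 * pi * x)))%:C * cexp (0 +i* t)] =
      - (qc b w - \sum_(k < N) (b k)%:C * qe k w) + (qc b w - rho%:C).
    rewrite /p hornerD hornerN hornerC horner_poly.
    under [in RHS]eq_bigr do rewrite qeE.
    by ring.
  apply: le_trans (cnD _ _) _; rewrite cnN addrC; apply: lerD; first exact: HB.
  by apply: HN => //; rewrite /N leq_addr.
apply/eqP; rewrite -normr_le0.
have c0 : 0 < expR (- (2 * pi)) ^+ n :> R by rewrite exprn_gt0// expR_gt0.
rewrite -(pmulr_lle0 _ c0); apply/ler_addgt0Pr => e e0; rewrite add0r.
pose x := Num.min 1 (e / (B + 1)).
have B1 : 0 < B + 1 by lra.
have x0 : 0 < x by rewrite lt_min ltr01 divr_gt0.
have x1 : x <= 1 by rewrite ge_min lexx.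
have xe : x * (B + 1) <= e by rewrite -ler_pdivlMr// ge_min lexx orbT.
apply: (@le_trans _ _ (`|b n| * expR (- (2 * pi * x)) ^+ n)).
  by rewrite ler_wpM2l// lerXn2r ?nnegrE ?expR_ge0// ler_expR lerN2 ler_piMr// mulr_ge0// pi_ge0.
apply: le_trans (key x x0) _; apply: le_trans xe.
have : x ^+ 6 <= x by rewrite -[leRHS]expr1 ler_wiXn2l// ltW.
have := exprn_ge0 6 (ltW x0); nra.
Qed.

End CuspVanish.

Section Weight14.
Context {R : realType}.

Lemma weight14_vanish (a : nat -> R) :
  (forall x : R, 0 < x -> tsm setT (fun n => a n * expR (- (2 * pi * n%:R * x)))) ->
  a 0%N = 0 -> (forall x, 0 < x -> qr a x^-1 = - (x ^+ 14 * qr a x)) ->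
  forall n, a n = 0.
Proof.
move=> sa a0 fa.
have pi0 := @pi_gt0 R.
pose l (n : nat) : R := 2 * pi * n%:R.
have l0 n : 0 <= l n by rewrite /l !mulr_ge0// ltW.
(* [e 0] is the 13-fold primitive, [e j] its derivative of order [j], and [e 13] is [a] again. At
   [n = 0] the inverse of 0 is 0 by default, which is harmless as [a 0 = 0]. *)
pose e (j n : nat) := a n * (- l n) ^+ j * (- l n)^-1 ^+ 13.
have se j (c : R) : 0 < c -> tsm setT (fun n => e j n * expR (- (c * l n))).
  elim: j c => [|j IH] c c0.
    pose K := (2 * pi : R)^-1 ^+ 13.
    apply: tsm_le (tsm_norm (tsmZ K (sa c c0))) => n _.
    have -> : 2 * pi * n%:R * c = c * l n by rewrite /l mulrC.
    rewrite mulrA normrM [leRHS]normrM ler_wpM2r// /e expr0 mulr1 normrM [leRHS]normrM.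
    case: n => [|n]; first by rewrite a0 normr0 mul0r mulr0.
    rewrite mulrC ler_wpM2r// /K !normrX lerXn2r ?nnegrE// !normfV normrN.
    rewrite (ger0_norm (l0 _)) ger0_norm ?mulr_ge0 ?(ltW pi0)// lef_pV2 ?posrE.
    - by rewrite /l ler_peMr ?mulr_ge0 ?(ltW pi0)// ler1n.
    - by rewrite /l !mulr_gt0// ltr0n.
    - by rewrite mulr_gt0.
  have s1 := tsm_laplace (fun n _ => l0 n) IH c0.
  by apply: eq_tsm (tsmN s1) => n _; rewrite /e [_ ^+ j.+1]exprS; ring.
have sb j (x : R) : 0 < x -> tsm setT (fun n => e j n * expR (- (2 * pi * n%:R * x))).
  by move=> x0; apply: eq_tsm (se j x x0) => n _; rewrite /l [x * _]mulrC.
have qrE j x : qr (e j) x = tsum setT (fun n => e j n * expR (- (x * l n))).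
  by apply: eq_tsum => n _; rewrite /l [x * _]mulrC.
have dE j (x : R) : 0 < x -> is_derive x 1 (qr (e j)) (qr (e j.+1) x).
  move=> x0; have := laplace_derive (fun n _ => l0 n) (se j) x0.
  rewrite -tsumN (_ : (fun t => _) = qr (e j)); last by apply/funext => t; rewrite qrE.
  rewrite (_ : tsum _ _ = qr (e j.+1) x)// qrE; apply: eq_tsum => n _.
  by rewrite /e [_ ^+ j.+1]exprS; ring.
have e13 : qr (e 13) = qr a.
  apply/funext => x; apply: eq_tsum => n _; congr (_ * _); rewrite /e -mulrA -exprMn.
  case: n => [|n]; first by rewrite a0 mul0r.
  by rewrite divff ?expr1n ?mulr1// oppr_eq0 gt_eqF// /l !mulr_gt0// ltr0n.
have [H [dH H0 H13]] := bol_identity 12 dE.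
have [|x x0|c cG] := @poly_of_deriv R 13 (fun j x => qr (e j) x - H j x).
- move=> j x j13 x0; have d1 := dE j x x0; have d2 := dH j x j13 x0.
  exact: is_deriveB.
- rewrite H13// e13 fa//.
  have h : x^-1 ^+ 14 * x ^+ 14 = 1 by rewrite -exprMn mulVf ?expr1n// gt_eqF.
  have -> : (-1) ^+ 13 * (x^-1 ^+ 14 * - (x ^+ 14 * qr a x)) = x^-1 ^+ 14 * x ^+ 14 * qr a x.
    by rewrite -signr_odd/= expr1; ring.
  by rewrite h mul1r subrr.
have Hr x : 0 < x -> qr (e 0) x - x ^+ 12 * qr (e 0) x^-1 = \sum_(k < 13) c k * x ^+ k.
  by move=> x0; rewrite -cG// H0.
move=> [//|n]; have := cusp_coef_eq0 (sb 0%N) Hr (ltn0Sn n).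
move/eqP; rewrite /e expr0 mulr1 mulf_eq0 => /orP[/eqP//|].
rewrite expf_eq0/= invr_eq0 oppr_eq0 gt_eqF// /l !mulr_gt0// ltr0n//.
Qed.

End Weight14.

(** * Theta inversion in one variable *)
Section BinomialAsymptotics.
Context {R : realType}.

Lemma expR_ge_1B (y : R) : 0 <= y < 1 -> expR (- (y / (1 - y))) <= 1 - y.
Proof.
move=> /andP[y0 y1]; have h : 0 < 1 - y by lra.
have := expR_ge1Dx (y / (1 - y)).
have -> : 1 + y / (1 - y) = (1 - y)^-1 by field; rewrite gt_eqF.
by rewrite expRN => H; rewrite -[leRHS]invrK lef_pV2 ?posrE ?invr_gt0 ?expR_gt0.
Qed.

Lemma expR_le_1B (y : R) : 1 - y <= expR (- y).
Proof. exact: expR_ge1Dx. Qed.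

Definition cbin (m : nat) : R := 'C(m.*2, m)%:R / 4 ^+ m.

Lemma binS_double m : (m.+1 * 'C(m.+1.*2, m.+1) = 2 * (m.*2.+1 * 'C(m.*2, m)))%N.
Proof.
have := mul_bin_down m.*2.+1 m; have := mul_bin_diag m.*2.+2 m; rewrite /= doubleS => e1 e2.
have -> : (m.*2.+1 * 'C(m.*2, m) = m.+1 * 'C(m.*2.+1, m))%N by rewrite e2; congr (_ * _)%N; lia.
by rewrite -e1 mulnA; congr (_ * _)%N; lia.
Qed.

Lemma cbinS m : cbin m.+1 * (2 * m%:R + 2) = cbin m * (2 * m%:R + 1).
Proof.
have e : m.+1%:R * 'C(m.+1.*2, m.+1)%:R = 2 * ((2 * m%:R + 1) * 'C(m.*2, m)%:R) :> R.
  rewrite -natrM binS_double natrM natrM -[m.*2.+1]addn1 natrD -mul2n natrM; ring.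
rewrite -(natr1 m) in e.
rewrite /cbin exprS invfM.
have -> : 2 * m%:R + 2 = 2 * (m%:R + 1) :> R by ring.
rewrite [LHS](_ : _ = ((m%:R + 1) * 'C(m.+1.*2, m.+1)%:R) * (2 / 4 / 4 ^+ m)); last by ring.
by rewrite e; move: (4 ^+ m)^-1 (m%:R) => u v; field.
Qed.

Lemma cbin_gt0 m : 0 < cbin m.
Proof. by rewrite divr_gt0 ?exprn_gt0// ltr0n bin_gt0 -addnn leq_addr. Qed.

(** Wallis' limit by monotonicity: [m * cbin m ^+ 2] increases, while [(2 m + 1) * cbin m ^+ 2]
    never exceeds 1. *)
Lemma cvg_cbin : exists U : R, m%:R * cbin m ^+ 2 @[m --> \oo] --> U.
Proof.
suff : cvgn (fun m => m%:R * cbin m ^+ 2) by move=> h; exists (limn (fun m => m%:R * cbin m ^+ 2)).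
apply: nondecreasing_is_cvgn.
  apply/nondecreasing_seqP => m; have := cbinS m; have := cbin_gt0 m; have := cbin_gt0 m.+1.
  have : 0 <= m%:R :> R by []; rewrite -?(natr1 m).
  move: (m%:R) (cbin m) (cbin m.+1) => q a b q0 b0 a0 e.
  have -> : b = a * (2 * q + 1) / (2 * q + 2) by rewrite -e mulfK// gt_eqF//; lra.
  rewrite !exprMn exprVn !mulrA ler_pdivlMr; last by rewrite exprn_gt0//; lra.
  have : 0 <= a ^+ 2 by exact: sqr_ge0.
  nra.
exists 1 => _ [m _ <-].
have key : (2 * m%:R + 1) * cbin m ^+ 2 <= 1.
  elim: m => [|m IH]; first by rewrite /cbin bin0 expr0; lra.
  apply: le_trans IH; have := cbinS m; have := cbin_gt0 m; have := cbin_gt0 m.+1.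
  have : 0 <= m%:R :> R by []; rewrite -?(natr1 m).
  move: (m%:R) (cbin m) (cbin m.+1) => q a b q0 b0 a0 e.
  have -> : b = a * (2 * q + 1) / (2 * q + 2) by rewrite -e mulfK// gt_eqF//; lra.
  rewrite !exprMn exprVn !mulrA ler_pdivrMr; last by rewrite exprn_gt0//; lra.
  have : 0 <= a ^+ 2 by exact: sqr_ge0.
  nra.
apply: le_trans key; rewrite ler_wpM2r ?sqr_ge0//.
have : 0 <= m%:R :> R by []; lra.
Qed.

Lemma cvg_1B_pow (a : nat -> R) (m : nat -> nat) (l : R) :
  (\forall n \near \oo, 0 <= a n) -> a n @[n --> \oo] --> 0 ->
  (m n)%:R * a n @[n --> \oo] --> l ->
  (1 - a n) ^+ m n @[n --> \oo] --> expR (- l).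
Proof.
move=> a0 ac mc.
have h : \forall n \near \oo, a n < 1 by apply: (cvgr_lt 0 ac); exact: ltr01.
have c1 : expR (- ((m n)%:R * a n / (1 - a n))) @[n --> \oo] --> expR (- l).
  apply: continuous_cvg; first exact: continuous_expR.
  apply: cvgN; rewrite -[X in _ --> X]mulr1.
  apply: cvgM => //; rewrite -[X in _ --> X]invr1; apply: cvgV; first exact: oner_neq0.
  rewrite -[X in _ --> X]subr0; apply: cvgB => //; exact: cvg_cst.
have c2 : expR (- ((m n)%:R * a n)) @[n --> \oo] --> expR (- l).
  by apply: continuous_cvg; [exact: continuous_expR | apply: cvgN].
apply: squeeze_cvgr c1 c2.
near=> n.
have an0 : 0 <= a n by near: n.
have an1 : a n < 1 by near: n.
have e (u : R) : expR (- ((m n)%:R * u)) = expR (- u) ^+ m n by rewrite -expRM_natl mulrN.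
rewrite -mulrA !e !lerXn2r ?nnegrE ?expR_ge0 ?expR_ge_1B ?expR_le_1B ?an0//; lra.
Unshelve. all: by end_near.
Qed.

Let bin_ratioS m i : (i < m)%N ->
  'C(m.*2, m + i.+1)%:R = 'C(m.*2, m + i)%:R * (1 - (2 * i%:R + 1) / (m + i.+1)%:R) :> R.
Proof.
move=> im; have := mul_bin_left m.*2 (m + i); rewrite -addnS => /(congr1 (fun k => k%:R : R)).
have -> : (m.*2 - (m + i) = m - i)%N by lia.
rewrite !natrM natrB 1?ltnW// natrD -(natr1 i) => e.
have h : m%:R + (i%:R + 1) != 0 :> R by rewrite natr1 -natrD pnatr_eq0; lia.
by apply: (mulfI h); rewrite e; field.
Qed.

(** Consecutive coefficients have the quotient [1 - (2 k + 1) / (m + k + 1)], at most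
    [expR (- ((2 k + 1) / (m + i)))], and the odd numbers [2 k + 1] for [k < i] sum to [i ^+ 2]. The
    lower bound that follows uses [m - i] in the same way. *)
Lemma bin_ratio_le m i : (i <= m)%N ->
  'C(m.*2, m + i)%:R <= 'C(m.*2, m)%:R * expR (- (i%:R ^+ 2 / (m + i)%:R)) :> R.
Proof.
move=> im; have : (i <= i)%N by [].
(* The induction runs over [k], with the denominator [m + i] kept fixed. *)
move: {1 3 4}i => k; elim: k => [|k IH] ki.
  by rewrite addn0 expr0n mul0r oppr0 expR0 mulr1.
have h : (0 : R) < (m + i)%:R by rewrite ltr0n; lia.
rewrite bin_ratioS; last lia.
have e : k.+1%:R ^+ 2 / (m + i)%:R = k%:R ^+ 2 / (m + i)%:R + (2 * k%:R + 1) / (m + i)%:R :> R.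
  by rewrite -(natr1 k) -mulrDl; congr (_ / _); ring.
rewrite e opprD expRD mulrA; apply: ler_pM => //; last 2 first.
- exact/IH/ltnW.
- apply: le_trans (expR_le_1B _) _; rewrite ler_expR lerN2.
  rewrite ler_pM2l ?ltr_wpDl ?mulr_ge0// lef_pV2 ?posrE ?ltr0n ?ler_nat; lia.
rewrite subr_ge0 ler_pdivrMr ?mul1r ?ltr0n; last lia.
have -> : 2 * k%:R + 1 = (2 * k + 1)%:R :> R by rewrite natrD natrM.
by rewrite ler_nat; lia.
Qed.

Lemma bin_ratio_ge m i : (i < m)%N ->
  'C(m.*2, m)%:R * expR (- (i%:R ^+ 2 / (m - i)%:R)) <= 'C(m.*2, m + i)%:R :> R.
Proof.
move=> im; have : (i <= i)%N by [].
move: {1 3 5}i => k; elim: k => [|k IH] ki.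
  by rewrite addn0 expr0n mul0r oppr0 expR0 mulr1.
have h : (0 : R) < (m - i)%:R by rewrite ltr0n; lia.
rewrite bin_ratioS; last lia.
have e : k.+1%:R ^+ 2 / (m - i)%:R = k%:R ^+ 2 / (m - i)%:R + (2 * k%:R + 1) / (m - i)%:R :> R.
  by rewrite -(natr1 k) -mulrDl; congr (_ / _); ring.
have h2 : (0 : R) < (m + k.+1)%:R by rewrite ltr0n; lia.
have h3 : (2 * k%:R + 1) / (m + k.+1)%:R < 1 :> R.
  rewrite ltr_pdivrMr ?mul1r//.
  have -> : 2 * k%:R + 1 = (2 * k + 1)%:R :> R by rewrite natrD natrM.
  by rewrite ltr_nat; lia.
rewrite e opprD expRD mulrA; apply: ler_pM; rewrite ?mulr_ge0 ?expR_ge0//.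
- exact/IH/ltnW.
apply: le_trans (expR_ge_1B (y := (2 * k%:R + 1) / (m + k.+1)%:R) _); last first.
  rewrite h3 andbT divr_ge0// addr_ge0 ?mulr_ge0//.
rewrite ler_expR lerN2.
have h4 : (0 : R) < (m - k)%:R by rewrite ltr0n; lia.
rewrite [leLHS](_ : _ = (2 * k%:R + 1) / (m - k)%:R).
  rewrite ler_pM2l ?ltr_wpDl ?mulr_ge0// lef_pV2 ?posrE ?ltr0n ?ler_nat; lia.
rewrite natrB in h4 *; last lia.
rewrite natrD -(natr1 k) in h2 *; field.
by rewrite !gt_eqF//; lra.
Qed.
End BinomialAsymptotics.

(** * Polya's finite identity and its Gaussian limit *)

Section Polya.
Context {R : realType}.
Local Notation C := R[i].
Local Open Scope complex_scope.

Lemma cos2_pow (m : nat) (th : R) :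
  cos th ^+ m.*2 = 4^-1 ^+ m * \sum_(i < m.*2.+1) 'C(m.*2, i)%:R * cos (2 * (i%:Z - m%:Z)%:~R * th).
Proof.
have e1 : (2 * cos th)%:C = cexp (0 +i* th) + cexp (0 +i* (- th)).
  apply: complex_ext; rewrite /cexp ?ReD ?ImD/= expR0 ?cosN ?sinN; ring.
have e2 : ((2 * cos th) ^+ m.*2)%:C =
    \sum_(i < m.*2.+1) cexp (0 +i* (2 * (i%:Z - m%:Z)%:~R * th)) *+ 'C(m.*2, i).
  rewrite rmorphXn/= e1 addrC exprDn; apply: eq_bigr => i _; congr (_ *+ _).
  rewrite -!cexpMn -cexpD; congr cexp.
  have e (y : R) n : (0 +i* y) *+ n = 0 +i* (y * n%:R) :> C.
    elim: n => [|n IH]; first by rewrite mulr0n mulr0.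
    by rewrite mulrS IH; apply: complex_ext; rewrite ?ReD ?ImD/= ?addr0// -(natr1 n); ring.
  rewrite !e; apply: complex_ext; rewrite ?ReD ?ImD/= ?addr0//.
  rewrite natrB; last by have := ltn_ord i; lia.
  rewrite intrB (_ : m.*2%:R = 2 * m%:R); last by rewrite -mul2n natrM.
  by move: (nat_of_ord i) => k; rewrite !pmulrn; ring.
have e3 : (2 * cos th) ^+ m.*2 = \sum_(i < m.*2.+1) 'C(m.*2, i)%:R * cos (2 * (i%:Z - m%:Z)%:~R * th).
  have := congr1 (@complex.Re _) e2; rewrite Re_sum /= => ->; apply: eq_bigr => i _.
  set y := (2 * _ * th); elim: ('C(_, _)) => [|n IH]; first by rewrite mulr0n mul0r.
  by rewrite mulrS ReD IH -(natr1 n) /cexp/= expR0; ring.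
rewrite -e3 exprMn -mul2n [in X in _ * (X * _)]exprM mulrA -exprMn.
by rewrite (_ : 4^-1 * 2 ^+ 2 = 1) ?expr1n ?mul1r//; field.
Qed.

Lemma sum_cos (N d : nat) (a : R) : (0 < N)%N ->
  \sum_(j < N) cos (a + 2 * pi * d%:R * j%:R / N%:R) = if (N %| d)%N then N%:R * cos a else 0.
Proof.
move=> N0; have /(congr1 (fun z : C => complex.Re (cexp (0 +i* a) * z))) := @sum_cunit R N d N0.
rewrite mulr_sumr Re_sum.
under eq_bigr => j _.
  rewrite -cunitMn /cunit -cexpD.
  rewrite (_ : complex.Re _ = cos (a + 2 * pi * d%:R * j%:R / N%:R)); last first.
    rewrite /cexp ReD ImD/= addr0 expR0 mul1r natrM; congr (cos (a + _)); ring.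
  over.
move=> ->; case: ifP => _; last by rewrite mulr0.
rewrite -(rmorph_nat (real_complex R)) ReM/= mulr0 subr0 expR0; ring.
Qed.

Lemma tsum_int_fin (F : int -> R) (m : nat) :
  tsm setT (fun d : int => if (`|d| <= m)%N then F d else 0) /\
  tsum setT (fun d : int => if (`|d| <= m)%N then F d else 0) = \sum_(i < m.*2.+1) F (i%:Z - m%:Z).
Proof.
pose s : seq int := [seq i%:Z - m%:Z | i <- iota 0 m.*2.+1].
have us : uniq s by rewrite map_inj_uniq ?iota_uniq// => i j; lia.
have sE (d : int) : (d \in s) = (`|d| <= m)%N.
  apply/mapP/idP => [[i ilt ->]|dm]; first by move: ilt; rewrite mem_iota; lia.
  exists (absz (d + m%:Z)); last lia.
  rewrite mem_iota; lia.
have [sm e] := tsum_fin F us (fun x _ => I : setT x).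
split; first by apply: eq_tsm sm => d _; rewrite sE.
rewrite (eq_tsum (g := fun d => if d \in s then F d else 0)); last by move=> d _; rewrite sE.
by rewrite e big_map -[iota _ _]/(index_iota 0 m.*2.+1) big_mkord.
Qed.

Lemma tsum_int_mul (l : nat) (F : int -> R) : (0 < l)%N ->
  tsum setT (fun d : int => if (l %| `|d|)%N then F d else 0) =
  tsum setT (fun q : int => F (q * l%:Z)).
Proof.
move=> l0; pose A := [set d : int | (l %| `|d|)%N].
transitivity (tsum A F).
  rewrite (tsum_mkcond A); apply: eq_tsum => d _.
  by congr (if _ then _ else _); apply/idP/idP; rewrite ?inE.
apply: tsum_reindex; split => [q _|q q' _ _|d].
- by rewrite /A/= abszM dvdn_mull.
- by move=> h; apply: (mulIf (x := l%:Z)); rewrite // -lt0n; lia.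
move=> /= /dvdnP[k e]; exists (if 0 <= d then k%:Z else - k%:Z) => //=.
by case: ifP => ?; lia.
Qed.

Lemma cos_sub_2pi_int (a : R) (k : int) : cos (a - 2 * pi * k%:~R) = cos a.
Proof.
have key (n : nat) (b : R) : cos (b + 2 * pi * n%:R) = cos b.
  elim: n => [|n IH]; first by rewrite mulr0 addr0.
  rewrite -[RHS]IH -(natr1 n).
  have -> : b + 2 * pi * (n%:R + 1) = (b + 2 * pi * n%:R) + pi *+ 2 by rewrite mulr2n; ring.
  exact: cosD2pi.
case: k => n; first by rewrite -[LHS](key n) -pmulrn; congr cos; ring.
by rewrite NegzE mulrN opprK; exact: (key n.+1).
Qed.

(** A discrete Poisson summation: [cos ^+ m.*2] is a binomial sum of cosines, and summing over the
    [l = 2 p + 1] equally spaced points [|k| <= p] keeps only the frequencies divisible by [l]. *)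
Lemma polya_identity (p m : nat) (x : R) : let l := p.*2.+1 in
  tsum setT (fun k : int => if (`|k| <= p)%N then cos (pi * (x + k%:~R) / l%:R) ^+ m.*2 else 0) =
  l%:R * cbin m * tsum setT (fun q : int => if (`|q| * l <= m)%N
     then 'C(m.*2, m + `|q| * l)%:R / 'C(m.*2, m)%:R * cos (2 * pi * q%:~R * x) else 0).
Proof.
move=> l; rewrite (tsum_int_fin _ p).2 -/l.
pose G (d : int) := 4^-1 ^+ m * ('C(m.*2, m + `|d|)%:R *
  (if (l %| `|d|)%N then l%:R * cos (2 * pi * d%:~R * (x - p%:R) / l%:R) else 0)) : R.
have l0 : l%:R != 0 :> R by rewrite pnatr_eq0.
transitivity (\sum_(i < m.*2.+1) G (i%:Z - m%:Z)).
  under eq_bigr => j _ do rewrite cos2_pow mulr_sumr.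
  rewrite exchange_big /=; apply: eq_bigr => i _; rewrite /G.
  under eq_bigr => j _ do rewrite mulrA.
  rewrite -mulr_sumr -[LHS]mulrA; congr (_ * _).
  have ilt : (i <= m.*2)%N by have := ltn_ord i; lia.
  congr (_ * _).
    congr (_ %:R); have [im|im] := leqP m i; first by congr 'C(_, _); lia.
    by rewrite -bin_sub//; congr 'C(_, _); lia.
  set d : int := _ - _.
  pose a := 2 * pi * `|d|%:R * (x - p%:R) / l%:R : R.
  rewrite [X in if _ then X else _](_ : _ = l%:R * cos a); last first.
    congr (_ * _); rewrite /a; case: (d) => n; first by rewrite -pmulrn.
    rewrite NegzE abszN -[RHS]cosN; congr cos; rewrite rmorphN/= -pmulrn; ring.
  rewrite -sum_cos//; apply: eq_bigr => j _.
  rewrite /a; case: (d) => n.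
    rewrite -pmulrn; congr cos; rewrite intrB; field; exact: l0.
  rewrite NegzE abszN -[RHS]cosN; congr cos; rewrite rmorphN/= -pmulrn intrB; field; exact: l0.
rewrite -(tsum_int_fin _ m).2 /G.
pose H (d : int) : R := if (`|d| <= m)%N then 4^-1 ^+ m * ('C(m.*2, m + `|d|)%:R * (l%:R * cos (2 * pi * d%:~R * (x - p%:R) / l%:R))) else 0.
rewrite (eq_tsum (g := fun d : int => if (l %| `|d|)%N then H d else 0)); last first.
  by move=> d _; rewrite /H; case: ifP; case: ifP => //; rewrite !mulr0.
rewrite tsum_int_mul// /H -tsumZ; last first.
  apply: tsm_le (tsm_norm (tsum_int_fin (fun q : int => if (`|q| * l <= m)%N
     then 'C(m.*2, m + `|q| * l)%:R / 'C(m.*2, m)%:R * cos (2 * pi * q%:~R * x) else 0) m).1) => q _.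
  by case: ifP => //; case: ifP => h1 h2; rewrite ?normr0//; lia.
apply: eq_tsum => q _; rewrite abszM /=; case: ifP => h; last by rewrite mulr0.
rewrite /cbin exprVn.
have c0 : 'C(m.*2, m)%:R != 0 :> R by rewrite pnatr_eq0 -lt0n bin_gt0 -addnn leq_addr.
rewrite (_ : cos (2 * pi * (q * l)%:~R * (x - p%:R) / l%:R) = cos (2 * pi * q%:~R * x)).
  move: (4 ^+ m)^-1 => u; move: c0; move: ('C(m.*2, m)%:R : R) => c c0; field; exact: c0.
rewrite -[RHS](cos_sub_2pi_int _ (q * p%:Z)); congr cos; rewrite !intrM -!pmulrn; field; exact: l0.
Qed.

End Polya.

Section GaussianSum.
Context {R : realType}.
Implicit Types (c s x y : R).

Lemma tsm_geom_int (r : R) : 0 < r < 1 -> tsm setT (fun k : int => r ^+ `|k|%N).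
Proof.
move=> /andP[r0 r1].
have gn : tsm setT (fun n : nat => r ^+ n).
  apply: (@tsm_nat _ _ (1 - r)^-1) => n.
  rewrite (eq_bigr (fun k : 'I_n => r ^+ k)); last by move=> k _; rewrite ger0_norm// exprn_ge0// ltW.
  rewrite -[leRHS]mul1r ler_pdivlMr ?subr_gt0// mulrC -opprB mulNr -subrX1 opprB gerBl.
  by rewrite exprn_ge0// ltW.
apply: (@tsm_bound _ _ _ _ (tsum setT (fun n : nat => r ^+ n) *+ 2)) => F uF _.
rewrite (bigID (fun k : int => 0 <= k))/= mulr2n.
have f0 (k : nat) : [set: nat] k -> 0 <= r ^+ k by move=> _; rewrite exprn_ge0// ltW.
apply: lerD.
  rewrite -big_filter; apply: le_trans (ler_sum_tsum (F := [seq `|k|%N | k <- F & 0 <= k]) _ _ f0 gn) => //.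
    rewrite big_map le_eqVlt; apply/orP; left; apply/eqP; apply: eq_bigr => k _.
    by rewrite ger0_norm// exprn_ge0// ltW.
  rewrite map_inj_in_uniq ?filter_uniq// => a b; rewrite !mem_filter => /andP[a0 _] /andP[b0 _] /=; lia.
rewrite -big_filter; apply: le_trans (ler_sum_tsum (F := [seq `|k|%N | k <- F & ~~ (0 <= k)]) _ _ f0 gn) => //.
  rewrite big_map le_eqVlt; apply/orP; left; apply/eqP; apply: eq_bigr => k _.
  by rewrite ger0_norm// exprn_ge0// ltW.
rewrite map_inj_in_uniq ?filter_uniq// => a b; rewrite !mem_filter => /andP[a0 _] /andP[b0 _] /=; lia.
Qed.

Lemma tsm_gauss_int c x : 0 < c -> tsm setT (fun k : int => expR (- (c * (x + k%:~R) ^+ 2))).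
Proof.
move=> c0; have r01 : 0 < expR (- (c / 2)) < 1.
  by rewrite expR_gt0 -expR0 ltr_expR oppr_lt0 divr_gt0.
apply: tsm_le (tsmZ (expR (c * x ^+ 2)) (tsm_geom_int r01)) => k _.
rewrite ger0_norm ?expR_ge0// -expRM_natl -expRD ler_expR.
have h : (`|k|%N)%:R <= k%:~R ^+ 2 :> R.
  have -> : k%:~R ^+ 2 = (`|k| ^ 2)%N%:R :> R.
    by rewrite pmulrn -rmorphXn/=; congr (_ %:~R); lia.
  by rewrite ler_nat; case: `|k|%N => // n; rewrite leq_pmull.
move: h; move: (`|k|%N%:R : R) (k%:~R : R) => a b h.
have : 0 <= (x + b / 2) ^+ 2 by exact: sqr_ge0.
nra.
Qed.

Lemma sin_sqr_bounds y : `|y| <= 2 -> y ^+ 2 * (1 - y ^+ 2 / 6) ^+ 2 <= sin y ^+ 2 <= y ^+ 2.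
Proof.
move=> y2; apply/andP; split; last first.
  by rewrite -[leRHS]real_normK ?num_real// -[leLHS]real_normK ?num_real// lerXn2r ?nnegrE// ler_abs_sin.
have e : sin y ^+ 2 = sin `|y| ^+ 2.
  by have [y0|y0] := leP 0 y; [rewrite ger0_norm | rewrite ltr0_norm// sinN sqrrN].
rewrite e -[y ^+ 2]real_normK ?num_real//.
have y0 : 0 <= `|y| by [].
have := sin_ge y0; move: y0 y2; move: `|y| (sin `|y|) => z w z0 z2 h.
have {}h : z * (1 - z ^+ 2 / 6) <= w by apply: le_trans h; rewrite le_eqVlt; apply/orP; left; apply/eqP; ring.
have h2 : 0 <= z * (1 - z ^+ 2 / 6) by rewrite mulr_ge0//; nra.
by rewrite -exprMn lerXn2r ?nnegrE// (le_trans h2 h).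
Qed.

End GaussianSum.

Section PolyaLimit.
Context {R : realType}.
Variables (s x : R).
Hypothesis s0 : 0 < s.

Let lq (p : nat) : R := p.*2.+1%:R.
(** With [m] close to [s l^2 / pi] both sides have Gaussian limits: [m (pi (x + k) / l)^2] tends to
    [pi s (x + k)^2], and the exponent [(q l)^2 / m] of the binomial quotients tends to
    [pi q^2 / s]. *)
Let mq (p : nat) : nat := Num.trunc (s * lq p ^+ 2 / pi).

Let lq_gt0 p : 0 < lq p. Proof. by rewrite ltr0n. Qed.
Let lq_neq0 p : lq p != 0. Proof. by rewrite gt_eqF. Qed.
Let pi0 : (0 : R) < pi. Proof. exact: pi_gt0. Qed.
Let pin0 : (pi : R) != 0. Proof. by rewrite gt_eqF. Qed.

Let cvg_lqV : (lq p)^-1 @[p --> \oo] --> 0.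
Proof.
apply: (squeeze_cvgr (f := fun=> 0) (h := fun p => p.+1%:R^-1)).
- near=> p; rewrite invr_ge0 ltW//= lef_pV2 ?posrE// ler_nat; lia.
- exact: cvg_cst.
- exact: cvg_harmonic.
Unshelve. all: by end_near.
Qed.

Let mq_itv p : (mq p)%:R <= s * lq p ^+ 2 / pi < (mq p)%:R + 1.
Proof.
have h : 0 <= s * lq p ^+ 2 / pi by rewrite !mulr_ge0 ?invr_ge0 ?exprn_ge0 ?ltW.
by have := truncn_itv h; rewrite natr1.
Qed.

Let cvg_mq : (mq p)%:R / lq p ^+ 2 @[p --> \oo] --> s / pi.
Proof.
apply: (squeeze_cvgr (f := fun p => s / pi - (lq p)^-1 ^+ 2) (h := fun=> s / pi)).
- near=> p; have := mq_itv p => /andP[h1 h2].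
  have l2 : 0 < lq p ^+ 2 by rewrite exprn_gt0.
  rewrite ler_pdivrMr// exprVn ler_pdivlMr// mulrBl mulVf ?gt_eqF//.
  by move: h1 h2; rewrite mulrAC => h1 h2; apply/andP; split; lra.
- rewrite -[X in _ --> X]subr0 -[X in _ --> _ - X](mulr0 (0 : R)); apply: cvgB; first exact: cvg_cst.
  by apply: cvgM; exact: cvg_lqV.
- exact: cvg_cst.
Unshelve. all: by end_near.
Qed.

Let mq_cvg_oo : mq p @[p --> \oo] --> \oo.
Proof.
apply/cvgnyPge => A.
have h : \forall p \near \oo, s / pi / 2 < (mq p)%:R / lq p ^+ 2.
  apply: (cvgr_gt _ cvg_mq); rewrite ltr_pdivrMr// ltr_pMr ?divr_gt0//; lra.
near=> p; rewrite -(ler_nat R).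
have h1 : s / pi / 2 < (mq p)%:R / lq p ^+ 2 by near: p.
rewrite ltr_pdivlMr ?exprn_gt0// in h1.
have h2 : A%:R / (s / pi / 2) <= p%:R.
  by near: p; exact: nbhs_infty_ger.
have h3 : 0 < s / pi / 2 by rewrite !divr_gt0.
rewrite ler_pdivrMr// in h2.
have h4 : p%:R <= lq p ^+ 2.
  by rewrite /lq -natrX ler_nat; nia.
apply: le_trans h2 _; apply: le_trans (ltW h1); by rewrite mulrC ler_pM2l.
Unshelve. all: by end_near.
Qed.

Let cvg_const (U : R) : m%:R * cbin m ^+ 2 @[m --> \oo] --> U ->
  lq p * cbin (mq p) @[p --> \oo] --> Num.sqrt (pi / s * U).
Proof.
move=> cU.
have c1 : (mq p)%:R * cbin (mq p) ^+ 2 @[p --> \oo] --> U by exact: cvg_comp mq_cvg_oo cU.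
have c2 : ((mq p)%:R / lq p ^+ 2)^-1 @[p --> \oo] --> (s / pi)^-1.
  by apply: cvgV cvg_mq; rewrite gt_eqF// divr_gt0.
have c3 : ((mq p)%:R / lq p ^+ 2)^-1 * ((mq p)%:R * cbin (mq p) ^+ 2) @[p --> \oo] --> pi / s * U.
  by rewrite -[pi / s]invf_div; apply: cvgM.
have c4 : Num.sqrt (((mq p)%:R / lq p ^+ 2)^-1 * ((mq p)%:R * cbin (mq p) ^+ 2)) @[p --> \oo]
    --> Num.sqrt (pi / s * U).
  by apply: continuous_cvg c3; exact: sqrt_continuous.
apply: cvg_trans c4; apply: near_eq_cvg; near=> p.
have m0 : (0 < mq p)%N by near: p; have /cvgnyPgt := mq_cvg_oo; exact.
rewrite [X in Num.sqrt X](_ : _ = (lq p * cbin (mq p)) ^+ 2).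
  by rewrite sqrtr_sqr ger0_norm// mulr_ge0// ltW// cbin_gt0.
have : (mq p)%:R != 0 :> R by rewrite pnatr_eq0 -lt0n.
have := lq_neq0 p; move: (lq p) (cbin (mq p) : R) ((mq p)%:R : R) => a b c a0 c0; field.
by rewrite a0 c0.
Unshelve. all: by end_near.
Qed.

Let yq (k : int) p : R := pi * (x + k%:~R) / lq p.

Let cvg_yq k : yq k p @[p --> \oo] --> 0.
Proof.
rewrite -(mulr0 (pi * (x + k%:~R))); apply: cvgM; [exact: cvg_cst|exact: cvg_lqV].
Qed.

Let cvg_myq k : (mq p)%:R * yq k p ^+ 2 @[p --> \oo] --> pi * s * (x + k%:~R) ^+ 2.
Proof.
have : (mq p)%:R / lq p ^+ 2 * (pi * (x + k%:~R)) ^+ 2 @[p --> \oo] --> s / pi * (pi * (x + k%:~R)) ^+ 2.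
  by apply: cvgM => //; exact: cvg_cst.
rewrite [X in _ --> X](_ : _ = pi * s * (x + k%:~R) ^+ 2); last by move: (x + k%:~R) => z; rewrite exprMn [pi ^+ 2]expr2 mulrA -(mulrA s) [pi^-1 * _]mulrA mulVf// mul1r (mulrC s).
apply: cvg_trans; apply: near_eq_cvg; near=> p.
rewrite /yq; field; rewrite ?lq_neq0//.
Unshelve. all: by end_near.
Qed.

Let cvg_lhs : tsum setT (fun k : int => if (`|k| <= p)%N then cos (pi * (x + k%:~R) / p.*2.+1%:R) ^+ (mq p).*2 else 0)
   @[p --> \oo] --> tsum setT (fun k : int => expR (- (pi * s * (x + k%:~R) ^+ 2))).
Proof.
have cE y n : cos y ^+ n.*2 = (1 - sin y ^+ 2) ^+ n :> R.
  by rewrite -mul2n exprM -(cos2Dsin2 y) addrK.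
(* The 18 is [2 * 9]: eventually [m >= s l^2 / (2 pi)], and [sin y ^+ 2 >= y ^+ 2 / 9] for
   [|y| <= 2]. That range is reached because [|k| <= p] keeps [pi |k| / l] below [pi / 2 < 2]. *)
apply: (@tannery _ _ _ _ _ (fun k : int => expR (- (pi * s / 18 * (x + k%:~R) ^+ 2)))).
- by apply: tsm_gauss_int; rewrite divr_gt0// mulr_gt0.
- have h : \forall p \near \oo, s / pi / 2 < (mq p)%:R / lq p ^+ 2.
    apply: (cvgr_gt _ cvg_mq); rewrite ltr_pdivrMr// ltr_pMr ?divr_gt0//; lra.
  have h2 : \forall p \near \oo, pi * `|x| / lq p < 2 - pi / 2.
    apply: (cvgr_lt _ (_ : _ --> pi * `|x| * 0)); last by rewrite mulr0 subr_gt0 pihalf_lt2.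
    by apply: cvgM; [exact: cvg_cst|exact: cvg_lqV].
  near=> p => k _; case: ifPn => kp; last by rewrite normr0 expR_ge0.
  rewrite cE -/(lq p) -/(yq k p).
  have y2 : `|yq k p| <= 2.
    rewrite !normrM (gtr0_norm pi0) normfV (gtr0_norm (lq_gt0 p)).
    have e1 : pi * `|x| / lq p < 2 - pi / 2 by near: p.
    have e2 : pi * `|k%:~R| / lq p <= pi / 2.
      rewrite -mulrA ler_pM2l// ler_pdivrMr// -intr_norm -abszE.
      rewrite mulrC ler_pdivlMr// -natrM ler_nat; lia.
    apply: (@le_trans _ _ (pi * `|x| / lq p + pi * `|k%:~R| / lq p)); last by rewrite (le_trans (lerD (ltW e1) e2))// subrK.
    by rewrite -mulrDl -mulrDr ler_pM2r ?invr_gt0// ler_pM2l// ler_normD.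
  have := sin_sqr_bounds y2 => /andP[b1 b2].
  have b3 : yq k p ^+ 2 / 9 <= sin (yq k p) ^+ 2.
    apply: le_trans b1; rewrite ler_wpM2l ?sqr_ge0//.
    have : 0 <= yq k p ^+ 2 <= 4.
      by rewrite sqr_ge0 -[X in _ <= X](_ : 2 ^+ 2 = 4) -?[yq k p ^+ 2]real_normK ?num_real ?lerXn2r ?nnegrE//; ring.
    by move: (yq k p ^+ 2) => z z0; nra.
  rewrite ger0_norm; last by rewrite exprn_ge0// -(cos2Dsin2 (yq k p)) addrK sqr_ge0.
  apply: (@le_trans _ _ (expR (- sin (yq k p) ^+ 2) ^+ mq p)).
    by rewrite lerXn2r ?nnegrE ?expR_ge0 ?expR_le_1B// -(cos2Dsin2 (yq k p)) addrK sqr_ge0.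
  rewrite -expRM_natl ler_expR mulrN lerN2.
  have e1 : s / pi / 2 < (mq p)%:R / lq p ^+ 2 by near: p.
  apply: (@le_trans _ _ ((mq p)%:R * (yq k p ^+ 2 / 9))); last by rewrite ler_wpM2l.
  have -> : (mq p)%:R * (yq k p ^+ 2 / 9) = (mq p)%:R / lq p ^+ 2 * (pi ^+ 2 / 9 * (x + k%:~R) ^+ 2).
    rewrite /yq; field; rewrite ?lq_neq0//.
  have -> : pi * s / 18 * (x + k%:~R) ^+ 2 = s / pi / 2 * (pi ^+ 2 / 9 * (x + k%:~R) ^+ 2).
    by move: pi0; move: (pi : R) (x + k%:~R) => q z q0; field; rewrite ?gt_eqF.
  apply: ler_wpM2r (ltW e1); by rewrite mulr_ge0 ?sqr_ge0// mulr_ge0 ?sqr_ge0// invr_ge0.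
move=> k _.
have c := @cvg_1B_pow _ (fun p => sin (yq k p) ^+ 2) mq (pi * s * (x + k%:~R) ^+ 2).
have y2 : \forall p \near \oo, `|yq k p| <= 2.
  have := cvg_yq k => /cvgr0_norm_le; apply; lra.
have cy2 : yq k p ^+ 2 @[p --> \oo] --> 0.
  by rewrite -(mulr0 0); apply: cvgM; exact: cvg_yq.
apply: cvg_trans (c _ _ _).
- apply: near_eq_cvg; near=> p; rewrite cE ifT//.
  by near: p; exact: nbhs_infty_ge.
- by near=> p; exact: sqr_ge0.
- apply: (squeeze_cvgr (f := fun=> 0) (h := fun p => yq k p ^+ 2)) => //; last exact: cvg_cst.
  near=> p; rewrite sqr_ge0/=.
  have /sin_sqr_bounds/andP[_ ->]// : `|yq k p| <= 2 by near: p.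
apply: (squeeze_cvgr (f := fun p => (mq p)%:R * yq k p ^+ 2 * (1 - yq k p ^+ 2 / 6) ^+ 2) (h := fun p => (mq p)%:R * yq k p ^+ 2)).
- near=> p.
  have /sin_sqr_bounds/andP[a b] : `|yq k p| <= 2 by near: p.
  by rewrite -mulrA !ler_wpM2l.
- rewrite -[X in _ --> X]mulr1; apply: cvgM; first exact: cvg_myq.
  have c1 : 1 - yq k p ^+ 2 / 6 @[p --> \oo] --> (1 : R).
    rewrite -[X in _ --> X]subr0 -[X in _ --> _ - X](mul0r 6^-1).
    by apply: cvgB; [exact: cvg_cst | apply: cvgM => //; exact: cvg_cst].
  by rewrite -[X in _ --> X]mulr1; apply: cvgM.
- exact: cvg_myq.
Unshelve. all: by end_near.
Qed.

Let cvg_rhs : tsum setT (fun q : int => if (`|q| * p.*2.+1 <= mq p)%N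
     then 'C((mq p).*2, mq p + `|q| * p.*2.+1)%:R / 'C((mq p).*2, mq p)%:R * cos (2 * pi * q%:~R * x) else 0)
   @[p --> \oo] --> tsum setT (fun q : int => expR (- (pi / s * q%:~R ^+ 2)) * cos (2 * pi * q%:~R * x)).
Proof.
have C0 m : (0 : R) < 'C(m.*2, m)%:R by rewrite ltr0n bin_gt0 -addnn leq_addr.
have sqn (q : int) : (`|q|%N%:R) ^+ 2 = q%:~R ^+ 2 :> R.
  by rewrite -[RHS]real_normK ?num_real// -intr_norm -abszE -pmulrn.
(* Only [|q| l <= m] occurs, so the denominator [m + |q| l] in [bin_ratio_le] is at most [2 m]; this
   is the extra factor 2 in the exponent. *)
apply: (@tannery _ _ _ _ _ (fun q : int => expR (- (pi / s / 2 * (0 + q%:~R) ^+ 2)))).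
- by apply: tsm_gauss_int; rewrite !divr_gt0.
- near=> p => q _; case: ifPn => qm; last by rewrite normr0 expR_ge0.
  rewrite normrM; apply: le_trans (ler_piMr (normr_ge0 _) (cos_max _)) _.
  rewrite ger0_norm ?divr_ge0// ler_pdivrMr// mulrC; apply: le_trans (bin_ratio_le qm) _.
  rewrite ler_pM2l// ler_expR lerN2 add0r natrM exprMn sqn -/(lq p).
  have [/eqP|mi] := posnP (mq p + `|q| * p.*2.+1)%N.
    rewrite addn_eq0 muln_eq0 orbF absz_eq0 => /andP[_ /eqP ->].
    by rewrite expr0n !mul0r mulr0.
  rewrite ler_pdivlMr ?ltr0n//; have /andP[h1 _] := mq_itv p.
  apply: (@le_trans _ _ (pi / s / 2 * q%:~R ^+ 2 * ((mq p)%:R + (mq p)%:R))).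
    apply: ler_wpM2l; last by rewrite -natrD ler_nat leq_add2l.
    by rewrite mulr_ge0 ?sqr_ge0// !divr_ge0// ltW.
  rewrite [leLHS](_ : _ = q%:~R ^+ 2 * (pi / s * (mq p)%:R)); last by field; rewrite gt_eqF.
  rewrite ler_wpM2l ?sqr_ge0// mulrAC ler_pdivrMr// mulrC -ler_pdivlMr//.
  by rewrite [_ * s]mulrC.
move=> q _.
have qm : \forall p \near \oo, (`|q| * p.*2.+1 < mq p)%N.
  have h : \forall p \near \oo, s / pi / 2 < (mq p)%:R / lq p ^+ 2.
    apply: (cvgr_gt _ cvg_mq); rewrite ltr_pdivrMr// ltr_pMr ?divr_gt0//; lra.
  have h2 : \forall p \near \oo, `|q|%N%:R / lq p < s / pi / 2.
    have c : `|q|%N%:R / lq p @[p --> \oo] --> (0 : R).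
      by rewrite -(mulr0 (`|q|%N%:R : R)); apply: cvgM; [exact: cvg_cst|exact: cvg_lqV].
    by apply: (cvgr_lt _ c); rewrite !divr_gt0.
  near=> p; rewrite -(ltr_nat R) natrM -/(lq p).
  have h3 : `|q|%N%:R / lq p < (mq p)%:R / lq p ^+ 2.
    by apply: (@lt_trans _ _ (s / pi / 2)); near: p.
  by move: h3; rewrite ltr_pdivlMr ?exprn_gt0// expr2 mulrA divfK.
have c1 : ('C((mq p).*2, mq p + `|q| * p.*2.+1)%:R : R) / 'C((mq p).*2, mq p)%:R @[p --> \oo] --> expR (- (pi / s * q%:~R ^+ 2)).
  have lim (e : R) : q%:~R ^+ 2 / ((mq p)%:R / lq p ^+ 2 + e * (lq p)^-1) @[p --> \oo] --> pi / s * q%:~R ^+ 2.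
    rewrite mulrC -[pi / s]invf_div; apply: cvgM; first exact: cvg_cst.
    apply: cvgV; first by rewrite gt_eqF// divr_gt0.
    rewrite -[X in _ --> X]addr0 -(mulr0 e); apply: cvgD => //.
    by apply: cvgM => //; exact: cvg_cst.
  have lim2 (e : R) : expR (- (q%:~R ^+ 2 / ((mq p)%:R / lq p ^+ 2 + e * (lq p)^-1))) @[p --> \oo] --> expR (- (pi / s * q%:~R ^+ 2)).
    by apply: continuous_cvg; [exact: continuous_expR | apply: cvgN].
  apply: (squeeze_cvgr _ (lim2 (- `|q|%N%:R)) (lim2 `|q|%N%:R)).
  near=> p.
  have qmp : (`|q| * p.*2.+1 < mq p)%N by near: p.
  have e (u : R) : (mq p)%:R + u * lq p != 0 ->
      (`|q| * p.*2.+1)%:R ^+ 2 / ((mq p)%:R + u * lq p) = q%:~R ^+ 2 / ((mq p)%:R / lq p ^+ 2 + u * (lq p)^-1) :> R.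
    move=> u0; rewrite natrM exprMn sqn -/(lq p).
    have -> : (mq p)%:R / lq p ^+ 2 + u * (lq p)^-1 = ((mq p)%:R + u * lq p) / lq p ^+ 2.
      by field; rewrite ?lq_neq0.
    by rewrite invf_div; ring.
  have qR : `|q|%N%:R * lq p < (mq p)%:R by rewrite -natrM ltr_nat.
  have q0 : 0 <= `|q|%N%:R * lq p by rewrite mulr_ge0// ltW.
  rewrite /= -!e ?gt_eqF//; try lra.
  apply/andP; split.
    rewrite ler_pdivlMr// mulrC mulNr; apply: le_trans (bin_ratio_ge qmp).
    by rewrite natrB 1?ltnW// natrM.
  rewrite ler_pdivrMr// mulrC; apply: le_trans (bin_ratio_le (ltnW qmp)) _.
  by rewrite natrD natrM.
have c2 : 'C((mq p).*2, mq p + `|q| * p.*2.+1)%:R / 'C((mq p).*2, mq p)%:R * cos (2 * pi * q%:~R * x)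
    @[p --> \oo] --> expR (- (pi / s * q%:~R ^+ 2)) * cos (2 * pi * q%:~R * x).
  by apply: cvgM => //; exact: cvg_cst.
apply: cvg_trans c2; apply: near_eq_cvg; near=> p.
rewrite ifT// ltnW//; near: p; exact: qm.
Unshelve. all: by end_near.
Qed.

Lemma theta_limit (U : R) : m%:R * cbin m ^+ 2 @[m --> \oo] --> U ->
  tsum setT (fun k : int => expR (- (pi * s * (x + k%:~R) ^+ 2))) =
  Num.sqrt (pi / s * U) * tsum setT (fun q : int => expR (- (pi / s * q%:~R ^+ 2)) * cos (2 * pi * q%:~R * x)).
Proof.
move=> cU; apply: (@cvg_unique _ (@norm_hausdorff _ R) _ _ _ _ cvg_lhs).
have : lq p * cbin (mq p) * tsum setT (fun q : int => if (`|q| * p.*2.+1 <= mq p)%N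
     then 'C((mq p).*2, mq p + `|q| * p.*2.+1)%:R / 'C((mq p).*2, mq p)%:R * cos (2 * pi * q%:~R * x) else 0)
   @[p --> \oo] --> Num.sqrt (pi / s * U) * tsum setT (fun q : int => expR (- (pi / s * q%:~R ^+ 2)) * cos (2 * pi * q%:~R * x)).
  by apply: cvgM; [exact: cvg_const|exact: cvg_rhs].
apply: cvg_trans; apply: near_eq_cvg; near=> p.
by rewrite polya_identity.
Unshelve. all: by end_near.
Qed.

End PolyaLimit.

Lemma theta_inversion {R : realType} (s x : R) : 0 < s ->
  tsum setT (fun k : int => expR (- (pi * s * (x + k%:~R) ^+ 2))) =
  (Num.sqrt s)^-1 * tsum setT (fun q : int => expR (- (pi / s * q%:~R ^+ 2)) * cos (2 * pi * q%:~R * x)).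
Proof.
move=> s0; have [U cU] := @cvg_cbin R.
(* The Wallis constant is read off from the symmetric case [s = 1], [x = 0]. *)
have U1 : Num.sqrt (pi * U) = 1.
  have := theta_limit (s := 1) 0 ltr01 cU; rewrite divr1.
  rewrite [X in _ = _ * X](eq_tsum (g := fun k : int => expR (- (pi * 1 * (0 + k%:~R) ^+ 2)))); last first.
    by move=> k _; rewrite mulr0 cos0 !mulr1 add0r.
  set T := tsum _ _ => /esym/eqP; rewrite -subr_eq0 -{2}[T]mul1r -mulrBl mulf_eq0 subr_eq0 => /orP[/eqP//|].
  have : 0 < T.
    have := @ler_sum_tsum R int setT [:: 0] (fun k : int => expR (- (pi * 1 * (0 + k%:~R) ^+ 2))) isT.
    rewrite big_seq1 => h; apply: lt_le_trans (h _ _ _) => //; first exact: expR_gt0.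
    by apply: tsm_gauss_int; rewrite mulr1 pi_gt0.
  by move=> /gt_eqF ->.
rewrite (theta_limit x s0 cU); congr (_ * _).
have U0 : 0 <= pi * U by rewrite leNgt; apply/negP => /ltW/ler0_sqrtr e; move: U1 => /eqP; rewrite e eq_sym oner_eq0.
by rewrite mulrAC sqrtrM// U1 mul1r sqrtrV// ltW.
Qed.

(** * Theta inversion for unimodular lattices *)
Section ProductSums.
Context {R : realType}.

Lemma tsum_prod (T1 T2 : choiceType) (A : set T1) (B : set T2) (f : T1 -> R) (g : T2 -> R) :
  tsm A f -> tsm B g ->
  tsm (A `*` B) (fun z => f z.1 * g z.2) /\
  tsum (A `*` B) (fun z => f z.1 * g z.2) = tsum A f * tsum B g.
Proof.
move=> sf sg.
pose P (h : R) := Num.max h 0; pose N (h : R) := Num.max (- h) 0.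
have P0 h : 0 <= P h by rewrite /P le_max lexx orbT.
have N0 h : 0 <= N h by rewrite /N le_max lexx orbT.
have PN h : h = P h - N h.
  by rewrite /P /N; have [h0|/ltW h0] := lerP 0 h;
    [rewrite max_r ?oppr_le0// subr0 | rewrite max_l ?oppr_ge0// sub0r opprK].
have sP (T : choiceType) (D : set T) (h : T -> R) : tsm D h -> tsm D (fun x => P (h x)).
  by exact: tsm_pos.
have sN (T : choiceType) (D : set T) (h : T -> R) : tsm D h -> tsm D (fun x => N (h x)).
  by move=> /tsmN/tsm_pos.
have [s1 e1] := psum_prod (fun x _ => P0 (f x)) (fun x _ => P0 (g x)) (sP _ _ _ sf) (sP _ _ _ sg).
have [s2 e2] := psum_prod (fun x _ => N0 (f x)) (fun x _ => N0 (g x)) (sN _ _ _ sf) (sN _ _ _ sg).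
have [s3 e3] := psum_prod (fun x _ => P0 (f x)) (fun x _ => N0 (g x)) (sP _ _ _ sf) (sN _ _ _ sg).
have [s4 e4] := psum_prod (fun x _ => N0 (f x)) (fun x _ => P0 (g x)) (sN _ _ _ sf) (sP _ _ _ sg).
have fE z : f z.1 * g z.2 = (P (f z.1) * P (g z.2) + N (f z.1) * N (g z.2)) -
    (P (f z.1) * N (g z.2) + N (f z.1) * P (g z.2)) :> R.
  by rewrite {1}[f z.1]PN {1}[g z.2]PN; ring.
have sfg := tsmB (tsmD s1 s2) (tsmD s3 s4).
split; first by apply: eq_tsm sfg => z _; exact: fE.
have -> : tsum (A `*` B) (fun z => f z.1 * g z.2) = _ := eq_tsum (fun z _ => fE z).
rewrite tsumB; [|exact: tsmD..]; rewrite !tsumD// e1 e2 e3 e4.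
rewrite [in RHS](eq_tsum (fun z _ => PN (f z))) [in X in _ = _ * X](eq_tsum (fun z _ => PN (g z))).
rewrite !tsumB; [|by [exact: sP|exact: sN]..]; ring.
Qed.

Lemma tsum_even_sin (f : int -> R) (g : R) : (forall k, f (- k) = f k) ->
  tsum setT (fun k : int => f k * sin (k%:~R * g)) = 0.
Proof.
move=> ef; have bN : set_bij [set: int] [set: int] (fun k => - k).
  by split=> // [k l _ _ /oppr_inj//|k _]; exists (- k); rewrite ?opprK.
have := tsum_reindex (fun k : int => f k * sin (k%:~R * g)) bN.
rewrite [X in _ = X -> _](eq_tsum (g := fun k : int => - (f k * sin (k%:~R * g)))); last first.
  by move=> k _; rewrite ef rmorphN/= mulNr sinN mulrN.
by rewrite tsumN; lra.
Qed.

Let fcons n (z : int * {ffun 'I_n -> int}) : {ffun 'I_n.+1 -> int} :=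
  [ffun i => oapp z.2 z.1 (unlift ord0 i)].

Let fcons0 n z : @fcons n z ord0 = z.1.
Proof. by rewrite ffunE unlift_none. Qed.

Let fconsS n z i : @fcons n z (lift ord0 i) = z.2 i.
Proof. by rewrite ffunE liftK. Qed.

Let fcons_bij n : set_bij (setT `*` setT) setT (@fcons n).
Proof.
split=> // [[a f] [c g] _ _ e|f _].
  congr (_, _); first by have := congr1 (fun h : {ffun _} => h ord0) e; rewrite !fcons0.
  by apply/ffunP => i; have := congr1 (fun h : {ffun _} => h (lift ord0 i)) e; rewrite !fconsS.
exists (f ord0, [ffun i => f (lift ord0 i)]) => //.
by apply/ffunP => i; case: (unliftP ord0 i) => [j|] ->; rewrite ?fcons0 ?fconsS ?ffunE.
Qed.

(** Characters are kept in real form. As every one-variable sine sum vanishes, the addition formulas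
    leave only the product of cosine sums; the vanishing of the full sine sum is carried along for
    the induction. *)
Lemma tsum_cos_prod n (f : 'I_n -> int -> R) (g : 'I_n -> R) :
  (forall i, tsm setT (f i)) ->
  (forall i, tsum setT (fun k : int => f i k * sin (k%:~R * g i)) = 0) ->
  let w (m : {ffun 'I_n -> int}) := \prod_i f i (m i) in
  let a (m : {ffun 'I_n -> int}) := \sum_i (m i)%:~R * g i in
  [/\ tsm setT w,
     tsum setT (fun m => w m * cos (a m)) = \prod_i tsum setT (fun k => f i k * cos (k%:~R * g i))
   & tsum setT (fun m => w m * sin (a m)) = 0].
Proof.
elim: n f g => [|n IH] f g sf ef w a.
  pose z : {ffun 'I_0 -> int} := [ffun => 0].
  have un (m : {ffun 'I_0 -> int}) : m = z by apply/ffunP => -[].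
  have [s1 e1] := @tsum_delta R _ setT z 1 I.
  have wE m : w m = 1 by rewrite /w big_ord0.
  have aE m : a m = 0 by rewrite /a big_ord0.
  split.
  - by apply: eq_tsm s1 => m _; rewrite wE (un m) eqxx.
  - rewrite big_ord0 -[RHS]e1; apply: eq_tsum => m _.
    by rewrite wE aE cos0 mulr1 (un m) eqxx.
  - by rewrite -[RHS](@tsum0 R _ (@setT {ffun 'I_0 -> int})); apply: eq_tsum => m _; rewrite aE sin0 mulr0.
pose f' i := f (lift ord0 i); pose g' i := g (lift ord0 i).
have [sw cw nw] := IH f' g' (fun i => sf _) (fun i => ef _).
move: sw cw nw; set w' := fun m : {ffun _} => \prod_i f' i (m i).
set a' := fun m : {ffun _} => \sum_i (m i)%:~R * g' i => sw cw nw.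
have wE z : w (fcons z) = f ord0 z.1 * w' z.2.
  by rewrite /w big_ord_recl fcons0; congr (_ * _); apply: eq_bigr => i _; rewrite fconsS.
have aE z : a (fcons z) = z.1%:~R * g ord0 + a' z.2.
  by rewrite /a big_ord_recl fcons0; congr (_ + _); apply: eq_bigr => i _; rewrite fconsS.
have bnd (T : choiceType) (h : T -> R) (u : T -> R) : tsm setT h -> (forall k, `|u k| <= 1) -> tsm setT (fun k => h k * u k).
  by move=> sh u1; apply: tsm_le (tsm_norm sh) => k _; rewrite normrM ler_piMr.
have c1 (y : R) := cos_max y; have s1 (y : R) := sin_max y.
have sc := bnd _ _ _ (sf ord0) (fun k : int => c1 (k%:~R * g ord0)).
have ss := bnd _ _ _ (sf ord0) (fun k : int => s1 (k%:~R * g ord0)).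
have sc' := bnd _ _ _ sw (fun k => c1 (a' k)).
have ss' := bnd _ _ _ sw (fun k => s1 (a' k)).
have s0 := ef ord0.
have [p1 q1] := tsum_prod sc sc'; have [p2 q2] := tsum_prod ss ss'.
have [p3 q3] := tsum_prod sc ss'; have [p4 q4] := tsum_prod ss sc'.
split.
- apply/(tsm_reindex _ (fcons_bij n)).
  by apply: eq_tsm (tsum_prod (sf ord0) sw).1 => z _; exact: wE.
- rewrite (tsum_reindex _ (fcons_bij n)) big_ord_recl -[X in _ * X]cw -q1 -[RHS]subr0 -(mulr0 (tsum setT (fun k : int => f ord0 k * sin (k%:~R * g ord0)))) -nw -q2 -tsumB//.
  by apply: eq_tsum => z _; rewrite wE aE cosD; ring.
have <- : tsum setT (fun k : int => f ord0 k * cos (k%:~R * g ord0)) * tsum setT (fun m => w' m * sin (a' m)) +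
    tsum setT (fun k : int => f ord0 k * sin (k%:~R * g ord0)) * tsum setT (fun m => w' m * cos (a' m)) = 0.
  by rewrite s0 mul0r addr0 [X in _ * X]nw mulr0.
rewrite (tsum_reindex _ (fcons_bij n)) -q3 -q4 -tsumD//.
by apply: eq_tsum => z _; rewrite wE aE sinD; ring.
Qed.

Lemma tsum_cover (T : choiceType) (I : eqType) (A : set T) (s : seq I) (B : I -> set T) (f : T -> R) :
  uniq s -> (forall c, c \in s -> B c `<=` A) ->
  (forall x, A x -> exists2 c, c \in s & B c x) ->
  (forall x c d, c \in s -> d \in s -> B c x -> B d x -> c = d) ->
  (forall c, c \in s -> tsm (B c) f) ->
  tsm A f /\ tsum A f = \sum_(c <- s) tsum (B c) f.
Proof.
move=> us BA cov dis sB.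
have key c : c \in s -> tsm A (fun x => if x \in B c then f x else 0) /\
    tsum A (fun x => if x \in B c then f x else 0) = tsum (B c) f.
  move=> cs.
  have e x : (if x \in A then if x \in B c then f x else 0 else 0) = if x \in B c then f x else 0.
    by case: ifPn => // /negP; rewrite inE => nA; case: ifPn => //; rewrite inE => /(BA _ cs).
  split; first by apply/tsm_mkcond; apply: eq_tsm (proj1 (tsm_mkcond _ _) (sB _ cs)) => x _; rewrite e.
  by rewrite tsum_mkcond [RHS]tsum_mkcond; apply: eq_tsum => x _; rewrite e.
have fE x : A x -> f x = \sum_(c <- s | c \in s) (if x \in B c then f x else 0).
  move=> Ax; have [c cs Bc] := cov x Ax.
  rewrite -big_seq (bigD1_seq c)//= ifT ?inE// big1_seq ?addr0// => d /andP[dc ds].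
  by rewrite ifF//; apply/negP; rewrite inE => Bd; move/eqP: dc; apply; exact: dis Bd Bc.
have [s1 e1] := @tsum_sum R T I s (fun c => c \in s) A (fun c x => if x \in B c then f x else 0) (fun c cs => (key c cs).1).
split; first by apply: eq_tsm s1.
by rewrite (eq_tsum fE) e1 [RHS]big_seq; apply: eq_bigr => c cs; exact: (key c cs).2.
Qed.

End ProductSums.

Section InnerProduct.
Context {R : realType} {n : nat}.
Implicit Types (x y z : 'cV[R]_n) (c : R).

Lemma dotpC x y : dotp x y = dotp y x.
Proof. by apply: eq_bigr => i _; rewrite mulrC. Qed.
Lemma dotpDl x y z : dotp (x + y) z = dotp x z + dotp y z.
Proof. by rewrite /dotp -big_split; apply: eq_bigr => i _; rewrite mxE mulrDl. Qed.
Lemma dotpDr x y z : dotp z (x + y) = dotp z x + dotp z y.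
Proof. by rewrite dotpC dotpDl !(dotpC z). Qed.
Lemma dotpZl c x y : dotp (c *: x) y = c * dotp x y.
Proof. by rewrite /dotp mulr_sumr; apply: eq_bigr => i _; rewrite mxE mulrA. Qed.
Lemma dotpZr c x y : dotp y (c *: x) = c * dotp y x.
Proof. by rewrite dotpC dotpZl dotpC. Qed.
Lemma dotpNl x y : dotp (- x) y = - dotp x y.
Proof. by rewrite -scaleN1r dotpZl mulN1r. Qed.
Lemma dotpNr x y : dotp y (- x) = - dotp y x.
Proof. by rewrite dotpC dotpNl dotpC. Qed.
Lemma dotpBl x y z : dotp (x - y) z = dotp x z - dotp y z.
Proof. by rewrite dotpDl dotpNl. Qed.
Lemma dotpBr x y z : dotp z (x - y) = dotp z x - dotp z y.
Proof. by rewrite dotpDr dotpNr. Qed.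
Lemma dotp0l x : dotp 0 x = 0.
Proof. by rewrite -(scale0r x) dotpZl mul0r. Qed.
Lemma dotp0r x : dotp x 0 = 0.
Proof. by rewrite dotpC dotp0l. Qed.
Lemma dotp_suml (I : Type) (r : seq I) (P : pred I) (F : I -> 'cV[R]_n) x :
  dotp (\sum_(i <- r | P i) F i) x = \sum_(i <- r | P i) dotp (F i) x.
Proof. by elim/big_rec2: _ => [|i a b _ <-]; rewrite ?dotp0l ?dotpDl. Qed.
Lemma dotp_sumr (I : Type) (r : seq I) (P : pred I) (F : I -> 'cV[R]_n) x :
  dotp x (\sum_(i <- r | P i) F i) = \sum_(i <- r | P i) dotp x (F i).
Proof. by rewrite dotpC dotp_suml; apply: eq_bigr => i _; rewrite dotpC. Qed.
Lemma dotp_ge0 x : 0 <= dotp x x.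
Proof. by apply: sumr_ge0 => i _; rewrite -expr2 sqr_ge0. Qed.
Lemma dotp_eq0 x : (dotp x x == 0) = (x == 0).
Proof.
apply/eqP/eqP => [|->]; last by rewrite dotp0l.
move/eqP; rewrite psumr_eq0; last by move=> i _; rewrite -expr2 sqr_ge0.
move/allP => h; apply/matrixP => i j; rewrite ord1 mxE.
by have := h i (mem_index_enum i); rewrite -expr2 sqrf_eq0 => /eqP.
Qed.
Lemma dotp_gt0 x : (0 < dotp x x) = (x != 0).
Proof. by rewrite lt_def dotp_eq0 dotp_ge0 andbT. Qed.
Lemma dotp_subrr x y : dotp (x - y) (x - y) = dotp x x - 2 * dotp x y + dotp y y.
Proof. by rewrite dotpBl !dotpBr (dotpC y x); ring. Qed.
Lemma dotp_addrr x y : dotp (x + y) (x + y) = dotp x x + 2 * dotp x y + dotp y y.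
Proof. by rewrite dotpDl !dotpDr (dotpC y x); ring. Qed.
(** Orthogonal but not normalized, so that the vectors can be chosen in the lattice. *)
Definition frame (b : 'I_n -> 'cV[R]_n) : Prop :=
  (forall i j, i != j -> dotp (b i) (b j) = 0) /\ (forall i, b i != 0).

Lemma frame_expand (b : 'I_n -> 'cV[R]_n) x : frame b ->
  x = \sum_i (dotp x (b i) / dotp (b i) (b i)) *: b i.
Proof.
move=> [ob nb]; pose B := \matrix_(i, j) b j i 0 : 'M[R]_n.
pose D := diag_mx (\row_j (dotp (b j) (b j))^-1) : 'M[R]_n.
have e : D *m B^T *m B = 1%:M.
  apply/matrixP => i j; rewrite -mulmxA mul_diag_mx !mxE.
  have -> : \sum_k B^T i k * B k j = dotp (b i) (b j).
    by apply: eq_bigr => k _; rewrite !mxE.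
  have [<-|ij] := eqVneq i j; last by rewrite (ob _ _ ij) mulr0.
  by rewrite mulVf// dotp_eq0.
have {}e := mulmx1C e.
rewrite -[LHS]mul1mx -e -!mulmxA; apply/matrixP => i k; rewrite ord1 !mxE summxE.
apply: eq_bigr => j _; rewrite mul_diag_mx !mxE mulrC; congr (_ * _).
by rewrite mulrC; congr (_ / _); apply: eq_bigr => l _; rewrite !mxE mulrC.
Qed.

Lemma frame_dotp (b : 'I_n -> 'cV[R]_n) x y : frame b ->
  dotp x y = \sum_i dotp x (b i) * dotp y (b i) / dotp (b i) (b i).
Proof.
move=> fb; rewrite {1}(frame_expand x fb) dotp_suml; apply: eq_bigr => i _.
by rewrite dotpZl (dotpC (b i)); ring.
Qed.
End InnerProduct.

Lemma cos_2pi_eq1 {R : realType} (z : R) : cos (2 * pi * z) = 1 -> z \is a Num.int.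
Proof.
move=> c1; have /andP[f0 f1] := floor_itv z.
pose f := z - (Num.floor z)%:~R.
have cf : cos (2 * pi * f) = 1.
  by rewrite -[RHS]c1 -[RHS](cos_sub_2pi_int _ (Num.floor z)) /f; congr cos; ring.
have [f00|fn0] := eqVneq f 0.
  by rewrite intrEfloor; move/eqP: f00; rewrite subr_eq0 eq_sym.
have fp : 0 < f by rewrite lt_def fn0 subr_ge0.
have fl : f < 1 by rewrite ltrBlDl; move: f1; rewrite intrD addrC.
have p2 : (0 : R) < 2 * pi by rewrite mulr_gt0 ?pi_gt0.
have := @cos_eq1 R (2 * pi * f).
by rewrite cf eqxx mulr_gt0//= gtr_pMr// fl => /(_ isT).
Qed.

(** * Cosets of an orthogonal sublattice and their characters *)

Section LatticeTheta.
Context {R : realType} {n : nat}.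
Variables (L : set 'cV[R]_n) (b : 'I_n -> 'cV[R]_n).
Hypotheses (L0 : L 0) (LB : forall x y, L x -> L y -> L (x - y)) (Lu : unimodular L)
  (Lb : forall i, L (b i)) (fb : frame b).
Implicit Types (x y c : 'cV[R]_n) (m k : {ffun 'I_n -> int}) (t : 'I_n -> R).

Let N i := dotp (b i) (b i).
Let N0 i : 0 < N i. Proof. by rewrite dotp_gt0; exact: fb.2. Qed.
Let Nn0 i : N i != 0. Proof. by rewrite gt_eqF. Qed.

Lemma latticeN x : L x -> L (- x). Proof. by rewrite -sub0r; exact: LB. Qed.
Lemma latticeD x y : L x -> L y -> L (x + y).
Proof. by move=> Lx Ly; rewrite -[y]opprK; apply: LB => //; exact: latticeN. Qed.
Lemma lattice_sum (I : Type) (r : seq I) (P : pred I) (F : I -> 'cV[R]_n) :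
  (forall i, P i -> L (F i)) -> L (\sum_(i <- r | P i) F i).
Proof. by move=> h; elim/big_ind: _ => //; exact: latticeD. Qed.
Lemma latticeZ (z : int) x : L x -> L (z%:~R *: x).
Proof.
move=> Lx; have key (p : nat) : L (p%:R *: x).
  by elim: p => [|p IH]; rewrite ?scale0r// -natr1 scalerDl scale1r; exact: latticeD.
case: z => p; first by rewrite -pmulrn.
by rewrite NegzE rmorphN/= scaleNr; apply: latticeN; exact: (key p.+1).
Qed.
Lemma lattice_int x y : L x -> L y -> dotp x y \is a Num.int.
Proof. by move=> Lx Ly; move: (Ly); rewrite Lu => /(_ x Lx). Qed.

(** [lin] parametrizes the sublattice spanned by the frame and [dlin] its dual lattice, which
    contains [L] because [L] is integral. *)
Let lin m := \sum_i (m i)%:~R *: b i.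
Let dlin m := \sum_i ((m i)%:~R / N i) *: b i.

Let dotp_lin m i : dotp (lin m) (b i) = (m i)%:~R * N i.
Proof.
rewrite dotp_suml (bigD1 i)//= big1 ?addr0 ?dotpZl// => j ji.
by rewrite dotpZl (fb.1 _ _ ji) mulr0.
Qed.
Let dotp_dlin m i : dotp (dlin m) (b i) = (m i)%:~R.
Proof.
rewrite dotp_suml (bigD1 i)//= big1 ?addr0 ?dotpZl ?divfK// => j ji.
by rewrite dotpZl (fb.1 _ _ ji) mulr0.
Qed.
Let lin_inj : injective lin.
Proof.
move=> m k e; apply/ffunP => i; have := dotp_lin m i; rewrite e dotp_lin => /(mulIf (Nn0 i)).
by move/eqP; rewrite eqr_int => /eqP.
Qed.
Let L_lin m : L (lin m).
Proof. by apply: lattice_sum => i _; exact: latticeZ. Qed.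
Let linB m k : lin m - lin k = lin [ffun i => m i - k i].
Proof. by rewrite /lin -sumrB; apply: eq_bigr => i _; rewrite ffunE intrB scalerBl. Qed.

Let box x := forall i, 0 <= dotp x (b i) < N i.

Let box_uniq x m : box x -> box (x + lin m) -> m = [ffun => 0].
Proof.
move=> bx bxm; apply/ffunP => i; rewrite ffunE.
have /andP[h1 h2] := bx i; have := bxm i; rewrite dotpDl dotp_lin => /andP[h3 h4].
have := N0 i => Ni.
have : m i < 1 by rewrite -(ltr_int R) -(ltr_pM2r Ni) mul1r; lra.
have : -1 < m i by rewrite -(ltr_int R) -(ltr_pM2r Ni) rmorphN/= mulN1r; lra.
by move: (m i) => z; lia.
Qed.

Let red x := x - lin [ffun i => Num.floor (dotp x (b i) / N i)].
Let box_red x : box (red x).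
Proof.
move=> i; rewrite dotpBl dotp_lin ffunE; have := floor_itv (dotp x (b i) / N i).
rewrite intrD ler_pdivlMr// ltr_pdivrMr// mulrDl mul1r => /andP[h1 h2].
by rewrite subr_ge0 h1/= ltrBlDl.
Qed.
Let L_red x : L x -> L (red x). Proof. by move=> Lx; apply: LB. Qed.

(** Representatives of [L] modulo the frame sublattice. Their number is finite because a lattice
    vector is determined by its products with the frame, which are integers and bounded in the
    box. *)
Lemma coset_reps : exists s : seq 'cV[R]_n, uniq s /\ forall x, x \in s <-> L x /\ box x.
Proof.
have [M NM] : exists M : nat, forall i, N i <= M%:R.
  exists (\max_i (Num.trunc (N i)).+1) => i.
  by apply: le_trans (ltW (truncnS_gt (N i))) _; rewrite ler_nat (leq_bigmax i).
have fin : finite_set [set x | L x /\ box x].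
  pose g (m : {ffun 'I_n -> 'I_M.+1}) := dlin [ffun i => (m i)%:Z].
  apply: (@sub_finite_set _ _ (g @` setT)); last exact/finite_image/finite_finset.
  move=> x [Lx bx] /=; have xi i := lattice_int Lx (Lb i).
  exists [ffun i => inord (Num.trunc (dotp x (b i)))] => //.
  rewrite /g [RHS](frame_expand x fb); apply: eq_bigr => i _; congr (_ / _ *: _).
  rewrite !ffunE; have /andP[h1 h2] := bx i.
  have e : (Num.trunc (dotp x (b i)))%:R = dotp x (b i) by apply: truncnK; rewrite natrEint xi.
  rewrite inordK -?pmulrn// ltnS -(ler_nat R) e; exact: le_trans (ltW h2) (NM i).
have /finite_seqP[s es] := fin.
exists (undup s); split=> [|x]; first exact: undup_uniq.
rewrite mem_undup; have := congr1 (fun A : set _ => A x) es => /= h.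
by rewrite h.
Qed.

(** Orthogonality of characters on the finite quotient of [L] by the frame sublattice. By
    unimodularity the character of [dlin m] is trivial exactly when [dlin m] lies in [L]. Otherwise
    translation by some [c0] permutes the cosets and rotates the pair of cosine and sine sums by an
    angle [th] with [cos th != 1], so the pair is zero. *)
Let char_sum (s : seq 'cV[R]_n) m : uniq s -> (forall x, x \in s <-> L x /\ box x) ->
  \sum_(c <- s) cos (2 * pi * dotp (dlin m) c) = if dlin m \in L then (size s)%:R else 0.
Proof.
move=> us sE; pose y := dlin m; case: ifPn => [|/negP]; rewrite inE => Ly.
  rewrite (eq_big_seq (fun=> 1)) => [|c /sE[Lc _]].
    by rewrite big_const_seq count_predT iter_addr_0.
  have /floorK <- := lattice_int Ly Lc.
  by rewrite -[LHS](cos_sub_2pi_int _ (Num.floor (dotp y c))) subrr cos0.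
have [c0 Lc0 nc0] : exists2 c0, L c0 & dotp c0 y \isn't a Num.int.
  apply: contrapT => h; apply: Ly; rewrite Lu => x Lx; apply: contrapT => nx.
  by apply: h; exists x => //; exact/negP.
pose sg c := red (c + c0).
have sgs c : c \in s -> sg c \in s.
  by move=> /sE[Lc _]; apply/sE; split; [apply: L_red; exact: latticeD | exact: box_red].
have sgi : {in s &, injective sg}.
  move=> c d /sE[Lc bc] /sE[Ld bd]; rewrite /sg /red.
  set p := [ffun i => _]; set q := [ffun i => _] => e.
  have {}e : c = d + lin [ffun i => p i - q i].
    by rewrite -linB; apply: (addIr (c0 - lin p)); rewrite addrA e -/q; rewrite !addrA; apply/matrixP => i j; rewrite !mxE; ring.
  move: bc; rewrite {1}e => /(box_uniq bd) z; rewrite e z.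
  rewrite /lin big1 ?addr0// => i _; rewrite ffunE scale0r//.
have ps : perm_eq s [seq sg c | c <- s].
  rewrite perm_sym; apply: uniq_perm => //; first by rewrite map_inj_in_uniq.
  apply: (uniq_min_size _ _ _).2; rewrite ?map_inj_in_uniq ?size_map//.
  by move=> _ /mapP[c cs ->]; exact: sgs.
have int_lin k : dotp y (lin k) \is a Num.int.
  by rewrite dotp_sumr; apply: rpred_sum => i _; rewrite dotpZr /y dotp_dlin rpredM ?intr_int.
pose th := 2 * pi * dotp y c0.
have sh c : [/\ cos (2 * pi * dotp y (sg c)) = cos (2 * pi * dotp y c + th)
               & sin (2 * pi * dotp y (sg c)) = sin (2 * pi * dotp y c + th)].
  have /floorK e := int_lin [ffun i => Num.floor (dotp (c + c0) (b i) / N i)].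
  rewrite dotpBr -e dotpDr; move: (Num.floor _) => z.
  have -> : 2 * pi * (dotp y c + dotp y c0 - z%:~R) = (2 * pi * dotp y c + th) - 2 * pi * z%:~R.
    by rewrite /th; ring.
  split; first exact: cos_sub_2pi_int.
  by rewrite -!cosBpihalf addrAC cos_sub_2pi_int.
pose S := \sum_(c <- s) cos (2 * pi * dotp y c); pose T := \sum_(c <- s) sin (2 * pi * dotp y c).
have eS : S = S * cos th - T * sin th.
  rewrite {1}/S (perm_big _ ps) big_map /S /T !mulr_suml -sumrB.
  by apply: eq_bigr => c _; rewrite (sh c).1 cosD.
have eT : T = T * cos th + S * sin th.
  rewrite {1}/T (perm_big _ ps) big_map /S /T !mulr_suml -big_split/=.
  by apply: eq_bigr => c _; rewrite (sh c).2 sinD.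
have c1 : cos th != 1.
  by apply: contra nc0 => /eqP/cos_2pi_eq1; rewrite dotpC.
have e0 : (1 - cos th) * (S ^+ 2 + T ^+ 2) = 0.
  move: eS eT; move: S T (cos th) (sin th) => S T p q eS eT.
  have -> : (1 - p) * (S ^+ 2 + T ^+ 2) = S * (S - (S * p - T * q)) + T * (T - (T * p + S * q)) by ring.
  by rewrite -eS -eT !subrr !mulr0 addr0.
move/eqP: e0; rewrite mulf_eq0 subr_eq0 eq_sym (negbTE c1)/= paddr_eq0 ?sqr_ge0// sqrf_eq0.
by move=> /andP[/eqP].
Qed.

(** One scale per axis, so that the theta series can be differentiated along a single axis; equal
    scales [t] give [t * dotp x x]. *)
Definition qform t x : R := \sum_i t i * (dotp x (b i) ^+ 2 / dotp (b i) (b i)).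

Let coset c := [set x | exists m, x = c + lin m].

Let coset_bij c : set_bij setT (coset c) (fun m => c + lin m).
Proof.
split=> [m _|m k _ _ /addrI/lin_inj//|x [m ->]]; first by exists m.
by exists m.
Qed.

(** On a coset the form splits into squares of shifted integers [g i + m i], and [theta_inversion]
    on each axis turns the shift into the character of [dlin m]. *)
Let coset_sum t c : (forall i, 0 < t i) ->
  let w m := \prod_i expR (- (pi / (t i * N i) * (m i)%:~R ^+ 2)) in
  [/\ tsm (coset c) (fun x => expR (- (pi * qform t x))),
      tsm setT w &
  tsum (coset c) (fun x => expR (- (pi * qform t x))) =
  \prod_i (Num.sqrt (t i * N i))^-1 * tsum setT (fun m => w m * cos (2 * pi * dotp (dlin m) c))].
Proof.
move=> t0 w; have tN i : 0 < t i * N i by rewrite mulr_gt0.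
pose g i := dotp c (b i) / N i.
have fE m : expR (- (pi * qform t (c + lin m))) = \prod_i expR (- (pi * (t i * N i) * (g i + (m i)%:~R) ^+ 2)).
  rewrite -expR_sum; congr expR; rewrite -mulrN /qform -sumrN mulr_sumr; apply: eq_bigr => i _.
  rewrite dotpDl dotp_lin -/(N i) /g; move: (Nn0 i) (dotp c (b i)) ((m i)%:~R : R) => h u v; field; exact: h.
have sf i : tsm setT (fun k : int => expR (- (pi * (t i * N i) * (g i + k%:~R) ^+ 2))).
  by apply: tsm_gauss_int; rewrite mulr_gt0 ?pi_gt0.
have zs i : tsum setT (fun l : int => expR (- (pi * (t i * N i) * (g i + l%:~R) ^+ 2)) * sin (l%:~R * 0)) = 0.
  by rewrite -[RHS](@tsum0 R _ [set: int]); apply: eq_tsum => l _; rewrite mulr0 sin0 mulr0.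
have [s1 e1 _] := tsum_cos_prod sf zs.
have sw i : tsm setT (fun l : int => expR (- (pi / (t i * N i) * l%:~R ^+ 2))).
  have h := @tsm_gauss_int R (pi / (t i * N i)) 0; apply: eq_tsm (h _) => [l _|]; first by rewrite add0r.
  by rewrite divr_gt0 ?pi_gt0.
have zw i : tsum setT (fun l : int => expR (- (pi / (t i * N i) * l%:~R ^+ 2)) * sin (l%:~R * (2 * pi * g i))) = 0.
  by apply: tsum_even_sin => l; rewrite rmorphN/= sqrrN.
have [s2 e2 _] := tsum_cos_prod sw zw.
split => //.
  by apply/(tsm_reindex _ (coset_bij c)); apply: eq_tsm s1 => m _; exact: fE.
rewrite (tsum_reindex _ (coset_bij c)) (eq_tsum (fun m _ => fE m)).
transitivity (tsum setT (fun m => \prod_i expR (- (pi * (t i * N i) * (g i + (m i)%:~R) ^+ 2)) * cos (\sum_i (m i)%:~R * (0 : R)))).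
  by apply: eq_tsum => m _; rewrite [X in cos X]big1 ?cos0 ?mulr1// => i _; rewrite mulr0.
rewrite e1; transitivity (\prod_i ((Num.sqrt (t i * N i))^-1 * tsum setT (fun l : int => expR (- (pi / (t i * N i) * l%:~R ^+ 2)) * cos (l%:~R * (2 * pi * g i))))).
  apply: eq_bigr => i _.
  rewrite (eq_tsum (g := fun k : int => expR (- (pi * (t i * N i) * (g i + k%:~R) ^+ 2)))); last first.
    by move=> k _; rewrite mulr0 cos0 mulr1.
  rewrite theta_inversion//; congr (_ * _); apply: eq_tsum => k _; congr (_ * cos _); ring.
rewrite big_split/= -e2; congr (_ * _); apply: eq_tsum => m _; congr (_ * cos _).
rewrite dotp_suml mulr_sumr; apply: eq_bigr => i _; rewrite dotpZl /g (dotpC (b i)).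
by ring.
Qed.

Let dlin_bij : set_bij L [set m | L (dlin m)] (fun x => [ffun i => Num.floor (dotp x (b i))]).
Proof.
have e x : L x -> dlin [ffun i => Num.floor (dotp x (b i))] = x.
  move=> Lx; rewrite [RHS](frame_expand x fb); apply: eq_bigr => i _.
  by rewrite ffunE floorK// lattice_int.
split=> [x Lx|x y /set_mem Lx /set_mem Ly h|m Lm].
- by rewrite /= e.
- by rewrite -(e x Lx) h e.
exists (dlin m) => //; apply/ffunP => i; rewrite ffunE dotp_dlin; exact: intrKfloor.
Qed.

(** Inverting every coset and adding, the character sums restrict the dual sum to the vectors
    [dlin m] in [L], that is, to [L] itself. *)
Lemma lattice_theta t : (forall i, 0 < t i) ->
  tsm L (fun x => expR (- (pi * qform t x))) /\
  tsum L (fun x => expR (- (pi * qform t x))) =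
  \prod_i (Num.sqrt (t i))^-1 * tsum L (fun x => expR (- (pi * qform (fun i => (t i)^-1) x))).
Proof.
have [s [us sE]] := coset_reps.
pose K := (\prod_i (Num.sqrt (N i))^-1) * (size s)%:R.
pose Th t := tsum L (fun x => expR (- (pi * qform t x))).
have key u : (forall i, 0 < u i) -> tsm L (fun x => expR (- (pi * qform u x))) /\
    Th u = K * (\prod_i (Num.sqrt (u i))^-1 * Th (fun i => (u i)^-1)).
  move=> u0; pose w m := \prod_i expR (- (pi / (u i * N i) * (m i)%:~R ^+ 2)).
  have cs c := coset_sum c u0.
  have sw : tsm setT w by have [] := cs 0.
  have [sL eL] : tsm L (fun x => expR (- (pi * qform u x))) /\
      Th u = \sum_(c <- s) tsum (coset c) (fun x => expR (- (pi * qform u x))).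
    apply: tsum_cover => // [c cs' _ [m ->]|x Lx|x c d /sE[_ bc] /sE[_ bd] [m xm] [k xk]|c _].
    - by apply: latticeD (L_lin m); have /sE[] := cs'.
    - exists (red x); first by apply/sE; split; [exact: L_red | exact: box_red].
      by exists [ffun i => Num.floor (dotp x (b i) / N i)]; rewrite subrK.
    - have e : c = d + lin [ffun i => k i - m i] by rewrite -linB addrA -xk xm addrK.
      move: bc; rewrite {1}e => /(box_uniq bd) z; rewrite e z /lin big1 ?addr0// => i _.
      by rewrite ffunE scale0r.
    - by have [] := cs c.
  split => //; rewrite eL.
  rewrite (eq_bigr (fun c => \prod_i (Num.sqrt (u i * N i))^-1 * tsum setT (fun m => w m * cos (2 * pi * dotp (dlin m) c)))); last first.
    by move=> c _; have [_ _] := cs c.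
  have bnd c : tsm setT (fun m => w m * cos (2 * pi * dotp (dlin m) c)).
    by apply: tsm_le (tsm_norm sw) => m _; rewrite normrM ler_piMr// cos_max.
  rewrite -mulr_sumr -(tsum_sum _ (fun c _ => bnd c)).2.
  rewrite (eq_tsum (g := fun m => (size s)%:R * (if m \in [set m | L (dlin m)] then w m else 0))); last first.
    move=> m _; rewrite -mulr_sumr char_sum//.
    have -> : (m \in [set m | L (dlin m)]) = (dlin m \in L) by apply/idP/idP; rewrite !inE.
    by case: ifP => _; rewrite ?mulr0// mulrC.
  have sw' : tsm setT (fun m => if m \in [set m | L (dlin m)] then w m else 0).
    by apply: tsm_le (tsm_norm sw) => m _; case: ifP => _; rewrite ?normr0.
  rewrite tsumZ// -tsum_mkcond (tsum_reindex _ dlin_bij).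
  rewrite (eq_tsum (g := fun x => expR (- (pi * qform (fun i => (u i)^-1) x)))); last first.
    move=> x Lx; rewrite /w -expR_sum; congr expR; rewrite -mulrN /qform -sumrN mulr_sumr; apply: eq_bigr => i _.
    rewrite ffunE floorK ?lattice_int// invfM; ring.
  rewrite /K; under eq_bigr => i _ do rewrite sqrtrM ?ltW// invfM.
  rewrite big_split/= /Th -![RHS]mulrA [RHS]mulrC; move: (tsum L _) (\prod_i _) (\prod_i _) => T P1 P2.
  ring.
move=> t0; have [st et] := key t t0; split=> //.
have [s1 e1] := key (fun=> 1) (fun=> ltr01).
(* The index of the sublattice and the norms of the frame enter only through [K], which the case of
   all scales equal to 1 evaluates: there both sides contain the same positive sum. *)
have K1 : K = 1.
  have T1 : Th (fun=> 1) != 0.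
    rewrite gt_eqF//; apply: lt_le_trans (ler_sum_tsum (F := [:: 0]) _ _ _ s1) => //.
      by rewrite big_seq1 expR_gt0.
    by move=> x; rewrite inE => /eqP ->.
  apply: (mulIf T1); rewrite mul1r {2}e1; congr (_ * _).
  rewrite big1 ?mul1r; last by move=> i _; rewrite sqrtr1 invr1.
  by congr Th; apply/funext => i; rewrite invr1.
by rewrite -/(Th t) et K1 mul1r.
Qed.

End LatticeTheta.

(** * Theta series with harmonic coefficients of degree 2 *)

Section HarmonicTheta.
Context {R : realType} {n : nat}.
Variables (L : set 'cV[R]_n) (b : 'I_n -> 'cV[R]_n).
Hypotheses (L0 : L 0) (LB : forall x y, L x -> L y -> L (x - y)) (Lu : unimodular L)
  (Lb : forall i, L (b i)) (fb : frame b).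
Implicit Types (x y : 'cV[R]_n) (t : R) (i j : 'I_n).

Let qc i x := dotp x (b i) ^+ 2 / dotp (b i) (b i).
Let T i (s t : R) k : R := if k == i then s else t.

Let qc_ge0 i x : 0 <= qc i x.
Proof. by rewrite divr_ge0 ?sqr_ge0 ?dotp_ge0. Qed.

Let qform_T i s t x : qform b (T i s t) x = s * qc i x + t * \sum_(k | k != i) qc k x.
Proof.
rewrite /qform (bigD1 i)//= {1}/T eqxx mulr_sumr; congr (_ + _).
by apply: eq_bigr => k ki; rewrite /T (negbTE ki).
Qed.

Let qform_cst t x : qform b (fun=> t) x = t * dotp x x.
Proof.
rewrite (frame_dotp x x fb) mulr_sumr; apply: eq_bigr => k _; by rewrite -expr2.
Qed.

Let T_gt0 i s t : 0 < s -> 0 < t -> forall k, 0 < T i s t k.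
Proof. by move=> s0 t0 k; rewrite /T; case: ifP. Qed.

Let p i t x := expR (- (pi * (t * \sum_(k | k != i) qc k x))).

Let thE i s t x : p i t x * expR (- (s * (pi * qc i x))) = expR (- (pi * qform b (T i s t) x)).
Proof. by rewrite -expRD qform_T; congr expR; ring. Qed.

Let F i t s := tsum L (fun x => p i t x * expR (- (s * (pi * qc i x)))).

Let F_tsm i t s : 0 < t -> 0 < s -> tsm L (fun x => p i t x * expR (- (s * (pi * qc i x)))).
Proof.
move=> t0 s0; have [h _] := lattice_theta L0 LB Lu Lb fb (T_gt0 i s0 t0).
by apply: eq_tsm h => x _; rewrite thE.
Qed.

Let F_inv i t s : 0 < t -> 0 < s ->
  F i t s = (Num.sqrt t)^-1 ^+ n.-1 * ((Num.sqrt s)^-1 * F i t^-1 s^-1).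
Proof.
move=> t0 s0; have [_ h] := lattice_theta L0 LB Lu Lb fb (T_gt0 i s0 t0).
rewrite /F (eq_tsum (fun x _ => thE i s t x)) h (bigD1 i)//= {1}/T eqxx -mulrA mulrCA.
congr (_ * (_ * _)); last first.
  apply: eq_tsum => x _; rewrite thE; congr (expR (- (pi * qform b _ x))).
  by apply/funext => k; rewrite /T; case: ifP.
rewrite (eq_bigr (fun=> (Num.sqrt t)^-1)); last by move=> k ki; rewrite /T (negbTE ki).
rewrite prodr_const; congr (_ ^+ _).
by rewrite cardC1 card_ord.
Qed.

Definition coord_theta i t := tsum L (fun x => dotp x (b i) ^+ 2 / dotp (b i) (b i) * expR (- (pi * t * dotp x x))).

Let p_eq i t x : p i t x * expR (- (t * (pi * qc i x))) = expR (- (pi * t * dotp x x)).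
Proof.
rewrite thE -mulrA -(qform_cst t x); congr (expR (- (pi * qform b _ x))).
by apply/funext => k; rewrite /T; case: ifP.
Qed.

Lemma coord_theta_tsm i t : 0 < t ->
  tsm L (fun x => dotp x (b i) ^+ 2 / dotp (b i) (b i) * expR (- (pi * t * dotp x x))).
Proof.
move=> t0; have := @tsm_laplace R _ L (p i t) (fun x => pi * qc i x).
move=> /(_ (fun x _ => mulr_ge0 (pi_ge0 R) (qc_ge0 i x)) (fun c => F_tsm i t0) t t0) => s1.
apply: eq_tsm (tsmZ pi^-1 s1) => x _.
rewrite -(p_eq i t x) -/(qc i x).
rewrite [RHS](_ : _ = (pi^-1 * pi) * (qc i x * (p i t x * expR (- (t * (pi * qc i x)))))); last by ring.
by rewrite mulVf ?mul1r// gt_eqF ?pi_gt0.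
Qed.

Let G i t s := tsum L (fun x => pi * qc i x * p i t x * expR (- (s * (pi * qc i x)))).

Let F_derive i t (s : R) : 0 < t -> 0 < s -> is_derive s 1 (F i t) (- G i t s).
Proof.
move=> t0 s0; apply: (@laplace_derive R _ L (p i t) (fun x => pi * qc i x)) => // [x _|c c0].
  by rewrite mulr_ge0 ?pi_ge0.
exact: F_tsm.
Qed.

Let G_cst i t : 0 < t -> G i t t = pi * coord_theta i t.
Proof.
move=> t0; rewrite /coord_theta -tsumZ; last exact: coord_theta_tsm.
by apply: eq_tsum => x _; rewrite -mulrA p_eq mulrA.
Qed.

Let F_cst i t : F i t t = tsum L (fun x => expR (- (pi * t * dotp x x))).
Proof. by apply: eq_tsum => x _; rewrite p_eq. Qed.

(** The inversion formula is differentiated in the scale [s] of one axis at [s = t]. The derivative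
    of the prefactor leaves a multiple of the plain theta series that is the same for all axes, so
    it cancels in the difference. The weight is [n / 2 + 2]. *)
Lemma coord_theta_inversion i j t : 0 < t ->
  coord_theta i t^-1 - coord_theta j t^-1 =
  - (Num.sqrt t ^+ (n.+4) * (coord_theta i t - coord_theta j t)).
Proof.
move=> t0; have n0 : (0 < n)%N by case: (n) i => [[]|].
have q0 : 0 < Num.sqrt t by rewrite sqrtr_gt0.
pose K := (Num.sqrt t)^-1 ^+ n.-1.
have key k : - (pi * coord_theta k t) = K * ((- (Num.sqrt t) ^- 2 * (2 * Num.sqrt t)^-1) *
     tsum L (fun x => expR (- (pi * t^-1 * dotp x x))) +
     (Num.sqrt t)^-1 * (t^-1 ^+ 2 * (pi * coord_theta k t^-1))).
  have d1 := F_derive k t0 t0; rewrite G_cst// in d1.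
  have d2 : is_derive t 1 (fun s => (Num.sqrt s)^-1) (- (Num.sqrt t) ^- 2 * (2 * Num.sqrt t)^-1).
    apply: is_deriveV; first by rewrite gt_eqF.
    exact: is_derive1_sqrt.
  have ti : 0 < t^-1 by rewrite invr_gt0.
  have d3 : is_derive t 1 (fun s => F k t^-1 s^-1) (t^-1 ^+ 2 * (pi * coord_theta k t^-1)).
    have := is_derive_inv_comp 0 t0 (fun (u : R) u0 => F_derive k ti u0); rewrite G_cst//.
    rewrite !mul0r oppr0 sub0r mulrN opprK.
    by under eq_fun do rewrite expr0 mul1r.
  have d4 := is_deriveM d2 d3.
  have d5 := is_deriveM (is_derive_cst K t 1) d4.
  have eF : \forall s \near t, K * ((Num.sqrt s)^-1 * F k t^-1 s^-1) = F k t s.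
    near=> s; apply/esym/F_inv => //; near: s; exact: lt_nbhsr.
  have d6 := near_eq_is_derive eF d5.
  have := @derive_val _ _ _ _ _ _ _ d1; rewrite (@derive_val _ _ _ _ _ _ _ d6) => <-.
  rewrite scaler0 addr0 /cst /= -/K -[_ *: (_ + _)]/(_ * _); congr (_ * _).
  rewrite -[_ *: _]/(_ * _) -[in RHS](F_cst k) addrC; congr (_ + _).
  by rewrite -[_ *: _]/(_ * _) mulrC.
have e := congr2 (fun u v => u - v) (key i) (key j); move: e.
have tE : t = Num.sqrt t ^+ 2 by rewrite sqr_sqrtr// ltW.
have K0 : Num.sqrt t ^+ n.-1 * K = 1 by rewrite /K exprVn divff// expf_neq0// gt_eqF.
(* The other axes contribute [n.-1] powers of [Num.sqrt t], and the distinguished one contributes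
   five: one from its prefactor, four from [t^-1 ^+ 2]. *)
rewrite (_ : n.+4 = 5 + n.-1)%N ?exprD; last by lia.
have p0 : (pi : R) != 0 by rewrite gt_eqF ?pi_gt0.
move: (coord_theta i t) (coord_theta j t) (coord_theta i t^-1) (coord_theta j t^-1) => A B A' B'.
clearbody K; move: (- _ ^- 2 / _ * _) => D; move: (Num.sqrt t) tE q0 K0 => q -> q0 K0 e.
have {}e : - (A - B) = K * (q^-1 * ((q ^+ 2)^-1 ^+ 2 * (A' - B'))).
  apply: (mulfI p0); rewrite mulrN mulrBr opprB addrC -[RHS](_ : K * (D + q^-1 * ((q ^+ 2)^-1 ^+ 2 * (pi * A'))) - K * (D + q^-1 * ((q ^+ 2)^-1 ^+ 2 * (pi * B'))) = _).
    by rewrite -e; ring.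
  by ring.
rewrite -mulrN e [RHS](_ : _ = (q ^+ n.-1 * K) * (q ^+ 5 * (q^-1 * ((q ^+ 2)^-1 ^+ 2 * (A' - B'))))); last by ring.
rewrite K0 mul1r.
by field; rewrite gt_eqF.
Unshelve. all: by end_near.
Qed.

Hypothesis Le : even_lattice L.

Lemma shell_partition : L = \bigcup_k shell L (2 * k%:R) /\ trivIset setT (fun k : nat => shell L (2 * k%:R)).
Proof.
split; last first.
  move=> k l _ _ [x [[_ e1] [_ e2]]]; apply/eqP; rewrite -(eqr_nat R); apply/eqP.
  by apply: (mulfI (x := 2 : R)); rewrite -?e1.
apply/seteqP; split=> [x Lx|x [k _ []]//].
have [k e] := Le Lx; exists `|k|%N => //; split => //; rewrite e.
have : 0 <= (k *+ 2)%:~R :> R by rewrite -e dotp_ge0.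
rewrite ler0z => k0; rewrite mulr2n intrD -mulr2n mulr_natl; congr (_ *+ 2).
by rewrite pmulrn; congr (_ %:~R); lia.
Qed.

Let shc i k := tsum (shell L (2 * k%:R)) (qc i).

Let shell_tsm i (k : nat) : tsm (shell L (2 * k%:R)) (qc i).
Proof.
have s1 : tsm (shell L (2 * k%:R)) (fun x => qc i x * expR (- (pi * 1 * dotp x x))).
  by apply: sub_tsm (coord_theta_tsm i ltr01) => x [].
apply: eq_tsm (tsmZ (expR (pi * 1 * (2 * k%:R))) s1) => x [_ e].
by rewrite e mulrCA -expRD addrN expR0 mulr1.
Qed.

Let coord_shells i t : 0 < t ->
  tsm setT (fun k : nat => shc i k * expR (- (2 * pi * k%:R * t))) /\
  tsum setT (fun k : nat => shc i k * expR (- (2 * pi * k%:R * t))) = coord_theta i t.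
Proof.
move=> t0; have [e tr] := shell_partition.
have h0 x : L x -> 0 <= qc i x * expR (- (pi * t * dotp x x)).
  by move=> _; rewrite mulr_ge0 ?expR_ge0.
have [s1 e1] := psum_partition e tr h0 (coord_theta_tsm i t0).
have shE k : tsum (shell L (2 * k%:R)) (fun x => qc i x * expR (- (pi * t * dotp x x))) =
    shc i k * expR (- (2 * pi * k%:R * t)).
  rewrite [RHS]mulrC /shc -tsumZ; last exact: shell_tsm.
  apply: eq_tsum => x [_ ->]; rewrite [RHS]mulrC; congr (_ * expR (- _)); ring.
split; first by apply: eq_tsm s1 => k _; rewrite shE.
by rewrite -[RHS]e1; apply: eq_tsum => k _; rewrite shE.
Qed.

(** The differences of the shell sums are the coefficients of a series of weight 14 for [n = 24];
    its constant term vanishes because the shell of norm 0 contains only the origin. *)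
Lemma shell_coord_eq (n24 : n = 24%N) i j (k : nat) :
  tsum (shell L (2 * k%:R)) (fun x => dotp x (b i) ^+ 2 / dotp (b i) (b i)) =
  tsum (shell L (2 * k%:R)) (fun x => dotp x (b j) ^+ 2 / dotp (b j) (b j)).
Proof.
pose a k := shc i k - shc j k; suff : a k = 0 by move/eqP; rewrite subr_eq0 => /eqP.
have sa (t : R) : 0 < t -> tsm setT (fun n : nat => a n * expR (- (2 * pi * n%:R * t))).
  move=> t0; apply: eq_tsm (tsmB (coord_shells i t0).1 (coord_shells j t0).1) => l _.
  by rewrite mulrBl.
have qa (t : R) : 0 < t -> qr a t = coord_theta i t - coord_theta j t.
  move=> t0; rewrite -(coord_shells i t0).2 -(coord_shells j t0).2 -tsumB; [|exact: (coord_shells _ t0).1..].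
  by apply: eq_tsum => l _; rewrite mulrBl.
apply: weight14_vanish => // [|t t0].
  have z l : shc l 0%N = 0.
    rewrite /shc -[RHS](@tsum0 R _ (shell L (2 * 0%:R))); apply: eq_tsum => x [_ e].
    move/eqP: e; rewrite mulr0 dotp_eq0 => /eqP ->.
    by rewrite /qc dotp0l expr0n mul0r.
  by rewrite /a !z subrr.
rewrite !qa ?invr_gt0// coord_theta_inversion//; congr (- (_ * _)).
by rewrite n24 -[28%N]/(2 * 14)%N exprM sqr_sqrtr// ltW.
Qed.

Lemma shell_coord_tsm i (k : nat) :
  tsm (shell L (2 * k%:R)) (fun x => dotp x (b i) ^+ 2 / dotp (b i) (b i)).
Proof. exact: shell_tsm. Qed.

Lemma coord_theta_eq (n24 : n = 24%N) i j t : 0 < t -> coord_theta i t = coord_theta j t.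
Proof.
move=> t0; rewrite -(coord_shells i t0).2 -(coord_shells j t0).2; apply: eq_tsum => k _.
by congr (_ * _); exact: shell_coord_eq.
Qed.

Lemma gauss_tsm t : 0 < t -> tsm L (fun x => expR (- (pi * t * dotp x x))).
Proof.
move=> t0; have [h _] := lattice_theta L0 LB Lu Lb fb (fun _ => t0).
by apply: eq_tsm h => x _; rewrite -mulrA -(qform_cst t x).
Qed.

End HarmonicTheta.

(** * Frames in the lattice and the design property *)
Section Frames.
Context {R : realType} {n : nat}.
Variable L : set 'cV[R]_n.
Hypotheses (L0 : L 0) (LB : forall x y, L x -> L y -> L (x - y)) (Lu : unimodular L).
Variable B : 'M[R]_n.
Hypotheses (uB : B \in unitmx) (LBj : forall j, L (col j B)).
Implicit Types (x y z : 'cV[R]_n).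

Lemma basis_expand y : y = \sum_j (invmx B *m y) j 0 *: col j B.
Proof.
rewrite -[LHS](mulKVmx uB); apply/matrixP => i k; rewrite ord1 !mxE summxE.
by apply: eq_bigr => j _; rewrite !mxE mulrC.
Qed.

Lemma dotp_col y : (forall j, dotp (col j B) y = 0) -> y = 0.
Proof.
move=> h; apply/eqP; rewrite -dotp_eq0 {1}(basis_expand y) dotp_suml big1// => j _.
by rewrite dotpZl h mulr0.
Qed.

Lemma orthogonal_vector m (b : 'I_m -> 'cV[R]_n) : (m < n)%N ->
  exists2 v, v != 0 & forall i, dotp (b i) v = 0.
Proof.
move=> mn; pose M := \matrix_(i < n, j < m) b j i 0 : 'M[R]_(n, m).
have : kermx M != 0 by rewrite -mxrank_eq0 mxrank_ker -lt0n subn_gt0 (leq_ltn_trans (rank_leq_col M)).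
rewrite -nz_row_eq0 => v0; exists (nz_row (kermx M))^T; first by rewrite trmx_eq0.
move=> i; have /sub_kermxP := nz_row_sub (kermx M).
move=> /matrixP/(_ 0 i); rewrite !mxE => <-.
by apply: eq_bigr => j _; rewrite !mxE mulrC.
Qed.

(** A Gram-Schmidt step with denominators cleared: multiplying by the product [M] of the norms, an
    integer, keeps the vector in [L]. It is nonzero because its product with [v], orthogonal to all
    [b i], is nonzero. *)
Lemma frame_extend m (b : 'I_m -> 'cV[R]_n) : (m < n)%N -> (forall i, L (b i)) ->
  (forall i j, i != j -> dotp (b i) (b j) = 0) -> (forall i, b i != 0) ->
  exists w, [/\ L w, w != 0 & forall i, dotp w (b i) = 0].
Proof.
move=> mn Lb ob b0; have [v v0 bv] := orthogonal_vector b mn.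
have [j Bv] : exists j, dotp (col j B) v != 0.
  apply: contrapT => h; move/eqP: v0; apply; apply: dotp_col => j.
  by apply/eqP; apply: contrapT => /negP h2; apply: h; exists j.
pose N i := dotp (b i) (b i); pose N' i := \prod_(k | k != i) N k.
have Nint i : N i \is a Num.int by exact: (lattice_int Lu).
have N'int i : N' i \is a Num.int by apply: rpred_prod => k _.
have Lz (c : R) x : c \is a Num.int -> L x -> L (c *: x).
  by move=> /floorK <-; exact: latticeZ.
pose M := \prod_i N i.
have NM i : N' i * N i = M by rewrite /M (bigD1 i)//= mulrC.
exists (M *: col j B - \sum_i (dotp (col j B) (b i) * N' i) *: b i); split.
- apply: LB; first by apply: Lz => //; apply: rpred_prod => k _.
  by apply: lattice_sum => // i _; apply: Lz => //; rewrite rpredM// (lattice_int Lu).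
- apply: contraNneq Bv => e; have := congr1 (fun w => dotp w v) e.
  rewrite dotpBl dotpZl dotp0l dotp_suml big1 ?subr0; last first.
    by move=> i _; rewrite dotpZl bv mulr0.
  move/eqP; rewrite mulf_eq0 => /orP[|//].
  by rewrite prodf_seq_eq0 => /hasP[i _]; rewrite dotp_eq0 (negbTE (b0 i)).
move=> i; rewrite dotpBl dotpZl dotp_suml (bigD1 i)//= big1 ?addr0.
  by rewrite dotpZl -mulrA NM mulrC subrr.
by move=> k ki; rewrite dotpZl ob ?mulr0.
Qed.

Lemma frame_through z : L z -> z != 0 ->
  exists b : 'I_n -> 'cV[R]_n, [/\ frame b, forall i, L (b i) & exists i, b i = z].
Proof.
move=> Lz z0.
have n0 : (0 < n)%N.
  case: (n) z z0 {Lz} => // z; rewrite -dotp_eq0 /dotp big_ord0 eqxx//.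
suff key m : (0 < m <= n)%N -> exists b : nat -> 'cV[R]_n,
    [/\ b 0%N = z, forall i, (i < m)%N -> L (b i), forall i, (i < m)%N -> b i != 0
      & forall i j, (i < m)%N -> (j < m)%N -> i != j -> dotp (b i) (b j) = 0].
  have [|b [bz Lb b0 ob]] := key n; first by rewrite n0 leqnn.
  exists (fun i => b i); split=> [|i|]; [split=> [i j ij|i]|exact: Lb|].
  - by apply: ob => //; rewrite ?ltn_ord.
  - exact: b0.
  - by exists (Ordinal n0).
elim: m => [//|m IH] /andP[_ mn].
have [m0|m0] := posnP m.
  exists (fun=> z); rewrite m0; split=> // i j; rewrite !ltnS !leqn0 => /eqP -> /eqP ->.
  by rewrite eqxx.
have [|b [bz Lb b0 ob]] := IH; first by rewrite m0 ltnW.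
have [|i|i j ij|i|w [Lw w0 ow]] := @frame_extend m (fun i => b i).
- exact: mn.
- exact: Lb.
- exact: ob.
- exact: b0.
exists (fun i => if i == m then w else b i); split=> [|i|i|i j].
- by rewrite ifF// eq_sym; apply/negbTE; rewrite -lt0n.
- by rewrite ltnS leq_eqVlt; case: eqVneq => //= _; exact: Lb.
- by rewrite ltnS leq_eqVlt; case: eqVneq => //= _; exact: b0.
have h l : (l < m.+1)%N -> l = m \/ (l < m)%N by lia.
move=> /h[->|ilt] /h[->|jlt]; rewrite ?eqxx ?(ltn_eqF ilt) ?(ltn_eqF jlt)//.
- by move=> _; exact: (ow (Ordinal jlt)).
- by move=> _; rewrite dotpC; exact: (ow (Ordinal ilt)).
- exact: ob.
Qed.

Lemma cauchy_schwarz x y : dotp x y ^+ 2 <= dotp x x * dotp y y.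
Proof.
have [->|y0] := eqVneq y 0; first by rewrite !dotp0r expr0n mulr0.
have yy : 0 < dotp y y by rewrite dotp_gt0.
have := dotp_ge0 (dotp y y *: x - dotp x y *: y).
rewrite dotp_subrr !dotpZl !dotpZr => h.
rewrite -(ler_pM2l yy); move: h; rewrite expr2; nra.
Qed.

Variables (A : set 'cV[R]_n) (w : 'cV[R]_n -> R).
Hypothesis w0 : forall x, 0 <= w x.
Hypothesis wA : forall b : 'I_n -> 'cV[R]_n, frame b -> (forall i, L (b i)) ->
  (forall i, tsm A (fun x => dotp x (b i) ^+ 2 / dotp (b i) (b i) * w x)) /\
  (forall i j, tsum A (fun x => dotp x (b i) ^+ 2 / dotp (b i) (b i) * w x) =
               tsum A (fun x => dotp x (b j) ^+ 2 / dotp (b j) (b j) * w x)).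
Hypothesis n0 : (0 < n)%N.

Lemma design_tsm y z : tsm A (fun x => dotp x y * dotp x z * w x).
Proof.
have [j] : exists j, col j B != 0.
  apply: contrapT => h; pose v : 'cV[R]_n := const_mx 1.
  have : v = 0.
    apply: dotp_col => j; have [->|e] := eqVneq (col j B) 0; first by rewrite dotp0l.
    by exfalso; apply: h; exists j.
  by move/matrixP/(_ (Ordinal n0) 0); rewrite !mxE => /eqP; rewrite oner_eq0.
move=> /(frame_through (LBj j))[b [fb Lb _]]; have [sb _] := wA fb Lb.
have [s1 _] := tsum_sum (index_enum 'I_n) (P := xpredT) (fun i _ => sb i).
have s2 : tsm A (fun x => dotp x x * w x).
  apply: eq_tsm s1 => x _; rewrite (frame_dotp x x fb) mulr_suml.
  by apply: eq_bigr => i _; rewrite expr2.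
apply: tsm_le (tsmZ (dotp y y + dotp z z) s2) => x _.
rewrite normrM (ger0_norm (w0 x)) mulrA; apply: ler_wpM2r => //.
have := cauchy_schwarz x y; have := cauchy_schwarz x z.
have := dotp_ge0 x; have := dotp_ge0 y; have := dotp_ge0 z.
move: (dotp x y) (dotp x z) (dotp x x) (dotp y y) (dotp z z) => a c X Y Z Z0 Y0 X0 h1 h2.
have : 0 <= (a - c) ^+ 2 by exact: sqr_ge0.
have : 0 <= (a + c) ^+ 2 by exact: sqr_ge0.
move=> h3 h4; rewrite ler_norml; apply/andP; split; nra.
Qed.

(** The form [T v v] takes the value [c * dotp v v] at a lattice vector [v], since a frame through
    [v] shares the total equally among its axes; polarization and a basis of lattice vectors extend
    this to all arguments. The statement serves both the whole lattice with Gaussian weight and the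
    shell of roots with weight 1. *)
Lemma design y z : tsum A (fun x => dotp x y * dotp x z * w x) =
  tsum A (fun x => dotp x x * w x) / n%:R * dotp y z.
Proof.
pose T y z := tsum A (fun x => dotp x y * dotp x z * w x).
pose c := tsum A (fun x => dotp x x * w x) / n%:R.
have TC u v : T u v = T v u by apply: eq_tsum => x _; rewrite (mulrC (dotp x u)).
have TD u v s : T (u + v) s = T u s + T v s.
  rewrite -tsumD; [|exact: design_tsm..]; apply: eq_tsum => x _; rewrite dotpDr; ring.
have TZ (d : R) u s : T (d *: u) s = d * T u s.
  rewrite -tsumZ; last exact: design_tsm. apply: eq_tsum => x _; rewrite dotpZr; ring.
have diag v : L v -> T v v = c * dotp v v.
  move=> Lv; have [->|v0] := eqVneq v 0.
    by rewrite dotp0l mulr0 -[RHS](@tsum0 R _ A); apply: eq_tsum => x _; rewrite dotp0r !mul0r.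
  have [b [fb Lb [i0 bi]]] := frame_through Lv v0; have [sb eb] := wA fb Lb.
  have [_ e1] := tsum_sum (index_enum 'I_n) (P := xpredT) (fun i _ => sb i).
  have e2 : n%:R * tsum A (fun x => dotp x (b i0) ^+ 2 / dotp (b i0) (b i0) * w x) = tsum A (fun x => dotp x x * w x).
    set S := tsum A _; have -> : n%:R * S = \sum_(i < n) S by rewrite sumr_const card_ord mulr_natl.
    rewrite (eq_bigr _ (fun i _ => eb i0 i)) -e1.
    apply: eq_tsum => x _; rewrite (frame_dotp x x fb) mulr_suml.
    by apply: eq_bigr => i _; rewrite expr2.
  have vv : dotp v v != 0 by rewrite dotp_eq0.
  have nn : n%:R != 0 :> R by rewrite pnatr_eq0 -lt0n.
  rewrite /c -e2 [n%:R * _]mulrC mulfK// mulrC bi -tsumZ.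
    by apply: eq_tsum => x _; rewrite -expr2 mulrA mulrCA mulfV ?mulr1// .
  by have := sb i0; rewrite bi.
have pol u v : L u -> L v -> T u v = c * dotp u v.
  move=> Lu' Lv; have := diag _ (latticeD L0 LB Lu' Lv); have := diag _ Lu'; have := diag _ Lv.
  rewrite TD (TC u) (TC v (u + v)) !TD (TC v u) dotp_addrr; lra.
have lin1 v : L v -> forall u, T u v = c * dotp u v.
  move=> Lv u; rewrite (basis_expand u); elim/big_rec: _ => [|j s _ IH].
    by rewrite dotp0l mulr0 -(scale0r u) TZ mul0r.
  by rewrite TD TZ pol// IH dotpDl dotpZl; ring.
change (T y z = c * dotp y z).
rewrite (basis_expand z); elim/big_rec: _ => [|j s _ IH].
  by rewrite dotp0r mulr0 -(scale0r y) TC TZ mul0r.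
by rewrite TC TD TZ (TC _ y) (TC s) lin1// IH dotpDr dotpZr; ring.
Qed.

End Frames.

(** * Irreducible root systems of rank 24 *)
Section IntegerFacts.
Context {R : realType}.

Lemma int_sqr_ge1 (x : R) : x \is a Num.int -> x != 0 -> 1 <= x ^+ 2.
Proof.
move=> /floorK <-; move: (Num.floor x) => m; rewrite intr_eq0 => m0.
by rewrite -rmorphXn/= (ler_int R 1); nia.
Qed.

Lemma int_sqr_lt4 (x : R) : x \is a Num.int -> x ^+ 2 < 4 -> [\/ x = 0, x = 1 | x = -1].
Proof.
move=> /floorK <-; move: (Num.floor x) => m.
rewrite -rmorphXn/= (ltr_int R _ 4) => h.
have : m = 0 \/ m = 1 \/ m = -1 by nia.
by case=> [->|[->|->]]; [apply: Or31|apply: Or32|apply: Or33; rewrite rmorphN].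
Qed.

Lemma int_half (x : R) : 2 * x \is a Num.int -> x \isn't a Num.int ->
  1 / 4 <= x ^+ 2 /\ (x ^+ 2 < 9 / 4 -> x = 1 / 2 \/ x = - (1 / 2)).
Proof.
move=> /floorK; move: (Num.floor _) => m e; have {e} -> : x = m%:~R / 2 by lra.
move=> h; have m2 : m%:~R / 2 != ((m %/ 2)%Z)%:~R :> R.
  by apply: contra h => /eqP ->; exact: intr_int.
have m21 : (m %% 2)%Z = 1.
  have : (m %% 2)%Z = 0 \/ (m %% 2)%Z = 1 by have := @modz_ge0 m 2 isT; have := @ltz_mod m 2 isT; lia.
  case=> // m0; exfalso; move/eqP: m2; apply.
  by rewrite {1}(divz_eq m 2) m0 addr0 intrM; field.
have e := divz_eq m 2; rewrite m21 in e.
rewrite exprMn; split.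
  have : (1 : int)%:~R <= m%:~R ^+ 2 :> R by rewrite -rmorphXn/= ler_int; nia.
  lra.
move=> lt; have : m%:~R ^+ 2 < (9 : int)%:~R :> R by lra.
rewrite -rmorphXn/= ltr_int => lt9.
have : m = 1 \/ m = -1 by nia.
by case=> ->; [left|right; rewrite rmorphN mulNr].
Qed.

Lemma sum_sqr_int1 (I : finType) (P : pred I) (p : I -> R) :
  (forall i, P i -> p i \is a Num.int) -> 0 < \sum_(i | P i) p i ^+ 2 < 2 ->
  exists i, [/\ P i, p i = 1 \/ p i = -1 & forall j, P j -> j != i -> p j = 0].
Proof.
move=> ip /andP[s0 s2].
have [i /andP[Pi pi0]] : exists i, P i && (p i != 0).
  apply/existsP; apply: contraTT s0; rewrite negb_exists => /forallP h.
  rewrite big1 ?ltxx// => i Pi; have := h i; rewrite Pi/= negbK => /eqP ->; rewrite expr0n//.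
exists i; have := int_sqr_ge1 (ip i Pi) pi0 => p1.
move: s2; rewrite (bigD1 i)//= => s2.
have r0 : 0 <= \sum_(j | P j && (j != i)) p j ^+ 2 by apply: sumr_ge0 => j _; exact: sqr_ge0.
split=> //.
  have [|e|e|e] := int_sqr_lt4 (ip i Pi); [lra|by rewrite e eqxx in pi0|by left|by right].
move=> j Pj ji; apply/eqP; apply: contraT => pj0.
have := int_sqr_ge1 (ip j Pj) pj0.
have : p j ^+ 2 <= \sum_(j | P j && (j != i)) p j ^+ 2.
  by rewrite (bigD1 j) ?Pj//= lerDl; apply: sumr_ge0 => l _; exact: sqr_ge0.
lra.
Qed.

Lemma sum_sqr_int2 (I : finType) (p : I -> R) :
  (forall i, p i \is a Num.int) -> \sum_i p i ^+ 2 = 2 ->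
  exists i j, [/\ i != j, p i = 1 \/ p i = -1, p j = 1 \/ p j = -1
    & forall l, l != i -> l != j -> p l = 0].
Proof.
move=> ip s2.
have [i pi0] : exists i, p i != 0.
  apply/existsP; rewrite -[X in is_true X]negbK negb_exists; apply/negP => /forallP h.
  move: s2; rewrite big1 => [|i _]; first by lra.
  by have := h i; rewrite negbK => /eqP ->; rewrite expr0n.
have p1 := int_sqr_ge1 (ip i) pi0.
move: (s2); rewrite (bigD1 i)//= => s2'.
have r0 : 0 <= \sum_(j | j != i) p j ^+ 2 by apply: sumr_ge0 => j _; exact: sqr_ge0.
have pi1 : p i = 1 \/ p i = -1.
  have [|e|e|e] := int_sqr_lt4 (ip i); [lra|by rewrite e eqxx in pi0|by left|by right].
have pi2 : p i ^+ 2 = 1 by case: pi1 => ->; rewrite ?sqrrN expr1n.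
have [|j [ji pj hj]] := @sum_sqr_int1 I (fun j => j != i) p (fun j _ => ip j).
  by apply/andP; split; lra.
by exists i, j; split=> //; rewrite eq_sym.
Qed.

Lemma even_norm_int (x : R) (k : int) : x = (k *+ 2)%:~R -> x = 2 * k%:~R.
Proof. by move=> ->; rewrite mulr2n intrD; ring. Qed.

End IntegerFacts.

Lemma max_nat_prop (P : nat -> Prop) k N : P k -> (forall l, P l -> (l <= N)%N) ->
  exists l, [/\ (k <= l)%N, P l & ~ P l.+1].
Proof.
move=> Pk PN; have [d] := ubnP (N - k)%N; elim: d k Pk => // d IH k Pk kd.
have [Pk1|nP] := pselect (P k.+1); last by exists k.
have [|l [kl Pl nPl]] := IH k.+1 Pk1; first by have := PN _ Pk1; lia.
by exists l; split=> //; exact: ltnW.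
Qed.

Section Roots.
Context {R : realType} {n : nat}.
Variable L : set 'cV[R]_n.
Hypotheses (L0 : L 0) (LB : forall x y, L x -> L y -> L (x - y)) (Lu : unimodular L)
  (Le : even_lattice L).
Hypothesis span : forall v, (forall a, shell L 2 a -> dotp a v = 0) -> v = 0.
Hypothesis irr : irreducible_roots (shell L 2).
Implicit Types (x y z u v w : 'cV[R]_n).

Let LN x : L x -> L (- x) := @latticeN _ _ _ L0 LB x.
Let LD x y : L x -> L y -> L (x + y) := @latticeD _ _ _ L0 LB x y.
Let Lint x y : L x -> L y -> dotp x y \is a Num.int := @lattice_int _ _ _ Lu x y.

Lemma root_dot x y : shell L 2 x -> shell L 2 y ->
  [\/ x = y, x = - y | [\/ dotp x y = 0, dotp x y = 1 | dotp x y = -1]].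
Proof.
move=> [Lx x2] [Ly y2].
have [->|xy] := eqVneq x y; first by apply: Or31.
have [->|xNy] := eqVneq x (- y); first by apply: Or32.
apply: Or33; apply: int_sqr_lt4; first exact: Lint.
have h1 : 0 < dotp (x - y) (x - y) by rewrite dotp_gt0 subr_eq0.
have h2 : 0 < dotp (x + y) (x + y) by rewrite dotp_gt0 addr_eq0.
move: h1 h2; rewrite dotp_subrr dotp_addrr x2 y2; nra.
Qed.

Lemma root_sub x y : shell L 2 x -> shell L 2 y -> dotp x y = 1 -> shell L 2 (x - y).
Proof. by move=> [Lx x2] [Ly y2] e; split; [exact: LB | rewrite dotp_subrr x2 y2 e; lra]. Qed.

Lemma rootN x : shell L 2 x -> shell L 2 (- x).
Proof. by move=> [Lx x2]; split; [exact: LN | rewrite dotpNl dotpNr opprK]. Qed.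

Definition perp k (g : nat -> 'cV[R]_n) x := forall i, (i < k)%N -> dotp (g i) x = 0.
(** The span is encoded as the double orthogonal complement, so that no coefficients have to be
    carried. *)
Definition in_span k (g : nat -> 'cV[R]_n) x := forall v, perp k g v -> dotp x v = 0.

Lemma perp_nonzero k (g : nat -> 'cV[R]_n) : (k < n)%N -> exists2 v, v != 0 & perp k g v.
Proof.
move=> kn; have [v v0 h] := orthogonal_vector (fun i : 'I_k => g i) kn.
by exists v => // i ik; exact: (h (Ordinal ik)).
Qed.

(** Otherwise the roots inside the span and those orthogonal to it would split the system. Neither
    part is empty: [a] lies in the first, and the roots span a space larger than that of [k < n]
    vectors. *)
Lemma irr_connect k g : (k < n)%N -> (exists2 a, shell L 2 a & in_span k g a) ->
  exists b, [/\ shell L 2 b, ~ in_span k g b & ~ perp k g b].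
Proof.
move=> kn [a ra sa]; apply: contrapT => h.
have [_ hi] := irr.
have := hi [set x | shell L 2 x /\ in_span k g x] [set x | shell L 2 x /\ perp k g x].
case.
- apply/seteqP; split=> [x [[]|[]]//|x rx].
  have [sx|sx] := pselect (in_span k g x); first by left.
  have [px|px] := pselect (perp k g x); first by right.
  by exfalso; apply: h; exists x.
- by move=> x y [_ sx] [_ py]; exact: sx.
- by move/seteqP => [/(_ a)] /= h1 _; exact: h1.
move/seteqP => [hb _]; have [v v0 pv] := perp_nonzero g kn.
move/eqP: v0; apply; apply: span => b rb.
have [sb|sb] := pselect (in_span k g b); first exact: sb.
by have [pb|pb] := pselect (perp k g b); [exfalso; exact: (hb b)|case: h; exists b].
Qed.

Lemma dependent k (g : nat -> 'cV[R]_n) : (n < k)%N ->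
  exists c : 'I_k -> R, (exists i, c i != 0) /\ \sum_(i < k) c i *: g i = 0.
Proof.
move=> nk; pose M := \matrix_(i < k, j < n) g i j 0 : 'M[R]_(k, n).
have : kermx M != 0 by rewrite -mxrank_eq0 mxrank_ker -lt0n subn_gt0 (leq_ltn_trans (rank_leq_col M)).
rewrite -nz_row_eq0 => v0; exists (fun i => nz_row (kermx M) 0 i); split.
  by have [i vi] := elimT (@rV0Pn _ _ _) v0; exists i.
have /sub_kermxP/matrixP e := nz_row_sub (kermx M).
apply/matrixP => j l; have e0 : (nz_row (kermx M) *m M) 0 j = 0 by rewrite e mxE.
rewrite ord1 summxE [RHS]mxE -[RHS]e0 [RHS]mxE.
by apply: eq_bigr => i _; rewrite !mxE.
Qed.

(** The coordinate vectors of a subsystem of type [D_k]: the [f i] themselves need not lie in [L],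
    only their sums in pairs. *)
Definition dframe k (f : nat -> 'cV[R]_n) : Prop :=
  (forall i j, (i < k)%N -> (j < k)%N -> dotp (f i) (f j) = (i == j)%:R) /\
  (forall i j, (i < k)%N -> (j < k)%N -> i != j -> L (f i + f j)).

Section DFrame.
Variables (k : nat) (f : nat -> 'cV[R]_n).
Hypotheses (k4 : (4 <= k)%N) (df : dframe k f).

Lemma dframe_sub i j : (i < k)%N -> (j < k)%N -> L (f i - f j).
Proof.
move=> ik jk; have [->|ij] := eqVneq i j; first by rewrite subrr.
have [l [lk li lj]] : exists l, [/\ (l < k)%N, l != i & l != j].
  have [l2|] := boolP ((0 != i) && (0 != j))%N; first by exists 0%N; move/andP: l2 => []; split=> //; lia.
  have [l2|] := boolP ((1 != i) && (1 != j))%N; first by exists 1%N; move/andP: l2 => []; split=> //; lia.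
  by move=> *; exists 2%N; split; lia.
have -> : f i - f j = (f i + f l) - (f j + f l) by rewrite opprD addrACA subrr addr0.
by apply: LB; apply: df.2; rewrite // eq_sym.
Qed.

Lemma dframe_double i : (i < k)%N -> L (f i + f i).
Proof.
move=> ik; have [j [jk ij]] : exists j, (j < k)%N /\ i != j.
  by exists (i == 0%N : nat); case: eqVneq => /= ?; split; lia.
have -> : f i + f i = (f i + f j) + (f i - f j) by rewrite addrACA subrr addr0.
by apply: LD; [apply: df.2 | apply: dframe_sub].
Qed.

Let p x i := dotp x (f i).
Definition dproj x := \sum_(i < k) p x i *: f i.

Lemma dproj_dot x j : (j < k)%N -> dotp (dproj x) (f j) = p x j.
Proof.
move=> jk; rewrite dotp_suml (bigD1 (Ordinal jk))//= big1 ?addr0.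
  by rewrite dotpZl df.1// eqxx mulr1.
move=> i ij; rewrite dotpZl df.1 ?ltn_ord// (_ : (nat_of_ord i == j) = false) ?mulr0//.
by apply: contraNF ij => /eqP e; apply/eqP/val_inj.
Qed.

Lemma dproj_perp x : perp k f (x - dproj x).
Proof. by move=> i ik; rewrite dotpC dotpBl dproj_dot// subrr. Qed.

Lemma dproj_norm x : dotp x x = \sum_(i < k) p x i ^+ 2 + dotp (x - dproj x) (x - dproj x).
Proof.
have e : dotp (dproj x) (x - dproj x) = 0.
  rewrite dotp_suml big1// => i _; rewrite dotpZl dproj_perp ?mulr0//.
transitivity (dotp ((x - dproj x) + dproj x) ((x - dproj x) + dproj x)); first by rewrite subrK.
rewrite dotp_addrr (dotpC _ (dproj x)) e mulr0 addr0 addrC; congr (_ + _).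
rewrite {2}/dproj dotp_sumr; apply: eq_bigr => i _.
by rewrite dotpZr dproj_dot ?ltn_ord// expr2.
Qed.

Lemma dproj_in_span x : x = dproj x -> in_span k f x.
Proof. by move=> -> v pv; rewrite dotp_suml big1// => i _; rewrite dotpZl pv ?mulr0. Qed.

Lemma dframe_ext f' : dotp f' f' = 1 -> perp k f f' -> (forall i, (i < k)%N -> L (f i + f')) ->
  dframe k.+1 (fun i => if i == k then f' else f i).
Proof.
have h l : (l < k.+1)%N -> l = k \/ (l < k)%N by lia.
move=> n1 pf Lf; split=> i j /h[->|ik] /h[->|jk]; rewrite ?eqxx ?(ltn_eqF ik) ?(ltn_eqF jk)//.
- by rewrite dotpC pf// (gtn_eqF jk).
- by rewrite pf.
- exact: df.1.
- by move=> _; rewrite addrC; exact: Lf.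
- by move=> _; exact: Lf.
- exact: df.2.
Qed.

Lemma coord_diff_int x i j : L x -> (i < k)%N -> (j < k)%N -> p x i - p x j \is a Num.int.
Proof. by move=> Lx ik jk; rewrite -dotpBr; apply: Lint => //; exact: dframe_sub. Qed.

Lemma coord_double_int x i : L x -> (i < k)%N -> 2 * p x i \is a Num.int.
Proof.
move=> Lx ik; have := Lint Lx (dframe_double ik).
by rewrite dotpDr -/(p x i) (_ : p x i + p x i = 2 * p x i)//; ring.
Qed.

(* A root with a single nonzero coordinate [1] along the frame is [f i + f'] with [f'] a new frame vector. *)
Lemma dframe_vector_root b i : shell L 2 b -> (i < k)%N -> p b i = 1 \/ p b i = -1 ->
  (forall j, (j < k)%N -> j != i -> p b j = 0) -> exists f, dframe k.+1 f.
Proof.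
move=> rb ik bi bj.
have [c [rc ci cj]] : exists c, [/\ shell L 2 c, p c i = 1 & forall j, (j < k)%N -> j != i -> p c j = 0].
  case: bi => bi; first by exists b.
  exists (- b); split; [exact: rootN | by rewrite /p dotpNl -/(p b i) bi opprK |].
  by move=> j jk ji; rewrite /p dotpNl -/(p b j) bj ?oppr0.
have [Lc c2] := rc.
exists (fun l => if l == k then c - f i else f l); apply: dframe_ext.
- by rewrite dotp_subrr c2 -/(p c i) ci df.1// eqxx mulr1n; lra.
- move=> j jk; rewrite dotpC dotpBl -/(p c j) df.1// eq_sym; case: (eqVneq j i) => [->|ji].
    by rewrite ci subrr.
  by rewrite cj ?subr0.
- move=> j jk; rewrite addrCA -opprB; have -> : c - (f i - f j) = c - (f i - f j) by [].
  by apply: LB => //; exact: dframe_sub.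
Qed.

(** Since [L] contains [f i - f j] and [f i + f i], the coordinates of a root are all integers or
    all halves of odd integers. Not lying in the span leaves their squares a sum below 2. In the
    integral case exactly one coordinate is nonzero and the frame grows; in the other case each
    square is at least 1/4, so [k < 8]. *)
Lemma coord_cases b : shell L 2 b -> ~ in_span k f b -> ~ perp k f b ->
  (exists f, dframe k.+1 f) \/
  ((k < 8)%N /\ forall i, (i < k)%N -> p b i = 1 / 2 \/ p b i = - (1 / 2)).
Proof.
move=> rb nsb npb; have [Lb b2] := rb.
have r0 : 0 < dotp (b - dproj b) (b - dproj b).
  rewrite dotp_gt0 subr_eq0; apply: contra_notN nsb => /eqP; exact: dproj_in_span.
have s2 : \sum_(i < k) p b i ^+ 2 < 2 by have := dproj_norm b; rewrite b2; lra.
have k0 : (0 < k)%N by lia.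
have [p0|np0] := boolP (p b 0%N \is a Num.int).
  left; have ip (i : 'I_k) : p b i \is a Num.int.
    by have := rpredD (coord_diff_int Lb (ltn_ord i) k0) p0; rewrite subrK.
  have s0 : 0 < \sum_(i < k) p b i ^+ 2.
    rewrite lt_def sumr_ge0 ?andbT => [|i _]; last exact: sqr_ge0.
    apply: contra_notN npb; rewrite psumr_eq0 => [/allP h i ik|i _]; last exact: sqr_ge0.
    by have := h (Ordinal ik) (mem_index_enum _); rewrite /= sqrf_eq0 => /eqP; rewrite dotpC.
  have [|i [_ bi bj]] := @sum_sqr_int1 R 'I_k xpredT (fun i => p b i) (fun i _ => ip i); first by rewrite s0.
  apply: (@dframe_vector_root b i) => // j jk ji; exact: (bj (Ordinal jk)).
right.
have nip i : (i < k)%N -> p b i \isn't a Num.int.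
  move=> ik; apply: contra np0 => pi; rewrite -(subrK (p b i) (p b 0%N)).
  by rewrite rpredD// coord_diff_int.
have q i : (i < k)%N -> _ := fun ik => int_half (coord_double_int Lb ik) (nip i ik).
have kk : k%:R / 4 <= \sum_(i < k) p b i ^+ 2.
  rewrite -[k in k%:R]card_ord -sumr_const mulr_suml; apply: ler_sum => i _.
  exact: (q i (ltn_ord i)).1.
split; first by rewrite -(ltr_nat R); lra.
move=> i ik; apply: (q i ik).2.
have : \sum_(j < k | j != Ordinal ik) (1 / 4) <= \sum_(j < k | j != Ordinal ik) p b j ^+ 2.
  by apply: ler_sum => j _; exact: (q j (ltn_ord j)).1.
rewrite sumr_const cardC1 card_ord -mulr_natl => h.
have k3 : (3 : R) <= k.-1%:R by rewrite (ler_nat R 3); lia.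
move: s2; rewrite (bigD1 (Ordinal ik))//=; lra.
Qed.

End DFrame.

Section Flip.
Variables (k : nat) (f : nat -> 'cV[R]_n).
Hypotheses (k4 : (4 <= k)%N) (df : dframe k f).

Lemma dframe_signs (e : nat -> bool) : dframe k (fun i => (-1) ^+ e i *: f i).
Proof.
split=> i j ik jk.
  rewrite dotpZl dotpZr df.1//; case: eqVneq => [->|_]; last by rewrite !mulr0.
  by rewrite mulr1 -expr2 sqrr_sign.
move=> ij; case: (e i); case: (e j); rewrite ?expr1 ?expr0 ?scale1r ?scaleN1r.
- by rewrite -opprD; apply/LN/df.2.
- by rewrite addrC; exact: (dframe_sub k4 df).
- exact: (dframe_sub k4 df).
- exact: df.2.
Qed.

Lemma perp_signs (e : nat -> bool) x : perp k (fun i => (-1) ^+ e i *: f i) x <-> perp k f x.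
Proof.
split=> h i ik; last by rewrite dotpZl h ?mulr0.
by have /eqP := h i ik; rewrite dotpZl mulf_eq0 signr_eq0 => /eqP.
Qed.

Lemma in_span_signs (e : nat -> bool) x : in_span k (fun i => (-1) ^+ e i *: f i) x <-> in_span k f x.
Proof. by split=> h v pv; apply: h; [exact: (iffRL (perp_signs e v)) | exact: (iffLR (perp_signs e v))]. Qed.

End Flip.

(* Triality: a spinor root with all coordinates [1/2] is the first vector of the Hadamard frame. *)
Lemma dframe4_triality f b : dframe 4 f -> shell L 2 b -> ~ in_span 4 f b ->
  (forall i, (i < 4)%N -> dotp b (f i) = 1 / 2) -> exists f, dframe 5 f.
Proof.
move=> df rb nsb hb.
pose h := fun i => nth 0 [:: (1 / 2) *: (f 0%N + f 1%N + f 2%N + f 3%N); (1 / 2) *: (f 0%N + f 1%N - f 2%N - f 3%N);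
  (1 / 2) *: (f 0%N - f 1%N + f 2%N - f 3%N); (1 / 2) *: (f 0%N - f 1%N - f 2%N + f 3%N)] i.
have d i j : (i < 4)%N -> (j < 4)%N -> dotp (f i) (f j) = (i == j)%:R by exact: df.1.
have dh : dframe 4 h.
  split.
    by move=> [|[|[|[|i]]]] // [|[|[|[|j]]]] // _ _; rewrite /h/= !(dotpZl, dotpZr, dotpDl, dotpDr, dotpNl, dotpNr) !d//=; field.
  have half (x y z : 'cV[R]_n) : x + y = z + z -> (1 / 2) *: x + (1 / 2) *: y = z.
    by move=> /matrixP e; apply/matrixP => r c; have := e r c; rewrite !mxE; lra.
  have D i j : (i < 4)%N -> (j < 4)%N -> i != j -> L (f i + f j) by exact: df.2.
  have S i j : (i < 4)%N -> (j < 4)%N -> L (f i - f j) by exact: dframe_sub.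
  have key i j : (i < j)%N -> (j < 4)%N -> L (h i + h j).
    case: i => [|[|[|i]]]; case: j => [|[|[|[|j]]]] // _ _; rewrite /h/=.
    - rewrite (half _ _ (f 0%N + f 1%N)); first exact: D.
      by apply/matrixP => r c; rewrite !mxE; ring.
    - rewrite (half _ _ (f 0%N + f 2%N)); first exact: D.
      by apply/matrixP => r c; rewrite !mxE; ring.
    - rewrite (half _ _ (f 0%N + f 3%N)); first exact: D.
      by apply/matrixP => r c; rewrite !mxE; ring.
    - rewrite (half _ _ (f 0%N - f 3%N)); first exact: S.
      by apply/matrixP => r c; rewrite !mxE; ring.
    - rewrite (half _ _ (f 0%N - f 2%N)); first exact: S.
      by apply/matrixP => r c; rewrite !mxE; ring.
    - rewrite (half _ _ (f 0%N - f 1%N)); first exact: S.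
      by apply/matrixP => r c; rewrite !mxE; ring.
  move=> i j i4 j4 ij; have [lt|] := ltnP i j; first exact: key.
  by rewrite leq_eqVlt eq_sym (negbTE ij)/= => lt; rewrite addrC; exact: key.
apply: (@dframe_vector_root 4 h _ dh b 0%N) => //.
  by left; rewrite /h/= dotpZr !dotpDr !hb//; field.
by move=> [|[|[|[|j]]]] // _ _; rewrite /h/= dotpZr !(dotpDr, dotpNr) !hb//; field.
Qed.

Section SpinorPair.
Variables (k : nat) (f : nat -> 'cV[R]_n) (b : 'cV[R]_n).
Hypotheses (k5 : (5 <= k <= 7)%N) (df : dframe k f) (next : ~ exists f, dframe k.+1 f).
Hypotheses (rb : shell L 2 b) (hb : forall i, (i < k)%N -> dotp b (f i) = 1 / 2).

Let k4 : (4 <= k)%N. Proof. by case/andP: k5 => h _; exact: ltnW. Qed.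
Let sg := (1 / 2) *: \sum_(i < k) f i.
Let u := b - sg.

Let sgE : dproj k f b = sg.
Proof. by rewrite /sg scaler_sumr; apply: eq_bigr => i _; rewrite hb. Qed.
Let pu : perp k f u. Proof. by rewrite /u -sgE; exact: dproj_perp. Qed.
Let u2 : dotp u u = 2 - k%:R / 4.
Proof.
have := dproj_norm df b; rewrite rb.2 sgE -/u (eq_bigr (fun=> 1 / 4)) => [|i _].
  by rewrite sumr_const card_ord -mulr_natl => ->; lra.
by rewrite hb//; field.
Qed.

Let f00 : dotp (f 0%N) (f 0%N) = 1. Proof. by rewrite df.1//; lia. Qed.

(* A root of the shape [+-f 0 + w] with [w] nonzero orthogonal to the frame would extend the frame. *)
Let no_vector w (s : bool) : perp k f w -> w != 0 -> shell L 2 ((-1) ^+ s *: f 0%N + w) -> False.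
Proof.
move=> pw w0 rc; apply: next; have k0 : (0 < k)%N by lia.
apply: (dframe_vector_root k4 df rc k0).
  rewrite dotpDl dotpZl f00 mulr1 dotpC pw// addr0.
  by case: (s); rewrite ?expr1 ?expr0; [right|left].
move=> j jk j0; rewrite dotpDl dotpZl df.1// eq_sym (negbTE j0) mulr0 dotpC pw ?addr0//.
Qed.

Let even_int x : L x -> exists m : int, dotp x x = 2 * m%:~R.
Proof. by move=> /Le[m e]; exists m; exact: even_norm_int. Qed.

Let sum_frame_parity (s : seq nat) : all (fun i => (i < k)%N) s ->
  L (\sum_(i <- s) f i - (odd (size s))%:R *: f 0%N).
Proof.
have k0 : (0 < k)%N by lia.
elim: s => [_|i s IH /= /andP[ik /IH]]; first by rewrite big_nil scale0r subrr.
rewrite big_cons; case: (odd _) => /= h; last first.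
  rewrite scale1r addrAC; apply: LD; first exact: (dframe_sub k4 df).
  by move: h; rewrite scale0r subr0.
rewrite scale0r subr0 -(subrK (f 0%N) (\sum_(_ <- _) _)) addrCA; apply: LD; first by rewrite scale1r in h.
have [->|i0] := eqVneq i 0%N; first exact: (dframe_double k4 df).
exact: df.2.
Qed.

Let range (m : int) (x : R) : 2 * m%:~R = x -> -1 < x < 4 -> x = 0 \/ x = 2.
Proof.
move=> <- /andP[h1 h2].
have : -1 < m by rewrite -(ltr_int R) rmorphN/=; lra.
have : m < 2 by rewrite -(ltr_int R); lra.
move=> a1 a2; have : m = 0 \/ m = 1 by move: a1 a2; lia.
by case=> ->; [left|right]; lra.
Qed.

(** Let [w] be the part of [c] orthogonal to the frame. Modulo [L] the frame sums reduce to 0 or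
    [f 0], so [w - u] and [w + u], each possibly shifted by [f 0], lie in [L] and have even norm. A
    part of norm 1 together with the shift would be a root extending the frame. *)
Lemma spinor_pair c : shell L 2 c ->
  (forall i, (i < k)%N -> dotp c (f i) = 1 / 2 \/ dotp c (f i) = - (1 / 2)) ->
  c - dproj k f c = u \/ c - dproj k f c = - u.
Proof.
move=> rc hc; set w := c - dproj k f c.
have pw : perp k f w by exact: dproj_perp.
have w2 : dotp w w = 2 - k%:R / 4.
  have := dproj_norm df c; rewrite rc.2 -/w (eq_bigr (fun=> 1 / 4)) => [|i _].
    by rewrite sumr_const card_ord -mulr_natl => ->; lra.
  by case: (hc i (ltn_ord i)) => ->; field.
pose e (i : nat) := dotp c (f i) != 1 / 2.
have cE : c = sg - \sum_(i < k | e i) f i + w.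
  rewrite -[LHS](subrK (dproj k f c)) -/w addrC; congr (_ + w).
  rewrite /sg scaler_sumr [X in _ - X]big_mkcond -sumrB; apply: eq_bigr => i _.
  rewrite /e; case: eqP => [->|ne] /=; first by rewrite subr0.
  case: (hc i (ltn_ord i)) => // ->.
  by apply/matrixP => r l; rewrite !mxE; field.
have [ep Lp] : exists ep : bool, L (sg + w - ep%:R *: f 0%N).
  pose s : seq nat := map (@nat_of_ord k) (seq.filter (fun i : 'I_k => e i) (enum 'I_k)).
  have sk : all (fun i => (i < k)%N) s.
    by apply/allP => _ /mapP[i _ ->]; exact: ltn_ord.
  have := sum_frame_parity sk; set ep := odd _ => h; exists ep.
  have -> : sg + w - ep%:R *: f 0%N = c + (\sum_(i <- s) f i - ep%:R *: f 0%N).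
    rewrite {1}cE /s big_map big_filter big_enum_cond/=.
    by apply/matrixP => r l; rewrite !mxE; ring.
  by apply: LD => //; case: rc.
have Lb : L (sg + u) by rewrite /u subrKC; case: rb.
have LDf : L ((w - u) - ep%:R *: f 0%N).
  by have := LB Lp Lb; congr L; apply/matrixP => r l; rewrite !mxE; ring.
(* Here [sg] occurs twice and makes the full frame sum, which is [odd k] times [f 0] modulo [L]. *)
have LSf : L ((w + u) + ((odd k)%:R - ep%:R) *: f 0%N).
  have sk : all (fun i => (i < k)%N) (iota 0 k) by apply/allP => i; rewrite mem_iota.
  have := sum_frame_parity sk; rewrite size_iota (_ : iota 0 k = index_iota 0 k) ?big_mkord => [h|]; last by rewrite /index_iota subn0.
  have := LB (LD Lp Lb) h; congr L; rewrite /sg.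
  by apply/matrixP => r l; rewrite !mxE; field.
have k0 : (0 < k)%N by lia.
have norm (x : 'cV[R]_n) (a : R) : perp k f x -> dotp (x + a *: f 0%N) (x + a *: f 0%N) = dotp x x + a ^+ 2.
  move=> px; rewrite dotp_addrr !(dotpZr, dotpZl) f00 (dotpC x) px//; ring.
have pD : perp k f (w - u) by move=> i ik; rewrite dotpBr pw// pu// subrr.
have pS : perp k f (w + u) by move=> i ik; rewrite dotpDr pw// pu// addr0.
have [m1 e1] := even_int LDf; have [m2 e2] := even_int LSf.
rewrite -scaleNr norm// dotp_subrr w2 u2 in e1; rewrite norm// dotp_addrr w2 u2 in e2.
have zD : dotp (w - u) (w - u) = 0 -> w = u.
  by move/eqP; rewrite dotp_eq0 subr_eq0 => /eqP.
have zS : dotp (w + u) (w + u) = 0 -> w = - u.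
  by move/eqP; rewrite dotp_eq0 addr_eq0 => /eqP.
have := dotp_ge0 (w - u); have := dotp_ge0 (w + u).
have rD : dotp (w - u) (w - u) != 0 -> 2 * m1%:~R = 2 :> R -> ep -> False.
  move=> h m12 ep1; apply: (@no_vector (w - u) true); rewrite -?dotp_eq0//.
  rewrite expr1 scaleN1r addrC; move: LDf e1; rewrite ep1 scale1r => LDf e1; split=> //.
  by rewrite -[f 0%N]scale1r -scaleNr norm// dotp_subrr w2 u2 e1.
have rS : dotp (w + u) (w + u) != 0 -> 2 * m2%:~R = 2 :> R -> (odd k)%:R - ep%:R = 1 :> R -> False.
  move=> h m12 ep1; apply: (@no_vector (w + u) false); rewrite -?dotp_eq0//.
  rewrite expr0 scale1r addrC; move: LSf e2; rewrite ep1 scale1r => LSf e2; split=> //.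
  by rewrite -[f 0%N]scale1r norm// dotp_addrr w2 u2 e2.
move: e1 e2 zD zS rD rS; rewrite dotp_subrr dotp_addrr w2 u2; move: (dotp w u) => q.
(* The norms of [w - u] and [w + u] add up to [8 - k], that is 3, 2 or 1. Parity then forces one of
   them to be 0, unless one is 1 with a shift, which [rD] and [rS] exclude. *)
have [->|[->|->]] : k = 5%N \/ k = 6%N \/ k = 7%N by lia.
all: case: (ep) => /= e1 e2 zD zS rD rS h1 h2.
all: rewrite ?mulr0n ?mulr1n in e1 e2 rD rS.
- case: (range (esym e2)) => [|x|x]; [lra | right; apply: zS; lra | exfalso; apply: rD => //; [|lra]].
  by apply/eqP; lra.
- case: (range (esym e1)) => [|x|x]; [lra | left; apply: zD; lra | exfalso; apply: rS => //; [|lra|lra]].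
  by apply/eqP; lra.
- case: (range (esym e1)) => [|x|x]; [lra | exfalso; lra | exfalso; apply: rD => //; [|lra]].
  by apply/eqP; lra.
- case: (range (esym e1)) => [|x|x]; [lra | left; apply: zD; lra | right; apply: zS; lra].
- case: (range (esym e2)) => [|x|x]; [lra | right; apply: zS; lra | exfalso; lra].
- case: (range (esym e1)) => [|x|x]; [lra | left; apply: zD; lra | exfalso; lra].
Qed.

End SpinorPair.

(** If no frame vector can be added, a connecting root is a spinor with [k < 8], and [k = 4] is
    settled by triality. For [k] from 5 to 7 all spinor roots have orthogonal part [u] or [- u], so
    with the frame they span only [k + 1 <= 8 < n] dimensions, and connectedness supplies a root [c]
    outside. It can only be orthogonal to the frame without being orthogonal to [u], which is
    refuted by combining it with [b]. *)
Lemma dframe_next k f : (4 <= k < n)%N -> (8 < n)%N -> dframe k f -> exists f, dframe k.+1 f.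
Proof.
move=> /andP[k4 kn] n8 df; apply: contrapT => next.
have frame_root f' : dframe k f' -> shell L 2 (f' 0%N + f' 1%N) /\ in_span k f' (f' 0%N + f' 1%N).
  move=> df'; have [k0 k1] : (0 < k)%N /\ (1 < k)%N by lia.
  split; last by move=> v pv; rewrite dotpDl !pv ?addr0.
  split; first exact: df'.2.
  by rewrite dotp_addrr !df'.1//=; ring.
have [b [rb nsb npb]] := irr_connect kn (ex_intro2 _ _ _ (frame_root f df).1 (frame_root f df).2).
have [//|[k8 hb]] := coord_cases k4 df rb nsb npb.
pose e i := dotp b (f i) != 1 / 2; pose g i := (-1) ^+ e i *: f i.
have dg : dframe k g by exact: dframe_signs.
have hg i : (i < k)%N -> dotp b (g i) = 1 / 2.
  move=> ik; rewrite /g dotpZr /e; have [h|ne] := eqVneq (dotp b (f i)) (1 / 2).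
    by rewrite h /= expr0 !mul1r.
  by case: (hb i ik) => h; [rewrite h eqxx in ne | rewrite h expr1 mulN1r opprK].
have nsg : ~ in_span k g b by move=> /in_span_signs.
have npg : ~ perp k g b by move=> /perp_signs.
have [k4e|k4n] := eqVneq k 4%N.
  apply: next; rewrite k4e in dg nsg hg *; exact: dframe4_triality dg rb nsg hg.
have k5 : (5 <= k <= 7)%N by lia.
pose u := b - (1 / 2) *: \sum_(i < k) g i.
have dpb c : (forall i, (i < k)%N -> dotp c (g i) = 1 / 2) -> dproj k g c = (1 / 2) *: \sum_(i < k) g i.
  by move=> hc; rewrite scaler_sumr; apply: eq_bigr => i _; rewrite hc.
pose W i := if i == k then u else g i.
have Wk : W k = u by rewrite /W eqxx.
have Wlt i : (i < k)%N -> W i = g i by move=> ik; rewrite /W ltn_eqF.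
have perpW v : perp k.+1 W v -> perp k g v /\ dotp u v = 0.
  move=> h; split; last by rewrite -Wk h.
  by move=> i ik; rewrite -Wlt// h// ltnW.
have spanW c (a : R) : c - dproj k g c = a *: u -> in_span k.+1 W c.
  move=> h v /perpW[pv uv]; rewrite -(subrK (dproj k g c) c) h dotpDl dotpZl uv mulr0 add0r.
  by rewrite dotp_suml big1// => i _; rewrite dotpZl pv ?mulr0.
have sb : in_span k.+1 W b by apply: (spanW b 1); rewrite scale1r dpb.
have k1n : (k.+1 < n)%N by lia.
have [c [rc nsc npc]] := irr_connect k1n (ex_intro2 _ _ b rb sb).
have pair := spinor_pair k5 dg next rb hg.
have c0 : c != 0 by rewrite -dotp_eq0 rc.2 pnatr_eq0.
have [pc|npc'] := pselect (perp k g c).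
  have cu : dotp c b = dotp c u.
    rewrite dotpBr dotpZr dotp_sumr big1 ?mulr0 ?subr0// => i _; rewrite dotpC pc//.
  have cu0 : dotp c u != 0.
    apply/eqP => z; apply: npc => i; rewrite ltnS leq_eqVlt => /orP[/eqP ->|ik].
      by rewrite Wk dotpC.
    by rewrite Wlt// pc.
  (* Such a root would be another spinor, with orthogonal part [u - (-1) ^+ s *: c]. Being [u] or
     [- u], this makes [c] zero or a multiple of [u]. *)
  have shifted (s : bool) : shell L 2 (b - (-1) ^+ s *: c) -> False.
    move=> rd; have hd i : (i < k)%N -> dotp (b - (-1) ^+ s *: c) (g i) = 1 / 2.
      by move=> ik; rewrite dotpBl dotpZl (dotpC c) pc// mulr0 subr0 hg.
    have := pair _ rd (fun i ik => or_introl (hd i ik)); rewrite dpb//.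
    have -> : b - (-1) ^+ s *: c - (1 / 2) *: (\sum_(i < k) g i) = u - (-1) ^+ s *: c by rewrite addrAC.
    have ss : (-1) ^+ s * (-1) ^+ s = 1 :> R by rewrite -expr2 sqrr_sign.
    case=> h.
      have : (-1) ^+ s *: c = 0 by apply/eqP; rewrite -oppr_eq0; apply/eqP/(addrI u); rewrite h addr0.
      by move/eqP; rewrite scaler_eq0 signr_eq0 (negbTE c0).
    apply: nsc; apply: (spanW c ((-1) ^+ s * 2)).
    have -> : dproj k g c = 0 by rewrite /dproj big1// => i _; rewrite dotpC pc ?scale0r.
    have {}h : (-1) ^+ s *: c = 2 *: u.
      by apply/matrixP => i j; have /matrixP/(_ i j) := h; rewrite !mxE; lra.
    by rewrite subr0 -scalerA -h scalerA ss scale1r.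
  case: (root_dot rc rb) => [e0|e0|[e0|e0|e0]].
  - by apply: npg; rewrite -e0.
  - by apply: npg => i ik; apply/eqP; rewrite -oppr_eq0 -dotpNr -e0 pc.
  - by rewrite -cu e0 eqxx in cu0.
  - by apply: (shifted false); rewrite expr0 scale1r; apply: root_sub => //; rewrite dotpC.
  - apply: (shifted true); rewrite expr1 scaleN1r; apply: root_sub => //; first exact: rootN.
    by rewrite dotpNr dotpC e0 opprK.
have nsc' : ~ in_span k g c.
  by move=> h; apply: nsc => v /perpW[pv _]; exact: h.
have [//|[_ hc]] := coord_cases k4 dg rc nsc' npc'.
case: (pair c rc hc) => h; apply: nsc.
  by apply: (spanW c 1); rewrite scale1r.
by apply: (spanW c (-1)); rewrite scaleN1r.
Qed.

Lemma dframe_full k f : (8 < n)%N -> (4 <= k <= n)%N -> dframe k f -> exists f, dframe n f.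
Proof.
move=> n8 /andP[k4 kn]; have [d] := ubnP (n - k)%N; elim: d k f k4 kn => // d IH k f k4 kn kd df.
have [ekn|kn'] := eqVneq k n; first by rewrite ekn in df; exists f.
have kn2 : (4 <= k < n)%N by lia.
have [f' df'] := dframe_next kn2 n8 df.
by apply: (IH k.+1 f') => //; lia.
Qed.

(** The model is the set of roots [e_i - e_(k+1)] for [i <= k] in type [A_k]. *)
Definition clique k (r : nat -> 'cV[R]_n) : Prop :=
  (forall i, (i < k)%N -> shell L 2 (r i)) /\
  (forall i j, (i < k)%N -> (j < k)%N -> i != j -> dotp (r i) (r j) = 1).

(** The Gram matrix is the identity plus the all-ones matrix; being positive definite, it makes a
    clique linearly independent. *)
Lemma clique_gram k r (c : 'I_k -> R) : clique k r ->
  dotp (\sum_(i < k) c i *: r i) (\sum_(i < k) c i *: r i) = \sum_i c i ^+ 2 + (\sum_i c i) ^+ 2.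
Proof.
move=> [rv dv]; rewrite dotp_suml expr2 mulr_suml -big_split/=; apply: eq_bigr => i _.
rewrite dotpZl dotp_sumr (bigD1 i)//= dotpZr (rv i (ltn_ord i)).2.
rewrite (eq_bigr (fun j => c j)) => [|j ji]; last first.
  by rewrite dotpZr dv ?mulr1// eq_sym.
by rewrite [X in _ = _ + _ * X](bigD1 i)//=; ring.
Qed.

Lemma clique_leq k r : clique k r -> (k <= n)%N.
Proof.
move=> cv; rewrite leqNgt; apply/negP => /(dependent r)[c [[i ci] e]].
have := clique_gram c cv; rewrite e dotp0l => /eqP.
rewrite eq_sym paddr_eq0 ?sqr_ge0//; last by apply: sumr_ge0 => j _; exact: sqr_ge0.
move=> /andP[]; rewrite psumr_eq0 => [/allP/(_ i (mem_index_enum _))|j _]; last exact: sqr_ge0.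
by rewrite sqrf_eq0 (negbTE ci).
Qed.

Lemma maximal_clique : exists k r, [/\ (1 <= k)%N, clique k r & ~ exists r, clique k.+1 r].
Proof.
have [a ra] := irr.1.
have [|l [r cr]|k [k1 [r cr] nk]] := @max_nat_prop (fun k => exists r, clique k r) 1 n.
- exists (fun=> a); split=> // i j; rewrite !ltnS !leqn0 => /eqP -> /eqP ->; by rewrite eqxx.
- exact: clique_leq cr.
- by exists k, r.
Qed.

(** Up to sign, a root [b] that meets the span without lying in it has products 0 and 1 with the
    members, for a difference of two members would have product 2 with [b]. Maximality demands a
    product 0 and two products 1; three such members and [b] generate a [D_4]. *)
Lemma clique_to_dframe k r : (1 <= k)%N -> clique k r -> ~ (exists r, clique k.+1 r) -> (k < n)%N ->
  exists f, dframe 4 f.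
Proof.
move=> k1 cr max kn; have [rr dr] := cr.
have r0 : in_span k r (r 0%N) by move=> v; apply.
have [b0 [rb0 nsb0 npb0]] := irr_connect kn (ex_intro2 _ _ _ (rr 0%N k1) r0).
have coord b i : shell L 2 b -> ~ in_span k r b -> (i < k)%N ->
    [\/ dotp b (r i) = 0, dotp b (r i) = 1 | dotp b (r i) = -1].
  move=> rb nsb ik; case: (root_dot rb (rr i ik)) => // e; exfalso; apply: nsb => v pv.
    by rewrite e pv.
  by rewrite e dotpNl pv ?oppr0.
have diff b i j : shell L 2 b -> ~ in_span k r b -> (i < k)%N -> (j < k)%N ->
    dotp b (r i) = 1 -> dotp b (r j) = -1 -> False.
  move=> rb nsb ik jk ei ej; have ij : i != j by apply: contra_eq_neq ej => <-; rewrite ei; lra.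
  have rd : shell L 2 (r i - r j) by apply: root_sub; rewrite ?dr//; exact: rr.
  have e2 : dotp b (r i - r j) = 2 by rewrite dotpBr ei ej; lra.
  apply: nsb; have -> : b = r i - r j.
    apply/eqP; rewrite -subr_eq0 -dotp_eq0 dotp_subrr rb.2 rd.2 e2; apply/eqP; lra.
  by move=> v pv; rewrite dotpBl !pv ?subrr.
have [b [rb nsb npb b01]] : exists b, [/\ shell L 2 b, ~ in_span k r b, ~ perp k r b
    & forall i, (i < k)%N -> dotp b (r i) = 0 \/ dotp b (r i) = 1].
  have [[i [ik ei]]|h] := pselect (exists i, (i < k)%N /\ dotp b0 (r i) = -1).
    have nsN : ~ in_span k r (- b0) by move=> h; apply: nsb0 => v /h; rewrite dotpNl => /eqP; rewrite oppr_eq0 => /eqP.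
    exists (- b0); split=> //; first exact: rootN.
      by move=> /(_ i ik)/eqP; rewrite dotpNr oppr_eq0 dotpC ei; move/eqP; lra.
    move=> j jk; rewrite dotpNl; case: (coord b0 j rb0 nsb0 jk) => e; rewrite e.
    - by left; rewrite oppr0.
    - by exfalso; exact: diff rb0 nsb0 jk ik e ei.
    - by right; rewrite opprK.
  exists b0; split=> // j jk; case: (coord b0 j rb0 nsb0 jk) => e; [by left|by right|].
  by exfalso; apply: h; exists j.
have h l : (l < k.+1)%N -> l = k \/ (l < k)%N by lia.
have [i1 [i1k e1]] : exists i, (i < k)%N /\ dotp b (r i) = 1.
  apply: contrapT => h1; apply: npb => i ik; rewrite dotpC; case: (b01 i ik) => // e.
  by exfalso; apply: h1; exists i.
have [i3 [i3k e3]] : exists i, (i < k)%N /\ dotp b (r i) = 0.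
  apply: contrapT => h1; apply: max; exists (fun i => if i == k then b else r i).
  have all1 i : (i < k)%N -> dotp b (r i) = 1.
    by move=> ik; case: (b01 i ik) => // e; exfalso; apply: h1; exists i.
  split=> [i /h[->|ik]|i j /h[->|ik] /h[->|jk]]; rewrite ?eqxx ?(ltn_eqF ik) ?(ltn_eqF jk)//.
  - exact: rr.
  - by move=> _; exact: all1.
  - by move=> _; rewrite dotpC; exact: all1.
  - exact: dr.
(* With a single product 1, at [i1], the roots [b], [r i1] and the differences [r i1 - r i] would
   form a clique with one more member. *)
have [i2 [i2k i21 e2]] : exists i, [/\ (i < k)%N, i != i1 & dotp b (r i) = 1].
  apply: contrapT => h1; apply: max.
  have all0 i : (i < k)%N -> i != i1 -> dotp b (r i) = 0.
    by move=> ik ii; case: (b01 i ik) => // e; exfalso; apply: h1; exists i.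
  exists (fun i => if i == k then b else if i == i1 then r i1 else r i1 - r i).
  split=> [i /h[->|ik]|i j /h[->|ik] /h[->|jk]]; rewrite ?eqxx ?(ltn_eqF ik) ?(ltn_eqF jk)//.
  - case: eqVneq => ii; first exact: rr.
    by apply: root_sub; rewrite ?dr// 1?eq_sym//; exact: rr.
  - move=> _; case: (eqVneq j i1) => ji //; by rewrite dotpBr e1 all0// subr0.
  - move=> _; rewrite dotpC; case: (eqVneq i i1) => ii //; by rewrite dotpBr e1 all0// subr0.
  - have n1 := (rr i1 i1k).2.
    case: (eqVneq i i1) => ii; case: (eqVneq j i1) => ji ij.
    + by rewrite ii ji eqxx in ij.
    + by rewrite dotpBr n1 dr// 1?eq_sym//; ring.
    + by rewrite dotpBl n1 dr//; ring.
    + by rewrite dotpBr !dotpBl n1 !dr// 1?eq_sym//; ring.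
have i31 : i3 != i1 by apply: contra_eq_neq e3 => ->; rewrite e1 oner_eq0.
have i32 : i3 != i2 by apply: contra_eq_neq e3 => ->; rewrite e2 oner_eq0.
have [L1 n1] := rr i1 i1k; have [L2 n2] := rr i2 i2k; have [L3 n3] := rr i3 i3k.
have d12 : dotp (r i1) (r i2) = 1 by rewrite dr// eq_sym.
have d13 : dotp (r i1) (r i3) = 1 by rewrite dr// eq_sym.
have d23 : dotp (r i2) (r i3) = 1 by rewrite dr// eq_sym.
have [Lb nb] := rb.
move: (r i1) (r i2) (r i3) L1 L2 L3 n1 n2 n3 d12 d13 d23 e1 e2 e3 => v1 v2 v3 L1 L2 L3 n1 n2 n3 d12 d13 d23 e1 e2 e3.
(* These solve [f1 + f3 = v1], [f1 + f2 = v2], [f2 + f3 = v3]; since [dotp b f1 = 1] and [b] is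
   orthogonal to [f2] and [f3], the fourth vector is [b - f1]. *)
pose f1 := (1 / 2) *: (v1 + v2 - v3); pose f2 := (1 / 2) *: (v2 + v3 - v1); pose f3 := (1 / 2) *: (v1 + v3 - v2).
exists (fun i => nth 0 [:: f1; f2; f3; b - f1] i).
have dd := (n1, n2, n3, d12, d13, d23, e1, e2, e3, nb, (dotpC v2 v1), (dotpC v3 v1), (dotpC v3 v2), (dotpC v1 b), (dotpC v2 b), (dotpC v3 b)).
split.
  by move=> [|[|[|[|i]]]] // [|[|[|[|j]]]] // _ _ /=; rewrite /f1 /f2 /f3 !(dotpZl, dotpZr, dotpDl, dotpDr, dotpNl, dotpNr) !dd /=; field.
have key i j : (i < j)%N -> (j < 4)%N -> L (nth 0 [:: f1; f2; f3; b - f1] i + nth 0 [:: f1; f2; f3; b - f1] j).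
  case: i => [|[|[|i]]]; case: j => [|[|[|[|j]]]] // _ _ /=.
  - rewrite (_ : f1 + f2 = v2)//; by apply/matrixP => x y; rewrite !mxE; field.
  - rewrite (_ : f1 + f3 = v1)//; by apply/matrixP => x y; rewrite !mxE; field.
  - by rewrite addrC subrK.
  - rewrite (_ : f2 + f3 = v3)//; by apply/matrixP => x y; rewrite !mxE; field.
  - rewrite (_ : f2 + (b - f1) = b - (v1 - v3)); first by apply: LB => //; exact: LB.
    by apply/matrixP => x y; rewrite !mxE; field.
  - rewrite (_ : f3 + (b - f1) = b - (v2 - v3)); first by apply: LB => //; exact: LB.
    by apply/matrixP => x y; rewrite !mxE; field.
move=> i j i4 j4 ij; have [lt|] := ltnP i j; first exact: key.
by rewrite leq_eqVlt eq_sym (negbTE ij)/= => lt; rewrite addrC; exact: key.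
Qed.

Lemma root_classification : (8 < n)%N -> (exists f, dframe n f) \/ (exists r, clique n r).
Proof.
move=> n8; have [k [r [k1 cr max]]] := maximal_clique.
have := clique_leq cr; rewrite leq_eqVlt => /orP[/eqP ekn|kn]; first by right; rewrite ekn in cr; exists r.
left; have [f df] := clique_to_dframe k1 cr max kn.
by apply: (dframe_full n8 _ df); rewrite leqnn/= ltnW// (leq_trans _ n8).
Qed.

End Roots.

(** * Coordinate models of types D and A *)

Section RootIso.
Context {R : realType} {n : nat}.
Variable L : set 'cV[R]_n.
Hypotheses (L0 : L 0) (LB : forall x y, L x -> L y -> L (x - y)) (Lu : unimodular L).
Implicit Types (x y z u w : 'cV[R]_n).

Section TypeD.
Variable f : nat -> 'cV[R]_n.
Hypotheses (n8 : (8 < n)%N) (df : dframe L n f).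

Let n4 : (4 <= n)%N. Proof. exact: leq_trans n8. Qed.

Lemma dframe_frame : frame (fun i : 'I_n => f i).
Proof.
split=> [i j ij|i]; first by rewrite df.1// (_ : (nat_of_ord i == j) = false)//; apply: contraNF ij => /eqP/val_inj ->.
by rewrite -dotp_eq0 df.1// eqxx oner_eq0.
Qed.

Let f1 (i : 'I_n) : dotp (f i) (f i) = 1. Proof. by rewrite df.1// eqxx. Qed.

Lemma dframe_root (i j : 'I_n) (s t : bool) : i != j -> shell L 2 ((-1) ^+ s *: f i + (-1) ^+ t *: f j).
Proof.
move=> ij; have ds := @dframe_signs R n L L0 LB n f n4 df (fun k => if k == i then s else t).
have := ds.2 i j (ltn_ord i) (ltn_ord j) ij; have := ds.1 i j (ltn_ord i) (ltn_ord j).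
have := ds.1 i i (ltn_ord i) (ltn_ord i); have := ds.1 j j (ltn_ord j) (ltn_ord j).
rewrite !eqxx -(inj_eq val_inj) in ij *; rewrite (eq_sym (val j)) (negbTE ij) => dj di dij Lij.
by split=> //; rewrite dotp_addrr di dj dij /=; ring.
Qed.

Lemma dframe_roots x : shell L 2 x ->
  exists (i j : 'I_n) (s t : bool), i != j /\ x = (-1) ^+ s *: f i + (-1) ^+ t *: f j.
Proof.
move=> [Lx x2]; have fb := dframe_frame; have n0 : (0 < n)%N by exact: ltn_trans n8.
have s2 : \sum_(i < n) dotp x (f i) ^+ 2 = 2.
  rewrite -x2 (frame_dotp x x fb); apply: eq_bigr => i _; by rewrite f1 divr1 expr2.
have [p0|np0] := boolP (dotp x (f 0%N) \is a Num.int); last first.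
  (* Halves of odd integers would give norm at least [n%:R / 4], which exceeds 2 as [n >= 9]. *)
  exfalso; have q (i : 'I_n) : 1 / 4 <= dotp x (f i) ^+ 2.
    apply: (int_half (coord_double_int L0 LB Lu n4 df Lx (ltn_ord i)) _).1.
    apply: contra np0 => pi; rewrite -(subrK (dotp x (f i)) (dotp x (f 0%N))).
    by rewrite rpredD// (coord_diff_int L0 LB Lu n4 df Lx).
  have : n%:R / 4 <= \sum_(i < n) dotp x (f i) ^+ 2.
    by rewrite -[X in X%:R]card_ord -sumr_const mulr_suml; apply: ler_sum => i _.
  rewrite s2; have : (9 : R) <= n%:R by rewrite (ler_nat R 9).
  lra.
have ip (i : 'I_n) : dotp x (f i) \is a Num.int.
  by rewrite -(subrK (dotp x (f 0%N)) (dotp x (f i))) rpredD// (coord_diff_int L0 LB Lu n4 df Lx).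
have [i [j [ij ei ej hl]]] := sum_sqr_int2 ip s2.
have sgn (a : R) : a = 1 \/ a = -1 -> exists s : bool, a = (-1) ^+ s.
  by case=> ->; [exists false|exists true; rewrite expr1].
have [s es] := sgn _ ei; have [t et] := sgn _ ej.
exists i, j, s, t; split=> //.
rewrite [LHS](frame_expand x fb) (bigD1 i)//= (bigD1 j)/= 1?eq_sym// big1 ?addr0 ?f1 ?divr1 -?es -?et//.
by move=> l /andP[li lj]; rewrite hl// mul0r scale0r.
Qed.

Lemma root_iso_D : root_iso (shell L 2) (@rootsD R n).
Proof.
exists (\matrix_(i < n, j < n) f i j 0).
have Mx x i : (\matrix_(i < n, j < n) f i j 0 *m x) i 0 = dotp x (f i).
  by rewrite mxE; apply: eq_bigr => j _; rewrite mxE mulrC.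
have Mf (s t : bool) (i j : 'I_n) :
    \matrix_(i < n, j < n) f i j 0 *m ((-1) ^+ s *: f i + (-1) ^+ t *: f j) =
    (-1) ^+ s *: unit_vec i + (-1) ^+ t *: unit_vec j.
  apply/matrixP => k l; rewrite ord1 Mx dotpDl !dotpZl !df.1// !mxE eqxx !andbT.
  by rewrite !(eq_sym _ (nat_of_ord k)).
split=> [x y _ _|].
  rewrite (frame_dotp x y dframe_frame); apply: eq_bigr => i _.
  by rewrite !Mx f1 divr1.
apply/seteqP; split=> [_ [x rx <-]|_ [i [j [s [t [ij ->]]]]]].
  by have [i [j [s [t [ij ->]]]]] := dframe_roots rx; exists i, j, s, t; split=> //; rewrite Mf.
by exists ((-1) ^+ s *: f i + (-1) ^+ t *: f j); [exact: dframe_root | rewrite Mf].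
Qed.
End TypeD.

End RootIso.

Section TypeA.
Context {R : realType}.
Local Notation n := 24%N.
Variable L : set 'cV[R]_n.
Hypotheses (L0 : L 0) (LB : forall x y, L x -> L y -> L (x - y)) (Lu : unimodular L).
Variable r : nat -> 'cV[R]_n.
Hypothesis cr : clique L n r.

Lemma clique_perp0 w : perp n r w -> w = 0.
Proof.
move=> pw; apply/eqP; apply: contraT => w0.
have [c [[i ci] e]] := dependent (fun i => if i == n then w else r i) (ltnSn n).
move: e; rewrite big_ord_recr /= => e.
have e' : \sum_(i < n) c (widen_ord (leqnSn n) i) *: r i + c ord_max *: w = 0.
  rewrite -[RHS]e; congr (_ + _); apply: eq_bigr => j _.
  by rewrite ifF//; apply/negbTE; rewrite neq_ltn ltn_ord.
have cm : c ord_max = 0.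
  have := congr1 (fun x => dotp x w) e'; rewrite dotpDl dotp0l dotp_suml big1 ?add0r => [|j _].
    by rewrite dotpZl => /eqP; rewrite mulf_eq0 dotp_eq0 (negbTE w0) orbF => /eqP.
  by rewrite dotpZl pw ?mulr0.
move: e'; rewrite cm scale0r addr0 => e'.
have := clique_gram (fun j => c (widen_ord (leqnSn n) j)) cr; rewrite e' dotp0l => /eqP.
rewrite eq_sym paddr_eq0 ?sqr_ge0//; last by apply: sumr_ge0 => j _; exact: sqr_ge0.
move=> /andP[]; rewrite psumr_eq0 => [/allP h _|j _]; last exact: sqr_ge0.
move/eqP: ci; case; case: (unliftP ord_max i) => [j ->|->]//.
have := h j (mem_index_enum _); rewrite sqrf_eq0 => /eqP <-; congr c.
by apply/val_inj; rewrite /= /bump leqNgt ltn_ord.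
Qed.

(* The convention [cvec 24 = 0] makes the roots of type A the differences [cvec i - cvec j]. *)
Definition cvec (i : 'I_n.+1) : 'cV[R]_n := if i == ord_max then 0 else r i.

Lemma cvec_dot i j : dotp (cvec i) (cvec j) =
  (i == j)%:R - (i == ord_max)%:R - (j == ord_max)%:R + 1.
Proof.
rewrite /cvec; have lt (k : 'I_n.+1) : k != ord_max -> (k < n)%N.
  by move=> k0; have := ltn_ord k; rewrite ltnS leq_eqVlt => /orP[/eqP e|//]; case/eqP: k0; exact/val_inj.
have [ei|i0] := eqVneq i ord_max; have [ej|j0] := eqVneq j ord_max.
- by rewrite dotp0l ei ej eqxx /=; ring.
- by rewrite dotp0l ei eq_sym (negbTE j0) /=; ring.
- by rewrite dotp0r ej (negbTE i0) /=; ring.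
have [<-|ij] := eqVneq i j; first by rewrite (cr.1 _ (lt i i0)).2 /=; ring.
by rewrite cr.2 ?lt//=; ring.
Qed.

Lemma cvec_root i j : i != j -> shell L 2 (cvec i - cvec j).
Proof.
move=> ij; split; last by rewrite dotp_subrr !cvec_dot !eqxx (negbTE ij) /=; ring.
have Lc k : L (cvec k).
  rewrite /cvec; case: eqVneq => // k0; apply: (cr.1 k _).1.
  by have := ltn_ord k; rewrite ltnS leq_eqVlt => /orP[/eqP e|//]; case/eqP: k0; exact/val_inj.
exact: LB.
Qed.

(** The inverse of the Gram matrix, identity minus [1 / 25] times all-ones, expresses [x] and its
    norm through the products [m i], which are 0, 1 or -1 unless [x] is a member up to sign.
    Arithmetic then leaves one product 1, one -1 and the others 0. *)
Lemma clique_roots x : shell L 2 x -> exists i j, i != j /\ x = cvec i - cvec j.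
Proof.
move=> rx; have [Lx x2] := rx.
pose lo (i : 'I_n) : 'I_n.+1 := widen_ord (leqnSn n) i.
have lom i : lo i != ord_max by apply/eqP => /(congr1 val)/= e; have := ltn_ord i; rewrite e ltnn.
have lov i : cvec (lo i) = r i by rewrite /cvec (negbTE (lom i)).
have loi i j : (lo i == lo j) = (i == j) by rewrite -!(inj_eq val_inj).
have vm : cvec ord_max = 0 by rewrite /cvec eqxx.
have [[i [e|e]]|h] := pselect (exists i : 'I_n, x = r i \/ x = - r i).
- by exists (lo i), ord_max; rewrite lom lov vm subr0.
- by exists ord_max, (lo i); rewrite eq_sym lom lov vm sub0r.
pose m (i : 'I_n) := dotp x (r i); pose S := \sum_i m i.
have im i : m i \is a Num.int by apply: (lattice_int Lu) => //; exact: (cr.1 i (ltn_ord i)).1.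
have m1 i : [\/ m i = 0, m i = 1 | m i = -1].
  case: (root_dot Lu rx (cr.1 i (ltn_ord i))) => // e; exfalso; apply: h; exists i; by [left|right].
pose c i := m i - S / 25.
have cS : \sum_i c i = S / 25.
  by rewrite sumrB -/S sumr_const card_ord -mulr_natl; field.
have xE : x = \sum_i c i *: r i.
  apply/eqP; rewrite -subr_eq0; apply/eqP/clique_perp0 => k kn.
  rewrite dotpBr dotp_sumr (bigD1 (Ordinal kn))//= dotpZr (cr.1 k kn).2.
  rewrite (eq_bigr c) => [|j jk]; last first.
    by rewrite dotpZr cr.2// ?mulr1// eq_sym; apply: contra jk => /eqP e; apply/eqP/val_inj.
  have := cS; rewrite (bigD1 (Ordinal kn))//= => cS'.
  rewrite dotpC -[dotp x (r k)]/(m (Ordinal kn)); move: cS'; rewrite /c; lra.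
have e2 : \sum_i m i ^+ 2 - S ^+ 2 / 25 = 2.
  rewrite -x2 {1}xE dotp_suml [RHS](eq_bigr (fun i => m i ^+ 2 - S / 25 * m i)) => [|i _].
    by rewrite sumrB -mulr_sumr -/S; ring.
  by rewrite dotpZl dotpC -/(m i) /c; ring.
pose s := \sum_i m i ^+ 2.
have s24 : s <= 24.
  have : \sum_(i < n) m i ^+ 2 <= \sum_(i < n) 1.
    by apply: ler_sum => i _; case: (m1 i) => ->; rewrite ?expr0n ?sqrrN ?expr1n.
  by rewrite sumr_const card_ord.
have Ss : S ^+ 2 <= s ^+ 2.
  have up : S <= s by apply: ler_sum => i _; case: (m1 i) => ->; lra.
  have dn : - S <= s by rewrite -sumrN; apply: ler_sum => i _; case: (m1 i) => ->; lra.
  have s0 : 0 <= s by apply: sumr_ge0 => i _; exact: sqr_ge0.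
  nra.
have is' : s \is a Num.int by apply: rpred_sum => i _; rewrite rpredX.
have iS : S \is a Num.int by apply: rpred_sum => i _.
have [s2 S0] : s = 2 /\ S = 0.
  move: e2 s24 Ss; rewrite -/s -(floorK is') -(floorK iS).
  move: (Num.floor s) (Num.floor S) => a b e2 s24 Ss.
  have {}e2 : 25 * (a - 2) = b ^+ 2.
    by apply/eqP; rewrite -(eqr_int R) intrM intrB rmorphXn/=; apply/eqP; lra.
  have {}s24 : a <= 24 by rewrite -(ler_int R).
  have {}Ss : b ^+ 2 <= a ^+ 2 by rewrite -(ler_int R) !rmorphXn.
  have a2 : 2 <= a by nia.
  (* From [25 * (a - 2) = b ^+ 2 <= a ^+ 2] and [a <= 24]; the two larger values fail because 525
     and 550 are not squares. *)
  have : a = 2 \/ a = 23 \/ a = 24 by nia.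
  case=> [ea|[ea|ea]]; last first.
  - exfalso; have h1 : b <= 23 by nia.
    have h2 : -23 <= b by nia.
    nia.
  - exfalso; have h1 : b <= 22 by nia.
    have h2 : -22 <= b by nia.
    nia.
  have eb : b = 0 by nia.
  by rewrite ea eb; split.
have [i [j [ij ei ej hl]]] := sum_sqr_int2 im s2.
have Sij : m i + m j = 0.
  by rewrite -S0 /S (bigD1 i)//= (bigD1 j)/= 1?eq_sym// big1 ?addr0// => l /andP[li lj]; exact: hl.
have fin a b : a != b -> m a = 1 -> m b = -1 -> (forall l, l != a -> l != b -> m l = 0) ->
    exists i j, i != j /\ x = cvec i - cvec j.
  move=> ab ea eb hab; exists (lo a), (lo b); rewrite loi !lov; split=> //.
  rewrite xE (bigD1 a)//= (bigD1 b)/= 1?eq_sym// big1 ?addr0 => [|l /andP[la lb]].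
    by rewrite /c ea eb S0 mul0r !subr0 scale1r scaleN1r.
  by rewrite /c hab// S0 mul0r subr0 scale0r.
case: ei ej Sij => ei [] ej; rewrite ei ej => Sij; first by lra.
- exact: (fin i j).
- by apply: (fin j i); rewrite 1?eq_sym// => l lj li; exact: hl.
- by lra.
Qed.

Lemma root_iso_A : root_iso (shell L 2) (@rootsA R n).
Proof.
(* [dual] is the dual basis of the clique, so that [M] sends [r i] to [e_i - e_24] with indices
   starting at 0. *)
pose sig := \sum_(i < n) r i; pose dual (i : 'I_n) := r i - (1 / 25) *: sig.
pose lo (i : 'I_n) : 'I_n.+1 := widen_ord (leqnSn n) i.
pose ev (i : 'I_n.+1) : 'cV[R]_n.+1 := unit_vec i.
pose M : 'M[R]_(n.+1, n) := \matrix_(a, j) \sum_(i < n) dual i j 0 * (ev (lo i) - ev ord_max) a 0.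
have Mx x : M *m x = \sum_i dotp x (dual i) *: (ev (lo i) - ev ord_max).
  apply/matrixP => a l; rewrite ord1 mxE summxE.
  under eq_bigr => j _ do rewrite mxE mulr_suml.
  rewrite exchange_big /=; apply: eq_bigr => i _; rewrite [RHS]mxE /dotp mulr_suml.
  by apply: eq_bigr => j _; ring.
have rd (i j : 'I_n) : dotp (r i) (dual j) = (i == j)%:R.
  rewrite dotpBr dotpZr dotp_sumr (bigD1 i)//= (cr.1 i (ltn_ord i)).2 (eq_bigr (fun=> 1)) => [|l li]; last first.
    by rewrite cr.2// eq_sym; apply: contra li => /eqP e; apply/eqP/val_inj.
  rewrite sumr_const cardC1 card_ord; case: eqVneq => [->|ij].
    by rewrite (cr.1 j (ltn_ord j)).2 /=; field.
  by rewrite cr.2//=; field.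
have Mv i : M *m cvec i = ev i - ev ord_max.
  rewrite /cvec; case: eqVneq => [->|i0]; first by rewrite mulmx0 subrr.
  have ilt : (i < n)%N.
    by have := ltn_ord i; rewrite ltnS leq_eqVlt => /orP[/eqP e|//]; case/eqP: i0; exact/val_inj.
  rewrite Mx (bigD1 (Ordinal ilt))//= (rd (Ordinal ilt)) eqxx scale1r big1 ?addr0 => [|j ji].
    by congr (ev _ - _); exact/val_inj.
  by rewrite (rd (Ordinal ilt)) eq_sym (negbTE ji) scale0r.
have Mvv i j : M *m (cvec i - cvec j) = ev i - ev j.
  by rewrite mulmxBr !Mv; apply/matrixP => a l; rewrite !mxE; ring.
have evd i j : dotp (ev i) (ev j) = (i == j)%:R.
  rewrite /dotp (bigD1 i)//= big1 ?addr0 => [|k ki]; first by rewrite !mxE !eqxx mul1r andbT.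
  by rewrite !mxE (negbTE ki) mul0r.
exists M; split=> [x y rx ry|].
  have [i [j [_ ->]]] := clique_roots rx; have [k [l [_ ->]]] := clique_roots ry.
  by rewrite !Mvv !dotpBl !dotpBr !evd !cvec_dot; ring.
apply/seteqP; split=> [_ [x rx <-]|_ [i [j [ij ->]]]].
  by have [i [j [ij ->]]] := clique_roots rx; exists i, j; rewrite Mvv.
by exists (cvec i - cvec j); [exact: cvec_root | rewrite Mvv].
Qed.

End TypeA.

(** * Irreducibility of the coordinate models *)

Section IrreducibleModels.
Context {R : realType} {n : nat}.

(** Two roots whose supports share exactly one index are not orthogonal, so they belong to the same
    part. An index [m] outside both supports, available in dimension at least 5, links any two roots
    by such steps. *)
Lemma irreducible_pairs (Psi : set 'cV[R]_n) : (5 <= n)%N ->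
  (forall x, Psi x -> exists (i j : 'I_n) (a b : R), [/\ i != j, a != 0, b != 0 & x = a *: unit_vec i + b *: unit_vec j]) ->
  (forall i j : 'I_n, i != j -> exists a b : R, [/\ a != 0, b != 0 & Psi (a *: unit_vec i + b *: unit_vec j)]) ->
  irreducible_roots Psi.
Proof.
move=> n5 supp ex.
have n0 : (0 < n)%N by exact: leq_trans n5.
have n1 : (1 < n)%N by exact: leq_trans n5.
split; first by have [a [b [_ _ h]]] := ex (Ordinal n0) (Ordinal n1) isT; eexists; exact: h.
move=> A B AB orth.
have evd (i j : 'I_n) : dotp (unit_vec i) (unit_vec j) = (i == j)%:R :> R.
  rewrite /dotp (bigD1 i)//= big1 ?addr0 => [|k ki]; first by rewrite !mxE !eqxx mul1r andbT.
  by rewrite !mxE (negbTE ki) mul0r.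
have [[x Ax]|nA] := pselect (A !=set0); last by left; apply/eqP/negPn/negP => /set0P.
right; apply/seteqP; split=> // y By.
have PA x' : A x' -> Psi x' by rewrite -AB; left.
have PB x' : B x' -> Psi x' by rewrite -AB; right.
have step (i j k : 'I_n) (a b c d : R) : i != j -> j != k -> i != k -> b != 0 -> c != 0 ->
    A (a *: unit_vec i + b *: unit_vec j) -> Psi (c *: unit_vec j + d *: unit_vec k) ->
    A (c *: unit_vec j + d *: unit_vec k).
  move=> ij jk ik b0 c0 Ax'; rewrite -AB => -[//|By'].
  have := orth _ _ Ax' By'; rewrite !dotpDl !dotpDr !dotpZl !dotpZr !evd eqxx (negbTE ij) (negbTE jk) (negbTE ik).
  rewrite !mulr0 !add0r mulr1 addr0 => /eqP; by rewrite mulf_eq0 (negbTE b0) (negbTE c0).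
have [i [j [a [b [ij a0 b0 xE]]]]] := supp x (PA x Ax).
have [k [l [c [d [kl c0 d0 yE]]]]] := supp y (PB y By).
have [m] : exists m, m \notin [:: i; j; k; l].
  apply/existsP; rewrite -[X in is_true X]negbK negb_exists; apply/negP => /forallP h.
  have : (#|'I_n| <= size [:: i; j; k; l])%N.
    by apply: leq_trans (card_size _); apply/subset_leq_card/fintype.subsetP => z _; have := h z; rewrite negbK.
  by rewrite card_ord leqNgt n5.
rewrite !inE !negb_or => /and4P[mi mj mk ml].
rewrite xE in Ax; rewrite yE in By.
have [a1 [b1 [a10 b10 P1]]] := ex j m (ltac:(by rewrite eq_sym)).
have A1 := step i j m _ _ _ _ ij (ltac:(by rewrite eq_sym)) (ltac:(by rewrite eq_sym)) b0 a10 Ax P1.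
have Ay : A (c *: unit_vec k + d *: unit_vec l).
  have PyB : Psi (c *: unit_vec k + d *: unit_vec l) by exact: PB.
  have [ek|jk] := eqVneq j k.
    have [a2 [b2 [a20 b20 P2]]] := ex m l ml.
    have [el|jl] := eqVneq j l; first by rewrite -ek el eqxx in kl.
    have A2 := step j m l _ _ _ _ (ltac:(by rewrite eq_sym)) ml jl b10 a20 A1 P2.
    rewrite addrC in PyB *; apply: (step m l k _ _ _ _ ml _ mk b20 d0 A2 PyB); by rewrite eq_sym.
  have [a2 [b2 [a20 b20 P2]]] := ex m k mk.
  have A2 := step j m k _ _ _ _ (ltac:(by rewrite eq_sym)) mk jk b10 a20 A1 P2.
  exact: (step m k l _ _ _ _ mk kl ml b20 c0 A2 PyB).
have := orth _ _ Ay By => /eqP; rewrite dotp_eq0 => /eqP e.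
have := congr1 (fun v => dotp v (unit_vec k)) e.
rewrite dotpDl !dotpZl !evd eqxx (eq_sym l) (negbTE kl) mulr0 addr0 mulr1 dotp0l => /eqP.
by rewrite (negbTE c0).
Qed.

End IrreducibleModels.

Lemma irreducible_rootsD (R : realType) : irreducible_roots (@rootsD R 24).
Proof.
apply: irreducible_pairs => // [x [i [j [s [t [ij ->]]]]]|i j ij].
  by exists i, j, ((-1) ^+ s), ((-1) ^+ t); split=> //; rewrite signr_eq0.
exists 1, 1; split; rewrite ?oner_eq0//.
by exists i, j, false, false; rewrite expr0.
Qed.

Lemma irreducible_rootsA (R : realType) : irreducible_roots (@rootsA R 24).
Proof.
apply: irreducible_pairs => // [x [i [j [ij ->]]]|i j ij].
  by exists i, j, 1, (-1); split=> //; rewrite ?oppr_eq0 ?oner_eq0// scale1r scaleN1r.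
exists 1, (-1); split; rewrite ?oppr_eq0 ?oner_eq0//.
by exists i, j; rewrite scale1r scaleN1r.
Qed.

Lemma root_iso_irreducible {R : realType} {m n : nat} (Phi : set 'cV[R]_m) (Psi : set 'cV[R]_n) :
  root_iso Phi Psi -> irreducible_roots Psi -> irreducible_roots Phi.
Proof.
move=> [M [Md MP]] [[y Py] irr]; split.
  by move: Py; rewrite -MP => -[x Px _]; exists x.
move=> A B AB orth.
have PA x : A x -> Phi x by rewrite -AB; left.
have PB x : B x -> Phi x by rewrite -AB; right.
have := irr [set M *m x | x in A] [set M *m x | x in B]; case.
- by rewrite -MP -AB image_setU.
- by move=> _ _ [x Ax <-] [z Bz <-]; rewrite Md; [exact: orth | exact: PA | exact: PB].
- by move=> e; left; apply/seteqP; split=> // x Ax; have : [set M *m x | x in A] (M *m x) by [exists x]; rewrite e.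
- by move=> e; right; apply/seteqP; split=> // x Bx; have : [set M *m x | x in B] (M *m x) by [exists x]; rewrite e.
Qed.

(** * Quadratic forms near the identity *)
Section QuadraticForms.
Context {R : realType} {n : nat}.
Implicit Types (x y p q : 'cV[R]_n) (K Y : 'M[R]_n).

Lemma dotpE x y : dotp x y = (x^T *m y) 0 0.
Proof. by rewrite mxE; apply: eq_bigr => i _; rewrite mxE. Qed.

Lemma quadE K x : quad K x = dotp x (K *m x).
Proof. by rewrite dotpE /quad mulmxA. Qed.

Lemma quad_sum K x : quad K x = \sum_i \sum_j K i j * (x i 0 * x j 0).
Proof.
rewrite quadE; apply: eq_bigr => i _; rewrite mxE mulr_sumr; apply: eq_bigr => j _; ring.
Qed.

Lemma quadD K K' x : quad (K + K') x = quad K x + quad K' x.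
Proof. by rewrite !quadE mulmxDl dotpDr. Qed.

Lemma quad1 x : quad 1%:M x = dotp x x.
Proof. by rewrite quadE mul1mx. Qed.

Lemma quad0r K : quad K 0 = 0.
Proof. by rewrite quadE dotp0l. Qed.

Lemma sqr_coord_le x i : x i 0 ^+ 2 <= dotp x x.
Proof.
rewrite /dotp (bigD1 i)//= -expr2 lerDl; apply: sumr_ge0 => j _.
by rewrite -expr2 sqr_ge0.
Qed.

Lemma prod_coord_le x y i j : `|x i 0 * y j 0| <= (dotp x x + dotp y y) / 2.
Proof.
have h1 := sqr_coord_le x i; have h2 := sqr_coord_le y j.
have h3 : 0 <= (x i 0 - y j 0) ^+ 2 by exact: sqr_ge0.
have h4 : 0 <= (x i 0 + y j 0) ^+ 2 by exact: sqr_ge0.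
rewrite ler_norml; apply/andP; split; nra.
Qed.

Lemma quad_bound K x (e : R) : 0 <= e -> (forall i j, `|K i j| <= e) ->
  `|quad K x| <= (n%:R ^+ 2 * e) * dotp x x.
Proof.
move=> e0 Ke; rewrite quad_sum.
apply: le_trans (ler_norm_sum _ _ _) _.
apply: (@le_trans _ _ (\sum_(i < n) \sum_(j < n) e * dotp x x)).
  apply: ler_sum => i _; apply: le_trans (ler_norm_sum _ _ _) _; apply: ler_sum => j _.
  rewrite normrM; apply: ler_pM => //; have := prod_coord_le x x i j; lra.
rewrite !sumr_const !card_ord -mulrnA -[leLHS]mulr_natl natrM le_eqVlt; apply/orP; left; apply/eqP; ring.
Qed.

Lemma mul_outer x p q : (p *m q^T) *m x = dotp q x *: p.
Proof.
by rewrite -mulmxA; apply/matrixP => i j; rewrite ord1 !mxE big_ord1 !mxE dotpE mxE mulrC.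
Qed.

(* The shears [1 + s p q^T] with [p] orthogonal to [q] generate curves [T^T T] in the manifold of forms of determinant 1. *)
Definition shear p q (s : R) : 'M[R]_n := 1%:M + s *: (p *m q^T).

Lemma outer_sq p q : dotp q p = 0 -> (p *m q^T) *m (p *m q^T) = 0.
Proof.
move=> qp; rewrite mulmxA -(mulmxA p) (_ : q^T *m p = 0) ?mulmx0 ?mul0mx//.
by apply/matrixP => i j; rewrite !ord1 -dotpE qp mxE.
Qed.

Lemma shearN p q s : dotp q p = 0 -> shear p q s *m shear p q (- s) = 1%:M.
Proof.
move=> qp; rewrite /shear mulmxDl !mulmxDr !mul1mx mulmx1 -scalemxAl -scalemxAr outer_sq// !scaler0 addr0.
by rewrite -addrA -scalerDl addNr scale0r addr0.
Qed.

(** The reflection in [p] conjugates the shear into the one with parameter [- s], its inverse, so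
    its determinant equals the inverse of itself. The square is what enters [shear_form]. *)
Lemma det_shear_sqr p q s : dotp q p = 0 -> \det (shear p q s) ^+ 2 = 1.
Proof.
move=> qp; have [->|p0] := eqVneq p 0.
  by rewrite /shear mul0mx scaler0 addr0 det1 expr1n.
have P0 : dotp p p != 0 by rewrite dotp_eq0.
pose S := 1%:M - (2 / dotp p p) *: (p *m p^T) : 'M[R]_n.
have Sp : S *m p = - p.
  rewrite mulmxBl mul1mx -scalemxAl mul_outer scalerA divfK// scaler_nat mulr2n; apply/matrixP => i j.
  by rewrite !mxE; ring.
have ST : S^T = S by rewrite linearB linearZ/= trmx1 trmx_mul trmxK.
have qS : q^T *m S = q^T.
  rewrite mulmxBr mulmx1 -scalemxAr mulmxA (_ : q^T *m p = 0) ?mul0mx ?scaler0 ?subr0//.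
  by apply/matrixP => i j; rewrite !ord1 -dotpE qp mxE.
have SS : S *m S = 1%:M.
  rewrite {2}/S mulmxBr mulmx1 -scalemxAr mulmxA Sp mulNmx scalerN opprK /S subrK//.
have e : S *m shear p q s *m S = shear p q (- s).
  rewrite /shear mulmxDr mulmx1 mulmxDl SS; congr (_ + _).
  by rewrite -scalemxAr -scalemxAl mulmxA Sp -mulmxA qS mulNmx scalerN scaleNr.
have d : \det (shear p q (- s)) = \det (shear p q s).
  have dS : \det S * \det S = 1 by rewrite -det_mulmx SS det1.
  by rewrite -e !det_mulmx mulrAC dS mul1r.
by rewrite expr2 -{2}d -det_mulmx shearN// det1.
Qed.

Definition shear_form p q s : 'M[R]_n := (shear p q s)^T *m shear p q s.
Definition shear_diff p q s : 'M[R]_n := s *: (p *m q^T + q *m p^T) + (s ^+ 2 * dotp p p) *: (q *m q^T).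

Lemma shear_formE p q s : shear_form p q s = 1%:M + shear_diff p q s.
Proof.
have sT : (shear p q s)^T = 1%:M + s *: (q *m p^T).
  by rewrite linearD/= trmx1 linearZ/= trmx_mul trmxK.
rewrite /shear_form sT /shear mulmxDl !mulmxDr !mul1mx mulmx1.
rewrite -scalemxAl -!scalemxAr scalerA -expr2 mulmxA -(mulmxA q) (_ : p^T *m p = (dotp p p)%:M); last first.
  by apply/matrixP => i j; rewrite !ord1 -dotpE mxE eqxx mulr1n.
rewrite mul_mx_scalar -scalemxAl scalerA -addrA; congr (_ + _).
by rewrite /shear_diff scalerDr addrA.
Qed.

Lemma shear_unit_posdef p q s : dotp q p = 0 -> unit_posdef (shear_form p q s).
Proof.
move=> qp; split; first by rewrite /shear_form trmx_mul trmxK.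
- move=> x x0; rewrite /quad -mulmxA /shear_form -[_^T *m _ *m x]mulmxA mulmxA -trmx_mul -dotpE dotp_gt0.
  apply: contraNneq x0 => e.
  have h := mulmx1C (shearN (- s) qp); rewrite opprK in h.
  by rewrite -[x]mul1mx -(shearN (- s) qp) opprK -mulmxA e mulmx0.
- by rewrite det_mulmx det_tr -expr2 det_shear_sqr.
Qed.

Lemma quad_shear_diff p q s x :
  quad (shear_diff p q s) x = 2 * s * dotp p x * dotp q x + s ^+ 2 * dotp p p * dotp q x ^+ 2.
Proof.
rewrite quadE /shear_diff mulmxDl -!scalemxAl mulmxDl !mul_outer dotpDr !dotpZr dotpDr !dotpZr.
rewrite (dotpC x p) (dotpC x q); ring.
Qed.

Lemma trace_shear_diff p q s : dotp q p = 0 -> \tr (shear_diff p q s) = s ^+ 2 * dotp p p * dotp q q.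
Proof.
have tro (u v : 'cV[R]_n) : \tr (u *m v^T) = dotp v u by rewrite mxtrace_mulC trace_mx11 dotpE.
by move=> qp; rewrite /shear_diff linearD !linearZ linearD/= !tro qp (dotpC p) qp addr0 mulr0 add0r.
Qed.

Lemma shear_diff_entry p q s i j : `|s| <= 1 ->
  `|shear_diff p q s i j| <= `|s| * (dotp p p + dotp q q + dotp p p * dotp q q).
Proof.
move=> s1; have -> : shear_diff p q s i j =
    s * (p i 0 * q j 0 + q i 0 * p j 0) + s * (s * (dotp p p * (q i 0 * q j 0))).
  by rewrite !mxE !big_ord1 !mxE; ring.
apply: le_trans (ler_normD _ _) _; rewrite !normrM -mulrDr; apply: ler_wpM2l => //.
apply: lerD.
  apply: le_trans (ler_normD _ _) _.
  have := prod_coord_le p q i j; have := prod_coord_le q p i j; lra.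
rewrite -[leRHS]mul1r; apply: ler_pM => //.
rewrite (ger0_norm (dotp_ge0 p)); apply: ler_wpM2l; first exact: dotp_ge0.
have := prod_coord_le q q i j; rewrite normrM; lra.
Qed.

End QuadraticForms.

Section TraceDeterminant.
Context {R : realType}.

Lemma prod_add1_approx (m : nat) (k : 'I_m -> R) (e : R) : 0 <= e <= 1 ->
  (forall i, `|k i| <= e) ->
  `|\prod_i (1 + k i) - 1 - \sum_i k i| <= 3 ^+ m * e ^+ 2.
Proof.
move=> /andP[e0 e1]; elim: m k => [|m IH] k ke.
  by rewrite !big_ord0 subrr subr0 normr0 expr0 mul1r sqr_ge0.
rewrite !big_ord_recl; set P := \prod_(i < m) _; set S := \sum_(i < m) _.
have hP : `|P - 1 - S| <= 3 ^+ m * e ^+ 2 by apply: IH => i; exact: ke.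
have hS : `|S| <= 3 ^+ m * e.
  apply: le_trans (ler_norm_sum _ _ _) _; apply: (@le_trans _ _ (\sum_(i < m) e)).
    by apply: ler_sum => i _; exact: ke.
  rewrite sumr_const card_ord -[leLHS]mulr_natl ler_wpM2r// -natrX ler_nat.
  by apply: ltnW; exact: ltn_expl.
have -> : (1 + k ord0) * P - 1 - (k ord0 + S) = (P - 1 - S) * (1 + k ord0) + k ord0 * S by ring.
apply: le_trans (ler_normD _ _) _; rewrite !normrM exprS.
have h0 := ke ord0.
have h1 : `|1 + k ord0| <= 2 by apply: le_trans (ler_normD _ _) _; rewrite normr1; lra.
have h2 : `|P - 1 - S| * `|1 + k ord0| <= 3 ^+ m * e ^+ 2 * 2 by exact: ler_pM.
have h3 : `|k ord0| * `|S| <= e * (3 ^+ m * e) by exact: ler_pM.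
lra.
Qed.

(* Every permutation other than the identity moves two indices, so it contributes to second order. *)
Lemma trace_det_quadratic (n : nat) : exists2 D : R, 0 <= D &
  forall (K : 'M[R]_n) (e : R), 0 <= e <= 1 -> (forall i j, `|K i j| <= e) ->
    \det (1%:M + K) = 1 -> `|\tr K| <= D * e ^+ 2.
Proof.
exists (3 ^+ n + \sum_(s : {perm 'I_n}) 2 ^+ n); first by rewrite addr_ge0// sumr_ge0// => ? _; rewrite exprn_ge0.
move=> K e e01 Ke; have /andP[e0 e1] := e01.
rewrite /determinant (bigD1 (1%g : {perm 'I_n}))//= odd_perm1 expr0 mul1r => dK.
have eP : \prod_i (1%:M + K) i ((1%g : {perm 'I_n}) i) = \prod_i (1 + K i i).
  by apply: eq_bigr => i _; rewrite perm1 !mxE eqxx.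
have hP := prod_add1_approx e01 (fun i => Ke i i).
have hQ : `|\sum_(s : {perm 'I_n} | s != (1%g : {perm 'I_n})) (-1) ^+ s * \prod_i (1%:M + K) i (s i)| <= (\sum_(s : {perm 'I_n}) 2 ^+ n) * e ^+ 2.
  apply: le_trans (ler_norm_sum _ _ _) _; rewrite mulr_suml big_mkcond; apply: ler_sum => s _.
  case: ifPn => s1; last by rewrite mulr_ge0// ?exprn_ge0.
  rewrite normrM normrX normrN1 expr1n mul1r normr_prod.
  have [i si] : exists i, s i != i.
    by apply/existsP; rewrite -negb_forall; apply: contra s1 => /forallP h; apply/eqP/permP => i; rewrite perm1; apply/eqP.
  have ssi : s (s i) != s i by apply: contra si => /eqP/perm_inj ->.
  have ent a b : `|(1%:M + K) a b| <= 2.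
    rewrite !mxE; apply: le_trans (ler_normD _ _) _; apply: (@le_trans _ _ (1 + 1)) => //; apply: lerD.
      by case: (a == b); rewrite ?mulr1n ?mulr0n ?normr1 ?normr0.
    exact: le_trans (Ke a b) e1.
  have off a : s a != a -> `|(1%:M + K) a (s a)| <= e.
    by move=> sa; rewrite !mxE eq_sym (negbTE sa) add0r.
  rewrite (bigD1 i)//= (bigD1 (s i))//= mulrA expr2 mulrC.
  have h2 : \prod_(j | (j != i) && (j != s i)) `|(1%:M + K) j (s j)| <= 2 ^+ n.
    apply: (@le_trans _ _ (\prod_(j < n) 2)); last by rewrite prodr_const card_ord.
    rewrite [leLHS]big_mkcond; apply: ler_prod => j _; case: ifP => _; first by rewrite normr_ge0 ent.
    by rewrite ler01 ler1n.
  apply: ler_pM => //; first by apply: prodr_ge0.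
  by apply: ler_pM => //; apply: off.
rewrite eP in dK; rewrite mulrDl.
set P := \prod_i _ in hP dK; set Q := \sum_(s | _) _ in dK hQ.
have -> : \tr K = - (P - 1 - \sum_i K i i) - Q by rewrite /mxtrace; lra.
by apply: le_trans (ler_normD _ _) _; rewrite !normrN; apply: lerD.
Qed.

End TraceDeterminant.

(** Congruence by the inverse [H] of the matrix with columns [g i] recovers [K] from its values on
    pairs of the family; [C] is the square of the sum of the absolute entries of [H]. *)
Lemma form_control {R : realType} {n : nat} (g : 'I_n -> 'cV[R]_n) :
  (forall c : 'I_n -> R, \sum_i c i *: g i = 0 -> forall i, c i = 0) ->
  exists2 C : R, 0 <= C & forall (K : 'M[R]_n) (m : R), 0 <= m ->
    (forall i j, `|dotp (g i) (K *m g j)| <= m) -> forall i j, `|K i j| <= C * m.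
Proof.
move=> free; pose G : 'M[R]_n := \matrix_(k, i) g i k 0.
have Gc (c : 'cV[R]_n) : G *m c = \sum_i c i 0 *: g i.
  apply/matrixP => a b; rewrite ord1 mxE summxE; apply: eq_bigr => i _; rewrite !mxE; exact: mulrC.
have uG : G \in unitmx.
  rewrite -unitmx_tr -row_free_unit -kermx_eq0; apply/eqP/row_matrixP => i; rewrite row0.
  set u := row i _; have uG0 : u *m G^T = 0 by apply/sub_kermxP; exact: row_sub.
  have Gu : G *m u^T = 0 by rewrite -[G]trmxK -trmx_mul uG0 trmx0.
  rewrite Gc in Gu; apply/matrixP => a j; rewrite [a]ord1 [RHS]mxE.
  by have := free _ Gu j; rewrite mxE.
pose H := invmx G; pose h := \sum_i \sum_j `|H i j|.
have hr j : \sum_k `|H k j| <= h.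
  apply: ler_sum => k _; rewrite (bigD1 j)//= lerDl; exact: sumr_ge0.
exists (h * h); first by rewrite -expr2 sqr_ge0.
move=> K m m0 Km i j.
pose N := G^T *m K *m G.
have KN : K = H^T *m N *m H.
  by rewrite /N !mulmxA -trmx_mul (mulmxV uG) trmx1 mul1mx -mulmxA mulmxV// mulmx1.
have Nm k l : `|N k l| <= m.
  suff -> : N k l = dotp (g k) (K *m g l) by [].
  rewrite /N -mulmxA mxE; apply: eq_bigr => a _; rewrite !mxE; congr (_ * _).
  by apply: eq_bigr => b _; rewrite !mxE.
rewrite KN mxE; apply: le_trans (ler_norm_sum _ _ _) _.
apply: (@le_trans _ _ (\sum_l h * m * `|H l j|)); last first.
  by rewrite -mulr_sumr [leRHS]mulrAC ler_wpM2l// mulr_ge0// sumr_ge0// => ? _; rewrite sumr_ge0.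
apply: ler_sum => l _; rewrite normrM ler_wpM2r// mxE; apply: le_trans (ler_norm_sum _ _ _) _.
apply: (@le_trans _ _ (\sum_k `|H k i| * m)); last by rewrite -mulr_suml ler_wpM2r.
by apply: ler_sum => k _; rewrite normrM mxE ler_wpM2l.
Qed.

Lemma near_one_within {R : realType} {n : nat} (S P : set 'M[R]_n) :
  (\forall Y \near within S (nbhs (1%:M : 'M[R]_n)), P Y) <->
  exists2 e : R, 0 < e & forall K : 'M[R]_n, S (1%:M + K) -> (forall i j, `|K i j| < e) -> P (1%:M + K).
Proof.
split.
  rewrite near_withinE => /nbhs_ballP[e e0 H]; exists e => // K SK Ke; apply: H => //.
  by split=> // i j; rewrite /ball/= !mxE opprD addrA subrr sub0r normrN.
move=> [e e0 H]; rewrite near_withinE; apply/nbhs_ballP; exists e => // Y Ye SY.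
have -> : Y = 1%:M + (Y - 1%:M) by rewrite addrC subrK.
apply: H; first by rewrite addrC subrK.
by move=> i j; have := Ye.2 i j; rewrite /ball/= distrC !mxE.
Qed.

(** * The energy near the identity *)
Section Energy.
Context {R : realType} {n : nat} (L : set 'cV[R]_n).
Hypothesis n0 : (0 < n)%N.
Hypothesis L00 : L 0.
Hypothesis Lnorm : forall x, L x -> x != 0 -> 2 <= dotp x x.

Definition weight (a : R) (x : 'cV[R]_n) : R := expR (- (a * dotp x x)).
Definition moment (k : nat) (a : R) : R := tsum L (fun x => dotp x x ^+ k * weight a x).

Hypothesis Lsum : forall a, 0 < a -> tsm L (weight a).
Hypothesis Ldes : forall a y z, 0 < a ->
  tsm L (fun x => dotp x y * dotp x z * weight a x) /\
  tsum L (fun x => dotp x y * dotp x z * weight a x) = moment 1 a / n%:R * dotp y z.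

Implicit Types (a s e : R) (x y : 'cV[R]_n) (K : 'M[R]_n).

Lemma moment_tsm k a : 0 < a -> tsm L (fun x => dotp x x ^+ k * weight a x).
Proof.
elim: k a => [|k IH] a a0.
  by apply: eq_tsm (Lsum a0) => x _; rewrite expr0 mul1r.
apply: (eq_tsm (g := fun x => dotp x x * dotp x x ^+ k * expR (- (a * dotp x x)))).
  by move=> x _; rewrite exprS.
by apply: tsm_laplace => // x _; exact: dotp_ge0.
Qed.

Lemma moment_ge0 k a : 0 <= moment k a.
Proof. by apply: tsum_ge0 => x _; rewrite mulr_ge0 ?expR_ge0// exprn_ge0// dotp_ge0. Qed.

Lemma moment_le k a a' : 0 < a -> a <= a' -> moment k a' <= moment k a.
Proof.
move=> a0 aa'; apply: le_tsum; try by apply: moment_tsm; lra.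
move=> x _; rewrite ler_wpM2l ?exprn_ge0 ?dotp_ge0// ler_expR lerN2 ler_wpM2r ?dotp_ge0//.
Qed.

Lemma trace_term K a : 0 < a ->
  tsm L (fun x => quad K x * weight a x) /\
  tsum L (fun x => quad K x * weight a x) = moment 1 a / n%:R * \tr K.
Proof.
move=> a0.
pose F (i j : 'I_n) x := K i j * (dotp x (unit_vec i) * dotp x (unit_vec j) * weight a x).
have du i x : dotp x (unit_vec i) = x i 0.
  rewrite /dotp (bigD1 i)//= big1 ?addr0; first by rewrite mxE !eqxx mulr1.
  by move=> j ji; rewrite mxE (negbTE ji) mulr0.
have e x : quad K x * weight a x = \sum_i \sum_j F i j x.
  rewrite quad_sum mulr_suml; apply: eq_bigr => i _; rewrite mulr_suml; apply: eq_bigr => j _.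
  by rewrite /F !du; ring.
have sF i j : tsm L (F i j) /\ tsum L (F i j) = K i j * (moment 1 a / n%:R * (i == j)%:R).
  have [h1 h2] := Ldes (unit_vec i) (unit_vec j) a0.
  by rewrite /F; split; [exact: tsmZ|rewrite tsumZ// h2 du mxE eqxx andbT eq_sym].
have sS i : tsm L (fun x => \sum_j F i j x) /\ tsum L (fun x => \sum_j F i j x) = K i i * (moment 1 a / n%:R).
  have [h1 ->] := tsum_sum (index_enum 'I_n) (fun (j : 'I_n) (_ : true) => (sF i j).1); split => //.
  rewrite (bigD1 i)//= big1 ?addr0; first by rewrite (sF i i).2 eqxx mulr1.
  by move=> j ji; rewrite (sF i j).2 eq_sym (negbTE ji) !mulr0.
have [h1 h2] := tsum_sum (index_enum 'I_n) (fun (i : 'I_n) (_ : true) => (sS i).1).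
split; first exact: eq_tsm h1.
rewrite (eq_tsum (g := fun x => \sum_i \sum_j F i j x))// h2 /mxtrace mulr_sumr.
by apply: eq_bigr => i _; rewrite (sS i).2 mulrC.
Qed.

Definition excess a K : R := tsum L (fun x => weight a x * (expR (- (a * quad K x)) - 1 + a * quad K x)).

(* The first order part of the energy is a multiple of the trace because the lattice is a design. *)
Lemma energy_expansion a K e : 0 < a -> 0 <= e <= 1 / 2 ->
  (forall x, `|quad K x| <= e * dotp x x) ->
  tsm L (fun x => weight a x * (expR (- (a * quad K x)) - 1 + a * quad K x)) /\
  energy a L (1%:M + K) - energy a L 1%:M = excess a K - a * (moment 1 a / n%:R) * \tr K.
Proof.
move=> a0 /andP[e0 e1] Ke.
pose E x := weight a x * expR (- (a * quad K x)).
have sE : tsm L E.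
  apply: (@tsm_le _ _ _ _ (weight (a / 2))); last by apply: Lsum; lra.
  move=> x _; rewrite ger0_norm ?mulr_ge0 ?expR_ge0// /E /weight -expRD ler_expR.
  have := Ke x; rewrite ler_norml => /andP[h _]; have d0 := dotp_ge0 x.
  have h2 : e * dotp x x <= 1 / 2 * dotp x x by exact: ler_wpM2r.
  have h3 : 0 <= a * (quad K x + 1 / 2 * dotp x x) by apply: mulr_ge0; lra.
  lra.
have sw := Lsum a0; have [sT eT] := trace_term K a0.
(* The energy omits the origin, where the Gaussian is 1. *)
have en (f : 'cV[R]_n -> R) Y : (forall x, f x = gauss a (quad Y x)) -> tsm L f ->
    energy a L Y = tsum L f - 1.
  move=> fE sf; rewrite /energy -/(psum _ _) -tsum_psum; last by move=> x _; exact: expR_ge0.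
  have [d1 d2] := @tsum_delta R _ L 0 1 L00.
  rewrite -d2 -tsumB// [LHS]tsum_mkcond [RHS]tsum_mkcond; apply: eq_tsum => x _.
  case: (boolP (x \in L)) => xL; last by rewrite ifN//; apply: contra xL => /set_mem[xL _]; rewrite inE.
  have [->|x0] := eqVneq x 0.
    by rewrite ifN ?fE ?quad0r ?/gauss ?mulr0 ?expR0 ?subrr//; apply/negP => /set_mem[_ /=].
  by rewrite subr0 fE ifT// inE; split; [exact: set_mem|exact/eqP].
have e1' : energy a L 1%:M = tsum L (weight a) - 1.
  by apply: en => // x; rewrite quad1 /gauss mulNr.
have eK : energy a L (1%:M + K) = tsum L E - 1.
  by apply: en => // x; rewrite quadD quad1 /gauss /E /weight -expRD; congr expR; ring.
have sB : tsm L (fun x => E x - weight a x + a * (quad K x * weight a x)).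
  by apply: tsmD; [exact: tsmB|exact: tsmZ].
have eB x : weight a x * (expR (- (a * quad K x)) - 1 + a * quad K x) =
    E x - weight a x + a * (quad K x * weight a x) by rewrite /E; ring.
split; first by apply: eq_tsm sB => x _; exact: eB.
have -> : excess a K = tsum L E - tsum L (weight a) + a * tsum L (fun x => quad K x * weight a x).
  by rewrite -tsumZ// -tsumB// -tsumD; [apply: eq_tsum => x _; exact: eB|exact: tsmB|exact: tsmZ].
by rewrite e1' eK eT; ring.
Qed.

Lemma excess_term_bound a K e x (t : R) : 0 < a -> 0 <= e <= 1 / 2 -> `|quad K x| <= e * dotp x x ->
  `|quad K x| <= t ->
  `|weight a x * (expR (- (a * quad K x)) - 1 + a * quad K x)| <=
    (a * t) ^+ 2 * weight (a * (1 - e)) x.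
Proof.
move=> a0 /andP[e0 e1] Ke Kt.
have t0 : 0 <= t := le_trans (normr_ge0 _) Kt.
rewrite normrM (ger0_norm (expR_ge0 _)).
have := expR_quad (- (a * quad K x)); rewrite opprK normrN sqrrN normrM (gtr0_norm a0) => h.
apply: (le_trans (ler_wpM2l (expR_ge0 _) h)).
have -> : weight (a * (1 - e)) x = weight a x * expR (a * (e * dotp x x)).
  by rewrite /weight -expRD; congr expR; ring.
rewrite mulrCA; apply: ler_pM.
- by rewrite sqr_ge0.
- by rewrite mulr_ge0 ?expR_ge0.
- by rewrite !exprMn ler_wpM2l ?sqr_ge0// -[X in X <= _]real_normK ?num_real// ler_sqr ?nnegrE.
- by rewrite ler_wpM2l ?expR_ge0// ler_expR ler_wpM2l// ltW.
Qed.

Lemma excess_bound a K e : 0 < a -> 0 <= e <= 1 / 2 ->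
  (forall x, `|quad K x| <= e * dotp x x) ->
  `|excess a K| <= (a * e) ^+ 2 * moment 2 (a / 2).
Proof.
move=> a0 e01 Ke; have [sx _] := energy_expansion a0 e01 Ke; have /andP[e0 e1] := e01.
apply: le_trans (ler_norm_tsum sx) _; rewrite /moment -tsumZ; last by apply: moment_tsm; lra.
apply: le_tsum; [exact: tsm_norm|by apply/tsmZ/moment_tsm; lra|move=> x _].
apply: le_trans (excess_term_bound a0 e01 (Ke x) (Ke x)) _.
have -> : (a * e) ^+ 2 * (dotp x x ^+ 2 * weight (a / 2) x) = (a * (e * dotp x x)) ^+ 2 * weight (a / 2) x by ring.
apply: ler_wpM2l; first exact: sqr_ge0.
have h : 0 <= a * (1 / 2 - e) by apply: mulr_ge0; lra.
rewrite ler_expR lerN2 ler_wpM2r ?dotp_ge0//; lra.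
Qed.

(** All terms of the excess are nonnegative, so one root bounds it from below. For [y <= 2],
    squaring [expR (- (y / 2)) >= 1 - y / 2 >= 0] gives [expR (- y) - 1 + y >= y ^+ 2 / 4]. *)
Lemma excess_root a K e r : 0 < a -> 0 <= e <= 1 / 2 ->
  (forall x, `|quad K x| <= e * dotp x x) -> shell L 2 r -> a * quad K r <= 2 ->
  a ^+ 2 / 4 * expR (- (2 * a)) * quad K r ^+ 2 <= excess a K.
Proof.
move=> a0 e01 Ke [Lr rr] Kr; have [sx _] := energy_expansion a0 e01 Ke.
have f0 x : 0 <= weight a x * (expR (- (a * quad K x)) - 1 + a * quad K x).
  rewrite mulr_ge0 ?expR_ge0//; have := expR_ge1Dx (- (a * quad K x)); lra.
have h : weight a r * (expR (- (a * quad K r)) - 1 + a * quad K r) <= excess a K.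
  have := @ler_sum_tsum _ _ L [:: r] _ isT _ (fun x _ => f0 x) sx; rewrite big_seq1; apply.
  by move=> x; rewrite inE => /eqP ->.
apply: le_trans h; rewrite /weight rr [a * 2]mulrC.
set y := a * quad K r in Kr *.
have -> : a ^+ 2 / 4 * expR (- (2 * a)) * quad K r ^+ 2 = expR (- (2 * a)) * (y ^+ 2 / 4) by rewrite /y; ring.
rewrite ler_wpM2l ?expR_ge0//.
have h1 : 0 <= 1 - y / 2 by lra.
have h2 : 1 - y / 2 <= expR (- (y / 2)) by have := expR_ge1Dx (- (y / 2)); lra.
have h3 : (1 - y / 2) ^+ 2 <= expR (- (y / 2)) ^+ 2 by rewrite ler_sqr ?nnegrE ?expR_ge0.
have h4 : expR (- (y / 2)) ^+ 2 = expR (- y) by rewrite expr2 -expRD; congr expR; lra.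
rewrite -h4; lra.
Qed.

(** Nonzero lattice vectors have norm at least 2, so raising the exponent from 1 to [a] gains at
    least the factor [expR (- (2 * (a - 1)))] in every term. *)
Lemma moment1_le a : 1 <= a -> moment 1 a <= expR 2 * moment 1 1 * expR (- (2 * a)).
Proof.
move=> a1; rewrite mulrAC /moment -tsumZ; last exact: moment_tsm.
apply: le_tsum; [by apply: moment_tsm; lra|by apply/tsmZ/moment_tsm; lra|move=> x Lx].
have [->|x0] := eqVneq x 0; first by rewrite dotp0l expr1 !mul0r mulr0.
rewrite mulrCA ler_wpM2l ?exprn_ge0 ?dotp_ge0// /weight -!expRD ler_expR.
have h : 0 <= (a - 1) * (dotp x x - 2) by rewrite mulr_ge0// subr_ge0// Lnorm.
lra.
Qed.

Lemma moment1_ge a r : 0 < a -> shell L 2 r -> 2 * expR (- (2 * a)) <= moment 1 a.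
Proof.
move=> a0 [Lr rr].
have := @ler_sum_tsum _ _ L [:: r] _ isT _ _ (moment_tsm 1 a0); rewrite big_seq1 rr expr1 /weight rr [a * 2]mulrC.
by apply=> x; [rewrite inE => /eqP -> | rewrite mulr_ge0 ?expR_ge0 ?dotp_ge0].
Qed.

Lemma entry_energy_bound a : 0 < a -> exists C e : R, [/\ 0 <= C, 0 < e <= 1 &
  forall K (m : R), 0 <= m <= e -> (forall i j, `|K i j| <= m) -> \det (1%:M + K) = 1 ->
    `|energy a L (1%:M + K) - energy a L 1%:M| <= C * m ^+ 2].
Proof.
move=> a0; have [D D0 HD] := trace_det_quadratic (R := R) n.
pose N : R := n%:R ^+ 2; have N0 : 0 < N by rewrite exprn_gt0// ltr0n.
pose c := moment 1 a / n%:R; have c0 : 0 <= c by rewrite divr_ge0 ?moment_ge0.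
exists (a * c * D + (a * N) ^+ 2 * moment 2 (a / 2)), (Num.min 1 (2 * N)^-1).
split.
- by apply: addr_ge0; apply: mulr_ge0; rewrite ?moment_ge0 ?sqr_ge0// mulr_ge0// ltW.
- by rewrite lt_min ge_min lexx ltr01 invr_gt0 mulr_gt0.
move=> K m /andP[m0]; rewrite le_min => /andP[m1 mN] Km dK.
have e01 : 0 <= N * m <= 1 / 2.
  rewrite (mulr_ge0 (ltW N0) m0)/=; have N2 : 0 < 2 * N by lra.
  by move: mN; rewrite -[_^-1]mul1r ler_pdivlMr// => mN; lra.
have Ke x := quad_bound x m0 Km.
have [_ ->] := energy_expansion a0 e01 Ke.
have h1 := excess_bound a0 e01 Ke.
have m01 : 0 <= m <= 1 by rewrite m0.
have h2 := HD K m m01 Km dK.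
apply: le_trans (ler_normB _ _) _; rewrite [leRHS]mulrDl [leRHS]addrC -/c; apply: lerD.
  by apply: le_trans h1 _; rewrite le_eqVlt; apply/orP; left; apply/eqP; ring.
have ac : 0 <= a * c by apply: mulr_ge0 => //; exact: ltW.
by rewrite normrM (ger0_norm ac) -mulrA ler_wpM2l.
Qed.

Lemma derivable_entry_bound (c : R -> 'M[R]_n) : derivable c 0 1 ->
  exists M e : R, [/\ 0 < M, 0 < e & forall h : R, `|h| <= e -> forall i j, `|(c h - c 0) i j| <= M * `|h|].
Proof.
move=> /cvg_ex[l hl].
have /nbhs_ballP[d /= d0 H] := hl _ (nbhsx_ballx l 1 ltr01).
pose S := \sum_i \sum_j `|l i j|.
have S0 : 0 <= S by apply: sumr_ge0 => ? _; apply: sumr_ge0.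
exists (1 + S), (d / 2); split; [lra|lra|move=> h hd i j].
have [->|h0] := eqVneq h 0; first by rewrite subrr mxE normr0 mulr0.
have hb : ball 0 d h by rewrite /ball/= sub0r normrN; lra.
have [_ /(_ i j)] := H h hb h0; rewrite /ball/= addr0 [_ *: 1]mulr1 => hij.
have lij : `|l i j| <= S.
  rewrite /S (bigD1 i)//= (bigD1 j)//= -addrA lerDl addr_ge0//; apply: sumr_ge0 => // ? _.
  exact: sumr_ge0.
have e : (c h - c 0) i j = h * (h^-1 *: (c h - c 0)) i j by rewrite [in RHS]mxE mulrA divff// mul1r.
rewrite e normrM mulrC ler_wpM2r//.
have := ler_distD (l i j) 0 ((h^-1 *: (c h - c 0)) i j); rewrite !sub0r !normrN; lra.
Qed.

(** On the manifold the energy changes only by the square of the entries of [K], and along a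
    differentiable curve these entries are of first order in the parameter. *)
Lemma energy_critical a : 0 < a -> critical (energy a L).
Proof.
move=> a0 c cu c0 dc.
have [C [e [C0 /andP[e0 e1] H]]] := entry_energy_bound a0.
have [M [d [M0 d0 Hc]]] := derivable_entry_bound dc.
apply: (@is_derive_quad _ _ _ _ (C * M ^+ 2) (Num.min d (e / M))).
  by rewrite lt_min d0 divr_gt0.
move=> h; rewrite le_min ler_pdivlMr// => /andP[hd hM].
rewrite mulr0 subr0 add0r /= c0.
have -> : c h = 1%:M + (c h - c 0) by rewrite c0 addrC subrK.
have -> : C * M ^+ 2 * h ^+ 2 = C * (M * `|h|) ^+ 2 by rewrite exprMn real_normK ?num_real//; ring.
apply: H; [by rewrite mulrC hM mulr_ge0// ltW|exact: Hc|].
by rewrite c0 addrC subrK; have [] := cu h.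
Qed.

Lemma energy_local_min : (exists2 C : R, 0 <= C & forall K (m : R), 0 <= m -> K^T = K ->
    (forall r, shell L 2 r -> `|quad K r| <= m) -> forall i j, `|K i j| <= C * m) ->
  \forall a \near +oo, local_min (energy a L).
Proof.
move=> [C C0 HC]; have [D D0 HD] := trace_det_quadratic (R := R) n.
pose N : R := n%:R ^+ 2; have N0 : 0 < N by rewrite exprn_gt0// ltr0n.
pose c1 := expR 2 * moment 1 1 / n%:R.
have c10 : 0 <= c1 by rewrite divr_ge0// mulr_ge0 ?expR_ge0 ?moment_ge0.
near=> a.
have a2 : 2 <= a by near: a; exact: nbhs_pinfty_ge.
have aC : 4 * C ^+ 2 * c1 * D < a by near: a; apply: nbhs_pinfty_gt; exact: num_real.
have a0 : 0 < a by lra.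
(* The radius shrinks with [a] so that [a * quad K r <= 2] for every root, the range of
   [excess_root]. *)
apply/near_one_within; exists (N * a)^-1; first by rewrite invr_gt0 mulr_gt0.
move=> K [KT Kpos dK] Kb.
have KT' : K^T = K.
  by move: KT; rewrite linearD/= trmx1 => /addrI.
rewrite leNgt; apply/negP => neg.
have [m [[p q] mE] Km] : exists2 m : R, exists ij, m = `|K ij.1 ij.2| & forall i j, `|K i j| <= m.
  pose i0 := Ordinal n0.
  have [[p q] _ h] := @arg_maxP _ R _ (i0, i0) predT (fun ij : 'I_n * 'I_n => `|K ij.1 ij.2|) isT.
  by exists `|K p q|; [exists (p, q)|move=> i j; exact: (h (i, j) isT)].
have m0 : 0 <= m by rewrite mE.
have mN : m * (N * a) <= 1.
  have Na : 0 < N * a by exact: mulr_gt0.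
  have := ltW (Kb p q); rewrite -mE -[leRHS]mul1r ler_pdivlMr//.
have m01 : 0 <= m <= 1.
  rewrite m0/=; have h1 : 1 <= N by rewrite -(expr1n _ 2) lerXn2r ?nnegrE// ler1n.
  have h2 : 1 <= N * a by rewrite -[leLHS]mulr1; apply: ler_pM => //; lra.
  have h3 : m * 1 <= m * (N * a) by rewrite ler_wpM2l.
  move: h3 mN; clear -n0 L00 Lnorm Lsum Ldes; lra.
have e01 : 0 <= N * m <= 1 / 2.
  rewrite (mulr_ge0 (ltW N0) m0)/=.
  have h3 : N * m * 2 <= N * m * a by rewrite ler_wpM2l// mulr_ge0// ltW.
  move: h3 mN; clear -n0 L00 Lnorm Lsum Ldes; lra.
have Ke x := quad_bound x m0 Km.
have [_ EK] := energy_expansion a0 e01 Ke.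
have tK := HD K m m01 Km dK.
(* If the energy were lower at [1 + K], every root would satisfy [quad K r ^+ 2 < u], where [m] is
   the largest entry of [K]. Control by the roots gives [m ^+ 2 <= C ^+ 2 * u], which by the choice
   of [a] is less than [m ^+ 2] unless [m = 0]. *)
pose u := 4 * c1 * D / a * m ^+ 2.
have u0 : 0 <= u.
  apply: mulr_ge0; last exact: sqr_ge0.
  by apply: divr_ge0; [apply: mulr_ge0 => //; apply: mulr_ge0|exact: ltW].
have rootb r : shell L 2 r -> quad K r ^+ 2 < u.
  move=> rL; have ek : a * quad K r <= 2.
    have := Ke r; rewrite rL.2 -/N => h.
    have h2 : a * `|quad K r| <= a * (N * m * 2) by rewrite ler_wpM2l// ltW.
    have h3 : a * quad K r <= a * `|quad K r| by rewrite ler_wpM2l ?ler_norm// ltW.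
    move: h2 h3 mN; clear -n0 L00 Lnorm Lsum Ldes; lra.
  have h1 := excess_root a0 e01 Ke rL ek.
  have h2 : excess a K < a * (moment 1 a / n%:R) * \tr K by rewrite -subr_lt0 -EK subr_lt0.
  have h3 : a * (moment 1 a / n%:R) * \tr K <= a * (c1 * expR (- (2 * a))) * (D * m ^+ 2).
    apply: (le_trans (ler_norm _)); rewrite normrM; apply: ler_pM => //.
    rewrite ger0_norm; last by rewrite mulr_ge0 ?divr_ge0 ?moment_ge0// ltW.
    apply: ler_wpM2l; first exact: ltW.
    rewrite /c1 mulrAC ler_wpM2r// moment1_le//; move: a2; clear -n0 L00 Lnorm Lsum Ldes; lra.
  have h4 : a ^+ 2 / 4 * expR (- (2 * a)) * quad K r ^+ 2 < a ^+ 2 / 4 * expR (- (2 * a)) * u.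
    apply: (le_lt_trans h1); apply: (lt_le_trans h2); apply: (le_trans h3).
    by rewrite /u le_eqVlt; apply/orP; left; apply/eqP; field; rewrite gt_eqF.
  by rewrite ltr_pM2l// in h4; rewrite mulr_gt0 ?expR_gt0// divr_gt0// exprn_gt0.
have Ku i j : `|K i j| <= C * Num.sqrt u.
  apply: HC => // r rL.
  by rewrite -sqrtr_sqr ler_wsqrtr// ltW// rootb.
have mu : m <= C * Num.sqrt u by rewrite mE.
have m2u : m ^+ 2 <= C ^+ 2 * u.
  rewrite -[u]sqr_sqrtr// -exprMn; rewrite ler_sqr ?nnegrE// mulr_ge0// sqrtr_ge0.
have mz : m ^+ 2 <= 0.
  have h1 : m ^+ 2 * a <= 4 * C ^+ 2 * c1 * D * m ^+ 2.
    apply: le_trans (ler_wpM2r (ltW a0) m2u) _.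
    by rewrite /u le_eqVlt; apply/orP; left; apply/eqP; field; rewrite gt_eqF.
  rewrite leNgt; apply/negP => mp.
  have h2 : m ^+ 2 * (4 * C ^+ 2 * c1 * D) < m ^+ 2 * a by rewrite ltr_pM2l.
  by rewrite [leRHS]mulrC leNgt h2 in h1.
have m00 : m = 0 by apply/eqP; rewrite -sqrf_eq0 eq_le mz sqr_ge0.
have K0 : K = 0.
  by apply/matrixP => i j; apply/eqP; rewrite mxE -normr_le0 (le_trans (Km i j))// m00.
by move: neg; rewrite K0 addr0 ltxx.
Unshelve. all: by end_near. Qed.

Lemma energy_not_local_max x y : shell L 2 x -> shell L 2 y -> dotp x y = 0 ->
  \forall a \near +oo, ~ local_max (energy a L).
Proof.
move=> rx ry xy.
pose c1 := expR 2 * moment 1 1 / n%:R.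
near=> a.
have a1 : 1 <= a by near: a; exact: nbhs_pinfty_ge.
(* The excess is at least [a ^+ 2 / 4 * 64 * s ^+ 2] and the trace term at most
   [a * c1 * 16 * s ^+ 2], both times [expR (- (2 * a))], so [a > c1] decides. *)
have ac : c1 < a by near: a; apply: nbhs_pinfty_gt; exact: num_real.
have a0 : 0 < a by lra.
move=> /near_one_within[e e0 H].
pose p := x + y; pose q := x - y.
have yx : dotp y x = 0 by rewrite dotpC.
have qp : dotp q p = 0.
  by rewrite /q /p dotpBl !dotpDr rx.2 ry.2 xy yx; lra.
have pp : dotp p p = 4 by rewrite /p dotpDl !dotpDr rx.2 ry.2 xy yx; lra.
have qq : dotp q q = 4 by rewrite /q dotpBl !dotpBr rx.2 ry.2 xy yx; lra.
have px : dotp p x = 2 by rewrite /p dotpDl rx.2 yx addr0.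
have qx : dotp q x = 2 by rewrite /q dotpBl rx.2 yx subr0.
pose N : R := n%:R ^+ 2; have N0 : 0 < N by rewrite exprn_gt0// ltr0n.
have [s [s0 s1 se sN sa]] : exists s : R, [/\ 0 < s, s <= 1, s * 24 < e, s * (48 * N) <= 1 & s * (24 * a) <= 2].
  pose s := Num.min (Num.min 1 (e / 25)) (Num.min (48 * N)^-1 (12 * a)^-1).
  have h1 : s <= 1 by rewrite /s !ge_min lexx.
  have h2 : s <= e / 25 by rewrite /s !ge_min lexx orbT.
  have h3 : s <= (48 * N)^-1 by rewrite /s !ge_min lexx !orbT.
  have h4 : s <= (12 * a)^-1 by rewrite /s !ge_min lexx !orbT.
  have N48 : 0 < 48 * N by rewrite mulr_gt0.
  have a12 : 0 < 12 * a by rewrite mulr_gt0.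
  exists s; split => //.
  - by rewrite /s !lt_min ltr01 !invr_gt0 N48 a12 andbT/= divr_gt0.
  - lra.
  - by rewrite -ler_pdivlMr// div1r.
  - by move: h4; rewrite -div1r ler_pdivlMr//; lra.
pose K := shear_diff p q s.
have eK : shear_form p q s = 1%:M + K by exact: shear_formE.
have uK := shear_unit_posdef s qp; rewrite eK in uK.
have Kb i j : `|K i j| <= s * 24.
  have h := @shear_diff_entry R n p q s i j.
  rewrite gtr0_norm// pp qq in h; apply: le_trans (h s1) _; apply: ler_wpM2l; [exact: ltW|lra].
have s24 : 0 <= s * 24 by lra.
have Ke z := quad_bound z s24 Kb.
have e01 : 0 <= N * (s * 24) <= 1 / 2.
  apply/andP; split; [by apply: mulr_ge0 => //; exact: ltW|lra].
have KE : energy a L (1%:M + K) <= energy a L 1%:M.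
  by apply: H => // i j; apply: le_lt_trans (Kb i j) _.
have [_ EK] := energy_expansion a0 e01 Ke.
have Kx : quad K x = 8 * s + 16 * s ^+ 2 by rewrite quad_shear_diff px qx pp; ring.
have tr : \tr K = 16 * s ^+ 2 by rewrite trace_shear_diff// pp qq; ring.
have Kx2 : a * quad K x <= 2.
  have h : a * quad K x <= a * (24 * s).
    apply: ler_wpM2l; first exact: ltW.
    rewrite Kx; have this : s * s <= s * 1 by rewrite ler_wpM2l// ltW.
    move: this; rewrite expr2; move: s1; clear -n0 L00 Lnorm Lsum Ldes; lra.
  move: h sa; clear -n0 L00 Lnorm Lsum Ldes; lra.
have h1 := excess_root a0 e01 Ke rx Kx2.
have h2 : excess a K <= a * (moment 1 a / n%:R) * \tr K by rewrite -subr_le0 -EK subr_le0.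
have W0 : 0 < expR (- (2 * a)) by exact: expR_gt0.
have h3 : a * (moment 1 a / n%:R) * \tr K <= a * (c1 * expR (- (2 * a))) * \tr K.
  rewrite tr ler_wpM2r//; first by apply: mulr_ge0 => //; exact: sqr_ge0.
  by apply: ler_wpM2l; [exact: ltW|]; rewrite /c1 mulrAC ler_wpM2r// moment1_le.
have h4 : a ^+ 2 / 4 * expR (- (2 * a)) * (64 * s ^+ 2) <= a ^+ 2 / 4 * expR (- (2 * a)) * quad K x ^+ 2.
  apply: ler_wpM2l; first by apply: mulr_ge0; [apply: divr_ge0 => //; exact: sqr_ge0|exact: ltW].
  have -> : 64 * s ^+ 2 = (8 * s) ^+ 2 by ring.
  have h5 : 8 * s <= quad K x by rewrite Kx lerDl; apply: mulr_ge0 => //; exact: sqr_ge0.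
  have h6 : 0 <= 8 * s by apply: mulr_ge0 => //; exact: ltW.
  by rewrite ler_sqr ?nnegrE//; exact: le_trans h5.
have h5 := le_trans h4 (le_trans h1 (le_trans h2 h3)).
have P0 : 0 < 16 * a * expR (- (2 * a)) * s ^+ 2.
  by rewrite mulr_gt0 ?exprn_gt0// mulr_gt0// mulr_gt0.
have h6 : 16 * a * expR (- (2 * a)) * s ^+ 2 * a <= 16 * a * expR (- (2 * a)) * s ^+ 2 * c1.
  by rewrite tr in h5; apply: le_trans (le_trans _ h5) _; rewrite le_eqVlt; apply/orP; left; apply/eqP; field.
by rewrite ler_pM2l// leNgt ac in h6.
Unshelve. all: by end_near. Qed.

(* The shear along two orthogonal roots moves every root only to second order, because no root meets both of them. *)
Lemma energy_not_local_min x y : shell L 2 x -> shell L 2 y -> dotp x y = 0 ->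
  (forall r, shell L 2 r -> dotp x r = 0 \/ dotp y r = 0) ->
  (forall r, L r -> r != 0 -> dotp r r != 2 -> 4 <= dotp r r) ->
  \forall a \near +oo, ~ local_min (energy a L).
Proof.
move=> rx ry xy ort L4.
(* The level 1/8 fits the gap above the roots: for [s <= 1 / 64] and norm [N >= 4], the exponent
   [a (1 - 8 s) N] is at least [7 / 8 * a N], hence at least [3 a + a N / 8]. *)
pose C := moment 2 (1 / 8); have C0 : 0 <= C := moment_ge0 _ _.
have nR : 0 < n%:R :> R by rewrite ltr0n.
near=> a.
have a1 : 1 <= a by near: a; exact: nbhs_pinfty_ge.
have aC : 64 * n%:R * C <= a by near: a; apply: nbhs_pinfty_ge; exact: num_real.
have a0 : 0 < a by lra.
move=> /near_one_within[e e0 H].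
have yx : dotp y x = 0 by rewrite dotpC.
have W0 : 0 < expR (- (2 * a)) by exact: expR_gt0.
have [s [s0 s1 se sa]] : exists s : R, [/\ 0 < s, s * 64 <= 1, s * 8 < e & s * (16 * a * C * n%:R) < 4 * expR (- (2 * a))].
  pose D := 16 * a * C * n%:R + 1.
  have D0 : 0 < D.
    by apply: ltr_wpDl => //; apply: mulr_ge0; [apply: mulr_ge0 => //; apply: mulr_ge0 => //; exact: ltW|].
  pose s := Num.min (64^-1) (Num.min (e / 9) (4 * expR (- (2 * a)) / D)).
  have h1 : s <= 64^-1 by rewrite /s !ge_min lexx.
  have h2 : s <= e / 9 by rewrite /s !ge_min lexx orbT.
  have h3 : s <= 4 * expR (- (2 * a)) / D by rewrite /s !ge_min lexx !orbT.
  have s0 : 0 < s by rewrite /s !lt_min !divr_gt0// ?mulr_gt0// invr_gt0 ltr0n.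
  exists s; split => //; [lra|lra|].
  move: h3; rewrite ler_pdivlMr// /D; lra.
pose K := shear_diff x y s.
have eK : shear_form x y s = 1%:M + K by exact: shear_formE.
have uK := shear_unit_posdef s yx; rewrite eK in uK.
have Kb i j : `|K i j| <= s * 8.
  have h := @shear_diff_entry R n x y s i j; have s1' : s <= 1 by lra.
  rewrite gtr0_norm// rx.2 ry.2 in h; apply: le_trans (h s1') _; apply: ler_wpM2l; [exact: ltW|lra].
have s2 : 0 <= 2 * s ^+ 2 by apply: mulr_ge0 => //; exact: sqr_ge0.
have KE z : quad K z = 2 * s * (dotp x z * dotp y z) + 2 * s ^+ 2 * dotp y z ^+ 2.
  by rewrite quad_shear_diff rx.2; ring.
have cs u z : shell L 2 u -> dotp u z ^+ 2 <= 2 * dotp z z.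
  by move=> ru; have := cauchy_schwarz u z; rewrite ru.2.
have Ke z : `|quad K z| <= 8 * s * dotp z z.
  have h1 := cs x z rx; have h2 := cs y z ry; have d0 := dotp_ge0 z.
  have h3 : `|dotp x z * dotp y z| <= 2 * dotp z z.
    have h4 := sqr_ge0 (dotp x z - dotp y z); have h5 := sqr_ge0 (dotp x z + dotp y z).
    rewrite ler_norml; apply/andP; move: h1 h2 h4 h5; clear -n0 L00 Lnorm Lsum Ldes => h1 h2 h4 h5; split; lra.
  rewrite KE; apply: le_trans (ler_normD _ _) _; rewrite normrM (gtr0_norm (_ : 0 < 2 * s)); last lra.
  have h6 : 2 * s * `|dotp x z * dotp y z| <= 2 * s * (2 * dotp z z) by apply: ler_wpM2l => //; lra.
  rewrite (ger0_norm (mulr_ge0 s2 (sqr_ge0 (dotp y z)))).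
  have h7 : 2 * s ^+ 2 * dotp y z ^+ 2 <= 2 * s ^+ 2 * (2 * dotp z z).
    by apply: ler_wpM2l => //; apply: mulr_ge0 => //; exact: sqr_ge0.
  have h8 : s * (s * dotp z z) <= 1 * (s * dotp z z).
    by apply: ler_wpM2r; [apply: mulr_ge0 => //; exact: ltW|lra].
  rewrite expr2 in h7 *; move: h6 h7 h8; clear -n0 L00 Lnorm Lsum Ldes; lra.
have e01 : 0 <= 8 * s <= 1 / 2 by apply/andP; split; lra.
have HE : energy a L 1%:M <= energy a L (1%:M + K).
  by apply: H => // i j; apply: le_lt_trans (Kb i j) _.
have [sx EK] := energy_expansion a0 e01 Ke.
have tr : \tr K = 4 * s ^+ 2 by rewrite trace_shear_diff// rx.2 ry.2; ring.
(* The first summand covers the roots, whose norms change by order [s ^+ 2]; the second covers norms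
   from 4 on, which change by order [s] but carry the extra factor [expR (- (3 * a))]. *)
pose B := a ^+ 2 * (16 * s ^+ 4 + 64 * s ^+ 2 * expR (- (3 * a))).
have B0 : 0 <= B.
  apply: mulr_ge0; first exact: sqr_ge0.
  by apply: addr_ge0; [apply: mulr_ge0 => //; apply: exprn_ge0; exact: ltW|apply: mulr_ge0; [apply: mulr_ge0 => //; exact: sqr_ge0|exact: expR_ge0]].
have term z : L z -> weight a z * (expR (- (a * quad K z)) - 1 + a * quad K z) <= B * (dotp z z ^+ 2 * weight (a / 8) z).
  move=> Lz; have d0 := dotp_ge0 z.
  have [->|z0] := eqVneq z 0.
    by rewrite quad0r dotp0l mulr0 oppr0 expR0 expr2 !mul0r mulr0 subrr addr0 mulr0.
  apply: le_trans (ler_norm _) _.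
  have [z2|z2] := eqVneq (dotp z z) 2.
    have Kz : `|quad K z| <= 2 * s ^+ 2 * (2 * dotp z z).
      rewrite KE (_ : dotp x z * dotp y z = 0) ?mulr0 ?add0r; last first.
        by have [->|->] := ort z (conj Lz z2); rewrite ?mul0r ?mulr0.
      rewrite (ger0_norm (mulr_ge0 s2 (sqr_ge0 (dotp y z)))).
      by apply: ler_wpM2l; [apply: mulr_ge0 => //; exact: sqr_ge0|exact: cs].
    apply: le_trans (excess_term_bound a0 e01 (Ke z) Kz) _.
    have w1 : weight (a * (1 - 8 * s)) z <= weight (a / 8) z.
      have h : 8^-1 <= 1 - 8 * s by move: s1; clear -n0 L00 Lnorm Lsum Ldes; lra.
      by rewrite ler_expR lerN2; apply: ler_wpM2r => //; apply: ler_wpM2l => //; exact: ltW.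
    apply: le_trans (ler_wpM2l (sqr_ge0 _) w1) _; rewrite [leRHS]mulrA; apply: ler_wpM2r; first exact: expR_ge0.
    rewrite /B mulrDr mulrDl.
    have -> : (a * (2 * s ^+ 2 * (2 * dotp z z))) ^+ 2 = a ^+ 2 * (16 * s ^+ 4) * dotp z z ^+ 2 by ring.
    rewrite lerDl; apply: mulr_ge0; last exact: sqr_ge0.
    by apply: mulr_ge0; [exact: sqr_ge0|apply: mulr_ge0; [apply: mulr_ge0 => //; exact: sqr_ge0|exact: expR_ge0]].
  have z4 := L4 z Lz z0 z2.
  apply: le_trans (excess_term_bound a0 e01 (Ke z) (Ke z)) _.
  have w1 : weight (a * (1 - 8 * s)) z <= expR (- (3 * a)) * weight (a / 8) z.
    rewrite /weight -expRD ler_expR.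
    have h1 : 0 <= a * (3 / 4 * (dotp z z - 4)).
      by apply: mulr_ge0; [exact: ltW|move: z4; clear -n0 L00 Lnorm Lsum Ldes; lra].
    have h2 : 0 <= a * ((1 / 8 - 8 * s) * dotp z z).
      by apply: mulr_ge0; [exact: ltW|apply: mulr_ge0 => //; move: s1; clear -n0 L00 Lnorm Lsum Ldes; lra].
    move: h1 h2; clear -n0 L00 Lnorm Lsum Ldes; lra.
  apply: le_trans (ler_wpM2l (sqr_ge0 _) w1) _; rewrite [leLHS]mulrA [leRHS]mulrA; apply: ler_wpM2r; first exact: expR_ge0.
  have -> : (a * (8 * s * dotp z z)) ^+ 2 * expR (- (3 * a)) = a ^+ 2 * (64 * s ^+ 2 * expR (- (3 * a))) * dotp z z ^+ 2 by ring.
  rewrite /B mulrDr mulrDl lerDr; apply: mulr_ge0; last exact: sqr_ge0.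
  by apply: mulr_ge0; [exact: sqr_ge0|apply: mulr_ge0 => //; apply: exprn_ge0; exact: ltW].
have h1 : excess a K <= B * C.
  have a8 : 0 < a / 8 by exact: divr_gt0.
  apply: (@le_trans _ _ (B * moment 2 (a / 8))).
    rewrite -tsumZ; last exact: moment_tsm.
    by apply: le_tsum => //; apply: tsmZ; exact: moment_tsm.
  by apply: ler_wpM2l => //; apply: moment_le; [exact: divr_gt0|exact: ler_wpM2r].
have h2 : a * (moment 1 a / n%:R) * \tr K <= excess a K by rewrite -subr_ge0 -EK subr_ge0.
have h3 := moment1_ge a0 rx.
have h4 : a * (2 * expR (- (2 * a)) / n%:R) * \tr K <= a * (moment 1 a / n%:R) * \tr K.
  rewrite tr; apply: ler_wpM2r; first by apply: mulr_ge0 => //; exact: sqr_ge0.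
  by apply: ler_wpM2l; [exact: ltW|apply: ler_wpM2r => //; rewrite invr_ge0 ltW].
have h5 := le_trans h4 (le_trans h2 h1).
pose P := a * s ^+ 2 / n%:R.
have P0 : 0 < P by apply: divr_gt0 => //; apply: mulr_gt0 => //; exact: exprn_gt0.
have h6 : P * (8 * expR (- (2 * a))) <= P * (n%:R * C * (16 * a * s ^+ 2) + a * expR (- (3 * a)) * (64 * n%:R * C)).
  apply: le_trans (le_trans _ h5) _; rewrite le_eqVlt; apply/orP; left; apply/eqP; rewrite /P ?tr ?/B; field; by rewrite gt_eqF.
rewrite ler_pM2l// in h6.
have h7 : s * (s * (16 * a * C * n%:R)) <= 1 * (s * (16 * a * C * n%:R)).
  apply: ler_wpM2r; last by move: s0 s1; clear -n0 L00 Lnorm Lsum Ldes; lra.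
  apply: mulr_ge0; first exact: ltW.
  by apply: mulr_ge0; [apply: mulr_ge0 => //; apply: mulr_ge0 => //|]; exact: ltW.
have h8 : a * expR (- (3 * a)) * (64 * n%:R * C) <= a * expR (- (3 * a)) * a.
  by apply: ler_wpM2l => //; apply: mulr_ge0; [exact: ltW|exact: expR_ge0].
have h9 : a * a * expR (- a) <= 4.
  have g1 : 1 + a / 2 <= expR (a / 2) := expR_ge1Dx _.
  have g2 : (a / 2) ^+ 2 <= expR (a / 2) ^+ 2.
    by rewrite ler_sqr ?nnegrE ?expR_ge0//; [apply: le_trans g1; rewrite lerDr|apply: divr_ge0 => //; exact: ltW].
  have g3 : expR (a / 2) ^+ 2 = expR a by rewrite expr2 -expRD; congr expR; field.
  rewrite expRN -ler_pdivlMr ?invr_gt0 ?expR_gt0// invrK -g3; move: g2; clear -n0 L00 Lnorm Lsum Ldes; lra.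
have h10 : a * expR (- (3 * a)) * a <= 4 * expR (- (2 * a)).
  have -> : expR (- (3 * a)) = expR (- a) * expR (- (2 * a)) by rewrite -expRD; congr expR; ring.
  have -> : a * (expR (- a) * expR (- (2 * a))) * a = a * a * expR (- a) * expR (- (2 * a)) by ring.
  by apply: ler_wpM2r => //; exact: ltW.
(* The two summands on the right of [h6] are below [4 * expR (- (2 * a))] and at most that: the
   first by the choice of [s], the second by [aC] and [a ^+ 2 * expR (- a) <= 4]. *)
rewrite expr2 in h6; move: h6 h7 h8 h10 sa; clear -n0 L00 Lnorm Lsum Ldes; lra.
Unshelve. all: by end_near. Qed.

End Energy.

Lemma gram_free {R : realType} {n : nat} (f : nat -> 'cV[R]_n) :
  (forall i j, (i < n)%N -> (j < n)%N -> dotp (f i) (f j) = (i == j)%:R) ->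
  forall c : 'I_n -> R, \sum_i c i *: f i = 0 -> forall i, c i = 0.
Proof.
move=> ff c c0 i; have : dotp (f i) (\sum_j c j *: f j) = 0 by rewrite c0 dotp0r.
rewrite dotp_sumr (bigD1 i)//= big1 ?addr0.
  by rewrite dotpZr ff// eqxx mulr1.
by move=> j ji; rewrite dotpZr ff// -(inj_eq val_inj) eq_sym in ji *; rewrite (negbTE ji) mulr0.
Qed.

Lemma dotp_symm {R : realType} {n : nat} (K : 'M[R]_n) x y : K^T = K ->
  dotp x (K *m y) = dotp y (K *m x).
Proof. by move=> KT; rewrite [RHS]dotpC !dotpE trmx_mul KT mulmxA. Qed.

Lemma quad_polar {R : realType} {n : nat} (K : 'M[R]_n) x y : K^T = K ->
  quad K (x + y) = quad K x + quad K y + 2 * dotp x (K *m y) /\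
  quad K (x - y) = quad K x + quad K y - 2 * dotp x (K *m y).
Proof.
move=> KT; rewrite !quadE !mulmxDr mulmxN !dotpDl !dotpDr !dotpNl !dotpNr (dotp_symm y x KT); split; ring.
Qed.

Section RootControl.
Context {R : realType} {n : nat} (L : set 'cV[R]_n).
Hypothesis L00 : L 0.
Hypothesis LB : forall x y, L x -> L y -> L (x - y).

(* Polarization at the roots [f i + f j] and [f i - f j] recovers the form on the frame. *)
Lemma dframe_control (f : nat -> 'cV[R]_n) : (8 < n)%N -> dframe L n f ->
  exists2 C : R, 0 <= C & forall (K : 'M[R]_n) (m : R), 0 <= m -> K^T = K ->
    (forall r, shell L 2 r -> `|quad K r| <= m) -> forall i j, `|K i j| <= C * m.
Proof.
move=> n8 df; have [C C0 HC] := form_control (gram_free df.1).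
exists (C * 2); first exact: mulr_ge0.
move=> K m m0 KT Kr; rewrite -mulrA; apply: HC; first exact: mulr_ge0.
pose B i j := dotp (f i) (K *m f j).
have pm (i j : 'I_n) : i != j -> `|B i i + B j j + 2 * B i j| <= m /\ `|B i i + B j j - 2 * B i j| <= m.
  move=> ij; have [h1 h2] := quad_polar (f i) (f j) KT.
  rewrite -[B i i]quadE -[B j j]quadE -h1 -h2; split; apply: Kr.
    by have := dframe_root L00 LB n8 df false false ij; rewrite !expr0 !scale1r.
  by have := dframe_root L00 LB n8 df false true ij; rewrite expr0 expr1 scale1r scaleN1r.
have off (i j : 'I_n) : i != j -> `|2 * B i j| <= m /\ `|B i i + B j j| <= m.
  move=> /pm; rewrite !ler_norml => -[/andP[h1 h2] /andP[h3 h4]]; split; apply/andP; split; lra.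
move=> i j; rewrite -/(B i j); have [<-|ij] := eqVneq i j; last first.
  by have [h _] := off i j ij; rewrite normrM ger0_norm// in h; lra.
(* Roots give sums of two diagonal entries; the entry at [i] is half of the sum for [i, k] plus that
   for [i, l] minus that for [k, l]. *)
have [k [l [ik il kl]]] : exists k l : 'I_n, [/\ i != k, i != l & k != l].
  have h2 : (2 < n)%N by apply: leq_trans n8.
  have h1 : (1 < n)%N by apply: leq_trans n8.
  have h0 : (0 < n)%N by apply: leq_trans n8.
  pose o0 := Ordinal h0; pose o1 := Ordinal h1; pose o2 := Ordinal h2.
  have [->|i0] := eqVneq i o0; first by exists o1, o2.
  have [->|i1] := eqVneq i o1; first by exists o0, o2.
  by exists o0, o1.
have [_ h1] := off _ _ ik; have [_ h2] := off _ _ il; have [_ h3] := off _ _ kl.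
move: h1 h2 h3; rewrite !ler_norml => /andP[? ?] /andP[? ?] /andP[? ?]; apply/andP; split; lra.
Qed.

(** The differences [r i - r j] are roots too, so polarization yields all values on pairs of the
    clique, which is a basis. *)
Lemma clique_control (r : nat -> 'cV[R]_n) : clique L n r ->
  exists2 C : R, 0 <= C & forall (K : 'M[R]_n) (m : R), 0 <= m -> K^T = K ->
    (forall r, shell L 2 r -> `|quad K r| <= m) -> forall i j, `|K i j| <= C * m.
Proof.
move=> cl; have free (c : 'I_n -> R) : \sum_i c i *: r i = 0 -> forall i, c i = 0.
  move=> c0; have := clique_gram c cl; rewrite c0 dotp0l => e i.
  apply/eqP; rewrite -sqrf_eq0; apply/eqP.
  have h : 0 <= \sum_(j | j != i) c j ^+ 2 by apply: sumr_ge0 => j _; exact: sqr_ge0.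
  have h1 := sqr_ge0 (c i); have h2 := sqr_ge0 (\sum_i c i).
  rewrite (bigD1 i)//= in e; lra.
have [C C0 HC] := form_control free.
exists (C * 2); first exact: mulr_ge0.
move=> K m m0 KT Kr; rewrite -mulrA; apply: HC; first exact: mulr_ge0.
have Kd i : (i < n)%N -> `|quad K (r i)| <= m by move=> /cl.1; exact: Kr.
move=> i j; have [<-|ij] := eqVneq i j.
  by rewrite -quadE; have := Kd i (ltn_ord i); lra.
have rij : shell L 2 (r i - r j).
  have [[Li ri] [Lj rj]] := (cl.1 i (ltn_ord i), cl.1 j (ltn_ord j)).
  split; first exact: LB.
  have e : dotp (r i) (r j) = 1 by apply: cl.2 => //; exact: ij.
  by rewrite dotp_subrr ri rj e; lra.
have [_ h] := quad_polar (r i) (r j) KT.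
have := Kr _ rij; have := Kd i (ltn_ord i); have := Kd j (ltn_ord j); rewrite h !ler_norml.
move=> /andP[? ?] /andP[? ?] /andP[? ?]; apply/andP; split; lra.
Qed.

End RootControl.

(** * Conclusion for Niemeier lattices *)

Section NiemeierLattice.
Context {R : realType} (L : set 'cV[R]_24).
Hypothesis L00 : L 0.
Hypothesis LB : forall x y, L x -> L y -> L (x - y).
Hypothesis Lu : unimodular L.
Hypothesis Le : even_lattice L.
Context (B : 'M[R]_24).
Hypothesis uB : B \in unitmx.
Hypothesis LBj : forall j, L (col j B).

Lemma even_norm x : L x -> [\/ x = 0, dotp x x = 2 | 4 <= dotp x x].
Proof.
move=> Lx; have [k e] := Le Lx.
have k0 : 0 <= k by have := dotp_ge0 x; rewrite e ler0z mulr2n; lia.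
have [->|x0] := eqVneq x 0; first by constructor 1.
have k1 : 0 < k.
  rewrite lt_def k0 andbT; apply: contra_neq x0 => k00; apply/eqP.
  by rewrite -dotp_eq0 e k00 mul0rn.
have [k2|k2] := eqVneq k 1; first by constructor 2; rewrite e k2.
constructor 3; rewrite e -[4]/(4%:~R) ler_int mulr2n; lia.
Qed.

Hypothesis root : shell L 2 !=set0.

Lemma root_neq0 r : shell L 2 r -> r != 0.
Proof. by move=> [_ rr]; rewrite -dotp_eq0 rr. Qed.

Lemma frame_exists : exists2 b : 'I_24 -> 'cV[R]_24, frame b & forall i, L (b i).
Proof.
have [r Lr] := root.
by have [b [fb Lb _]] := frame_through L00 LB Lu uB LBj Lr.1 (root_neq0 Lr); exists b.
Qed.

Lemma weight_tsm a : 0 < a -> tsm L (weight a).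
Proof.
move=> a0; have [b fb Lb] := frame_exists.
have t0 : 0 < a / pi :> R by rewrite divr_gt0// pi_gt0.
apply: eq_tsm (gauss_tsm L00 LB Lu Lb fb t0) => x _.
by rewrite /weight mulrCA divff ?mulr1// gt_eqF// pi_gt0.
Qed.

Lemma weight_design a y z : 0 < a ->
  tsm L (fun x => dotp x y * dotp x z * weight a x) /\
  tsum L (fun x => dotp x y * dotp x z * weight a x) = moment L 1 a / 24%:R * dotp y z.
Proof.
move=> a0; have w0 (x : 'cV[R]_24) : 0 <= weight a x by exact: expR_ge0.
have t0 : 0 < a / pi :> R by rewrite divr_gt0// pi_gt0.
have wE x : weight a x = expR (- (pi * (a / pi) * dotp x x)).
  by rewrite /weight mulrCA divff ?mulr1// gt_eqF// pi_gt0.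
have wA (b : 'I_24 -> 'cV[R]_24) : frame b -> (forall i, L (b i)) ->
    (forall i, tsm L (fun x => dotp x (b i) ^+ 2 / dotp (b i) (b i) * weight a x)) /\
    (forall i j, tsum L (fun x => dotp x (b i) ^+ 2 / dotp (b i) (b i) * weight a x) =
                 tsum L (fun x => dotp x (b j) ^+ 2 / dotp (b j) (b j) * weight a x)).
  move=> fb Lb; split=> [i|i j].
    by apply: eq_tsm (coord_theta_tsm L00 LB Lu Lb fb i t0) => x _; rewrite wE.
  have E k : tsum L (fun x => dotp x (b k) ^+ 2 / dotp (b k) (b k) * weight a x) = coord_theta L b k (a / pi).
    by apply: eq_tsum => x _; rewrite wE.
  by rewrite !E; exact: coord_theta_eq.
split; first exact: (design_tsm L00 LB Lu uB LBj w0 wA).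
exact: (design L00 LB Lu uB LBj w0 wA).
Qed.

(** The design identity on the shell of roots, taken at [v, v], reads [0 = c * dotp v v] with
    [c > 0] because there is a root. *)
Lemma roots_span v : (forall r, shell L 2 r -> dotp r v = 0) -> v = 0.
Proof.
move=> rv; have w0 (x : 'cV[R]_24) : 0 <= (fun=> 1) x :> R by [].
have s1 : shell L (2 * 1%:R) = shell L 2 by rewrite mulr1.
have wA (b : 'I_24 -> 'cV[R]_24) : frame b -> (forall i, L (b i)) ->
    (forall i, tsm (shell L 2) (fun x => dotp x (b i) ^+ 2 / dotp (b i) (b i) * 1)) /\
    (forall i j, tsum (shell L 2) (fun x => dotp x (b i) ^+ 2 / dotp (b i) (b i) * 1) =
                 tsum (shell L 2) (fun x => dotp x (b j) ^+ 2 / dotp (b j) (b j) * 1)).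
  move=> fb Lb; split=> [i|i j].
    have := shell_coord_tsm L00 LB Lu Lb fb i 1; rewrite s1 => h.
    by apply: eq_tsm h => x _; exact: mulr1.
  have := shell_coord_eq L00 LB Lu Lb fb Le erefl i j 1; rewrite s1 => h.
  have E k : tsum (shell L 2) (fun x => dotp x (b k) ^+ 2 / dotp (b k) (b k) * 1) =
      tsum (shell L 2) (fun x => dotp x (b k) ^+ 2 / dotp (b k) (b k)).
    by apply: eq_tsum => x _; exact: mulr1.
  by rewrite !E.
have := design L00 LB Lu uB LBj w0 wA isT v v.
rewrite (@eq_tsum _ _ _ _ (fun=> 0)) ?tsum0; last by move=> x Lx; rewrite rv// mul0r mul0r.
have c0 : 0 < tsum (shell L 2) (fun x => dotp x x * 1).
  have sw : tsm (shell L 2) (fun x => dotp x x * 1).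
    apply: eq_tsm (tsmZ (2 * expR 2) (sub_tsm (B := L) _ (weight_tsm ltr01))); last by move=> x [].
    by move=> x [_ xx]; rewrite /weight xx mulr1 mul1r -mulrA -expRD addrN expR0 mulr1.
  have [r Lr] := root.
  have := @ler_sum_tsum _ _ (shell L 2) [:: r] _ isT _ _ sw; rewrite big_seq1 Lr.2 mulr1 => h.
  apply: lt_le_trans (h _ _) => //; first by move=> x; rewrite inE => /eqP ->.
  by move=> x _; rewrite mulr1 dotp_ge0.
by move/esym/eqP; rewrite mulf_eq0 gt_eqF ?divr_gt0 ?ltr0n//= dotp_eq0 => /eqP.
Qed.

Lemma irreducible_root_types : irreducible_roots (shell L 2) ->
  (exists f, dframe L 24 f) \/ (exists r, clique L 24 r).
Proof. move=> irr; exact: (root_classification L00 LB Lu Le roots_span irr). Qed.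

Lemma irreducible_rootsP : irreducible_roots (shell L 2) <->
  (root_iso (shell L 2) (@rootsA R 24) \/ root_iso (shell L 2) (@rootsD R 24)).
Proof.
split=> [/irreducible_root_types[[f df]|[r cr]]|[h|h]].
- by right; exact: root_iso_D df.
- by left; exact: root_iso_A cr.
- by apply: root_iso_irreducible h _; exact: irreducible_rootsA.
- by apply: root_iso_irreducible h _; exact: irreducible_rootsD.
Qed.

Lemma norm_ge2 x : L x -> x != 0 -> 2 <= dotp x x.
Proof. by move=> /even_norm[->|->//|h _]; rewrite ?eqxx//; lra. Qed.

Lemma local_min_of_irreducible : irreducible_roots (shell L 2) ->
  \forall a \near +oo, local_min (energy a L).
Proof.
move=> irr; apply: (energy_local_min _ L00 norm_ge2 weight_tsm weight_design) => //.
have [[f df]|[r cr]] := irreducible_root_types irr.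
  exact: (dframe_control L00 LB _ df).
exact: (clique_control LB cr).
Qed.

Lemma reducible_roots : ~ irreducible_roots (shell L 2) -> exists x y,
  [/\ shell L 2 x, shell L 2 y, dotp x y = 0 &
    forall r, shell L 2 r -> dotp x r = 0 \/ dotp y r = 0].
Proof.
move=> nirr; apply: contrapT => nex; apply: nirr; split => // P Q PQ ort.
apply: contrapT => /not_orP[/eqP/set0P[x Px] /eqP/set0P[y Qy]]; apply: nex; exists x, y; split.
- by rewrite -PQ; left.
- by rewrite -PQ; right.
- exact: ort.
- by move=> r; rewrite -PQ => -[Pr|Qr]; [right; rewrite dotpC|left]; apply: ort.
Qed.

Lemma saddle_of_reducible : ~ irreducible_roots (shell L 2) ->
  \forall a \near +oo, saddle (energy a L).
Proof.
move=> /reducible_roots[x [y [rx ry xy ort]]].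
have L4 r : L r -> r != 0 -> dotp r r != 2 -> 4 <= dotp r r.
  by move=> /even_norm[->|->|]; rewrite ?eqxx.
have nmin := @energy_not_local_min R 24 L isT L00 weight_tsm weight_design x y rx ry xy ort L4.
have nmax := @energy_not_local_max R 24 L isT L00 norm_ge2 weight_tsm weight_design x y rx ry xy.
have pos : \forall a \near (+oo : set_system R), 0 < a by apply: nbhs_pinfty_gt; exact: num_real.
apply: filterS3 pos nmin nmax => a a0 hmin hmax; split => //.
exact: (energy_critical _ L00 weight_tsm weight_design).
Qed.

End NiemeierLattice.

Theorem mainTheorem3 (R : realType) (L : set 'cV[R]_24)
    (L_lattice : is_lattice L) (L_unimodular : unimodular L)
    (L_even : even_lattice L) (L_roots : shell L 2 !=set0) :
  [/\ irreducible_roots (shell L 2) <->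
        (root_iso (shell L 2) (@rootsA R 24) \/
         root_iso (shell L 2) (@rootsD R 24)),
      irreducible_roots (shell L 2) ->
        \forall alpha \near +oo, local_min (energy alpha L)
    & ~ irreducible_roots (shell L 2) ->
        \forall alpha \near +oo, saddle (energy alpha L)].
Proof.
have [L00 LB _ [B [uB LBj]]] := L_lattice.
split.
- exact: (irreducible_rootsP L00 LB L_unimodular L_even uB LBj L_roots).
- exact: (local_min_of_irreducible L00 LB L_unimodular L_even uB LBj L_roots).
- exact: (saddle_of_reducible L00 LB L_unimodular L_even uB LBj L_roots).
Qed.
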